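(* Let $0<\alpha\le 2$ and $s\ge 2+\alpha$. Assume that $u_0\in H^s_{\mathrm{per}}(\Omega)$ is real-valued. Then there exists a time $\bar T>0$, depending on $\|u_0\|_s$, such that the fractional Zakharov--Kuznetsov equation $$\partial_t u-\partial_{x_1}(-\Delta)^{\alpha/2}u+u\,\partial_{x_1}u=0,\qquad u(\cdot,0)=u_0,$$ on the periodic domain $\Omega$ has a unique strong solution $$u\in L^\infty(0,\bar T;H^s_{\mathrm{per}}(\Omega))\cap W^{1,\infty}(0,\bar T;L^2_{\mathrm{per}}(\Omega)).$$ Moreover, the semi-discrete Fourier--Galerkin approximations $u_N$ (with values in $\mathbb X_N$) defined by $$(\partial_t u_N, v) + ((-\Delta)^{\alpha/2} u_N, \partial_{x_1} v) - \tfrac12 (u_N^2, \partial_{x_1} v) = 0 \quad \forall v\in\mathbb X_N,\qquad (u_N(0),v)=(u_0,v)\quad\forall v\in\mathbb X_N,$$ converge to $u$ strongly in $C([0,\bar T];L^2_{\mathrm{per}}(\Omega))$ as $N\to\infty$.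
   Context: $\Omega=[-\pi,\pi]^2$ with periodic boundary conditions (the two-dimensional torus), $\mathbf x=(x_1,x_2)$. All functions are real-valued. $L^2_{\mathrm{per}}(\Omega)$ has inner product $(u,v)=\int_\Omega u\overline v\,d\mathbf x$ and norm $\|\cdot\|$. Fourier coefficients: $\hat f(\mathbf k)=(2\pi)^{-2}\int_\Omega f(\mathbf x)e^{-i\mathbf k\cdot\mathbf x}\,d\mathbf x$. $H^s_{\mathrm{per}}(\Omega)$ has norm $\|u\|_s^2=\sum_{\mathbf k\in\mathbb Z^2}(1+|\mathbf k|^2)^s|\hat u(\mathbf k)|^2$. $(-\Delta)^{\alpha/2}f=\sum_{\mathbf k\in\mathbb Z^2}|\mathbf k|^\alpha\hat f(\mathbf k)e^{i\mathbf k\cdot\mathbf x}$, $|\mathbf k|^2=k_1^2+k_2^2$. $\mathbb X_N$ is the space of (real-valued) trigonometric polynomials in $\mathrm{span}\{e^{i\mathbf k\cdot\mathbf x}:\max\{|k_1|,|k_2|\}\le N\}$. A strong solution in the stated class is a function for which the equation holds as an identity in $L^2_{\mathrm{per}}(\Omega)$ for almost every $t\in(0,\bar T)$ and $u(0)=u_0$ (which makes sense since $W^{1,\infty}(0,\bar T;L^2_{\mathrm{per}}(\Omega))\subset C([0,\bar T];L^2_{\mathrm{per}}(\Omega))$). *)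

(* Defs.v *)
From HB Require Import structures.
From mathcomp Require Import all_boot all_order all_algebra.
From mathcomp Require Import all_classical all_reals all_analysis.
From mathcomp Require Import complex.

Set Implicit Arguments.
Unset Strict Implicit.
Unset Printing Implicit Defensive.

Import Order.TTheory GRing.Theory Num.Theory.
Import numFieldNormedType.Exports.

Local Open Scope classical_set_scope.
Local Open Scope ring_scope.

(* A class in L^2_per is represented by a function on the whole plane; its
   values outside [Omega] and on null sets are irrelevant.  Trigonometric
   polynomials and smooth test functions, in contrast, are genuine periodic
   functions on the plane. *)

Section Torus.
Context (R : realType).

Definition Omega : set (R * R) := `[- pi, pi] `*` `[- pi, pi].

Definition leb1 := @lebesgue_measure R.
Definition leb2 := (leb1 \x leb1)%E.

Definition eq_torus (f g : R * R -> R) : Prop :=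
  {ae leb2, forall x, Omega x -> f x = g x}.

Definition inner (f g : R * R -> R) : R := \int[leb2]_(x in Omega) (f x * g x).

(* A space of functions on the torus together with its norm. *)
Record fspace := FSpace {
  carrier :> (R * R -> R) -> Prop;
  fnorm : (R * R -> R) -> \bar R }.

Definition L2per : fspace :=
  FSpace (fun f => f \_ Omega \in Lfun leb2 2%:E)
         (fun f => 'N[leb2]_(2%:E)[EFin \o (f \_ Omega)])%E.

Definition dotk (k : int * int) (x : R * R) : R :=
  k.1%:~R * x.1 + k.2%:~R * x.2.

Definition sqnormk (k : int * int) : R := k.1%:~R ^+ 2 + k.2%:~R ^+ 2.

Definition expi (theta : R) : R[i] := Complex (cos theta) (sin theta).

Definition fourier (f : R * R -> R) (k : int * int) : R[i] :=
  Complex ((2 * pi) ^- 2 * \int[leb2]_(x in Omega) (f x * cos (- dotk k x)))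
          ((2 * pi) ^- 2 * \int[leb2]_(x in Omega) (f x * sin (- dotk k x))).

Definition Hper (s : R) : fspace :=
  let nrm f := ((\esum_(k in [set: int * int])
    ((1 + sqnormk k) `^ s * Normc.normc (fourier f k) ^+ 2)%:E) `^ 2^-1)%E in
  FSpace (fun f => L2per f /\ (nrm f < +oo)%E) nrm.

(* Sum of c_k e^{i k.x} over max(|k_1|, |k_2|) <= N. *)
Definition trig_sum (N : nat) (c : int * int -> R[i]) (x : R * R) : R[i] :=
  \sum_(i < N.*2.+1) \sum_(j < N.*2.+1)
    let k := (i%:Z - N%:Z, j%:Z - N%:Z) in c k * expi (dotk k x).

(* The space X_N of real-valued trigonometric polynomials. *)
Definition trig_poly (N : nat) : set (R * R -> R) :=
  [set v | exists c, forall x, real_complex R (v x) = trig_sum N c x].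

(* [g] is the sum in L^2 of the Fourier series defining the fractional
   Laplacian (-Delta)^{alpha/2} f. *)
Definition is_frac_lap (alpha : R) (f g : R * R -> R) : Prop :=
  L2per g /\
  fnorm L2per (fun x => Normc.normc
      (trig_sum N (fun k => real_complex R (Num.sqrt (sqnormk k) `^ alpha)
                            * fourier f k) x
       - real_complex R (g x))) @[N --> \oo] --> 0%E.

Definition partial1 (f : R * R -> R) (x : R * R) : R :=
  derive1 (fun y => f (y, x.2)) x.1.

(* [D i j] is the partial derivative of [phi] of order [i] in the first and
   [j] in the second variable. *)
Definition smooth_periodic (phi : R * R -> R) : Prop :=
  (forall x, phi (x.1 + 2 * pi, x.2) = phi x /\
             phi (x.1, x.2 + 2 * pi) = phi x) /\
  exists D : nat -> nat -> R * R -> R,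
    D 0%N 0%N = phi /\
    forall i j,
      [/\ continuous (D i j),
          forall x : R * R, is_derive x.1 (1 : R) (fun y => D i j (y, x.2)) (D i.+1 j x) &
          forall x : R * R, is_derive x.2 (1 : R) (fun y => D i j (x.1, y)) (D i j.+1 x)].

(* [g] is the weak (distributional, periodic) derivative of [f] in x_1. *)
Definition is_weak_partial1 (f g : R * R -> R) : Prop :=
  [/\ L2per f, L2per g &
      forall phi, smooth_periodic phi ->
        inner f (partial1 phi) = - inner g phi].

(* Bochner measurability and integration for functions of time with values
   in a space of functions on the torus. *)

Record simple (X : fspace) := Simple {
  sdim : nat;
  slevel : 'I_sdim -> set R;
  svalue : 'I_sdim -> R * R -> R;
  slevelP : forall i, measurable (slevel i);
  svalueP : forall i, X (svalue i) }.

Definition simple_fun X (p : simple X) (t : R) : R * R -> R :=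
  fun x => \sum_(i < sdim p) \1_(slevel i) t * svalue i x.

Definition simple_integral X (D : set R) (p : simple X) : R * R -> R :=
  fun x => \sum_(i < sdim p) fine (leb1 (slevel i `&` D)) * svalue i x.

Definition strongly_measurable (X : fspace) (D : set R) (f : R -> R * R -> R) :=
  exists p : nat -> simple X,
    {ae leb1, forall t, D t ->
      X (f t) /\ fnorm X (simple_fun (p n) t \- f t) @[n --> \oo] --> 0%E}.

Definition is_bochner_integral (X : fspace) (D : set R) (f : R -> R * R -> R)
    (I : R * R -> R) : Prop :=
  [/\ strongly_measurable X D f, X I &
      exists p : nat -> simple X,
        (\int[leb1]_(t in D) fnorm X (simple_fun (p n) t \- f t)%R)%E
          @[n --> \oo] --> 0%E /\
        fnorm X (simple_integral D (p n) \- I) @[n --> \oo] --> 0%E].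

(* u belongs to L^oo(0, T; X). *)
Definition Linfty (T : R) (X : fspace) (u : R -> R * R -> R) : Prop :=
  strongly_measurable X `]0, T[ u /\
  exists M : R, {ae leb1, forall t, t \in `]0, T[ -> (fnorm X (u t) <= M%:E)%E}.

(* phi belongs to C_c^oo(0, T). *)
Definition test_function (T : R) (phi : R -> R) : Prop :=
  (forall n t, derivable (derive1n n phi) t 1) /\
  exists a b : R, [/\ 0 < a, b < T & forall t, t \notin `[a, b] -> phi t = 0].

(* u belongs to W^{1,oo}(0, T; X), with weak time derivative g. *)
Definition W1infty (T : R) (X : fspace) (u g : R -> R * R -> R) : Prop :=
  [/\ Linfty T X u, Linfty T X g &
      forall phi, test_function T phi -> exists I,
        is_bochner_integral X `]0, T[ (fun t x => derive1 phi t * u t x) I /\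
        is_bochner_integral X `]0, T[ (fun t x => phi t * g t x) (\- I)].

(* w is the representative of u in C([0, T]; X). *)
Definition continuous_repr (T : R) (X : fspace) (u w : R -> R * R -> R) : Prop :=
  [/\ forall t, t \in `[0, T] -> X (w t),
      forall t, t \in `[0, T] ->
        fnorm X (w r \- w t) @[r --> within `[0, T] (nbhs t)] --> 0%E &
      {ae leb1, forall t, t \in `]0, T[ -> eq_torus (u t) (w t)}].

(* ut - d_1 (-Delta)^{alpha/2} u + u d_1 u = 0 as an identity in L^2. *)
Definition fzk_equation (alpha : R) (u ut : R * R -> R) : Prop :=
  exists Lu dLu du,
    [/\ is_frac_lap alpha u Lu, is_weak_partial1 Lu dLu,
        is_weak_partial1 u du &
        eq_torus (fun x => ut x - dLu x + u x * du x) (fun=> 0)].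

Definition strong_solution (alpha s T : R) (u0 : R * R -> R)
    (u : R -> R * R -> R) : Prop :=
  Linfty T (Hper s) u /\
  (exists ut, W1infty T L2per u ut /\
     {ae leb1, forall t, t \in `]0, T[ -> fzk_equation alpha (u t) (ut t)}) /\
  (exists w, continuous_repr T L2per u w /\ eq_torus (w 0) u0).

Definition galerkin_solution (alpha T : R) (N : nat) (u0 : R * R -> R)
    (uN : R -> R * R -> R) : Prop :=
  [/\ forall t, t \in `[0, T] -> trig_poly N (uN t),
      forall x, {within `[0, T], continuous (uN^~ x)},
      forall x t, t \in `]0, T[ -> derivable (uN^~ x) t 1,
      forall t, t \in `]0, T[ -> exists2 LuN, is_frac_lap alpha (uN t) LuN &
        forall v, trig_poly N v ->
          inner (fun x => derive1 (uN^~ x) t) v + inner LuN (partial1 v)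
          - 2^-1 * inner (fun x => uN t x ^+ 2) (partial1 v) = 0 &
      forall v, trig_poly N v -> inner (uN 0) v = inner u0 v].

End Torus.

(* Main.v *)
(** On the Fourier side the equation is c_k' = i k_1 |k|^alpha c_k - (i k_1 / 2) (u^2)^_k,
    and the Galerkin system is the same system for |k_1|, |k_2| <= N.  It conserves the
    L^2 norm, hence has global solutions.  The dispersive term does not contribute to the
    evolution of Y = sum_k (1 + |k|^2)^s |c_k|^2, and a commutator estimate with
    sum_k (1 + |k|^2)^(1-s) < oo (this is where s > 2 enters) gives Y' <= C (1 + Y)^2, so Y
    stays below a bound B on [0, T], T = T(|u_0|_s), uniformly in N.

    If f has Y <= B and solves the full system (or a larger Galerkin system), its modes in
    the box of size N solve the Galerkin system of size N up to a tail O(N^(1-s)); the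
    antisymmetry of the transport term and Gronwall's lemma give the distance
    O((N + 1)^(2-s)) in L^2, uniformly in time, from f to the N-th Galerkin solution.  This
    single estimate yields the Cauchy property and the limit u, the convergence rate,
    and uniqueness.

    For uniqueness, the weak time derivative of an arbitrary strong solution v is tested
    against the bumps exp(-1/x) exp(-1/(d-x)) (du Bois-Reymond): the Fourier coefficients
    of its continuous representative are classical solutions of the system, so the same
    estimate applies to v. *)

Require Import Defs.
From mathcomp Require Import all_boot all_order all_algebra.
From mathcomp Require Import all_classical all_reals all_analysis.
From mathcomp Require Import measurable_realfun.
From mathcomp Require Import complex.
From mathcomp Require Import ring lra zify.
Import Order.TTheory GRing.Theory Num.Theory.
Import numFieldNormedType.Exports.
Set Implicit Arguments.
Unset Strict Implicit.
Unset Printing Implicit Defensive.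
Local Open Scope classical_set_scope.
Local Open Scope ring_scope.

(** * The space L^2 of the torus *)

Section L2layer.
Context {R : realType}.
Local Notation mu := (@leb2 R).
Local Notation Om := (@Omega R).
Local Notation mfO f := (measurable_fun (Om : set (measurableTypeR R * measurableTypeR R)) f).
Implicit Types f g h : R * R -> R.

(** The rate loses two powers of N for two different reasons: the residual in one mode is |k_1| <= N
    times a tail of size (N + 1)^(-s), and adding the squares over the (2 N + 1)^2 modes of the box
    costs one more factor N. Only Cauchy-Schwarz for single coefficients enters the residual. The
    system [coef_ode] is stated for trajectories in L^2 and not for trigonometric polynomials, since
    one stability estimate has to accept the limit, the representative of an arbitrary strong
    solution and the Galerkin solution of a larger box. The obstacle is regularity in time. A
    Galerkin solution is differentiable in time only pointwise in x, and a strong solution has only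
    a weak derivative defined by Bochner integrals. Both are reduced to scalar statements on single
    Fourier coefficients: by a discrete Fourier transform over finitely many nodes, and by testing
    Bochner integrals against fixed modes. The limit is known through its coefficients and has to be
    synthesised at each time, hence the completeness of the modes and of L^2. The synthesis
    truncates, so that the function is bounded at every point and its product with its derivative
    stays in L^2. *)

Lemma measurable_Omega : measurable (Om : set (measurableTypeR R * measurableTypeR R)).
Proof. by apply: measurableX; exact: measurable_itv. Qed.
Hint Resolve measurable_Omega : core.

Lemma leb2_Omega : mu Om = ((2 * pi) ^+ 2)%:E.
Proof.
rewrite /leb2 /Omega product_measure1E; [|exact: measurable_itv|exact: measurable_itv].
have h : @leb1 R `[- pi, pi] = (2 * pi)%:E.
  rewrite /leb1 lebesgue_measure_itv/= lte_fin.
  rewrite gtrN ?pi_gt0// -EFinB opprK; congr EFin; ring.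
by rewrite [X in (X * X)%E]h -EFinM expr2.
Qed.

Lemma integrable_sqr_restrict f :
  mu.-integrable Om (EFin \o (fun x => f x ^+ 2)) <->
  mu.-integrable setT (EFin \o (fun x => (f \_ Om) x ^+ 2)).
Proof.
rewrite (integrable_mkcond _ measurable_Omega).
rewrite [X in mu.-integrable setT X <-> _](_ : _ = (EFin \o (fun x => (f \_ Om) x ^+ 2)))//.
apply/funext => x /=; rewrite !patchE; case: ifP => // _; by rewrite expr0n.
Qed.

(** [L2per] speaks of the zero extension and a finite p-norm on the whole plane; later arguments use
    measurability and square integrability on [Omega] itself. *)
Lemma L2perP f : L2per R f <->
  mfO f /\
  mu.-integrable Om (EFin \o (fun x => f x ^+ 2)).
Proof.
split=> /=.
- move=> H; split; last first.
    by apply/integrable_sqr_restrict; exact: Lfun2_integrable_sqr.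
  move: H; rewrite inE => /andP[]; rewrite inE/= => mf _.
  exact/(measurable_restrictT f measurable_Omega).
- move=> [mf i2]; rewrite inE; apply/andP; split.
    by rewrite inE/=; exact/(measurable_restrictT f measurable_Omega).
  rewrite inE/= /finite_norm unlock/=.
  apply: poweR_lty.
  move/integrable_sqr_restrict/integrableP : i2 => [_].
  apply: le_lt_trans.
  rewrite le_eqVlt; apply/orP; left; apply/eqP.
  apply: eq_integral => x _ /=; congr EFin.
  by rewrite powR_mulrn ?normr_ge0// normrX.
Qed.

Lemma measurable_L2 f : L2per R f ->
  mfO f.
Proof. by case/L2perP. Qed.

Lemma integrable_L2M f g : L2per R f -> L2per R g ->
  mu.-integrable Om (EFin \o (fun x => f x * g x)).
Proof.
move=> /L2perP[mf f2] /L2perP[mg g2].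
apply: (@le_integrable _ _ _ mu Om measurable_Omega _ (fun x => (f x ^+ 2)%:E + (g x ^+ 2)%:E)%E).
- by apply/measurable_EFinP; exact: measurable_funM.
- move=> x _ /=; rewrite lee_fin normrM.
  rewrite [leRHS]ger0_norm ?addr_ge0 ?sqr_ge0//.
  rewrite -(real_normK (num_real (f x))) -(real_normK (num_real (g x))).
  have := normr_ge0 (f x); have := normr_ge0 (g x); nra.
- exact: integrableD.
Qed.

Lemma integrable_cst_Omega (c : R) : mu.-integrable Om (EFin \o (fun=> c)).
Proof.
apply/integrableP; split; first exact/measurable_EFinP.
rewrite /= integral_cst//.
suff : (`|c|%:E * mu Om < +oo)%E by [].
by rewrite leb2_Omega -EFinM ltry.
Qed.

Lemma L2_le f g : mfO f ->
  L2per R g -> (forall x, Om x -> `|f x| <= `|g x|) -> L2per R f.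
Proof.
move=> mf /L2perP[mg g2] fg; apply/L2perP; split => //.
apply: (le_integrable measurable_Omega _ _ g2).
  by apply/measurable_EFinP; exact: measurable_funX.
by move=> x Ox /=; rewrite lee_fin !normrX lerXn2r ?nnegrE ?normr_ge0 ?fg.
Qed.

Lemma L2_cst (c : R) : L2per R (fun=> c).
Proof.
apply/L2perP; split; first exact: measurable_cst.
exact: integrable_cst_Omega.
Qed.

Lemma L2_bounded f (M : R) : mfO f ->
  (forall x, Om x -> `|f x| <= M) -> L2per R f.
Proof.
move=> mf fM; apply: (L2_le (g := fun=> M)) => //; first exact: L2_cst.
by move=> x /fM/le_trans; apply; exact: ler_norm.
Qed.

Lemma L2Z (c : R) f : L2per R f -> L2per R (fun x => c * f x).
Proof.
move=> /L2perP[mf f2]; apply/L2perP; split; first exact: measurable_funM.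
rewrite (_ : _ \o _ = (fun x => (c ^+ 2)%:E * (f x ^+ 2)%:E)%E).
  exact: integrableZl.
by apply/funext => x /=; rewrite -EFinM exprMn.
Qed.

Lemma L2D f g : L2per R f -> L2per R g -> L2per R (fun x => f x + g x).
Proof.
move=> Lf Lg; have /L2perP[mf f2] := Lf; have /L2perP[mg g2] := Lg.
apply/L2perP; split; first exact: measurable_funD.
have fg := integrable_L2M Lf Lg.
rewrite (_ : _ \o _ = (fun x => (f x ^+ 2)%:E + 2%:E * (f x * g x)%:E + (g x ^+ 2)%:E)%E).
  apply: integrableD => //; apply: integrableD => //; exact: integrableZl.
by apply/funext => x /=; rewrite -EFinM -!EFinD; congr EFin; ring.
Qed.

Lemma L2N f : L2per R f -> L2per R (fun x => - f x).
Proof. by move=> /(L2Z (-1)); under eq_fun do rewrite mulN1r. Qed.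

Lemma L2B f g : L2per R f -> L2per R g -> L2per R (fun x => f x - g x).
Proof. by move=> Lf /L2N Lg; exact: L2D. Qed.

Lemma L2_sum (I : Type) (r : seq I) (P : pred I) (F : I -> R * R -> R) :
  (forall i, L2per R (F i)) -> L2per R (fun x => \sum_(i <- r | P i) F i x).
Proof.
move=> LF; elim: r => [|i r IH].
  by under eq_fun do rewrite big_nil; exact: L2_cst.
under eq_fun do rewrite big_cons.
by case: (P i) => //; exact: L2D.
Qed.

Lemma L2M_bounded f g (M : R) : L2per R f -> mfO g ->
  (forall x, Om x -> `|g x| <= M) -> L2per R (fun x => f x * g x).
Proof.
move=> Lf mg gM; apply: (L2_le (g := fun x => M * f x)); last 2 first.
- exact: L2Z.
- move=> x /gM gx; rewrite !normrM mulrC ler_wpM2r//.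
  by rewrite (le_trans gx)// ler_norm.
by apply: measurable_funM => //; exact: measurable_L2.
Qed.

Lemma innerC f g : inner f g = inner g f.
Proof. by rewrite /inner; apply: eq_Rintegral => x _; rewrite mulrC. Qed.

Lemma innerDl f g h : L2per R f -> L2per R g -> L2per R h ->
  inner (fun x => f x + g x) h = inner f h + inner g h.
Proof.
move=> Lf Lg Lh; rewrite /inner -RintegralD//; try exact: integrable_L2M.
by apply: eq_Rintegral => x _; rewrite mulrDl.
Qed.

Lemma innerZl (c : R) f h : L2per R f -> L2per R h ->
  inner (fun x => c * f x) h = c * inner f h.
Proof.
move=> Lf Lh; rewrite /inner -RintegralZl//; try exact: integrable_L2M.
by apply: eq_Rintegral => x _; rewrite mulrA.
Qed.

Lemma innerNl f h : L2per R f -> L2per R h ->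
  inner (fun x => - f x) h = - inner f h.
Proof.
move=> Lf Lh; rewrite -mulN1r -innerZl//.
by apply: eq_Rintegral => x _; rewrite mulN1r.
Qed.

Lemma innerBl f g h : L2per R f -> L2per R g -> L2per R h ->
  inner (fun x => f x - g x) h = inner f h - inner g h.
Proof. by move=> Lf Lg Lh; rewrite innerDl// ?innerNl//; exact: L2N. Qed.

Lemma inner0l h : inner (fun=> 0) h = 0.
Proof.
rewrite /inner (eq_Rintegral _ (g := fun=> 0)) ?Rintegral_cst ?mul0r//.
by move=> x _; rewrite mul0r.
Qed.

Lemma inner_suml (I : Type) (r : seq I) (P : pred I) (F : I -> R * R -> R) h :
  (forall i, L2per R (F i)) -> L2per R h ->
  inner (fun x => \sum_(i <- r | P i) F i x) h = \sum_(i <- r | P i) inner (F i) h.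
Proof.
move=> LF Lh; elim: r => [|i r IH].
  by under eq_fun do rewrite big_nil; rewrite big_nil inner0l.
under eq_fun do rewrite big_cons.
rewrite big_cons; case: (P i) => //; rewrite innerDl ?IH//.
exact: L2_sum.
Qed.

Lemma inner_ge0 f : 0 <= inner f f.
Proof. by apply: Rintegral_ge0 => x _; rewrite -expr2 sqr_ge0. Qed.

Lemma innerDr f g h : L2per R f -> L2per R g -> L2per R h ->
  inner h (fun x => f x + g x) = inner h f + inner h g.
Proof. by move=> Lf Lg Lh; rewrite innerC innerDl// innerC (innerC g). Qed.

Lemma innerBr f g h : L2per R f -> L2per R g -> L2per R h ->
  inner h (fun x => f x - g x) = inner h f - inner h g.
Proof. by move=> Lf Lg Lh; rewrite innerC innerBl// innerC (innerC g). Qed.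

Lemma innerZr (c : R) f h : L2per R f -> L2per R h ->
  inner h (fun x => c * f x) = c * inner h f.
Proof. by move=> Lf Lh; rewrite innerC innerZl// innerC. Qed.

Lemma aeS_Omega (P Q : R * R -> Prop) : (forall x, P x -> Q x) ->
  {ae mu, forall x, P x} -> {ae mu, forall x, Q x}.
Proof. by move=> PQ; apply: negligibleS => x nQ /PQ. Qed.

Definition nrm2 f : R := Num.sqrt (inner f f).

Lemma nrm2_ge0 f : 0 <= nrm2 f. Proof. exact: sqrtr_ge0. Qed.

Lemma sqr_nrm2 f : nrm2 f ^+ 2 = inner f f.
Proof. by rewrite sqr_sqrtr ?inner_ge0. Qed.

Lemma nrm2Z (c : R) f : L2per R f -> nrm2 (fun x => c * f x) = `|c| * nrm2 f.
Proof.
move=> Lf; rewrite /nrm2 innerZl ?innerZr//; try exact: L2Z.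
by rewrite mulrA -expr2 sqrtrM ?sqr_ge0// sqrtr_sqr.
Qed.

Lemma fnorm_L2E f : L2per R f -> fnorm (L2per R) f = (nrm2 f)%:E.
Proof.
move=> /L2perP[mf f2]; rewrite /= unlock/=.
rewrite (_ : \int[_]_x _ = (inner f f)%:E)%E; last first.
  rewrite /inner /Rintegral fineK; last first.
    by apply: integrable_fin_num => //; under eq_fun do rewrite -expr2.
  rewrite [RHS]integral_mkcond; apply: eq_integral => x _ /=.
  rewrite !patchE; case: ifP => _; last by rewrite normr0 powR0// ?pnatr_eq0.
  by rewrite powR_mulrn ?normr_ge0// real_normK ?num_real// -expr2.
by rewrite poweR_EFin /nrm2 powR12_sqrt// inner_ge0.
Qed.

Lemma CauchySchwarz f g : L2per R f -> L2per R g -> `|inner f g| <= nrm2 f * nrm2 g.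
Proof.
move=> Lf Lg.
(* Discriminant argument: the square norm of f + c g is a nonnegative quadratic polynomial in c. *)
have H (c : R) : 0 <= inner f f + 2 * c * inner f g + c ^+ 2 * inner g g.
  have := inner_ge0 (fun x => f x + c * g x).
  have Lcg := L2Z c Lg.
  rewrite innerDl//; try exact: L2D.
  rewrite !innerDr// !innerZl// !innerZr// (innerC g f) => h; apply: le_trans h _.
  by rewrite le_eqVlt; apply/orP; left; apply/eqP; ring.
have F0 := inner_ge0 f; have G0 := inner_ge0 g.
rewrite /nrm2 -sqrtrM// -sqrtr_sqr ler_wsqrtr//.
(* If g has norm zero the polynomial is affine; the chosen c would give it the value -1 unless the
   inner product vanishes. *)
have [g0|g0] := eqVneq (inner g g) 0.
  rewrite g0 mulr0; have := H (- (inner f f + 1) / (2 * inner f g)).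
  rewrite g0 mulr0 addr0.
  have [->|fg0] := eqVneq (inner f g) 0; first by rewrite expr0n.
  have -> : 2 * (- (inner f f + 1) / (2 * inner f g)) * inner f g = - (inner f f + 1).
    by field.
  lra.
have gp : 0 < inner g g by rewrite lt_neqAle eq_sym g0.
have := H (- (inner f g / inner g g)).
have -> : inner f f + 2 * - (inner f g / inner g g) * inner f g + (- (inner f g / inner g g)) ^+ 2 * inner g g = (inner f f * inner g g - inner f g ^+ 2) / inner g g by field.
by rewrite pmulr_lge0 ?invr_gt0// subr_ge0.
Qed.

Lemma nrm2D f g : L2per R f -> L2per R g -> nrm2 (fun x => f x + g x) <= nrm2 f + nrm2 g.
Proof.
move=> Lf Lg; rewrite -(@ler_pXn2r _ 2) ?nnegrE ?addr_ge0 ?nrm2_ge0//.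
have /(le_trans (ler_norm _)) CS := CauchySchwarz Lf Lg.
rewrite sqrrD !sqr_nrm2.
rewrite innerDl//; last exact: L2D.
rewrite !innerDr//.
rewrite (innerC g f); lra.
Qed.

Lemma nrm2N f : L2per R f -> nrm2 (fun x => - f x) = nrm2 f.
Proof.
by move=> Lf; rewrite /nrm2; congr Num.sqrt; apply: eq_Rintegral => x _; rewrite mulrNN.
Qed.

Lemma nrm2B f g : L2per R f -> L2per R g -> nrm2 (fun x => f x - g x) <= nrm2 f + nrm2 g.
Proof. by move=> Lf Lg; rewrite (le_trans (nrm2D Lf (L2N Lg)))// nrm2N. Qed.

Lemma nrm2_distC f g : nrm2 (fun x => f x - g x) = nrm2 (fun x => g x - f x).
Proof.
by rewrite /nrm2; congr Num.sqrt; apply: eq_Rintegral => x _; rewrite -mulrNN !opprB.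
Qed.

Lemma eq_torus_nrm2 f : L2per R f -> nrm2 f = 0 -> eq_torus f (fun=> 0).
Proof.
move=> /L2perP[mf f2] f0.
have i0 : (\int[mu]_(x in Om) `| (f x ^+ 2)%:E | = 0)%E.
  have : fine (\int[mu]_(x in Om) `| (f x ^+ 2)%:E |)%E = 0.
    rewrite -[RHS](expr0n _ 2) -f0 sqr_nrm2 /inner /Rintegral; congr fine.
    by apply: eq_integral => x _ /=; rewrite -expr2 ger0_norm// sqr_ge0.
  move=> h; rewrite -(@fineK _ (\int[mu]_(x in Om) _)%E) ?h//.
  by apply: integrable_fin_num => //; exact: integrable_abse.
have := ae_eq_integral_abs mu measurable_Omega (f := EFin \o (fun x => f x ^+ 2)).
case=> [|+ _]; first by apply/measurable_EFinP; exact: measurable_funX.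
move=> /(_ i0); apply: aeS_Omega => x /= h /h[] /eqP.
by rewrite expf_eq0/= => /eqP.
Qed.

Lemma inner_eq_torus f g h : L2per R f -> L2per R g -> L2per R h -> eq_torus f g ->
  inner f h = inner g h.
Proof.
move=> Lf Lg Lh fg; rewrite /inner /Rintegral; congr fine.
apply: ae_eq_integral => //.
- by apply/measurable_EFinP; apply: measurable_funM; exact: measurable_L2.
- by apply/measurable_EFinP; apply: measurable_funM; exact: measurable_L2.
- by apply: aeS_Omega fg => x h1 /h1 ->.
Qed.

Lemma eq_torusP f g : L2per R f -> L2per R g ->
  eq_torus f g <-> nrm2 (fun x => f x - g x) = 0.
Proof.
move=> Lf Lg; split=> [fg|/eq_torus_nrm2 h].
  have L := L2B Lf Lg.
  rewrite /nrm2 (inner_eq_torus (g := fun=> 0)) ?inner0l ?sqrtr0//; try exact: L2_cst.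
  by apply: aeS_Omega fg => x h /h ->; rewrite subrr.
have {}h := h (L2B Lf Lg).
by apply: aeS_Omega h => x h /h /subr0_eq.
Qed.

End L2layer.
#[global] Hint Resolve measurable_Omega : core.

(** * Locating a point in a uniform partition *)

Section Steps.
Context {R : realType}.

(** Half-open cells are disjoint, so their indicators select one index. This serves to sample a
    continuous function in one space variable and to build simple functions of time. *)
Lemma step_index (a d x : R) (n : nat) : 0 < d -> a <= x -> x < a + n%:R * d ->
  exists2 j : 'I_n, a + j%:R * d <= x < a + j.+1%:R * d &
  forall i : 'I_n, \1_(`[a + i%:R * d, a + i.+1%:R * d[) x = (i == j)%:R :> R.
Proof.
move=> d0 ax xn.
have xd0 : 0 <= (x - a) / d by apply: divr_ge0; [rewrite subr_ge0|exact: ltW].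
set j := Num.truncn ((x - a) / d).
have /andP[j1 j2] := Num.Theory.truncn_itv xd0.
have jn : (j < n)%N.
  rewrite -(ltr_nat R) (le_lt_trans j1)// ltr_pdivrMr// ltrBlDl//.
have k1 : a + j%:R * d <= x by rewrite -lerBrDl -ler_pdivlMr.
have k2 : x < a + j.+1%:R * d by rewrite -ltrBlDl -ltr_pdivrMr.
exists (Ordinal jn) => /=; first by rewrite k1 k2.
move=> i; rewrite indicE; congr ((nat_of_bool _)%:R); rewrite mem_setE in_itv/=.
apply/idP/eqP => [/andP[i1 i2]|->]; last by rewrite k1 k2.
have h1 : (i%:R * d < j.+1%:R * d) by rewrite -(ltrD2l a); exact: le_lt_trans i1 k2.
have h2 : (j%:R * d < i.+1%:R * d) by rewrite -(ltrD2l a); exact: le_lt_trans k1 i2.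
move: h1 h2; rewrite !ltr_pM2r// !ltr_nat !ltnS => h1 h2.
by apply/val_inj/eqP; rewrite eqn_leq h1 h2.
Qed.

End Steps.

(** * Integration over the torus and orthogonality of the Fourier modes *)

Section TorusIntegral.
Context {R : realType}.
Local Notation mu := (@leb2 R).
Local Notation Om := (@Omega R).
Local Notation mfO f := (measurable_fun (Om : set (measurableTypeR R * measurableTypeR R)) f).
Local Notation I := (`[- pi, pi]%classic : set R).
Implicit Types f g h : R * R -> R.

Lemma fubini_Omega1 (f : R * R -> \bar R) : mu.-integrable Om f ->
  (\int[mu]_(z in Om) f z = \int[@leb1 R]_(x in I) \int[@leb1 R]_(y in I) f (x, y))%E.
Proof.
move=> intf; rewrite integral_mkcond -integral12_prod_meas1; last first.
  exact/(integrable_mkcond _ measurable_Omega).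
rewrite [RHS]integral_mkcond; apply: eq_integral => x _.
rewrite /fubini_F patchE; case: ifPn => [xI|xI].
  rewrite [RHS]integral_mkcond; apply: eq_integral => y _.
  rewrite !patchE; congr (if _ then _ else _).
  apply/idP/idP; rewrite !inE/=; first by case.
  by move=> yI; split => //=; move: xI; rewrite inE.
transitivity (0%E : \bar R); last by [].
rewrite (eq_integral (fun=> 0%E)) ?integral0// => y _.
rewrite patchE; case: ifPn => //; rewrite inE => -[/= xI' _].
by move: xI; rewrite notin_setE.
Qed.

Lemma fubini_Omega2 (f : R * R -> \bar R) : mu.-integrable Om f ->
  (\int[mu]_(z in Om) f z = \int[@leb1 R]_(y in I) \int[@leb1 R]_(x in I) f (x, y))%E.
Proof.
move=> intf; rewrite integral_mkcond -integral21_prod_meas1; last first.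
  exact/(integrable_mkcond _ measurable_Omega).
rewrite [RHS]integral_mkcond; apply: eq_integral => y _.
rewrite /fubini_G patchE; case: ifPn => [yI|yI].
  rewrite [RHS]integral_mkcond; apply: eq_integral => x _.
  rewrite !patchE; congr (if _ then _ else _).
  apply/idP/idP; rewrite !inE/=; first by case.
  by move=> xI; split => //=; move: yI; rewrite inE.
transitivity (0%E : \bar R); last by [].
rewrite (eq_integral (fun=> 0%E)) ?integral0// => x _.
rewrite patchE; case: ifPn => //; rewrite inE => -[/= _ yI'].
by move: yI; rewrite notin_setE.
Qed.

Lemma Rintegral_Omega_eq0_1 f : mu.-integrable Om (EFin \o f) ->
  (forall y, I y -> (\int[@leb1 R]_(x in I) (f (x, y))%:E = 0)%E) ->
  \int[mu]_(x in Om) f x = 0.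
Proof.
move=> intf f0; rewrite /Rintegral fubini_Omega2//.
rewrite (eq_integral (fun=> 0%E)) ?integral0//.
by move=> y; rewrite inE => /f0 <-.
Qed.

Lemma Rintegral_Omega_eq0_2 f : mu.-integrable Om (EFin \o f) ->
  (forall x, I x -> (\int[@leb1 R]_(y in I) (f (x, y))%:E = 0)%E) ->
  \int[mu]_(x in Om) f x = 0.
Proof.
move=> intf f0; rewrite /Rintegral fubini_Omega1//.
rewrite (eq_integral (fun=> 0%E)) ?integral0//.
by move=> y; rewrite inE => /f0 <-.
Qed.

Lemma Npi_lt_pi : - pi < pi :> R.
Proof. by rewrite gtrN ?pi_gt0. Qed.

Lemma integral_derive_period (F f : R -> R) : continuous f ->
  (forall x, is_derive x (1 : R) F (f x)) -> F pi = F (- pi) ->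
  (\int[@leb1 R]_(x in I) (f x)%:E = 0)%E.
Proof.
move=> cf dF Fpi.
have cF : continuous F.
  by move=> x; apply/differentiable_continuous/derivable1_diffP; have [] := dF x.
rewrite (@continuous_FTC2 _ f F)// ?Fpi ?subee//.
- exact: Npi_lt_pi.
- exact: continuous_subspaceT.
- split.
  + by move=> x _; have [] := dF x.
  + exact/cvg_at_right_filter/cF.
  + exact/cvg_at_left_filter/cF.
- by move=> x _; rewrite derive1E; have [_ ->] := dF x.
Qed.

(** Freezing the first variable at the left end of its grid cell gives a finite sum of products of
    an indicator in one variable and a continuous function of the other, which is measurable for the
    product sigma-algebra; refining the grid recovers f pointwise. *)
Lemma mfO_cont2 f : continuous f -> mfO f.
Proof.
move=> cf.
pose d (n : nat) : R := 2 * pi / n.+1%:R.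
have d0 n : 0 < d n by rewrite divr_gt0 ?mulr_gt0 ?pi_gt0.
have dE n : (- pi + n.+2%:R * d n = pi + d n)%R.
  rewrite /d -natr1 mulrDl mul1r addrA [n.+1%:R * _]mulrC divfK ?pnatr_eq0//; congr (_ + _); ring.
(* There is one cell more than a period requires, so that half-open cells also cover the right end
   pi. *)
pose h (n : nat) (z : R * R) : R := \sum_(i < n.+2)
  \1_(`[- pi + i%:R * d n, - pi + i.+1%:R * d n[) z.1 * f (- pi + i%:R * d n, z.2).
apply: (@measurable_fun_cvg _ _ _ _ h).
  move=> n; apply: measurable_sum => i; apply: measurable_funM.
    apply: (measurable_funS measurableT (subsetT _)).
    apply: measurableT_comp; last exact: measurable_fst.
    exact: measurable_indic.
  apply: (measurable_funS measurableT (subsetT _)).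
  apply: (@measurableT_comp _ _ _ _ _ _ (fun y => f (- pi + i%:R * d n, y))); last exact: measurable_snd.
  exact: continuous_measurable_fun ((continuous_curry cf).2 _).
move=> [x y] [/= xI yI].
have H n : exists2 t, x - d n <= t <= x & h n (x, y) = f (t, y).
  have [||j jx jE] := @step_index _ (- pi) (d n) x n.+2 (d0 n).
  - by move: xI; rewrite in_itv/= => /andP[].
  - by rewrite dE; move: xI (d0 n); rewrite in_itv/=; lra.
  exists (- pi + j%:R * d n).
    by move: jx; rewrite -natr1; lra.
  rewrite /h (bigD1 j)//= jE eqxx mul1r big1 ?addr0// => i ij.
  by rewrite jE (negbTE ij) mul0r.
pose t n := sval (cid2 (H n)).
have tx n : x - d n <= t n <= x by rewrite /t; case: cid2.
have -> : h ^~ (x, y) = (fun n => f (t n, y)).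
  by apply/funext => n; rewrite /t; case: cid2.
have d_0 : d n @[n --> \oo] --> 0.
  rewrite /d -(mulr0 (2 * pi)); apply: cvgMr.
  exact: cvg_harmonic.
have tcv : t n @[n --> \oo] --> x.
  apply: (@squeeze_cvgr _ _ _ _ (fun n => x - d n) (fun=> x)).
  - by apply: nearW => n; exact: tx.
  - rewrite -[X in _ --> X]subr0; apply: cvgB => //; exact: cvg_cst.
  - exact: cvg_cst.
apply: (@cvg_comp _ _ _ (fun n => (t n, y)) f _ (nbhs (x, y))); last exact: cf.
have cy : (fun=> y) n @[n --> \oo] --> y by exact: cvg_cst.
exact: (cvg_pair tcv cy).
Qed.

Lemma L2_cont2 f (M : R) : continuous f -> (forall x, Om x -> `|f x| <= M) -> L2per R f.
Proof. by move=> /mfO_cont2 mf; exact: L2_bounded. Qed.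

Lemma dotkE (k : int * int) (x y : R) : dotk k (x, y) = k.1%:~R * x + k.2%:~R * y.
Proof. by []. Qed.

Lemma dotk_continuous (k : int * int) : continuous (@dotk R k).
Proof.
move=> x; rewrite /dotk; apply: cvgD; apply: cvgM; try exact: cvg_cst.
  exact: cvg_fst.
exact: cvg_snd.
Qed.

Definition cosk (k : int * int) (x : R * R) : R := cos (dotk k x).
Definition sink (k : int * int) (x : R * R) : R := sin (dotk k x).

Lemma cosk_cont k : continuous (cosk k).
Proof. by move=> x; apply: continuous_comp; [exact: dotk_continuous|exact: continuous_cos]. Qed.

Lemma sink_cont k : continuous (sink k).
Proof. by move=> x; apply: continuous_comp; [exact: dotk_continuous|exact: continuous_sin]. Qed.

Lemma normr_cos_le1 (x : R) : `|cos x| <= 1.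
Proof. by rewrite ler_norml cos_geN1 cos_le1. Qed.

Lemma normr_sin_le1 (x : R) : `|sin x| <= 1.
Proof. by rewrite ler_norml sin_geN1 sin_le1. Qed.

Lemma L2_cosk k : L2per R (cosk k).
Proof. by apply: L2_cont2 (@cosk_cont k) _ => x _; exact: normr_cos_le1. Qed.

Lemma L2_sink k : L2per R (sink k).
Proof. by apply: L2_cont2 (@sink_cont k) _ => x _; exact: normr_sin_le1. Qed.

Lemma sin_intpi (m : int) : sin (pi * m%:~R) = 0 :> R.
Proof.
have H (n : nat) : sin (pi * n%:R) = 0 :> R.
  elim: n => [|n IH]; first by rewrite mulr0 sin0.
  by rewrite -natr1 mulrDr mulr1 sinDpi IH oppr0.
case: (intP m) => [|n|n]; first by rewrite mulr0 sin0.
  exact: H.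
by rewrite mulrNz mulrN sinN H oppr0.
Qed.

Lemma is_derive_sin_affine (a b x : R) :
  is_derive x (1 : R) (fun y => sin (a * y + b)) (a * cos (a * x + b)).
Proof.
rewrite mulrC; apply: (is_derive1_comp (f := sin) (g := fun y => a * y + b)).
rewrite -[X in is_derive _ _ _ X]addr0; apply: is_deriveD.
rewrite -[X in is_derive _ _ _ X]mulr1 -[a * 1]/(a *: (1:R)); exact: is_deriveZ.
Qed.

Lemma is_derive_cos_affine (a b x : R) :
  is_derive x (1 : R) (fun y => cos (a * y + b)) (- (a * sin (a * x + b))).
Proof.
rewrite mulrC -mulNr; apply: (is_derive1_comp (f := cos) (g := fun y => a * y + b)).
rewrite -[X in is_derive _ _ _ X]addr0; apply: is_deriveD.
rewrite -[X in is_derive _ _ _ X]mulr1 -[a * 1]/(a *: (1:R)); exact: is_deriveZ.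
Qed.

Lemma integral_cos_affine (m : int) (b : R) : m != 0 ->
  (\int[@leb1 R]_(x in I) (cos (m%:~R * x + b))%:E = 0)%E.
Proof.
move=> m0; have mr0 : m%:~R != 0 :> R by rewrite intr_eq0.
apply: (@integral_derive_period (fun y => m%:~R^-1 * sin (m%:~R * y + b))).
- move=> x; apply: continuous_comp; last exact: continuous_cos.
  by apply: cvgD; [apply: cvgM; [exact: cvg_cst|exact: cvg_id]|exact: cvg_cst].
- move=> x; rewrite -[X in is_derive _ _ _ X](mulKf mr0).
  exact: is_deriveZ (is_derive_sin_affine _ _ _).
- congr (_ * _); rewrite mulrN (addrC _ b) (addrC _ b) sinD sinB.
  by rewrite (mulrC m%:~R) sin_intpi mulr0 addr0 subr0.
Qed.

(** The phase b covers the sine as well, as a cosine shifted by pi / 2. *)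
Lemma integral_Omega_cos (k : int * int) (b : R) : k != (0, 0) ->
  \int[mu]_(x in Om) cos (dotk k x + b) = 0.
Proof.
have intf : mu.-integrable Om (EFin \o (fun x => cos (dotk k x + b))).
  have L : L2per R (fun x => cos (dotk k x + b)).
    apply: (@L2_cont2 _ 1) => [|x _]; last exact: normr_cos_le1.
    move=> x; apply: continuous_comp; last exact: continuous_cos.
    by apply: cvgD; [exact: dotk_continuous|exact: cvg_cst].
  have := integrable_L2M L (L2_cst 1).
  by under eq_fun do rewrite mulr1.
case: k intf => k1 k2 intf; rewrite xpair_eqE negb_and => /orP[k0|k0].
  apply: Rintegral_Omega_eq0_1 => // y _; rewrite -(@integral_cos_affine k1 (k2%:~R * y + b) k0).
  by apply: eq_integral => x _; rewrite dotkE addrA.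
apply: Rintegral_Omega_eq0_2 => // y _; rewrite -(@integral_cos_affine k2 (k1%:~R * y + b) k0).
apply: eq_integral => x _; rewrite dotkE/=; congr (cos _)%:E; ring.
Qed.

Definition vol : R := (2 * pi) ^+ 2.

Lemma vol_gt0 : 0 < vol. Proof. by rewrite exprn_gt0// mulr_gt0 ?pi_gt0. Qed.

Lemma integral_Omega_cosk (k : int * int) :
  \int[mu]_(x in Om) cosk k x = vol * (k == (0, 0))%:R.
Proof.
have [->|k0] := eqVneq; last first.
  rewrite mulr0 -(integral_Omega_cos 0 k0); apply: eq_Rintegral => x _.
  by rewrite addr0.
rewrite (eq_Rintegral _ (g := fun=> 1)); last first.
  by move=> x _; rewrite /cosk /dotk !mul0r addr0 cos0.
by rewrite (@Rintegral_cst _ _ _ mu)// mul1r mulr1 -[fine _]/(fine (mu Om)) leb2_Omega.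
Qed.

Lemma integral_Omega_sink (k : int * int) : \int[mu]_(x in Om) sink k x = 0.
Proof.
have [->|k0] := eqVneq k (0, 0); last first.
  rewrite -(integral_Omega_cos (- (pi / 2)) k0); apply: eq_Rintegral => x _.
  by rewrite cosBpihalf.
rewrite (eq_Rintegral _ (g := fun=> 0)); last first.
  by move=> x _; rewrite /sink /dotk !mul0r addr0 sin0.
by rewrite (@Rintegral_cst _ _ _ mu)// mul0r.
Qed.

Lemma dotkD (k l : int * int) (x : R * R) : dotk (k + l) x = dotk k x + dotk l x.
Proof. by rewrite /dotk !intrD; ring. Qed.

Lemma dotkN (k : int * int) (x : R * R) : dotk (- k) x = - dotk k x.
Proof. by rewrite /dotk !mulrNz; ring. Qed.

Lemma dotkB (k l : int * int) (x : R * R) : dotk (k - l) x = dotk k x - dotk l x.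
Proof. by rewrite dotkD dotkN. Qed.

Lemma integrable_L2 f : L2per R f -> mu.-integrable Om (EFin \o f).
Proof.
by move=> /integrable_L2M /(_ (L2_cst 1)); under eq_fun do rewrite mulr1.
Qed.

Lemma inner_cosk_cosk (k l : int * int) :
  inner (cosk k) (cosk l) = vol / 2 * ((k == l)%:R + (k == - l)%:R).
Proof.
transitivity (\int[mu]_(x in Om) (2^-1 * cosk (k - l) x + 2^-1 * cosk (k + l) x)).
  apply: eq_Rintegral => x _; rewrite /cosk dotkB dotkD cosB cosD; by field.
rewrite RintegralD//; try exact: integrable_L2 (L2Z _ (L2_cosk _)).
rewrite !RintegralZl//; try exact: integrable_L2 (L2_cosk _).
rewrite !integral_Omega_cosk subr_eq0 addr_eq0; by field.
Qed.

Lemma inner_sink_sink (k l : int * int) :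
  inner (sink k) (sink l) = vol / 2 * ((k == l)%:R - (k == - l)%:R).
Proof.
transitivity (\int[mu]_(x in Om) (2^-1 * cosk (k - l) x - 2^-1 * cosk (k + l) x)).
  apply: eq_Rintegral => x _; rewrite /cosk /sink dotkB dotkD cosB cosD; by field.
rewrite RintegralB//; try exact: integrable_L2 (L2Z _ (L2_cosk _)).
rewrite !RintegralZl//; try exact: integrable_L2 (L2_cosk _).
rewrite !integral_Omega_cosk subr_eq0 addr_eq0; by field.
Qed.

Lemma inner_sink_cosk (k l : int * int) : inner (sink k) (cosk l) = 0.
Proof.
transitivity (\int[mu]_(x in Om) (2^-1 * sink (k - l) x + 2^-1 * sink (k + l) x)).
  apply: eq_Rintegral => x _; rewrite /cosk /sink dotkB dotkD sinB sinD; by field.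
rewrite RintegralD//; try exact: integrable_L2 (L2Z _ (L2_sink _)).
rewrite !RintegralZl//; try exact: integrable_L2 (L2_sink _).
by rewrite !integral_Omega_sink !mulr0 addr0.
Qed.

End TorusIntegral.

(** * Trigonometric polynomials and Fourier coefficients *)

Section Box.

(** A duplicate-free list, in the order of the double sum in [trig_sum]; symmetries of the box then
    become permutations of a list. *)
Definition box (N : nat) : seq (int * int) :=
  [seq (i%:Z - N%:Z, j%:Z - N%:Z) | i <- iota 0 N.*2.+1, j <- iota 0 N.*2.+1].

Lemma mem_box N (k : int * int) :
  (k \in box N) = ((`|k.1| <= N)%N && (`|k.2| <= N)%N).
Proof.
apply/allpairsP/andP => [[[i j]] []|].
  rewrite !mem_iota [X in X -> _ -> _]/= [X in _ -> X -> _]/= => hi hj -> /=.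
  by lia.
case: k => a b [ha hb]; rewrite /= in ha hb.
exists (`|(a + N%:Z)%R|%N, `|(b + N%:Z)%R|%N); rewrite !mem_iota /=; split.
- by lia.
- by lia.
- by congr pair; lia.
Qed.

Lemma uniq_box N : uniq (box N).
Proof.
apply: allpairs_uniq; try exact: iota_uniq.
by move=> [a b] [c d] _ _ /= [] h1 h2; congr pair; lia.
Qed.

Lemma box_opp N k : (- k \in box N) = (k \in box N).
Proof. by rewrite !mem_box /= !abszN. Qed.

Lemma box_sub N M k : (N <= M)%N -> k \in box N -> k \in box M.
Proof. by rewrite !mem_box => NM /andP[h1 h2]; rewrite !(leq_trans _ NM). Qed.

Lemma size_box N : size (box N) = (N.*2.+1 ^ 2)%N.
Proof. by rewrite size_allpairs !size_iota. Qed.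

Lemma sum_box_opp (V : nmodType) N (F : int * int -> V) :
  \sum_(k <- box N) F (- k) = \sum_(k <- box N) F k.
Proof.
rewrite -(big_map (@GRing.opp _) xpredT F); apply: perm_big; apply: uniq_perm.
- by rewrite map_inj_uniq ?uniq_box//; exact: oppr_inj.
- exact: uniq_box.
- by move=> k; rewrite -[k in LHS]opprK mem_map ?box_opp//; exact: oppr_inj.
Qed.

Lemma sum_box_widen (V : nmodType) N M (F : int * int -> V) : (N <= M)%N ->
  (forall k, k \in box M -> k \notin box N -> F k = 0) ->
  \sum_(k <- box M) F k = \sum_(k <- box N) F k.
Proof.
move=> NM F0; rewrite (bigID (mem (box N)))/= [X in _ + X = _]big_seq_cond [X in _ + X = _]big1 ?addr0; last first.
  by move=> k /andP[]; exact: F0.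
rewrite -big_filter; apply: perm_big; apply: uniq_perm.
- by rewrite filter_uniq// uniq_box.
- exact: uniq_box.
- by move=> k; rewrite mem_filter; apply: andb_idr; exact: box_sub.
Qed.

Lemma ler_sum_box (R : realType) N M (F : int * int -> R) : (N <= M)%N ->
  (forall k, 0 <= F k) -> \sum_(k <- box N) F k <= \sum_(k <- box M) F k.
Proof.
move=> NM F0; rewrite [X in _ <= X](bigID (mem (box N)))/= [X in _ <= X + _]big_seq_cond.
rewrite -[X in X <= _]addr0 lerD//; last by apply: sumr_ge0.
have -> : \sum_(i <- box M | (i \in box M) && (i \in box N)) F i = \sum_(i <- box N) F i.
  rewrite -big_filter; apply: perm_big; apply: uniq_perm.
  - by rewrite filter_uniq// uniq_box.
  - exact: uniq_box.
  - move=> k; rewrite mem_filter -andbA andbC -andbA andbb.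
    by case: (boolP (k \in box N)) => [/(box_sub NM) ->|_]; rewrite ?andbF.
by [].
Qed.

End Box.

Section FourierCoef.
Context {R : realType}.
Local Notation mu := (@leb2 R).
Local Notation Om := (@Omega R).
Local Notation vol := (@vol R).
Local Notation Rec := (@complex.Re R).
Local Notation Imc := (@complex.Im R).
Implicit Types (f g h : R * R -> R) (c : int * int -> R[i]).

Definition normc2 (z : R[i]) : R := Rec z ^+ 2 + Imc z ^+ 2.
Definition cdot (z w : R[i]) : R := Rec z * Rec w + Imc z * Imc w.

Lemma normc2E z : Normc.normc z ^+ 2 = normc2 z.
Proof. by case: z => a b; rewrite /normc2/= sqr_sqrtr// addr_ge0 ?sqr_ge0. Qed.

Lemma normc2_ge0 z : 0 <= normc2 z.
Proof. by rewrite addr_ge0 ?sqr_ge0. Qed.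

Lemma cdotzz z : cdot z z = normc2 z.
Proof. by rewrite /cdot /normc2 !expr2. Qed.

Lemma RecD (z w : R[i]) : Rec (z + w) = Rec z + Rec w.
Proof. by case: z; case: w. Qed.
Lemma ImcD (z w : R[i]) : Imc (z + w) = Imc z + Imc w.
Proof. by case: z; case: w. Qed.
Lemma RecM (z w : R[i]) : Rec (z * w) = Rec z * Rec w - Imc z * Imc w.
Proof. by case: z; case: w. Qed.
Lemma ImcM (z w : R[i]) : Imc (z * w) = Rec z * Imc w + Imc z * Rec w.
Proof. by case: z => a b; case: w => u v. Qed.
Lemma Rec_sum (J : Type) (r : seq J) (P : pred J) (F : J -> R[i]) :
  Rec (\sum_(i <- r | P i) F i) = \sum_(i <- r | P i) Rec (F i).
Proof. by apply: big_morph => //; exact: RecD. Qed.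
Lemma Imc_sum (J : Type) (r : seq J) (P : pred J) (F : J -> R[i]) :
  Imc (\sum_(i <- r | P i) F i) = \sum_(i <- r | P i) Imc (F i).
Proof. by apply: big_morph => //; exact: ImcD. Qed.

Lemma complexP (z w : R[i]) : Rec z = Rec w -> Imc z = Imc w -> z = w.
Proof. by case: z => a b; case: w => c d /= -> ->. Qed.

(** The real part of the sum of c_k e^{i k.x}. For hermitian c and a symmetric set of modes it is
    the whole sum. *)
Definition tp (s : seq (int * int)) c (x : R * R) : R :=
  \sum_(k <- s) (Rec (c k) * cosk k x - Imc (c k) * sink k x).

Lemma trig_sumE N c x : trig_sum N c x = \sum_(k <- box N) c k * expi (dotk k x).
Proof.
rewrite /trig_sum /box big_allpairs_dep.
have H (F : nat -> R[i]) : \sum_(i <- iota 0 N.*2.+1) F i = \sum_(i < N.*2.+1) F i.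
  by rewrite -(big_mkord xpredT) /index_iota subn0.
by rewrite H; apply: eq_bigr => i _; rewrite H.
Qed.

Lemma Re_trig_sum N c x : Rec (trig_sum N c x) = tp (box N) c x.
Proof. by rewrite trig_sumE Rec_sum; apply: eq_bigr => k _; rewrite RecM. Qed.

Definition herm c := forall k, Rec (c (- k)) = Rec (c k) /\ Imc (c (- k)) = - Imc (c k).

Lemma coskN k : cosk (- k) =1 @cosk R k.
Proof. by move=> x; rewrite /cosk dotkN cosN. Qed.
Lemma sinkN k x : sink (- k) x = - @sink R k x.
Proof. by rewrite /sink dotkN sinN. Qed.

Lemma trig_sum_real N c x : herm c -> trig_sum N c x = real_complex R (tp (box N) c x).
Proof.
move=> hc; apply: complexP; first exact: Re_trig_sum.
rewrite trig_sumE Imc_sum/=.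
set S := (LHS); suff : S = - S by move=> h; lra.
rewrite /S -[in LHS]sum_box_opp -sumrN; apply: eq_bigr => k _.
have [h1 h2] := hc k.
by rewrite !ImcM/= h1 h2 dotkN cosN sinN; ring.
Qed.

Lemma L2_tp s c : L2per R (tp s c).
Proof.
by apply: L2_sum => k; apply: L2B; apply: L2Z; [exact: L2_cosk|exact: L2_sink].
Qed.

Lemma tp_cont s c : continuous (tp s c).
Proof.
elim: s => [|k s IH] x.
  have -> : tp [::] c = fun=> 0 by apply/funext => y; rewrite /tp big_nil.
  exact: cvg_cst.
have -> : tp (k :: s) c = fun y => (Rec (c k) * cosk k y - Imc (c k) * sink k y) + tp s c y.
  by apply/funext => y; rewrite /tp big_cons.
apply: cvgD; last exact: IH.
apply: cvgB; (apply: cvgM; first exact: cvg_cst).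
  exact: cosk_cont.
exact: sink_cont.
Qed.

Lemma fourierE f k : L2per R f ->
  fourier f k = Complex (vol^-1 * inner f (cosk k)) (- (vol^-1 * inner f (sink k))).
Proof.
move=> Lf; rewrite /fourier; congr Complex.
  by congr (_ * _); apply: eq_Rintegral => x _; rewrite cosN.
rewrite -mulrN; congr (_ * _).
have -> : - inner f (sink k) = inner f (fun x => -1 * sink k x).
  by rewrite innerZr ?mulN1r//; exact: L2_sink.
by apply: eq_Rintegral => x _; rewrite sinN mulN1r.
Qed.

Lemma fourier_herm f : L2per R f -> herm (fourier f).
Proof.
move=> Lf k; rewrite !fourierE//=; split.
  by congr (_ * _); apply: eq_Rintegral => x _; rewrite coskN.
have -> : inner f (sink (- k)) = inner f (fun x => -1 * sink k x).
  by apply: eq_Rintegral => x _; rewrite sinkN mulN1r.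
by rewrite innerZr ?mulN1r ?mulrN//; exact: L2_sink.
Qed.

Lemma inner_tp s c f : L2per R f ->
  inner (tp s c) f = vol * \sum_(k <- s) cdot (c k) (fourier f k).
Proof.
move=> Lf; have v0 := lt0r_neq0 (@vol_gt0 R).
rewrite /tp inner_suml//; last first.
  by move=> k; apply: L2B; apply: L2Z; [exact: L2_cosk|exact: L2_sink].
rewrite mulr_sumr; apply: eq_bigr => k _.
have Lc := @L2_cosk R k; have Ls := @L2_sink R k.
rewrite innerBl//; try exact: L2Z.
rewrite !innerZl// fourierE// /cdot/= (innerC (cosk k)) (innerC (sink k)).
by field.
Qed.

Lemma inner_tpr s c f : L2per R f ->
  inner f (tp s c) = vol * \sum_(k <- s) cdot (c k) (fourier f k).
Proof. by move=> Lf; rewrite innerC inner_tp. Qed.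

Lemma fourier_ext f g k : L2per R f -> L2per R g -> eq_torus f g ->
  fourier f k = fourier g k.
Proof.
move=> Lf Lg fg; rewrite !fourierE//.
by rewrite (inner_eq_torus Lf Lg (@L2_cosk R k) fg) (inner_eq_torus Lf Lg (@L2_sink R k) fg).
Qed.

Lemma fourierD f g k : L2per R f -> L2per R g ->
  fourier (fun x => f x + g x) k = fourier f k + fourier g k.
Proof.
move=> Lf Lg; rewrite !fourierE//; last exact: L2D.
have Lc := @L2_cosk R k; have Ls := @L2_sink R k.
rewrite !innerDl//; apply: complexP; rewrite ?RecD ?ImcD/=; ring.
Qed.

Lemma fourierB f g k : L2per R f -> L2per R g ->
  fourier (fun x => f x - g x) k = fourier f k - fourier g k.
Proof.
move=> Lf Lg; rewrite !fourierE//; last exact: L2B.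
have Lc := @L2_cosk R k; have Ls := @L2_sink R k.
rewrite !innerBl//; apply: complexP => /=; ring.
Qed.

Lemma fourierZ (a : R) f k : L2per R f ->
  fourier (fun x => a * f x) k = real_complex R a * fourier f k.
Proof.
move=> Lf; rewrite !fourierE//; last exact: L2Z.
have Lc := @L2_cosk R k; have Ls := @L2_sink R k.
rewrite !innerZl//; apply: complexP; rewrite ?RecM ?ImcM/=; ring.
Qed.

(** Real cosines and sines do not separate k from -k: the inner product with a mode collects half of
    c k and half of the conjugate of c (- k), which agree because c is hermitian. *)
Lemma fourier_tp N c k : herm c ->
  fourier (tp (box N) c) k = if k \in box N then c k else 0.
Proof.
move=> hc; rewrite fourierE; last exact: L2_tp.
have v0 := lt0r_neq0 (@vol_gt0 R).
have Lc := @L2_cosk R k; have Ls := @L2_sink R k.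
have pick (F : int * int -> R) (l : int * int) :
    \sum_(j <- box N) F j * (j == l)%:R = if l \in box N then F l else 0.
  case: ifPn => lN.
    rewrite (bigD1_seq l) ?uniq_box// eqxx mulr1 big1 => [|j /negbTE ->]; [exact: addr0|exact: mulr0].
  rewrite big_seq big1// => j jN; case: eqP => [jl|_]; last by rewrite mulr0.
  by rewrite -jl jN in lN.
rewrite /tp !inner_suml//; try by move=> j; apply: L2B; apply: L2Z; [exact: L2_cosk|exact: L2_sink].
have [h1 h2] := hc k.
have E1 j : inner (fun x => Rec (c j) * cosk j x - Imc (c j) * sink j x) (cosk k) =
    vol / 2 * (Rec (c j) * (j == k)%:R + Rec (c j) * (j == - k)%:R).
  have Lcj := @L2_cosk R j; have Lsj := @L2_sink R j.
  rewrite innerBl//; try exact: L2Z.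
  by rewrite !innerZl// inner_cosk_cosk inner_sink_cosk; ring.
have E2 j : inner (fun x => Rec (c j) * cosk j x - Imc (c j) * sink j x) (sink k) =
    - (vol / 2) * (Imc (c j) * (j == k)%:R - Imc (c j) * (j == - k)%:R).
  have Lcj := @L2_cosk R j; have Lsj := @L2_sink R j.
  rewrite innerBl//; try exact: L2Z.
  by rewrite !innerZl// inner_sink_sink innerC inner_sink_cosk; ring.
rewrite (eq_bigr _ (fun j _ => E1 j)) (eq_bigr _ (fun j _ => E2 j)).
rewrite -!mulr_sumr big_split sumrB /=.
rewrite !pick box_opp h1 h2; case: ifP => _; apply: complexP => /=; by field.
Qed.

(** The hermitian part of c; the real part of the sum over a box depends on c only through it. *)
Definition symm c (k : int * int) : R[i] :=
  Complex ((Rec (c k) + Rec (c (- k))) / 2) ((Imc (c k) - Imc (c (- k))) / 2).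

Lemma symm_herm c : herm (symm c).
Proof. by move=> k; rewrite /symm/= opprK; split; ring. Qed.

Lemma tp_symm N c : tp (box N) (symm c) =1 tp (box N) c.
Proof.
move=> x; rewrite /tp.
have -> : \sum_(k <- box N) (Rec (symm c k) * cosk k x - Imc (symm c k) * sink k x) =
  2^-1 * (\sum_(k <- box N) (Rec (c k) * cosk k x - Imc (c k) * sink k x) +
         \sum_(k <- box N) (Rec (c (- k)) * cosk (- k) x - Imc (c (- k)) * sink (- k) x)).
  rewrite -big_split mulr_sumr; apply: eq_bigr => k _ /=.
  by rewrite coskN sinkN; field.
rewrite (sum_box_opp N (fun k => Rec (c k) * cosk k x - Imc (c k) * sink k x)); by field.
Qed.

(** The given coefficients are replaced by their hermitian part, which has the same real sum and is
    recovered by [fourier_tp]. *)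
Lemma trig_polyP N f : trig_poly N f <-> f = tp (box N) (fourier f).
Proof.
split=> [[c fc]|->].
  have fE : f = tp (box N) (symm c).
    by apply/funext => x; rewrite tp_symm -Re_trig_sum -fc.
  rewrite [in RHS]fE [LHS]fE; apply/funext => x; rewrite /tp.
  rewrite big_seq [RHS]big_seq; apply: eq_bigr => k kN.
  by rewrite (fourier_tp _ _ (@symm_herm c)) kN.
exists (symm (fourier f)) => x; rewrite trig_sum_real ?tp_symm//; exact: symm_herm.
Qed.

Lemma trig_poly_tp N c : trig_poly N (tp (box N) c).
Proof. by exists (symm c) => x; rewrite trig_sum_real ?tp_symm//; exact: symm_herm. Qed.

Lemma trig_poly_L2 N f : trig_poly N f -> L2per R f.
Proof. by move=> /trig_polyP ->; exact: L2_tp. Qed.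

Lemma fourier_trig_poly N f k : trig_poly N f -> k \notin box N -> fourier f k = 0.
Proof.
move=> tf kN; have Lf := trig_poly_L2 tf.
move/trig_polyP : tf => ->; rewrite fourier_tp ?(negbTE kN)//; exact: fourier_herm.
Qed.

Definition proj N f := tp (box N) (fourier f).

Lemma nrm2_tp N c : herm c ->
  nrm2 (tp (box N) c) ^+ 2 = vol * \sum_(k <- box N) normc2 (c k).
Proof.
move=> hc; rewrite sqr_nrm2 inner_tp; last exact: L2_tp.
congr (_ * _); rewrite big_seq [RHS]big_seq; apply: eq_bigr => k kN.
by rewrite fourier_tp// kN cdotzz.
Qed.

Lemma nrm2_proj N f : L2per R f ->
  nrm2 (proj N f) ^+ 2 = vol * \sum_(k <- box N) normc2 (fourier f k).
Proof. by move=> /fourier_herm; exact: nrm2_tp. Qed.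

(** Pythagoras: the projection has the same inner product with f as with itself. *)
Lemma nrm2_subproj N f : L2per R f ->
  nrm2 (fun x => f x - proj N f x) ^+ 2 = nrm2 f ^+ 2 - nrm2 (proj N f) ^+ 2.
Proof.
move=> Lf; have Lp : L2per R (proj N f) by exact: L2_tp.
rewrite !sqr_nrm2 innerBl ?innerBr//; last exact: L2B.
rewrite (innerC f).
suff -> : inner (proj N f) f = inner (proj N f) (proj N f) by ring.
rewrite [LHS]inner_tp// [RHS]inner_tp//; congr (_ * _).
rewrite big_seq [RHS]big_seq; apply: eq_bigr => k kN.
by rewrite fourier_tp ?kN//; exact: fourier_herm.
Qed.

Lemma Bessel N f : L2per R f ->
  vol * \sum_(k <- box N) normc2 (fourier f k) <= nrm2 f ^+ 2.
Proof.
by move=> Lf; rewrite -nrm2_proj// -subr_ge0 -nrm2_subproj// sqr_ge0.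
Qed.

End FourierCoef.

(** * Completeness of the trigonometric system *)

Section IndicatorApprox.
Context {R : realType}.
Implicit Types (u v : R).

Lemma bernoulli_exprn (x : R) n : -1 <= x -> 1 + n%:R * x <= (1 + x) ^+ n.
Proof.
move=> x1; elim: n => [|n IH]; first by rewrite mul0r addr0 expr0.
rewrite exprS; apply: le_trans (_ : (1 + x) * (1 + n%:R * x) <= _).
  by rewrite -natr1; have := sqr_ge0 x; have := ler0n R n; rewrite expr2; nra.
by apply: ler_wpM2l => //; rewrite -lerBlDl sub0r.
Qed.

(** The steep polynomials of the Brosowski-Deutsch proof of the Stone-Weierstrass theorem. They jump
    at y = 1/2, and composition with a trigonometric polynomial is again one. *)
Definition bump (n : nat) (y : R) : R := (1 - y ^+ n) ^+ (2 ^ n).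

Lemma bump_itv n y : 0 <= y -> y <= 1 -> 0 <= bump n y <= 1.
Proof.
move=> y0 y1; have h1 := exprn_ge0 n y0; have h2 := exprn_ile1 n y0 y1.
by rewrite /bump exprn_ge0 ?subr_ge0//= exprn_ile1// ?subr_ge0// gerBl.
Qed.

(** Bernoulli's inequality bounds the bump below by 1 - (2 y)^n. *)
Lemma bump_cvg1 y : 0 <= y -> y < 2^-1 -> bump n y @[n --> \oo] --> (1 : R).
Proof.
move=> y0 y1; apply: (@squeeze_cvgr _ _ _ _ (fun n => 1 - (2 * y) ^+ n) (fun=> 1)).
- apply: nearW => n; have /andP[_ ->] := @bump_itv n y y0 ltac:(lra); rewrite andbT.
  apply: le_trans (@bernoulli_exprn (- y ^+ n) (2 ^ n) _).
    by rewrite mulrN natrX -exprMn.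
  by rewrite lerNr opprK exprn_ile1//; lra.
- rewrite -[X in _ --> X]subr0; apply: cvgB; first exact: cvg_cst.
  by apply: cvg_expr; rewrite ger0_norm; lra.
- exact: cvg_cst.
Qed.

(** The product of (1 - y^n)^(2^n) and (1 + y^n)^(2^n) is at most 1, and by Bernoulli's inequality
    the second factor is at least (2 y)^n. *)
Lemma bump_cvg0 y : 2^-1 < y -> y <= 1 -> bump n y @[n --> \oo] --> (0 : R).
Proof.
move=> y0 y1; have yp : 0 < y by lra.
apply: (@squeeze_cvgr _ _ _ _ (fun=> 0) (fun n => (2 * y)^-1 ^+ n)).
- apply: nearW => n; have /andP[-> _] /= := @bump_itv n y (ltW yp) y1.
  have e0 := exprn_gt0 n yp; have e1 := exprn_ile1 n (ltW yp) y1.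
  have k0 : 0 < (2 * y) ^+ n by rewrite exprn_gt0//; lra.
  rewrite exprVn -[X in _ <= X]mul1r ler_pdivlMr//.
  apply: le_trans (_ : bump n y * (1 + y ^+ n) ^+ (2 ^ n) <= _).
    apply: ler_wpM2l; first by have /andP[] := @bump_itv n y (ltW yp) y1.
    apply: le_trans (@bernoulli_exprn (y ^+ n) (2 ^ n) _); last lra.
    by rewrite natrX -exprMn lerDr.
  rewrite /bump -exprMn; apply: exprn_ile1.
    by apply: mulr_ge0; lra.
  by nra.
- exact: cvg_cst.
- by apply: cvg_expr; rewrite ger0_norm ?invr_ge0 ?invf_lt1; lra.
Qed.

(** A trigonometric polynomial of degree 1 with values in [0, 1], below 1/2 on the arc of radius d
    around c and above 1/2 beyond its end points: the argument on which [bump] acts. *)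
Definition arcy (c d x : R) : R := 2^-1 - (cos (x - c) - cos d) / 4.

Lemma arcy_itv c d x : 0 <= arcy c d x <= 1.
Proof.
rewrite /arcy; have := cos_le1 (x - c); have := cos_geN1 (x - c).
have := cos_le1 d; have := cos_geN1 d => h1 h2 h3 h4.
by apply/andP; split; lra.
Qed.

Lemma cos_normr (x : R) : cos `|x| = cos x.
Proof. by case: (ger0P x) => // _; rewrite cosN. Qed.

Lemma cosDpi2 (x : R) : cos (2 * pi - x) = cos x.
Proof.
by rewrite -(cosN x) -(cosD2pi (- x)); congr cos; rewrite mulr2n; ring.
Qed.

Lemma arcy_lt c d x : 0 < d -> d <= pi -> `|x - c| < d -> arcy c d x < 2^-1.
Proof.
move=> d0 dpi xd; suff : cos d < cos (x - c) by rewrite /arcy; lra.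
rewrite -[cos (x - c)]cos_normr ltr_cos// in_itv/=.
  by rewrite normr_ge0/=; lra.
by rewrite dpi ltW.
Qed.

Lemma arcy_gt c d x : 0 < d -> d <= pi -> d < `|x - c| -> `|x - c| < 2 * pi - d ->
  2^-1 < arcy c d x.
Proof.
move=> d0 dpi xd xd2; suff : cos (x - c) < cos d by rewrite /arcy; lra.
rewrite -[cos (x - c)]cos_normr.
have [h|h] := leP `|x - c| pi.
  by rewrite ltr_cos// in_itv/=; lra.
have {xd xd2} : d < 2 * pi - `|x - c| by lra.
move=> k; rewrite -cosDpi2 ltr_cos// in_itv/=; lra.
Qed.

(* Trigonometric polynomials with values in [0, 1] that converge to the
   indicator of ]a, b] on a period, outside a finite set. *)
Lemma indic_approx (a b : R) : exists (z : nat -> R -> R) (E : seq R),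
  [/\ (forall n x, 0 <= z n x <= 1),
      (forall x, x \in `[- pi, pi] -> x \notin E -> z n x @[n --> \oo] --> (\1_(`]a, b]) x : R)) &
      (exists c d, forall n x, z n x = bump n (arcy c d x)) \/ (forall n x, z n x = 0)].
Proof.
have pi0 := @pi_gt0 R.
pose a' := Num.max a (- pi); pose b' := Num.min b pi.
have [ab|ba] := ltP a' b'; last first.
  exists (fun _ _ => 0), [:: a'; b'; - pi; pi]; split.
  - by move=> n x; rewrite lexx ler01.
  - move=> x; rewrite in_itv/= !inE !negb_or => /andP[x1 x2] /and4P[n1 n2 n3 n4].
    rewrite indicE memNset; first exact: cvg_cst.
    move=> /=; rewrite in_itv/= => /andP[h1 h2].
    have : a' < x by rewrite gt_max h1 lt_neqAle eq_sym n3.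
    have : x <= b' by rewrite le_min h2.
    by lra.
  - by right.
pose c := (a' + b') / 2; pose d := (b' - a') / 2.
have aa : a <= a' by rewrite le_max lexx.
have ap : - pi <= a' by rewrite le_max lexx orbT.
have bb : b' <= b by rewrite ge_min lexx.
have bp : b' <= pi by rewrite ge_min lexx orbT.
have d0 : 0 < d by rewrite /d; lra.
have dp : d <= pi by rewrite /d; lra.
(* The excluded points are the end points, where [arcy] equals 1/2, and -pi and pi, each of which
   may be the periodic copy of an end point. *)
exists (fun n x => bump n (arcy c d x)), [:: a'; b'; - pi; pi]; split.
- by move=> n x; have /andP[h1 h2] := arcy_itv c d x; exact: bump_itv.
- move=> x; rewrite in_itv/= !inE !negb_or => /andP[x1 x2] /and4P[n1 n2 n3 n4].
  have /andP[y0 y1] := arcy_itv c d x.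
  have {n3}x1 : - pi < x by rewrite lt_neqAle eq_sym n3.
  have {n4}x2 : x < pi by rewrite lt_neqAle n4.
  have [xd|xd] := ltP `|x - c| d.
    rewrite indicE mem_set/=; first by apply: bump_cvg1 => //; exact: arcy_lt.
    by move: xd; rewrite in_itv/= ltr_norml /c /d => /andP[h1 h2]; apply/andP; split; lra.
  have {}xd : d < `|x - c|.
    rewrite lt_neqAle xd andbT; apply/eqP => dx.
    have : (x == a') || (x == b').
      have [h|h] := leP 0 (x - c).
        by apply/orP; right; apply/eqP; move: dx; rewrite ger0_norm// /c /d; lra.
      by apply/orP; left; apply/eqP; move: dx; rewrite ltr0_norm// /c /d; lra.
    by rewrite (negbTE n1) (negbTE n2).
  rewrite indicE memNset/=.
    apply: bump_cvg0 => //; apply: arcy_gt => //.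
    by rewrite ltr_norml /c /d; apply/andP; split; lra.
  rewrite in_itv/= => /andP[h1 h2].
  have k1 : a' <= x by rewrite ge_max (ltW h1) ltW.
  have k2 : x <= b' by rewrite le_min h2 ltW.
  move: xd; rewrite ltNge => /negP; apply.
  by rewrite ler_norml /c /d; apply/andP; split; lra.
- by left; exists c, d.
Qed.

End IndicatorApprox.

(** * Functions with vanishing Fourier coefficients *)

Section Uniqueness.
Context {R : realType}.
Local Notation mu := (@leb2 R).
Local Notation Om := (@Omega R).
Implicit Types (f g h : R * R -> R).

(** An inductive closure keeps no track of degrees: stability under products and orthogonality to a
    function with zero coefficients are both proved by induction. *)
Inductive tpoly : (R * R -> R) -> Prop :=
| tpoly_cos k : tpoly (cosk k)
| tpoly_sin k : tpoly (sink k)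
| tpoly_add f g : tpoly f -> tpoly g -> tpoly (fun x => f x + g x)
| tpoly_scale (a : R) f : tpoly f -> tpoly (fun x => a * f x).

Lemma tpoly_eq f g : f =1 g -> tpoly f -> tpoly g.
Proof. by move=> /funext ->. Qed.

Lemma tpoly_cst (a : R) : tpoly (fun=> a).
Proof.
apply: tpoly_eq (tpoly_scale a (tpoly_cos (0, 0))) => x.
by rewrite /cosk /dotk !mul0r addr0 cos0 mulr1.
Qed.

Lemma tpoly_mul f g : tpoly f -> tpoly g -> tpoly (fun x => f x * g x).
Proof.
have cc k l : tpoly (fun x => cosk k x * cosk l x).
  apply: tpoly_eq (tpoly_add (tpoly_scale 2^-1 (tpoly_cos (k - l))) (tpoly_scale 2^-1 (tpoly_cos (k + l)))) => x.
  by rewrite /cosk dotkB dotkD cosB cosD; field.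
have ss k l : tpoly (fun x => sink k x * sink l x).
  apply: tpoly_eq (tpoly_add (tpoly_scale 2^-1 (tpoly_cos (k - l))) (tpoly_scale (- 2^-1) (tpoly_cos (k + l)))) => x.
  by rewrite /cosk /sink dotkB dotkD cosB cosD; field.
have sc k l : tpoly (fun x => sink k x * cosk l x).
  apply: tpoly_eq (tpoly_add (tpoly_scale 2^-1 (tpoly_sin (k - l))) (tpoly_scale 2^-1 (tpoly_sin (k + l)))) => x.
  by rewrite /cosk /sink dotkB dotkD sinB sinD; field.
move=> tf; elim: tf g => {f} [k|k|f f' _ IH _ IH'|a f _ IH] g tg.
- elim: tg => {g} [l|l|g g' _ IH _ IH'|a g _ IH].
  + exact: cc.
  + by apply: tpoly_eq (sc l k) => x; rewrite mulrC.
  + by apply: tpoly_eq (tpoly_add IH IH') => x; rewrite mulrDr.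
  + by apply: tpoly_eq (tpoly_scale a IH) => x; rewrite mulrCA.
- elim: tg => {g} [l|l|g g' _ IH _ IH'|a g _ IH].
  + exact: sc.
  + exact: ss.
  + by apply: tpoly_eq (tpoly_add IH IH') => x; rewrite mulrDr.
  + by apply: tpoly_eq (tpoly_scale a IH) => x; rewrite mulrCA.
- by apply: tpoly_eq (tpoly_add (IH _ tg) (IH' _ tg)) => x; rewrite mulrDl.
- by apply: tpoly_eq (tpoly_scale a (IH _ tg)) => x; rewrite mulrA.
Qed.

Lemma tpoly_exp f n : tpoly f -> tpoly (fun x => f x ^+ n).
Proof.
move=> tf; elim: n => [|n IH]; first exact: tpoly_cst.
by apply: tpoly_eq (tpoly_mul tf IH) => x; rewrite exprS.
Qed.

Lemma tpoly_L2 f : tpoly f -> L2per R f.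
Proof.
elim=> [k|k|g h _ Lg _ Lh|a g _ Lg]; [exact: L2_cosk|exact: L2_sink|exact: L2D|exact: L2Z].
Qed.

Lemma tpoly_bump n f : tpoly f -> tpoly (fun x => bump n (f x)).
Proof.
move=> tf; apply: tpoly_exp.
apply: tpoly_eq (tpoly_add (tpoly_cst 1) (tpoly_scale (-1) (tpoly_exp n tf))) => x.
by rewrite mulN1r.
Qed.

Lemma tpoly_arcy1 c d : tpoly (fun x => arcy c d x.1).
Proof.
have t := tpoly_add (tpoly_scale (- (cos c / 4)) (tpoly_cos (1, 0))) (tpoly_scale (- (sin c / 4)) (tpoly_sin (1, 0))).
apply: tpoly_eq (tpoly_add (tpoly_cst (2^-1 + cos d / 4)) t) => x.
by rewrite /arcy cosB /cosk /sink /dotk /= mul0r mul1r addr0; field.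
Qed.

Lemma tpoly_arcy2 c d : tpoly (fun x => arcy c d x.2).
Proof.
have t := tpoly_add (tpoly_scale (- (cos c / 4)) (tpoly_cos (0, 1))) (tpoly_scale (- (sin c / 4)) (tpoly_sin (0, 1))).
apply: tpoly_eq (tpoly_add (tpoly_cst (2^-1 + cos d / 4)) t) => x.
by rewrite /arcy cosB /cosk /sink /dotk /= mul0r mul1r add0r; field.
Qed.

Lemma inner_tpoly_eq0 f g : L2per R f -> (forall k, fourier f k = 0) -> tpoly g ->
  inner f g = 0.
Proof.
move=> Lf f0; have v0 := lt0r_neq0 (@vol_gt0 R).
elim=> [k|k|h1 h2 t1 IH1 t2 IH2|a h t IH].
- have := f0 k; rewrite fourierE// => -[/eqP + _]; rewrite mulf_eq0 invr_eq0 (negbTE v0)/=.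
  by move/eqP.
- have := f0 k; rewrite fourierE// => -[_ /eqP]; rewrite oppr_eq0 mulf_eq0 invr_eq0 (negbTE v0)/=.
  by move/eqP.
- by rewrite innerDr ?IH1 ?IH2 ?addr0//; exact: tpoly_L2.
- by rewrite innerZr ?IH ?mulr0//; exact: tpoly_L2.
Qed.

Lemma negligible_line1 (E : seq R) : mu.-negligible [set x : R * R | x.1 \in E].
Proof.
have mE : measurable ([set` E] : set (measurableTypeR R)).
  apply: countable_measurable; first by move=> t; exact: measurable_set1.
  exact/finite_set_countable/finite_seq.
have -> : [set x : R * R | x.1 \in E] = [set` E] `*` setT by apply/seteqP; split => x //= [].
apply/negligibleP; first exact: measurableX.
have := @product_measure1E _ _ _ _ R (@leb1 R) (@leb1 R) [set` E] setT mE measurableT.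
rewrite [X in (X * _)%E](_ : _ = 0%E) ?mul0e//; apply: countable_lebesgue_measure0.
exact/finite_set_countable/finite_seq.
Qed.

Lemma negligible_line2 (E : seq R) : mu.-negligible [set x : R * R | x.2 \in E].
Proof.
have mE : measurable ([set` E] : set (measurableTypeR R)).
  apply: countable_measurable; first by move=> t; exact: measurable_set1.
  exact/finite_set_countable/finite_seq.
have -> : [set x : R * R | x.2 \in E] = setT `*` [set` E] by apply/seteqP; split => x //= [].
apply/negligibleP; first exact: measurableX.
have := @product_measure1E _ _ _ _ R (@leb1 R) (@leb1 R) setT [set` E] measurableT mE.
rewrite [X in (_ * X)%E](_ : _ = 0%E) ?mule0//; apply: countable_lebesgue_measure0.
exact/finite_set_countable/finite_seq.
Qed.

(** Products of one-dimensional approximations are orthogonal to f and converge to the indicator of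
    the rectangle outside finitely many lines; dominated convergence applies with the majorant
    |f|. *)
Lemma integral_rect_eq0 f (a b c d : R) : L2per R f -> (forall k, fourier f k = 0) ->
  (\int[mu]_(x in Om) (f x * (\1_(`]a, b]) x.1 * \1_(`]c, d]) x.2))%:E = 0)%E.
Proof.
move=> Lf f0.
have [z [E [z01 zc zt]]] := indic_approx a b.
have [w [E' [w01 wc wt]]] := indic_approx c d.
have tz n : tpoly (fun x => z n x.1).
  case: zt => [[c' [d' zE]]|zE].
    by apply: tpoly_eq (tpoly_bump n (tpoly_arcy1 c' d')) => x; rewrite zE.
  by apply: tpoly_eq (tpoly_cst 0) => x; rewrite zE.
have tw n : tpoly (fun x => w n x.2).
  case: wt => [[c' [d' wE]]|wE].
    by apply: tpoly_eq (tpoly_bump n (tpoly_arcy2 c' d')) => x; rewrite wE.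
  by apply: tpoly_eq (tpoly_cst 0) => x; rewrite wE.
have tzw n := tpoly_mul (tz n) (tw n).
pose F n x := (f x * (z n x.1 * w n x.2))%:E.
have F0 n : (\int[mu]_(x in Om) F n x = 0)%E.
  have := inner_tpoly_eq0 Lf f0 (tzw n); rewrite /inner /Rintegral => /eqP.
  rewrite fine_eq0; first by move/eqP.
  by apply: integrable_fin_num => //; apply: integrable_L2M => //; exact: tpoly_L2.
have mf := measurable_L2 Lf.
have m1 (i : interval R) : measurable_fun (Om : set (measurableTypeR R * measurableTypeR R)) (fun x => \1_[set` i] x.1 : R).
  apply: (measurable_funS measurableT (subsetT _)).
  apply: measurableT_comp; last exact: measurable_fst.
  exact: measurable_indic.
have m2 (i : interval R) : measurable_fun (Om : set (measurableTypeR R * measurableTypeR R)) (fun x => \1_[set` i] x.2 : R).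
  apply: (measurable_funS measurableT (subsetT _)).
  apply: measurableT_comp; last exact: measurable_snd.
  exact: measurable_indic.
have /= [||||| _ _] := @dominated_convergence _ _ R mu Om measurable_Omega F
  (fun x => (f x * (\1_(`]a, b]) x.1 * \1_(`]c, d]) x.2))%:E) (fun x => `|f x|%:E).
- move=> n; apply/measurable_EFinP; apply: measurable_funM => //.
  exact: measurable_L2 (tpoly_L2 (tzw n)).
- by apply/measurable_EFinP; apply: measurable_funM => //; apply: measurable_funM.
- have N := negligibleU (negligible_line1 E) (negligible_line2 E').
  apply: negligibleS N => x /= h; apply: contrapT => /not_orP[h1 h2]; apply: h => -[x1 x2].
  apply: cvg_EFin; first exact: nearW.
  apply: cvgMr; apply: cvgM; [apply: zc|apply: wc] => //; exact/negP.
- exact: integrable_abse (integrable_L2 Lf).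
- apply: nearW => x n _ /=; rewrite lee_fin normrM ler_piMr//.
  have /andP[h1 h2] := z01 n x.1; have /andP[h3 h4] := w01 n x.2.
  by rewrite ger0_norm ?mulr_ge0// mulr_ile1.
rewrite [X in X @ _ --> _](_ : _ = fun=> 0%E); last by apply/funext => n; rewrite F0.
by move/(@cvg_unique _ (@ereal_hausdorff R)) => /(_ _ (cvg_cst _)) <-.
Qed.

(** The sets A over whose preimage h integrates to zero form a Dynkin system; the vanishing total
    integral gives complements. The map [pr] is a coordinate when the sides of a rectangle are
    generalised one by one, and the identity for the product sigma-algebra. *)
Lemma dynkin_integral_eq0 d (T : measurableType d) (G : set (set T)) (pr : R * R -> T) h :
  d.-measurable = <<s G>> -> setI_closed G ->
  measurable_fun (setT : set (measurableTypeR R * measurableTypeR R)) pr ->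
  mu.-integrable Om (EFin \o h) ->
  (\int[mu]_(x in Om) (h x)%:E = 0)%E ->
  (forall A, G A -> (\int[mu]_(x in Om `&` pr @^-1` A) (h x)%:E = 0)%E) ->
  forall A, measurable A -> (\int[mu]_(x in Om `&` pr @^-1` A) (h x)%:E = 0)%E.
Proof.
move=> mG GI mpr ih h0 hG A mA.
have mOA B : measurable B -> measurable (Om `&` pr @^-1` B : set (measurableTypeR R * measurableTypeR R)).
  move=> mB; apply: measurableI => //; rewrite -[X in measurable X]setTI; exact: mpr.
have sub B : Om `&` pr @^-1` B `<=` Om by exact: subIsetl.
apply: (dynkin_induction (P := fun A => (\int[mu]_(x in Om `&` pr @^-1` A) (h x)%:E = 0)%E) mG GI).
- by rewrite preimage_setT setIT.
- exact: hG.
- move=> S mS hS; move: h0.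
  rewrite [X in (\int[_]_(_ in X) _)%E = _ -> _](_ : Om = Om `&` pr @^-1` S `|` Om `&` pr @^-1` (~` S)); last first.
    by rewrite -setIUr -preimage_setU setUv preimage_setT setIT.
  rewrite integral_setU//.
  + by rewrite [X in (X + _)%E = _ -> _]hS add0e.
  + exact: mOA.
  + by apply: mOA; exact: measurableC.
  + rewrite -setIUr -preimage_setU setUv preimage_setT setIT.
    by case/integrableP : ih.
  + by apply/disj_setPS => x /= [[_ h1] [_ h2]].
- move=> F mF tF hF; rewrite preimage_bigcup setI_bigcupr.
  rewrite integral_bigcup.
  + by rewrite eseries0.
  + apply/trivIsetP => i j _ _ ij; rewrite setIACA -preimage_setI.
    by move/trivIsetP : tF => /(_ i j I I ij) ->; rewrite preimage_set0 setI0.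
  + by move=> k; exact: mOA.
  + by apply: integrableS ih => //; [apply: bigcupT_measurable => k; exact: mOA|exact: bigcup_sub].
- by rewrite -mG.
Qed.

Lemma restrict_indic_eq (A : set (R * R)) f :
  (\int[mu]_(x in Om) (f x * \1_A x)%:E = \int[mu]_(x in Om `&` A) (f x)%:E)%E.
Proof.
rewrite [RHS]integral_mkcondr; apply: eq_integral => x _.
rewrite patchE indicE; case: ifPn => xA; rewrite ?mulr1// ?mulr0//.
Qed.

Lemma preimage_indic (T U : Type) (pr : T -> U) (A : set U) x :
  \1_A (pr x) = \1_(pr @^-1` A) x :> R.
Proof. by rewrite !indicE; congr (nat_of_bool _)%:R; apply/idP/idP; rewrite !inE. Qed.

Lemma integral_rect_eq0_meas f (A B : set (measurableTypeR R)) : L2per R f ->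
  (forall k, fourier f k = 0) -> measurable A -> measurable B ->
  (\int[mu]_(x in Om `&` (A `*` B)) (f x)%:E = 0)%E.
Proof.
move=> Lf f0 mA mB.
have mocitv : (measurable : set (set (measurableTypeR R))) = <<s @ocitv R >> by [].
have m1 (C : set (measurableTypeR R)) : measurable C -> measurable_fun (Om : set (measurableTypeR R * measurableTypeR R)) (fun x => \1_C x.1 : R).
  move=> mC; apply: (measurable_funS measurableT (subsetT _)).
  apply: measurableT_comp; last exact: measurable_fst.
  exact: measurable_indic.
have m2 (C : set (measurableTypeR R)) : measurable C -> measurable_fun (Om : set (measurableTypeR R * measurableTypeR R)) (fun x => \1_C x.2 : R).
  move=> mC; apply: (measurable_funS measurableT (subsetT _)).
  apply: measurableT_comp; last exact: measurable_snd.
  exact: measurable_indic.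
have i01 (C : set R) x : `|\1_C x| <= 1 :> R by rewrite indicE; case: (_ \in _); rewrite /= ?normr1 ?normr0.
have L1 C : measurable C -> L2per R (fun x => f x * \1_C x.1).
  by move=> mC; apply: (L2M_bounded (M := 1)) => //; exact: m1.
have L2' C : measurable C -> L2per R (fun x => f x * \1_C x.2).
  by move=> mC; apply: (L2M_bounded (M := 1)) => //; exact: m2.
(* A half-open interval containing the closed period: its indicator is 1 on [Omega], which turns a
   strip into a rectangle. *)
have big : forall x : R, x \in `[- pi, pi] -> \1_(`](- pi - 1), pi]) x = 1 :> R.
  by move=> x; rewrite in_itv/= => /andP[x1 x2]; rewrite indicE mem_set//= in_itv/= x2 andbT; lra.
have step1 c d C : measurable C -> (\int[mu]_(x in Om `&` (fst @^-1` C)) (f x * \1_(`]c, d]) x.2)%:E = 0)%E.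
  move: C; apply: (dynkin_integral_eq0 mocitv).
  - exact: ocitvI.
  - exact: measurable_fst.
  - by apply: integrable_L2; exact: L2'.
  - rewrite -(@integral_rect_eq0 f (- pi - 1) pi c d Lf f0); apply: eq_integral => x.
    by rewrite inE => -[x1 _]; rewrite big// mul1r.
  - move=> _ [[a b] _ <-] /=; rewrite -restrict_indic_eq -(@integral_rect_eq0 f a b c d Lf f0).
    by apply: eq_integral => x _; rewrite -preimage_indic; congr (_%:E); ring.
have step2 C D : measurable C -> measurable D -> (\int[mu]_(x in Om `&` (snd @^-1` D)) (f x * \1_C x.1)%:E = 0)%E.
  move=> mC; move: D; apply: (dynkin_integral_eq0 mocitv).
  - exact: ocitvI.
  - exact: measurable_snd.
  - by apply: integrable_L2; exact: L1.
  - rewrite -(step1 (- pi - 1) pi C mC) -restrict_indic_eq; apply: eq_integral => x.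
    by rewrite inE => -[_ x2]; rewrite big// mulr1 -preimage_indic.
  - move=> _ [[a b] _ <-] /=; rewrite -restrict_indic_eq -(step1 a b C mC) -restrict_indic_eq.
    by apply: eq_integral => x _; rewrite -!preimage_indic; congr (_%:E); ring.
rewrite -(step2 A B mA mB) -!restrict_indic_eq.
apply: eq_integral => x _; rewrite -preimage_indic -mulrA; congr ((_ * _)%:E).
rewrite !indicE -natrM mulnb; congr ((nat_of_bool _)%:R).
by apply/idP/andP; rewrite !inE.
Qed.

Lemma fourier_inj0 f : L2per R f -> (forall k, fourier f k = 0) -> eq_torus f (fun=> 0).
Proof.
move=> Lf f0.
have If := integrable_L2 Lf.
have all0 := @dynkin_integral_eq0 _ _ _ id f (@measurable_prod_measurableType _ _ (measurableTypeR R) (measurableTypeR R)).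
have := @integral_ae_eq _ _ R mu Om measurable_Omega (cst 0%E) (EFin \o f) If (measurable_cst _) _.
case=> [E EO mE|N [mN N0 sN]].
  rewrite /= integral0 -(setIidr EO) -[E]/(id @^-1` E).
  apply: all0 => //.
  - move=> _ _ [A1 mA1 [A2 mA2 <-]] [B1 mB1 [B2 mB2 <-]].
    exists (A1 `&` B1); first exact: measurableI.
    exists (A2 `&` B2); first exact: measurableI.
    by rewrite setXI.
  - have := integral_rect_eq0_meas Lf f0 measurableT measurableT.
    by rewrite setXTT setIT.
  - by move=> _ [A mA [B mB <-]]; exact: integral_rect_eq0_meas.
exists N; split => // x /= h; apply: sN => /= h'; apply: h => Ox.
by have /= [] := h' Ox.
Qed.

End Uniqueness.

(** * Completeness of L^2 and the Riesz-Fischer theorem *)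

Section RieszFischer.
Context {R : realType}.
Local Notation mu := (@leb2 R).
Local Notation Om := (@Omega R).
Local Notation mfO f := (measurable_fun (Om : set (measurableTypeR R * measurableTypeR R)) f).
Local Notation vol := (@vol R).
Implicit Types (f g h : R * R -> R).

Lemma nneseries_bound (u : (\bar R)^nat) (B : \bar R) : (forall n, (0 <= u n)%E) ->
  (forall n, (\sum_(0 <= k < n) u k <= B)%E) -> (\sum_(0 <= k <oo) u k <= B)%E.
Proof.
by move=> u0 uB; apply: lime_le; [exact: is_cvg_nneseries|exact: nearW].
Qed.

Lemma fatou_bound (F : nat -> R * R -> R) f (B : R) :
  (forall n, mfO (F n)) -> (forall n x, Om x -> 0 <= F n x) ->
  (forall x, Om x -> F n x @[n --> \oo] --> f x) ->
  (forall n, (\int[mu]_(x in Om) (F n x)%:E <= B%:E)%E) ->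
  (\int[mu]_(x in Om) (f x)%:E <= B%:E)%E.
Proof.
move=> mF F0 Ff FB.
have := @fatou _ _ R mu Om measurable_Omega (fun n x => (F n x)%:E).
have h1 n : measurable_fun (Om : set (measurableTypeR R * measurableTypeR R)) (fun x => (F n x)%:E) by exact/measurable_EFinP.
have h2 n x : Om x -> (0 <= (F n x)%:E)%E by move=> Ox; rewrite lee_fin F0.
move=> /(_ h1 h2) /=.
have -> : (\int[mu]_(x in Om) limn_einf (fun n => (F n x)%:E) = \int[mu]_(x in Om) (f x)%:E)%E.
  apply: eq_integral => x; rewrite inE => Ox.
  suff [-> _] : (limn_einf (fun n => (F n x)%:E) = (f x)%:E) * (limn_esup (fun n => (F n x)%:E) = (f x)%:E) by [].
  apply: cvg_limn_einf_sup; apply: cvg_EFin; first exact: nearW.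
  exact: Ff.
move/le_trans; apply; rewrite limn_einf_lim; apply: lime_le.
  exact: ereal_nondecreasing_is_cvgn (@nondecreasing_einfs _ _).
apply: nearW => n; apply: le_trans (FB n).
by apply: ereal_inf_lbound; exists n => //=.
Qed.

Lemma integral_sqr_nrm2 f : L2per R f -> (\int[mu]_(x in Om) (f x ^+ 2)%:E = (nrm2 f ^+ 2)%:E)%E.
Proof.
move=> Lf; rewrite sqr_nrm2 /inner /Rintegral fineK; last first.
  by apply: integrable_fin_num => //; exact: integrable_L2M.
by apply: eq_integral => x _; rewrite expr2.
Qed.

Lemma L2_of_bound f (B : R) : mfO f -> (\int[mu]_(x in Om) (f x ^+ 2)%:E <= (B ^+ 2)%:E)%E ->
  0 <= B -> L2per R f /\ nrm2 f <= B.
Proof.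
move=> mf fB B0.
have Lf : L2per R f.
  apply/L2perP; split => //; apply/integrableP; split.
    by apply/measurable_EFinP; exact: measurable_funX.
  apply: le_lt_trans (ltry (B ^+ 2)); apply: le_trans fB.
  rewrite le_eqVlt; apply/orP; left; apply/eqP; apply: eq_integral => x _ /=.
  by rewrite ger0_norm// sqr_ge0.
split => //; move: fB; rewrite integral_sqr_nrm2// lee_fin.
by rewrite ler_pXn2r// nnegrE// nrm2_ge0.
Qed.

Lemma nrm2_cst1 : nrm2 (fun=> 1) = 2 * pi :> R.
Proof.
rewrite /nrm2 /inner (eq_Rintegral _ (g := fun=> 1)); last by move=> x _; rewrite mulr1.
rewrite (@Rintegral_cst _ _ _ mu)// mul1r -[fine _]/(fine (mu Om)) leb2_Omega/=.
by rewrite sqrtr_sqr ger0_norm// mulr_ge0 ?pi_ge0.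
Qed.

Lemma L2_geometric_dist (F : nat -> R * R -> R) (K : R) : (forall n, L2per R (F n)) ->
  (forall n, nrm2 (fun x => F n.+1 x - F n x) <= K * 2^-1 ^+ n) ->
  forall n m, (n <= m)%N -> nrm2 (fun x => F m x - F n x) <= K * 2 * 2^-1 ^+ n.
Proof.
move=> LF FK.
have K0 : 0 <= K by have := FK 0%N; rewrite expr0 mulr1; apply: le_trans; exact: nrm2_ge0.
move=> n m /subnK <-; move: (m - n)%N => {m} d; rewrite addnC.
suff : nrm2 (fun x => F (n + d)%N x - F n x) <= K * 2 * 2^-1 ^+ n - K * 2 * 2^-1 ^+ (n + d).
  move/le_trans; apply; rewrite gerBl mulr_ge0 ?mulr_ge0 ?exprn_ge0//.
elim: d => [|d IH].
  rewrite addn0 subrr (_ : (fun x => F n x - F n x) = fun=> 0).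
    by rewrite /nrm2 inner0l sqrtr0.
  by apply/funext => x; rewrite subrr.
rewrite addnS (_ : (fun x => F (n + d).+1 x - F n x) = (fun x => (F (n + d).+1 x - F (n + d)%N x) + (F (n + d)%N x - F n x))); last first.
  by apply/funext => x; ring.
apply: le_trans (nrm2D (L2B (LF _) (LF _)) (L2B (LF _) (LF _))) _.
apply: le_trans (lerD (FK _) IH) _.
by rewrite exprS; lra.
Qed.

(** The series of |F (n+1) - F n| has finite integral, hence converges almost everywhere; Fatou's
    lemma carries the geometric distance bounds to the pointwise limit. *)
Lemma L2_complete (F : nat -> R * R -> R) (K : R) : (forall n, L2per R (F n)) ->
  (forall n, nrm2 (fun x => F n.+1 x - F n x) <= K * 2^-1 ^+ n) ->
  exists2 f, L2per R f & forall n, nrm2 (fun x => f x - F n x) <= K * 2 * 2^-1 ^+ n.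
Proof.
move=> LF FK.
have K0 : 0 <= K by have := FK 0%N; rewrite expr0 mulr1; apply: le_trans; exact: nrm2_ge0.
pose d n x : \bar R := (`|F n.+1 x - F n x|)%:E.
pose h x : \bar R := (\sum_(0 <= n <oo) d n x)%E.
have Ld n : L2per R (fun x => F n.+1 x - F n x) by exact: L2B.
have md n : mfO (d n).
  by apply/measurable_EFinP; apply: measurableT_comp => //; exact: measurable_L2.
have d0 n x : (0 <= d n x)%E by rewrite lee_fin.
have mh : mfO h.
  have := @ge0_emeasurable_sum _ _ R (Om : set (measurableTypeR R * measurableTypeR R)) d xpredT (fun k x _ _ => d0 k x) (fun k _ => md k).
  by [].
have ih : (\int[mu]_(x in Om) h x <= (2 * K * (2 * pi))%:E)%E.
  rewrite /h integral_nneseries//; apply: nneseries_bound => [n|n].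
    by apply: integral_ge0.
  apply: le_trans (_ : (\sum_(0 <= k < n) (K * 2^-1 ^+ k * (2 * pi))%:E <= _)%E).
    apply: lee_sum => k _.
    have Lab : L2per R (fun x => `|F k.+1 x - F k x|).
      apply: (L2_le (g := fun x => F k.+1 x - F k x)) => //.
        by apply: measurableT_comp => //; exact: measurable_L2.
      by move=> x _; rewrite normr_id.
    have := CauchySchwarz Lab (L2_cst 1).
    rewrite nrm2_cst1 => /(le_trans (ler_norm _)) CS.
    have -> : (\int[mu]_(x in Om) d k x = (inner (fun x => `|F k.+1 x - F k x|) (fun=> 1))%:E)%E.
      rewrite /inner /Rintegral fineK; last first.
        by apply: integrable_fin_num => //; exact: integrable_L2M Lab (L2_cst 1).
      by apply: eq_integral => x _; rewrite mulr1.
    rewrite lee_fin; apply: le_trans CS _; apply: ler_wpM2r.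
      by rewrite mulr_ge0 ?pi_ge0.
    apply: le_trans (FK k).
    rewrite /nrm2 le_eqVlt; apply/orP; left; apply/eqP; congr Num.sqrt.
    by apply: eq_Rintegral => x _; rewrite -!expr2 real_normK// num_real.
  rewrite sumEFin lee_fin.
  have -> : \sum_(0 <= k < n) K * 2^-1 ^+ k * (2 * pi) = 2 * K * (2 * pi) * (1 - 2^-1 ^+ n).
    elim: n => [|n IH]; first by rewrite big_geq// expr0; ring.
    by rewrite big_nat_recr//= IH exprS; field.
  rewrite -[X in _ <= X]mulr1; apply: ler_wpM2l; last by rewrite gerBl exprn_ge0.
  by rewrite !mulr_ge0 ?pi_ge0.
have hfin : {ae mu, forall x, Om x -> (h x < +oo)%E}.
  have : mu.-integrable Om h.
    apply/integrableP; split => //; apply: le_lt_trans (ltry (2 * K * (2 * pi))).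
    apply: le_trans ih; rewrite le_eqVlt; apply/orP; left; apply/eqP; apply: eq_integral => x _.
    by rewrite gee0_abs// nneseries_ge0.
  move/(integrable_ae measurable_Omega); apply: aeS_Omega => x hx /hx.
  by rewrite fin_numElt => /andP[].
pose A := Om `&` [set x | (h x < +oo)%E].
have mA : measurable (A : set (measurableTypeR R * measurableTypeR R)).
  exact: emeasurable_fun_infty_o.
(* Cutting off outside the convergence set A makes the limit exist at every point of [Omega], so
   that it is measurable there. *)
pose g n x := F n x * \1_A x.
pose f x := limn (g ^~ x).
have mg n : mfO (g n).
  by apply: measurable_funM; [exact: measurable_L2|exact: measurable_indic].
have gf x : Om x -> g n x @[n --> \oo] --> f x.
  move=> Ox; suff : cvgn (g ^~ x) by [].
  have [hx|hx] := pselect (h x < +oo)%E; last first.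
    rewrite (_ : g ^~ x = fun=> 0); first exact: is_cvg_cst.
    by apply/funext => n; rewrite /g indicE memNset ?mulr0// => -[].
  rewrite (_ : g ^~ x = fun n => F 0%N x + series (fun k => F k.+1 x - F k x) n); last first.
    apply/funext => n; rewrite /g indicE mem_set// mulr1 seriesEnat/= telescope_sumr//.
    by rewrite addrC subrK.
  apply: is_cvgD; first exact: is_cvg_cst.
  apply: normed_cvg; apply: nondecreasing_is_cvgn.
    change {homo series (fun k => `|F k.+1 x - F k x|) : n m / (n <= m)%N >-> n <= m}.
    apply/nondecreasing_seqP => n; rewrite !seriesEnat /= big_nat_recr//= lerDl.
    exact: normr_ge0.
  change (has_ubound (range (series (fun k => `|F k.+1 x - F k x|)))).
  exists (fine (h x)) => _ [n _ <-]; rewrite seriesEnat/= -lee_fin fineK; last first.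
    by rewrite ge0_fin_numE// nneseries_ge0.
  rewrite -sumEFin; exact: nneseries_lim_ge.
have Lg n : L2per R (g n).
  apply: (L2_le (g := F n)) => // x _; rewrite /g indicE.
  by case: (x \in A); rewrite /= ?mulr1 ?mulr0 ?normr0.
have mf : mfO f by apply: measurable_fun_cvg gf.
have gF n m : nrm2 (fun x => g m x - g n x) <= nrm2 (fun x => F m x - F n x).
  have LL := L2B (LF m) (LF n).
  rewrite -(@ler_pXn2r _ 2) ?nnegrE ?nrm2_ge0// -lee_fin -!integral_sqr_nrm2//; last exact: L2B.
  apply: ge0_le_integral => //.
  - by move=> x _; rewrite lee_fin sqr_ge0.
  - by apply/measurable_EFinP; apply: measurable_funX; apply: measurable_funB.
  - by apply/measurable_EFinP; apply: measurable_funX; exact: measurable_L2.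
  - move=> x _; rewrite lee_fin /g -mulrBl exprMn indicE.
    by case: (x \in A); rewrite /= ?expr1n ?mulr1// expr0n mulr0 sqr_ge0.
have fg n : L2per R (fun x => f x - g n x) /\ nrm2 (fun x => f x - g n x) <= K * 2 * 2^-1 ^+ n.
  apply: L2_of_bound.
  - exact: measurable_funB.
  - apply: (@fatou_bound (fun i x => (g (i + n)%N x - g n x) ^+ 2)).
    + by move=> i; apply: measurable_funX; exact: measurable_funB.
    + by move=> i x _; exact: sqr_ge0.
    + move=> x Ox; apply: (@cvg_comp _ _ _ (fun i => g (i + n)%N x - g n x) (fun y => y ^+ 2)); last exact: exprn_continuous.
      apply: cvgB; last exact: cvg_cst.
      by rewrite (cvg_shiftn n (g ^~ x)); exact: gf.
    + move=> i; rewrite integral_sqr_nrm2; last exact: L2B.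
      rewrite lee_fin ler_pXn2r ?nnegrE ?nrm2_ge0//; last by rewrite !mulr_ge0// exprn_ge0.
      by apply: le_trans (gF _ _) _; apply: L2_geometric_dist => //; exact: leq_addl.
  - by rewrite !mulr_ge0// exprn_ge0.
have Lf : L2per R f.
  rewrite (_ : f = fun x => (f x - g 0%N x) + g 0%N x); last by apply/funext => x; rewrite subrK.
  exact: L2D (fg 0%N).1 (Lg 0%N).
exists f => // n; have [L le] := fg n; apply: le_trans le.
rewrite /nrm2 (inner_eq_torus (g := fun x => f x - g n x))//; try exact: L2B.
  rewrite innerC (inner_eq_torus (g := fun x => f x - g n x))//; try exact: L2B.
  by apply: aeS_Omega hfin => x hx Ox; rewrite /g indicE mem_set ?mulr1//; split => //; exact: hx.
by apply: aeS_Omega hfin => x hx Ox; rewrite /g indicE mem_set ?mulr1//; split => //; exact: hx.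
Qed.

Definition hnrm (c : int * int -> R[i]) N := \sum_(k <- box N) normc2 (c k).

Lemma hnrm_nd (c : int * int -> R[i]) N M : (N <= M)%N -> hnrm c N <= hnrm c M.
Proof. by move=> NM; apply: ler_sum_box => // k; exact: normc2_ge0. Qed.

Lemma nrm2_tp_dist (c : int * int -> R[i]) N M : herm c -> (N <= M)%N ->
  nrm2 (fun x => tp (box M) c x - tp (box N) c x) ^+ 2 = vol * (hnrm c M - hnrm c N).
Proof.
move=> hc NM.
have E : proj N (tp (box M) c) = tp (box N) c.
  apply/funext => x; rewrite /proj /tp big_seq [RHS]big_seq; apply: eq_bigr => k kN.
  by rewrite !fourier_tp ?(box_sub NM kN).
have := nrm2_subproj N (L2_tp (box M) c); rewrite E => ->.
by rewrite !nrm2_tp// mulrBr.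
Qed.

Lemma fourier_le f k : L2per R f -> vol * normc2 (fourier f k) <= nrm2 f ^+ 2.
Proof.
move=> Lf; pose N := maxn `|k.1|%N `|k.2|%N.
have kN : k \in box N by rewrite mem_box leq_maxl leq_maxr.
apply: le_trans (Bessel N Lf); apply: ler_wpM2l; first exact: ltW (@vol_gt0 R).
rewrite (bigD1_seq k) ?uniq_box//= lerDl; apply: sumr_ge0 => j _; exact: normc2_ge0.
Qed.

Lemma normc2_eq0 (z : R[i]) : normc2 z <= 0 -> z = 0.
Proof.
case: z => a b; rewrite /normc2/= => h.
have := sqr_ge0 a; have := sqr_ge0 b => h1 h2.
have /eqP : a ^+ 2 = 0 by lra.
have /eqP : b ^+ 2 = 0 by lra.
by rewrite !expf_eq0/= => /eqP -> /eqP ->.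
Qed.

Lemma exp_half_small (C e : R) : 0 < e -> exists n, forall m, (n <= m)%N -> C * 2^-1 ^+ m < e.
Proof.
move=> e0; have := @cvg_geometric R C 2^-1.
rewrite ger0_norm; last lra.
move=> /(_ ltac:(lra)) /cvgrPdist_lt /(_ e e0) [n _ H]; exists n => m nm.
have := H m nm; rewrite /= sub0r normrN; apply: le_lt_trans; exact: ler_norm.
Qed.

(** Boxes are chosen so that the tail of the square sum after the j-th one is at most 4^(-j); the
    partial sums over them are then Cauchy at a geometric rate. *)
Lemma synth_strong (c : int * int -> R[i]) (M : R) : herm c -> (forall N, hnrm c N <= M) ->
  exists f (N : nat -> nat), [/\ L2per R f, (forall k, fourier f k = c k) &
    forall j, nrm2 (fun x => f x - tp (box (N j)) c x) <= 2 * pi * 2 * 2^-1 ^+ j].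
Proof.
move=> hc cM.
have cv : cvgn (hnrm c).
  apply: nondecreasing_is_cvgn; first by move=> n m; exact: hnrm_nd.
  by exists M => _ [n _ <-].
have H j : exists n, forall m, (n <= m)%N -> hnrm c m - hnrm c n <= (2^-1 ^+ j) ^+ 2.
  have e0 : 0 < (2^-1 ^+ j) ^+ 2 :> R by rewrite !exprn_gt0.
  have := cv => /cvgrPdist_le /(_ _ e0) [n _ hn]; exists n => m nm.
  have := hn n (leqnn n); rewrite /= ger0_norm ?subr_ge0; last first.
    by apply: nondecreasing_cvgn_le => // a b; exact: hnrm_nd.
  have : hnrm c m <= limn (hnrm c) by apply: nondecreasing_cvgn_le => // a b; exact: hnrm_nd.
  by lra.
pose n0 j := sval (cid (H j)).
(* The sum makes N monotone and at least n0; the summand j makes every mode enter the box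
   eventually. *)
pose N j := (j + \sum_(i < j.+1) n0 i)%N.
have Nn j : (n0 j <= N j)%N.
  by rewrite /N big_ord_recr/= addnA leq_addl.
have NS j : (N j <= N j.+1)%N.
  by rewrite /N [X in (_ <= _ + X)%N]big_ord_recr/= addSn leqW// leq_add2l leq_addr.
pose F j := tp (box (N j)) c.
have [f Lf fF] : exists2 f, L2per R f & forall n, nrm2 (fun x => f x - F n x) <= 2 * pi * 2 * 2^-1 ^+ n.
  apply: L2_complete => [j|j]; first exact: L2_tp.
  have p0 : 0 <= 2 * pi :> R by rewrite mulr_ge0 ?pi_ge0.
  rewrite -(@ler_pXn2r _ 2) ?nnegrE ?nrm2_ge0//; last by rewrite mulr_ge0 ?exprn_ge0.
  rewrite nrm2_tp_dist ?NS// exprMn; apply: ler_wpM2l; first exact: ltW (@vol_gt0 R).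
  apply: le_trans (svalP (cid (H j)) (N j.+1) _); last exact: leq_trans (Nn j) (NS j).
  by rewrite lerD2l lerN2; apply: hnrm_nd; exact: Nn.
exists f, N; split => // k.
apply/eqP; rewrite -subr_eq0; apply/eqP/normc2_eq0.
apply/ler_addgt0Pl => e e0; rewrite addr0.
have ve : 0 < Num.sqrt (vol * e) by rewrite sqrtr_gt0 mulr_gt0// vol_gt0.
have [n hn] := exp_half_small (2 * pi * 2) ve.
pose j := maxn n (maxn `|k.1|%N `|k.2|%N).
have kN : k \in box (N j).
  have jN : (j <= N j)%N by rewrite /N leq_addr.
  apply: (box_sub jN); rewrite mem_box /j.
  by rewrite !leq_max !leqnn !orbT.
have := fourier_le k (L2B Lf (L2_tp (box (N j)) c)).
rewrite fourierB//; last exact: L2_tp.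
rewrite fourier_tp// kN => h.
rewrite -(ler_pM2l (@vol_gt0 R)); apply: le_trans h _.
rewrite -(sqr_sqrtr (ltW (mulr_gt0 (@vol_gt0 R) e0))).
rewrite ler_pXn2r ?nnegrE ?nrm2_ge0 ?sqrtr_ge0//.
by apply: le_trans (fF j) _; apply/ltW/hn; exact: leq_maxl.
Qed.

Lemma synth (c : int * int -> R[i]) (M : R) : herm c -> (forall N, hnrm c N <= M) ->
  exists f, L2per R f /\ forall k, fourier f k = c k.
Proof. by move=> hc /(synth_strong hc)[f [? [? ? _]]]; exists f. Qed.

Lemma fourier_inj f g : L2per R f -> L2per R g -> (forall k, fourier f k = fourier g k) ->
  eq_torus f g.
Proof.
move=> Lf Lg fg.
have := fourier_inj0 (L2B Lf Lg) _; case.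
  by move=> k; rewrite fourierB// fg subrr.
move=> N [mN N0 sN]; exists N; split => // x /= h; apply: sN => /= h'; apply: h => Ox.
by apply/eqP; rewrite -subr_eq0; apply/eqP/h'.
Qed.

Lemma nrm2_subproj_ni f N M : L2per R f -> (N <= M)%N ->
  nrm2 (fun x => f x - proj M f x) <= nrm2 (fun x => f x - proj N f x).
Proof.
move=> Lf NM; rewrite -(@ler_pXn2r _ 2) ?nnegrE ?nrm2_ge0// (nrm2_subproj M Lf) (nrm2_subproj N Lf).
rewrite lerD2l lerN2 (nrm2_proj M Lf) (nrm2_proj N Lf); apply: ler_wpM2l; first exact: ltW (@vol_gt0 R).
exact: hnrm_nd.
Qed.

Lemma hnrm_fourier f N : L2per R f -> hnrm (fourier f) N <= vol^-1 * nrm2 f ^+ 2.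
Proof.
by move=> Lf; rewrite ler_pdivlMl ?vol_gt0//; exact: Bessel.
Qed.

(** By injectivity f is the function synthesised from its own coefficients, whose partial sums
    converge along a subsequence; the distance to the projection is nonincreasing, which covers all
    larger boxes. *)
Lemma proj_cvg f (e : R) : L2per R f -> 0 < e ->
  exists N, forall M, (N <= M)%N -> nrm2 (fun x => f x - proj M f x) < e.
Proof.
move=> Lf e0.
have [g [N [Lg gf gN]]] := synth_strong (fourier_herm Lf) (fun N => hnrm_fourier N Lf).
have fg : eq_torus f g by apply: fourier_inj => // k; rewrite gf.
have [j hj] := exp_half_small (2 * pi * 2) e0.
exists (N j) => M NM; apply: le_lt_trans (nrm2_subproj_ni Lf NM) _.
apply: le_lt_trans (hj j (leqnn j)); apply: le_trans (gN j).
have Lp := L2_tp (box (N j)) (fourier f).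
rewrite /nrm2 (inner_eq_torus (g := fun x => g x - tp (box (N j)) (fourier f) x))//; try exact: L2B.
  rewrite innerC (inner_eq_torus (g := fun x => g x - tp (box (N j)) (fourier f) x))//; try exact: L2B.
  by apply: aeS_Omega fg => x h /h ->.
by apply: aeS_Omega fg => x h /h ->.
Qed.

Lemma Parseval_le f (B : R) : L2per R f -> (forall N, vol * hnrm (fourier f) N <= B) ->
  nrm2 f ^+ 2 <= B.
Proof.
move=> Lf fB; apply/ler_addgt0Pl => e e0.
have se : 0 < Num.sqrt e by rewrite sqrtr_gt0.
have [N /(_ N (leqnn N)) h] := proj_cvg Lf se.
have : nrm2 (fun x => f x - proj N f x) ^+ 2 <= e.
  by rewrite -[X in _ <= X](sqr_sqrtr (ltW e0)) ler_pXn2r ?nnegrE ?nrm2_ge0 ?sqrtr_ge0// ltW.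
by rewrite nrm2_subproj// nrm2_proj//; have := fB N; rewrite /hnrm; lra.
Qed.

End RieszFischer.

(** * Ordinary differential equations *)

Section Calculus.
Context {R : realType}.
Local Notation leb := (@lebesgue_measure R).
Implicit Types (f g h : R -> R).

Lemma is_derive_eps f (t l : R) :
  (forall e : R, 0 < e -> exists2 d : R, 0 < d &
     forall s : R, `|s - t| < d -> `|f s - f t - l * (s - t)| <= e * `|s - t|) ->
  is_derive t (1 : R) f l.
Proof.
move=> H.
have cv : (h : R)^-1 *: (f (h *: (1 : R) + t) - f t) @[h --> 0^'] --> l.
  apply/cvgrPdist_le => e e0; have [d d0 hd] := H e e0.
  near=> x.
  have x0 : x != 0 by near: x; exact: nbhs_dnbhs_neq.
  have xd : `|x| < d by near: x; apply: dnbhs0_lt.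
  have := hd (x + t); rewrite addrK => /(_ xd) h.
  rewrite -[x *: 1]/(x * 1) mulr1 -[_ *: _]/(_ * _).
  rewrite -(ler_pM2r (_ : 0 < `|x|)) ?normr_gt0// -normrM.
  apply: le_trans h; rewrite -normrN le_eqVlt; apply/orP; left; apply/eqP; congr `|_|.
  by field.
apply: DeriveDef; first by apply/cvg_ex; exists l.
exact: cvg_lim cv.
Unshelve. all: by end_near. Qed.

Lemma derive_continuous f (t l : R) : is_derive t (1 : R) f l -> {for t, continuous f}.
Proof. by move=> [d _]; apply/differentiable_continuous/derivable1_diffP. Qed.

Lemma mean_value_le f (df : R -> R) (a b C : R) : a <= b ->
  (forall x : R, x \in `]a, b[ -> is_derive x (1 : R) f (df x)) ->
  {within `[a, b], continuous f} -> (forall x : R, x \in `]a, b[ -> `|df x| <= C) ->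
  `|f b - f a| <= C * (b - a).
Proof.
move=> ab df1 cf dC; have [e|ne] := eqVneq a b; first by rewrite e !subrr normr0 mulr0.
have {ne}ab : a < b by rewrite lt_neqAle ne.
have [c cab ->] := MVT ab df1 cf.
rewrite normrM [`|b - a|]ger0_norm ?subr_ge0 ?(ltW ab)//.
by apply: ler_wpM2r; [rewrite subr_ge0 ltW|exact: dC].
Qed.

Lemma within_sub f (a b c d : R) : a <= c -> d <= b -> {within `[a, b], continuous f} ->
  {within `[c, d], continuous f}.
Proof.
move=> ac db; apply: continuous_subspaceW => x /=; rewrite !in_itv/= => /andP[h1 h2].
by apply/andP; split; lra.
Qed.

Lemma lipschitz_itv f (df : R -> R) (T C : R) :
  (forall x : R, x \in `]0, T[ -> is_derive x (1 : R) f (df x)) ->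
  {within `[0, T], continuous f} -> (forall x : R, x \in `]0, T[ -> `|df x| <= C) ->
  forall t r : R, t \in `[0, T] -> r \in `[0, T] -> `|f t - f r| <= C * `|t - r|.
Proof.
move=> df1 cf dC.
have H (t r : R) : t \in `[0, T] -> r \in `[0, T] -> t <= r -> `|f r - f t| <= C * (r - t).
  rewrite !in_itv/= => /andP[t0 tT] /andP[r0 rT] tr.
  have sub (x : R) : x \in `]t, r[ -> x \in `]0, T[.
    by rewrite !in_itv/= => /andP[h1 h2]; apply/andP; split; lra.
  have w := within_sub t0 rT cf.
  exact: (mean_value_le tr (fun x xt => df1 x (sub x xt)) w (fun x xt => dC x (sub x xt))).
move=> t r tT rT; have [tr|rt] := leP t r.
  by rewrite distrC [`|t - r|]distrC [`|r - t|]ger0_norm ?subr_ge0//; exact: H.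
by rewrite [`|t - r|]ger0_norm ?subr_ge0 ?(ltW rt)//; apply: H => //; exact: ltW.
Qed.

Lemma nonincreasing_itv f (df : R -> R) (T : R) :
  (forall x : R, x \in `]0, T[ -> is_derive x (1 : R) f (df x)) ->
  {within `[0, T], continuous f} -> (forall x : R, x \in `]0, T[ -> df x <= 0) ->
  forall t : R, t \in `[0, T] -> f t <= f 0.
Proof.
move=> df1 cf d0 t; rewrite in_itv/= => /andP[t0 tT].
have [->|tn] := eqVneq t 0 => //.
have {tn}t0 : 0 < t by rewrite lt_neqAle eq_sym tn.
have sub (x : R) : x \in `]0, t[ -> x \in `]0, T[.
  by rewrite !in_itv/= => /andP[h1 h2]; apply/andP; split; lra.
have [c /sub c0 h] := @MVT R f df 0 t t0 (fun x xt => df1 x (sub x xt)) (within_sub (lexx 0) tT cf).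
rewrite -subr_le0 h subr0; apply: mulr_le0_ge0; [exact: d0|exact: ltW].
Qed.

Lemma is_derive_expM (a t : R) : is_derive t (1 : R) (fun s => expR (a * s)) (a * expR (a * t)).
Proof.
rewrite mulrC; apply: (is_derive1_comp (f := @expR R) (g := fun s => a * s)).
by rewrite -[X in is_derive _ _ _ X]mulr1 -[a * 1]/(a *: (1 : R)); exact: is_deriveZ.
Qed.

Lemma expM_cont (a : R) : continuous (fun s => expR (a * s)).
Proof. by move=> t; exact: derive_continuous (is_derive_expM a t). Qed.

Lemma within_cont (A : set R) f : continuous f -> {within A, continuous f}.
Proof. exact: continuous_subspaceT. Qed.

Lemma within_D (A : set R) f g : {within A, continuous f} -> {within A, continuous g} ->
  {within A, continuous (fun x => f x + g x)}.
Proof. by move=> cf cg x; apply: cvgD; [exact: cf|exact: cg]. Qed.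

Lemma within_B (A : set R) f g : {within A, continuous f} -> {within A, continuous g} ->
  {within A, continuous (fun x => f x - g x)}.
Proof. by move=> cf cg x; apply: cvgB; [exact: cf|exact: cg]. Qed.

Lemma within_M (A : set R) f g : {within A, continuous f} -> {within A, continuous g} ->
  {within A, continuous (fun x => f x * g x)}.
Proof. by move=> cf cg x; apply: cvgM; [exact: cf|exact: cg]. Qed.

Lemma within_cst (A : set R) (c : R) : {within A, continuous (fun=> c)}.
Proof. by move=> x; exact: cvg_cst. Qed.

Lemma within_sum (A : set R) (J : Type) (r : seq J) (F : J -> R -> R) :
  (forall j, {within A, continuous (F j)}) -> {within A, continuous (fun x => \sum_(j <- r) F j x)}.
Proof.
move=> cF; elim: r => [|j r IH].
  by under eq_fun do rewrite big_nil; exact: within_cst.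
by under eq_fun do rewrite big_cons; exact: within_D.
Qed.

Lemma within_sum_seq (A : set R) (J : eqType) (r : seq J) (F : J -> R -> R) :
  (forall j, j \in r -> {within A, continuous (F j)}) ->
  {within A, continuous (fun x => \sum_(j <- r) F j x)}.
Proof.
elim: r => [|j r IH] cF.
  by under eq_fun do rewrite big_nil; exact: within_cst.
under eq_fun do rewrite big_cons.
apply: within_D; first by apply: cF; rewrite mem_head.
by apply: IH => i ir; apply: cF; rewrite inE ir orbT.
Qed.

Lemma derive_sum_seq (J : eqType) (r : seq J) (F : J -> R -> R) (dF : J -> R) (t : R) :
  (forall j, j \in r -> is_derive t (1 : R) (F j) (dF j)) ->
  is_derive t (1 : R) (fun x => \sum_(j <- r) F j x) (\sum_(j <- r) dF j).
Proof.
elim: r => [|j r IH] cF.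
  by rewrite big_nil; under eq_fun do rewrite big_nil; exact: is_derive_cst.
rewrite big_cons; under eq_fun do rewrite big_cons.
apply: is_deriveD; first by apply: cF; rewrite mem_head.
by apply: IH => i ir; apply: cF; rewrite inE ir orbT.
Qed.

Lemma derive_M f g (t df dg : R) : is_derive t (1 : R) f df -> is_derive t (1 : R) g dg ->
  is_derive t (1 : R) (fun x => f x * g x) (f t * dg + g t * df).
Proof. exact: is_deriveM. Qed.

Lemma derive_D f g (t df dg : R) : is_derive t (1 : R) f df -> is_derive t (1 : R) g dg ->
  is_derive t (1 : R) (fun x => f x + g x) (df + dg).
Proof. exact: is_deriveD. Qed.

Lemma derive_B f g (t df dg : R) : is_derive t (1 : R) f df -> is_derive t (1 : R) g dg ->
  is_derive t (1 : R) (fun x => f x - g x) (df - dg).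
Proof. exact: is_deriveB. Qed.

Lemma derive_sqr f (t df : R) : is_derive t (1 : R) f df ->
  is_derive t (1 : R) (fun x => f x ^+ 2) (2 * f t * df).
Proof.
move=> h; have := derive_M h h.
under [X in is_derive _ _ X]eq_fun do rewrite -expr2.
by move/is_derive_eq; apply; ring.
Qed.

Lemma derive_Z (c : R) f (t df : R) : is_derive t (1 : R) f df ->
  is_derive t (1 : R) (fun x => c * f x) (c * df).
Proof. exact: is_deriveZ. Qed.

(* Gronwall: (f t + b / a) e^(-a t) is nonincreasing. *)
Lemma gronwall f (df : R -> R) (T a b : R) : 0 < a -> 0 <= b ->
  (forall x : R, x \in `]0, T[ -> is_derive x (1 : R) f (df x)) ->
  {within `[0, T], continuous f} -> (forall x : R, x \in `]0, T[ -> df x <= a * f x + b) ->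
  forall t : R, t \in `[0, T] -> f t <= (f 0 + b / a) * expR (a * t).
Proof.
move=> a0 b0 df1 cf fab t tT.
have an : a != 0 by rewrite gt_eqF.
have /= := @nonincreasing_itv (fun t => (f t + b / a) * expR (- a * t))
  (fun t => (f t + b / a) * (- a * expR (- a * t)) + expR (- a * t) * df t) T.
move=> /(_ _ _ _ t tT) H.
have : (f t + b / a) * expR (- a * t) <= (f 0 + b / a) * expR (- a * 0).
  apply: H.
  - move=> x xT; apply: derive_M; last exact: is_derive_expM.
    rewrite -[X in is_derive _ _ _ X]addr0; by apply: derive_D; first exact: df1.
  - apply: within_M; last exact/within_cont/expM_cont.
    by apply: within_D => //; exact: within_cst.
  - move=> x xT; rewrite [X in X <= _](_ : _ = (df x - (a * f x + b)) * expR (- a * x)); last by field.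
    by apply: mulr_le0_ge0; [rewrite subr_le0 fab|exact: expR_ge0].
rewrite mulr0 expR0 mulr1 mulNr expRN ler_pdivrMr ?expR_gt0// => h.
by apply: le_trans h; rewrite lerDl; exact: divr_ge0 b0 (ltW a0).
Qed.

(** The mean value theorem for F n - g t * id bounds the linearisation error at t by e |s - t| with
    the same neighbourhood for all large n, and the bound survives the limit. *)
Lemma derive_limit (F dF : nat -> R -> R) f g (T : R) :
  (forall n (x : R), x \in `]0, T[ -> is_derive x (1 : R) (F n) (dF n x)) ->
  (forall n, {within `[0, T], continuous (F n)}) ->
  (forall x : R, x \in `[0, T] -> F n x @[n --> \oo] --> f x) ->
  (forall e : R, 0 < e -> exists N, forall n (x : R), (N <= n)%N -> x \in `]0, T[ -> `|dF n x - g x| <= e) ->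
  forall t : R, t \in `]0, T[ -> {for t, continuous g} -> is_derive t (1 : R) f (g t).
Proof.
move=> dF1 cF Ff uF t tT cg.
apply: is_derive_eps => e e0.
have e20 : 0 < e / 2 by lra.
move/cvgrPdist_le : cg => /(_ _ e20)/= [d1 d10 h1].
move: (tT); rewrite in_itv/= => /andP[t0 tT'].
pose d := Num.min d1 (Num.min t (T - t)).
exists d; first by rewrite !lt_min; apply/and3P; split => //; lra.
move=> s; rewrite !lt_min => /and3P[sd1 st sTt].
have sT : s \in `]0, T[.
  by move: st sTt; rewrite in_itv/= !ltr_norml => /andP[a1 a2] /andP[a3 a4]; apply/andP; split; lra.
have in_cc (x : R) : x \in `]0, T[ -> x \in `[0, T].
  by rewrite !in_itv/= => /andP[a1 a2]; apply/andP; split; exact: ltW.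
have key n : (forall x : R, x \in `]0, T[ -> `|dF n x - g x| <= e / 2) ->
    `|F n s - F n t - g t * (s - t)| <= e * `|s - t|.
  move=> hn.
  have sub (a b x : R) : a \in `]0, T[ -> b \in `]0, T[ -> x \in `]a, b[ -> x \in `]0, T[.
    by rewrite !in_itv/= => /andP[a1 a2] /andP[a3 a4] /andP[a5 a6]; apply/andP; split; lra.
  have mv (a b : R) : a \in `]0, T[ -> b \in `]0, T[ -> a < b -> `|a - t| < d1 -> `|b - t| < d1 ->
     `|F n b - F n a - g t * (b - a)| <= e * (b - a).
    move=> aT bT ab ad bd.
    have wc : {within `[a, b], continuous (F n)}.
      by move: aT bT; rewrite !in_itv/= => /andP[a1 a2] /andP[a3 a4]; apply: within_sub (cF n); exact: ltW.
    have [c cab ->] := @MVT R (F n) (dF n) a b ab (fun x xt => dF1 n x (sub a b x aT bT xt)) wc.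
    have cT := sub a b c aT bT cab.
    rewrite -mulrBl normrM [`|b - a|]ger0_norm ?subr_ge0 ?(ltW ab)//.
    apply: ler_wpM2r; first by rewrite subr_ge0 ltW.
    have cd : `|t - c| < d1.
      move: cab ad bd; rewrite in_itv/= !ltr_norml => /andP[a1 a2] /andP[a3 a4] /andP[a5 a6].
      by apply/andP; split; lra.
    have := h1 c cd => h.
    rewrite -(subrKA (g c)); apply: le_trans (ler_normD _ _) _.
    have := hn c cT; rewrite (distrC (g c)) => h'.
    by apply: le_trans (lerD h' h) _; lra.
  have tt : `|t - t| < d1 by rewrite subrr normr0.
  have [st'|ts|->] := ltgtP s t.
  - have := mv s t sT tT st' sd1 tt.
    rewrite [`|s - t|]distrC [`|t - s|]ger0_norm ?subr_ge0 ?(ltW st')// => h.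
    apply: le_trans h; rewrite -normrN le_eqVlt; apply/orP; left; apply/eqP; congr `|_|; ring.
  - have := mv t s tT sT ts tt sd1.
    by rewrite [`|s - t|]ger0_norm ?subr_ge0 ?(ltW ts).
  - by rewrite !subrr mulr0 subrr normr0 mulr0.
have [N hN] := uF _ e20.
have cv : `|F n s - F n t - g t * (s - t)| @[n --> \oo] --> `|f s - f t - g t * (s - t)|.
  apply: cvg_norm; apply: cvgB; last exact: cvg_cst.
  by apply: cvgB; apply: Ff; exact: in_cc.
rewrite -(cvg_lim (@Rhausdorff R) cv).
apply: limr_le; first by apply/cvg_ex; eexists; exact: cv.
by exists N => // n /= Nn; apply: key => x; exact: hN.
Qed.

End Calculus.

(** * Primitives and the Cauchy-Lipschitz theorem *)

Section Picard.
Context {R : realType}.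
Local Notation leb := (@lebesgue_measure R).
Implicit Types (f g h : R -> R).

Definition lip_on (T : R) f := exists2 C : R, 0 <= C &
  forall t r : R, t \in `[0, T] -> r \in `[0, T] -> `|f t - f r| <= C * `|t - r|.

Lemma lip_on_within (T : R) f : 0 < T -> lip_on T f -> {within `[0, T], continuous f}.
Proof.
move=> T0 [C C0 fC].
(* Clamping to [0, T] is 1-Lipschitz and extends f to a continuous function on the line. *)
pose cl (t : R) := Num.min (Num.max t 0) T.
have clT t : cl t \in `[0, T].
  rewrite in_itv/= /cl ge_min lexx orbT andbT le_min le_max lexx orbT /=; exact: ltW.
have cl1 t r : `|cl t - cl r| <= `|t - r|.
  rewrite /cl /Num.min /Num.max.
  have := ler_norm (t - r); have := ler_norm (r - t); rewrite (distrC r t) ler_norml.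
  by case: (ltP t 0) => ?; case: (ltP r 0) => ?; do 2 case: ltP => ?; move=> ? ?; apply/andP; split; lra.
have cg : continuous (f \o cl).
  move=> t; apply/cvgrPdist_le => e e0.
  near=> s; apply: le_trans (fC _ _ (clT _) (clT _)) _.
  apply: le_trans (_ : (C + 1) * `|t - s| <= _).
    apply: le_trans (ler_wpM2l C0 (cl1 t s)) _.
    by rewrite mulrDl lerDl mul1r.
  rewrite -ler_pdivlMl; last by lra.
  near: s; apply: cvgr_dist_le; first exact: cvg_id.
  by rewrite mulr_gt0// invr_gt0; lra.
apply: (@subspace_eq_continuous _ _ _ (f \o cl)); last exact: continuous_subspaceT.
move=> x; rewrite inE/= in_itv/= => /andP[x0 xT]; congr f.
by rewrite /cl max_l// min_l.
Unshelve. all: by end_near. Qed.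

Lemma within_interior_cont (T : R) f : {within `[0, T], continuous f} ->
  forall t : R, t \in `]0, T[ -> {for t, continuous f}.
Proof.
move=> cf t tT; have T0 : 0 < T by move: tT; rewrite in_itv/= => /andP[]; exact: lt_trans.
by move/(continuous_within_itvP _ T0) : cf => [+ _ _]; exact.
Qed.

Definition prim f (t : R) : R := \int[leb]_(x in `[0, t]) f x.

Lemma prim0 f : prim f 0 = 0.
Proof. by rewrite /prim set_itv1 Rintegral_set1. Qed.

Lemma integrable_within (T : R) f : {within `[0, T], continuous f} ->
  leb.-integrable `[0, T] (EFin \o f).
Proof. by move=> cf; apply: continuous_compact_integrable => //; exact: segment_compact. Qed.

Lemma prim_cont (T : R) f : 0 < T -> {within `[0, T], continuous f} ->
  {within `[0, T], continuous (prim f)}.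
Proof.
by move=> T0 cf; exact: (parameterized_integral_continuous (ltW T0) (integrable_within cf)).
Qed.

Lemma prim_derive (T : R) f : {within `[0, T], continuous f} ->
  forall t : R, t \in `]0, T[ -> is_derive t (1 : R) (prim f) (f t).
Proof.
move=> cf t tT; have /andP[t0 tT'] : 0 < t < T by move: tT; rewrite in_itv.
have wt := within_interior_cont cf tT.
have [d1 d2] := @continuous_FTC1_closed R f 0 t T tT' (integrable_within cf) t0 wt.
rewrite derive1E in d2; exact: DeriveDef d1 d2.
Qed.

Lemma prim_lip (T C : R) f : 0 < T -> 0 <= C -> {within `[0, T], continuous f} ->
  (forall t : R, t \in `]0, T[ -> `|f t| <= C) -> lip_on T (prim f).
Proof.
move=> T0 C0 cf fC; exists C => //.
exact: lipschitz_itv (prim_derive cf) (prim_cont T0 cf) fC.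
Qed.

(** The gained factor 1 / a makes the Picard map a contraction for an exponential weight, whatever
    the length T of the interval. *)
Lemma prim_exp_bound (T C a : R) f : 0 < T -> 0 < a -> 0 <= C -> {within `[0, T], continuous f} ->
  (forall t : R, t \in `]0, T[ -> `|f t| <= C * expR (a * t)) ->
  forall t : R, t \in `[0, T] -> `|prim f t| <= C / a * expR (a * t).
Proof.
move=> T0 a0 C0 cf fC t tT.
have an : a != 0 by rewrite gt_eqF.
have H (s : R) : `|s| = 1 -> s * prim f t <= C / a * expR (a * t).
  move=> s1.
  have := @nonincreasing_itv R (fun t => s * prim f t - C / a * expR (a * t))
    (fun t => s * f t - C / a * (a * expR (a * t))) T _ _ _ t tT.
  rewrite prim0 mulr0 mulr0 expR0 mulr1 sub0r lerBlDr => h; apply: le_trans (h _ _ _) _.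
  - by move=> x xT; apply: derive_B; apply: derive_Z; [exact: prim_derive|exact: is_derive_expM].
  - apply: within_B; apply: within_M; try exact: within_cst.
      exact: prim_cont.
    exact/within_cont/expM_cont.
  - move=> x xT; rewrite subr_le0; apply: le_trans (ler_norm _) _.
    rewrite normrM s1 mul1r; apply: le_trans (fC x xT) _.
    by rewrite mulrA divfK.
  - by rewrite gerDr oppr_le0 divr_ge0// ltW.
rewrite ler_norml; apply/andP; split.
  by rewrite lerNl -mulN1r; apply: H; rewrite normrN1.
by rewrite -[X in X <= _]mul1r; apply: H; rewrite normr1.
Qed.

Lemma lip_on_bounded (T : R) f : lip_on T f -> exists2 B : R, 0 <= B &
  forall t : R, t \in `[0, T] -> `|f t| <= B.
Proof.
move=> [C C0 fC]; exists (`|f 0| + C * `|T|); first by rewrite addr_ge0 ?mulr_ge0.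
move=> t tT; have := tT; rewrite in_itv/= => /andP[t0 tT'].
have z0 : (0 : R) \in `[0, T] by rewrite in_itv/= lexx (le_trans t0).
have := fC t 0 tT z0; rewrite subr0 => h.
have : `|f t| <= `|f 0| + `|f t - f 0| by rewrite -[X in `|X| <= _](subrKC (f 0)) ler_normD.
move/le_trans; apply; rewrite lerD2l; apply: le_trans h _; apply: ler_wpM2l => //.
by rewrite !ger0_norm//; lra.
Qed.

Lemma itv_oo_cc (T t : R) : t \in `]0, T[ -> t \in `[0, T].
Proof. by rewrite !in_itv/= => /andP[h1 h2]; rewrite !ltW. Qed.

(* The Picard iterates converge geometrically for the weight exp(-2 n L t). *)
Lemma cauchy_lipschitz (I : finType) (F : (I -> R) -> I -> R) (L T : R) (y0 : I -> R) :
  0 < L -> 0 < T ->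
  (forall y z i, `|F y i - F z i| <= L * \sum_j `|y j - z j|) ->
  exists y : R -> I -> R, [/\ forall i, {within `[0, T], continuous (y^~ i)},
    forall i (t : R), t \in `]0, T[ -> is_derive t (1 : R) (y^~ i) (F (y t) i) &
    forall i, y 0 i = y0 i].
Proof.
move=> L0 T0 FL.
(* The added 1 keeps n positive for an empty index type. With a = 2 n L, each iteration gains n L /
   a = 1/2. *)
pose n : R := #|I|%:R + 1; have n0 : 0 < n by rewrite ltr_pwDr.
have sumc (c : R) : \sum_(j : I) c = #|I|%:R * c by rewrite sumr_const mulr_natl.
pose a := 2 * (n * L); have a0 : 0 < a by rewrite !mulr_gt0.
pose Y := fix Y (m : nat) (t : R) (i : I) : R :=
  if m is p.+1 then y0 i + prim (fun x => F (Y p x) i) t else y0 i.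
have Flip (y : R -> I -> R) i : (forall j, lip_on T (y^~ j)) -> lip_on T (fun t => F (y t) i).
  move=> ly; have /choice [C hC] : forall j, exists C : R, 0 <= C /\ forall t r : R, t \in `[0, T] -> r \in `[0, T] -> `|y t j - y r j| <= C * `|t - r|.
    by move=> j; have [C C0 h] := ly j; exists C.
  exists (L * \sum_j C j).
    by rewrite mulr_ge0 ?(ltW L0)// sumr_ge0// => j _; have [] := hC j.
  move=> t r tT rT; apply: le_trans (FL _ _ _) _; rewrite -mulrA; apply: ler_wpM2l; first exact: ltW.
  by rewrite mulr_suml; apply: ler_sum => j _; have [_] := hC j; exact.
have Ylip m i : lip_on T ((Y m)^~ i).
  elim: m i => [|m IH] i.
    by exists 0 => // t r _ _ /=; rewrite subrr normr0 mul0r.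
  have [B B0 hB] := lip_on_bounded (Flip _ i IH).
  have [C C0 hC] := prim_lip T0 B0 (lip_on_within T0 (Flip _ i IH)) (fun t tT => hB t (itv_oo_cc tT)).
  by exists C => // t r tT rT; rewrite /= [X in `|X|](_ : _ = prim (fun x => F (Y m x) i) t - prim (fun x => F (Y m x) i) r); [exact: hC|ring].
have Yc m i := lip_on_within T0 (Ylip m i).
have Fc m i := lip_on_within T0 (Flip _ i (Ylip m)).
have Yd m i (t : R) : t \in `]0, T[ -> is_derive t (1 : R) ((Y m.+1)^~ i) (F (Y m t) i).
  move=> tT /=; rewrite -[X in is_derive _ _ _ X]add0r.
  by apply: derive_D; exact: prim_derive (Fc m i) t tT.
pose A := (\sum_i `|F y0 i|) / a; have A0 : 0 <= A by rewrite divr_ge0 ?(ltW a0)// sumr_ge0.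
have exp1 (t : R) : t \in `[0, T] -> 1 <= expR (a * t).
  by rewrite in_itv/= => /andP[t0 _]; rewrite -expR0 ler_expR mulr_ge0// ltW.
have step m i (t : R) : t \in `[0, T] -> `|Y m.+1 t i - Y m t i| <= A * 2^-1 ^+ m * expR (a * t).
  elim: m i t => [|m IH] i t tT.
    rewrite /= addrAC subrr add0r expr0 mulr1.
    apply: (prim_exp_bound (T := T)) => //; first by rewrite sumr_ge0.
      exact: (Fc 0%N i).
    move=> x xT; rewrite -[X in X <= _]mulr1; apply: ler_pM => //; last exact: exp1 (itv_oo_cc xT).
    by rewrite (bigD1 i)//= lerDl sumr_ge0.
  have c1 := Fc m.+1 i; have c2 := Fc m i.
  have -> : Y m.+2 t i - Y m.+1 t i = prim (fun x => F (Y m.+1 x) i - F (Y m x) i) t.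
    rewrite /= [LHS](_ : _ = prim (fun x => F (Y m.+1 x) i) t - prim (fun x => F (Y m x) i) t); last by rewrite /=; ring.
    rewrite /prim -RintegralB//.
    - apply: integrableS (integrable_within c1) => // x /=; rewrite !in_itv/= => /andP[-> h]/=.
      by move: tT; rewrite in_itv/= => /andP[_]; exact: le_trans.
    - apply: integrableS (integrable_within c2) => // x /=; rewrite !in_itv/= => /andP[-> h]/=.
      by move: tT; rewrite in_itv/= => /andP[_]; exact: le_trans.
  have -> : A * 2^-1 ^+ m.+1 = (n * L * (A * 2^-1 ^+ m)) / a.
    by rewrite exprS /a; field; rewrite !gt_eqF.
  apply: (prim_exp_bound (T := T)) => //.
  - by apply: mulr_ge0; [exact: ltW (mulr_gt0 n0 L0)|apply: mulr_ge0 => //; exact: exprn_ge0].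
  - exact: within_B.
  - move=> x xT; apply: le_trans (FL _ _ _) _.
    rewrite [X in _ <= X](_ : _ = L * (n * (A * 2^-1 ^+ m * expR (a * x)))); last by ring.
    apply: ler_wpM2l; first exact: ltW.
    apply: le_trans (ler_sum _ (fun j _ => IH j x (itv_oo_cc xT))) _.
    rewrite sumc; apply: ler_wpM2r; last by rewrite /n lerDl.
    by apply: mulr_ge0; [apply: mulr_ge0 => //; exact: exprn_ge0|exact: expR_ge0].
pose E := expR (a * T).
have stepE m i (t : R) : t \in `[0, T] -> `|Y m.+1 t i - Y m t i| <= A * E * 2^-1 ^+ m.
  move=> tT; apply: le_trans (step m i t tT) _; rewrite mulrAC; apply: ler_wpM2r; first by rewrite exprn_ge0.
  apply: ler_wpM2l => //; rewrite /E ler_expR ler_pM2l//.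
  by move: tT; rewrite in_itv/= => /andP[].
have AE0 : 0 <= A * E by rewrite mulr_ge0// expR_ge0.
have dist m d i (t : R) : t \in `[0, T] -> `|Y (m + d)%N t i - Y m t i| <= A * E * 2 * 2^-1 ^+ m.
  move=> tT; suff : `|Y (m + d)%N t i - Y m t i| <= A * E * 2 * (2^-1 ^+ m - 2^-1 ^+ (m + d)).
    move/le_trans; apply; apply: ler_wpM2l; first by rewrite mulr_ge0.
    by rewrite gerBl exprn_ge0.
  elim: d => [|d IH]; first by rewrite addn0 !subrr normr0 mulr0.
  rewrite addnS -(subrKA (Y (m + d)%N t i)); apply: le_trans (ler_normD _ _) _.
  by apply: le_trans (lerD (stepE _ _ _ tT) IH) _; rewrite exprS; lra.
pose y (t : R) i := limn (fun m => Y m t i).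
have cv i (t : R) : t \in `[0, T] -> Y m t i @[m --> \oo] --> y t i.
  move=> tT; apply/cauchy_cvgP/cauchy_exP => e e0.
  have [m hm] := exp_half_small (A * E * 2) e0.
  exists (Y m t i); exists m => // k /= mk.
  rewrite /ball/= distrC -(subnKC mk); apply: le_lt_trans (dist m (k - m)%N i t tT) _.
  exact: hm.
have ydist m i (t : R) : t \in `[0, T] -> `|Y m t i - y t i| <= A * E * 2 * 2^-1 ^+ m.
  move=> tT.
  have cvn : `|Y m t i - Y k t i| @[k --> \oo] --> `|Y m t i - y t i|.
    by apply: cvg_norm; apply: cvgB; [exact: cvg_cst|exact: cv].
  rewrite -(cvg_lim (@Rhausdorff R) cvn); apply: limr_le.
    by apply/cvg_ex; eexists; exact: cvn.
  by exists m => // k /= mk; rewrite distrC -(subnKC mk); exact: dist.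
have ylip i : lip_on T (y^~ i).
  pose B := `|F y0 i| + L * (n * (A * E * 2)).
  have nAE : 0 <= n * (A * E * 2) by apply: mulr_ge0; [exact: ltW n0|exact: mulr_ge0].
  have B0 : 0 <= B by apply: addr_ge0 => //; apply: mulr_ge0 => //; exact: ltW.
  have FB m (x : R) : x \in `]0, T[ -> `|F (Y m x) i| <= B.
    move=> xT; rewrite -(subrK (F y0 i) (F (Y m x) i)); apply: le_trans (ler_normD _ _) _.
    rewrite addrC lerD2l; apply: le_trans (FL _ _ _) _; apply: ler_wpM2l; first exact: ltW.
    apply: le_trans (ler_sum _ (fun j _ => dist 0%N m j x (itv_oo_cc xT))) _.
    rewrite sumc expr0 mulr1; apply: ler_wpM2r; first by rewrite mulr_ge0.
    by rewrite /n lerDl.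
  exists B => // t r tT rT.
  have cvn : `|Y m.+1 t i - Y m.+1 r i| @[m --> \oo] --> `|y t i - y r i|.
    by apply: cvg_norm; apply: cvgB; rewrite (cvg_shiftS (fun m => Y m _ i)); exact: cv.
  rewrite -(cvg_lim (@Rhausdorff R) cvn); apply: limr_le.
    by apply/cvg_ex; eexists; exact: cvn.
  by apply: nearW => m; exact: lipschitz_itv (Yd m i) (Yc m.+1 i) (FB m) t r tT rT.
exists y; split.
- by move=> i; exact: lip_on_within.
- move=> i t tT; apply: (@derive_limit R (fun m => (Y m.+1)^~ i) (fun m x => F (Y m x) i) (y^~ i) (fun x => F (y x) i) T).
  + by move=> m; exact: Yc.
  + by move=> x xT; rewrite (cvg_shiftS (fun m => Y m x i)); exact: cv.
  + move=> e e0; have [N hN] := exp_half_small (L * (n * (A * E * 2))) e0.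
    exists N => m x Nm xT; apply: le_trans (ltW (hN m Nm)); apply: le_trans (FL _ _ _) _.
    rewrite [X in _ <= X](_ : _ = L * (n * (A * E * 2 * 2^-1 ^+ m))); last by ring.
    apply: ler_wpM2l; first exact: ltW.
    apply: le_trans (ler_sum _ (fun j _ => ydist m j x (itv_oo_cc xT))) _.
    rewrite sumc; apply: ler_wpM2r; last by rewrite /n lerDl.
    by apply: mulr_ge0; [exact: mulr_ge0|exact: exprn_ge0].
  + exact: tT.
  + exact: (within_interior_cont (lip_on_within T0 (Flip _ i ylip)) tT).
- move=> i; have z0 : (0 : R) \in `[0, T] by rewrite in_itv/= lexx ltW.
  apply: (cvg_unique (@Rhausdorff R) (cv i 0 z0)).
  rewrite (_ : (fun m => Y m 0 i) = fun=> y0 i); first exact: cvg_cst.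
  by apply/funext => -[|m] //=; rewrite prim0 addr0.
Qed.

End Picard.

(** * Energy estimates for the transport term *)

Section Weights.
Context {R : realType}.
Implicit Types (k l m : int * int).

Lemma sqnormk_ge0 k : 0 <= @sqnormk R k.
Proof. by rewrite addr_ge0 ?sqr_ge0. Qed.

(** The Japanese bracket of k. Its power [ws s] is the square root of the weight in the norm of
    H^s. *)
Definition bra k : R := Num.sqrt (1 + sqnormk R k).

Lemma bra1_ge0 k : 0 <= 1 + @sqnormk R k.
Proof. by rewrite addr_ge0 ?sqnormk_ge0. Qed.

Lemma sqr_bra k : bra k ^+ 2 = 1 + sqnormk R k.
Proof. by rewrite sqr_sqrtr// bra1_ge0. Qed.

Lemma bra_ge1 k : 1 <= bra k.
Proof. by rewrite -[X in X <= _]sqrtr1 ler_wsqrtr// lerDl sqnormk_ge0. Qed.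

Lemma bra_gt0 k : 0 < bra k.
Proof. exact: lt_le_trans ltr01 (bra_ge1 k). Qed.

Lemma braN k : bra (- k) = bra k.
Proof. by rewrite /bra /sqnormk /= !mulrNz !sqrrN. Qed.

Lemma abs1_bra k : `|k.1%:~R : R| <= bra k.
Proof.
rewrite -(@ler_pXn2r _ 2) ?nnegrE ?(ltW (bra_gt0 k))// sqr_bra real_normK ?num_real//.
by rewrite /sqnormk; have := sqr_ge0 (k.2%:~R : R); lra.
Qed.

Lemma braD k l : bra (k + l) <= bra k + bra l.
Proof.
have k0 := bra_gt0 k; have l0 := bra_gt0 l.
rewrite -(@ler_pXn2r _ 2) ?nnegrE ?(ltW (bra_gt0 _)) ?addr_ge0 ?ltW//.
rewrite sqrrD !sqr_bra.
have : k.1%:~R * l.1%:~R + k.2%:~R * l.2%:~R <= bra k * bra l.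
  apply: le_trans (ler_norm _) _.
  have kl0 : 0 <= bra k * bra l by exact: ltW (mulr_gt0 k0 l0).
  rewrite -(@ler_pXn2r _ 2) ?nnegrE// [X in _ <= X]exprMn !sqr_bra real_normK ?num_real//.
  rewrite /sqnormk; set a := k.1%:~R; set b := k.2%:~R; set c := l.1%:~R; set d := l.2%:~R.
  have := sqr_ge0 (a * d - b * c); have := sqr_ge0 a; have := sqr_ge0 b; have := sqr_ge0 c; have := sqr_ge0 d.
  by nra.
by rewrite /sqnormk /= !intrD; nra.
Qed.

Lemma bra_dist k m : `|bra k - bra m| <= bra (k - m).
Proof.
rewrite ler_norml; have := braD (k - m) m; rewrite subrK => h1.
have := braD (- (k - m)) k; rewrite braN opprB subrK => h2.
by apply/andP; split; lra.
Qed.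

Lemma powR_diff (s a b : R) : 1 <= s -> 0 < b -> b <= a ->
  a `^ s - b `^ s <= s * a `^ (s - 1) * (a - b).
Proof.
move=> s1 b0 ab; have [->|ne] := eqVneq a b; first by rewrite !subrr mulr0.
have {}ab : b < a by rewrite lt_neqAle eq_sym ne.
have d (x : R) : 0 < x -> is_derive x (1 : R) (fun y : R => y `^ s) (s * x `^ (s - 1)).
  by move=> x0; exact: is_derive1_powR.
have cf : {within `[b, a], continuous (fun y : R => y `^ s)}.
  apply: derivable_within_continuous => x; rewrite in_itv/= => /andP[bx _].
  by have [] := d x (lt_le_trans b0 bx).
have dab (x : R) : x \in `]b, a[ -> is_derive x (1 : R) (fun y : R => y `^ s) (s * x `^ (s - 1)).
  by rewrite in_itv/= => /andP[bx _]; apply: d; exact: lt_trans bx.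
have [c cab ->] := MVT ab dab cf.
apply: ler_wpM2r; first by rewrite subr_ge0 ltW.
apply: ler_wpM2l; first exact: le_trans s1.
move: cab; rewrite in_itv/= => /andP[bc ca].
by apply: ge0_ler_powR; rewrite ?subr_ge0// ?nnegrE; lra.
Qed.

Definition ws (s : R) k : R := bra k `^ s.

Lemma ws_gt0 s k : 0 < ws s k.
Proof. by rewrite powR_gt0// bra_gt0. Qed.

Lemma bra_powR k : bra k = (1 + sqnormk R k) `^ 2^-1.
Proof. by rewrite powR12_sqrt// bra1_ge0. Qed.

Lemma sqr_ws (s : R) k : ws s k ^+ 2 = (1 + sqnormk R k) `^ s.
Proof.
rewrite /ws bra_powR -powR_mulrn ?powR_ge0// -!powRrM; congr (_ `^ _); by field.
Qed.

Lemma ws1 k : ws 1 k = bra k.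
Proof. by rewrite /ws powRr1// ltW// bra_gt0. Qed.

Lemma ws0 k : ws 0 k = 1.
Proof. by rewrite /ws powRr0. Qed.

Lemma le_ws (s r : R) k : s <= r -> ws s k <= ws r k.
Proof. by move=> sr; apply: ler_powR => //; exact: bra_ge1. Qed.

Lemma wsD (s r : R) k : ws (s + r) k = ws s k * ws r k.
Proof. by rewrite /ws powRD//; apply/implyP => _; rewrite gt_eqF// bra_gt0. Qed.

Definition Cs (s : R) : R := s * 2 `^ (s - 1).

Lemma Cs_ge0 s : 1 <= s -> 0 <= Cs s.
Proof. by move=> s1; rewrite mulr_ge0 ?powR_ge0//; lra. Qed.

(** The mean value theorem gives s M^(s-1) [bra (k - m)], with M the larger of the brackets of k and
    m. By the triangle inequality M is at most twice the larger of [bra m] and [bra (k - m)], which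
    is the origin of 2^(s-1) in [Cs]. At most one of the two factors then carries the full weight
    s. *)
Lemma commutator_weight (s : R) k m : 1 <= s ->
  `|ws s k - ws s m| * `|m.1%:~R| <= Cs s * (bra (k - m) * ws s m + ws s (k - m) * bra m).
Proof.
move=> s1; set A := bra k; set B := bra m; set D := bra (k - m).
have A1 : 1 <= A := bra_ge1 k; have B1 : 1 <= B := bra_ge1 m; have D1 : 1 <= D := bra_ge1 _.
have AB : A <= B + D by have := braD (k - m) m; rewrite subrK -/A -/B -/D; lra.
have dAB : `|A - B| <= D := bra_dist k m.
pose M := Num.max A B; pose M' := Num.max B D.
have MM' : M <= 2 * M'.
  rewrite /M /M' /Num.max; case: (ltP A B) => ?; case: (ltP B D) => ?; lra.
have M1 : 1 <= M by rewrite le_max A1.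
have s10 : 0 <= s - 1 by lra.
have h1 : `|ws s k - ws s m| <= s * M `^ (s - 1) * D.
  rewrite /ws -/A -/B.
  have Mp : 0 <= s * M `^ (s - 1) by rewrite mulr_ge0 ?powR_ge0//; lra.
  have [le|lt] := leP B A.
    rewrite ger0_norm; last by rewrite subr_ge0; apply: ge0_ler_powR; rewrite ?nnegrE//; lra.
    apply: le_trans (powR_diff s1 _ le) _; first lra.
    rewrite /M max_l//; apply: ler_wpM2l; first by rewrite mulr_ge0 ?powR_ge0//; lra.
    exact: le_trans (ler_norm _) dAB.
  rewrite distrC ger0_norm; last by rewrite subr_ge0; apply: ge0_ler_powR; rewrite ?nnegrE//; lra.
  apply: le_trans (powR_diff s1 _ (ltW lt)) _; first lra.
  rewrite /M max_r ?(ltW lt)//; apply: ler_wpM2l; first by rewrite mulr_ge0 ?powR_ge0//; lra.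
  by apply: le_trans (ler_norm _) _; rewrite distrC.
have h2 : M `^ (s - 1) <= 2 `^ (s - 1) * (B `^ (s - 1) + D `^ (s - 1)).
  apply: le_trans (_ : (2 * M') `^ (s - 1) <= _).
    by apply: ge0_ler_powR; rewrite ?nnegrE//; lra.
  have M'0 : 0 <= M' by rewrite /M' le_max (le_trans ler01 B1).
  rewrite powRM//; apply: ler_wpM2l; first exact: powR_ge0.
  rewrite /M' /Num.max; case: (ltP B D) => _; first by rewrite lerDr powR_ge0.
  by rewrite lerDl powR_ge0.
have Bs : B * B `^ (s - 1) = B `^ s by rewrite mulr_powRB1//; lra.
have Ds : D * D `^ (s - 1) = D `^ s by rewrite mulr_powRB1//; lra.
apply: le_trans (_ : (s * M `^ (s - 1) * D) * B <= _).
  by apply: ler_pM => //; exact: abs1_bra.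
apply: le_trans (_ : s * (2 `^ (s - 1) * (B `^ (s - 1) + D `^ (s - 1))) * D * B <= _).
  apply: ler_wpM2r; first lra; apply: ler_wpM2r; first lra.
  by apply: ler_wpM2l; first lra.
rewrite /Cs /ws -/A -/B -/D -Bs -Ds le_eqVlt; apply/orP; left; apply/eqP; ring.
Qed.

End Weights.

(** * Convolution sums over a box and the energy identities *)

Section FiniteConv.
Context {R : realType}.
Implicit Types (k l m : int * int) (c d q : int * int -> R[i]).
Local Notation nc := (@Normc.normc R).

(** The map m -> k - m does not preserve the box; the two vanishing conditions restrict both sums to
    the part that it does preserve. *)
Lemma sum_reflect N k (F : int * int -> R) :
  (forall m, m \notin box N -> F m = 0) -> (forall m, k - m \notin box N -> F m = 0) ->
  \sum_(m <- box N) F (k - m) = \sum_(m <- box N) F m.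
Proof.
move=> F1 F2; pose r := [seq m <- box N | k - m \in box N].
have rE G : (forall m, k - m \notin box N -> G m = 0) -> \sum_(m <- box N) G m = \sum_(m <- r) G m :> R.
  move=> G0; rewrite big_filter [LHS](bigID (fun m => k - m \in box N))/=.
  by rewrite [X in _ + X]big1 ?addr0.
rewrite (rE F F2) (rE (fun m => F (k - m))); last by move=> m; exact: F1.
rewrite -(big_map (fun m => k - m) xpredT F); apply: perm_big; apply: uniq_perm.
- rewrite map_inj_uniq ?filter_uniq ?uniq_box//.
  by move=> a b /addrI/oppr_inj.
- by rewrite filter_uniq ?uniq_box.
- move=> m; apply/mapP/idP => [[j jr ->]|mr].
    by move: jr; rewrite !mem_filter subKr andbC.
  by exists (k - m); rewrite ?subKr//; move: mr; rewrite !mem_filter subKr andbC.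
Qed.

Lemma sum_shift_le N k (x : int * int -> R) : (forall m, 0 <= x m) ->
  (forall m, m \notin box N -> x m = 0) ->
  \sum_(m <- box N) x (k - m) <= \sum_(m <- box N) x m.
Proof.
move=> x0 xs.
pose F m := if k - m \in box N then x m else 0.
apply: le_trans (_ : \sum_(m <- box N) F m <= _); last first.
  by apply: ler_sum => m _; rewrite /F; case: ifP.
rewrite -(@sum_reflect N k F).
- rewrite big_seq [X in _ <= X]big_seq; apply: ler_sum => m mN.
  by rewrite /F subKr mN.
- by move=> m /xs h; rewrite /F h if_same.
- by move=> m /negbTE h; rewrite /F h.
Qed.

Lemma sum_shift_le2 N m (x : int * int -> R) : (forall m, 0 <= x m) ->
  (forall m, m \notin box N -> x m = 0) ->
  \sum_(k <- box N) x (k - m) <= \sum_(k <- box N) x k.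
Proof.
move=> x0 xs; rewrite -(sum_box_opp N x).
apply: le_trans (@sum_shift_le N m (fun j => x (- j)) _ _).
- by apply: ler_sum => k _; rewrite opprB.
- by move=> j; exact: x0.
- by move=> j jN; apply: xs; rewrite box_opp.
Qed.

(** Young's inequality for the convolution of l^2 with l^1 tested against l^2, through 2 a_k a_m <=
    a_k^2 + a_m^2. In [young2] the l^1 sequence is the other convolution factor. *)
Lemma young1 N (a x : int * int -> R) : (forall m, 0 <= x m) ->
  (forall m, m \notin box N -> x m = 0) ->
  \sum_(k <- box N) \sum_(m <- box N) a k * a m * x (k - m) <=
  (\sum_(m <- box N) x m) * \sum_(k <- box N) a k ^+ 2.
Proof.
move=> x0 xs; set X := \sum_(m <- box N) x m.
apply: le_trans (_ : \sum_(k <- box N) \sum_(m <- box N) (2^-1 * a k ^+ 2 * x (k - m) + 2^-1 * a m ^+ 2 * x (k - m)) <= _).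
  apply: ler_sum => k _; apply: ler_sum => m _; rewrite -mulrDl; apply: ler_wpM2r => //.
  by have := sqr_ge0 (a k - a m); rewrite sqrrB; lra.
under eq_bigr do rewrite big_split.
rewrite big_split/= [X in _ + X]exchange_big/=.
have H (y : int * int -> R) : (forall k, y k <= X) -> \sum_(k <- box N) 2^-1 * a k ^+ 2 * y k <= 2^-1 * (X * \sum_(k <- box N) a k ^+ 2).
  move=> yX; rewrite mulrA [_ * X]mulrC -mulrA !mulr_sumr; apply: ler_sum => k _.
  by rewrite mulrC; apply: ler_wpM2r => //; rewrite mulr_ge0// sqr_ge0.
have h1 := H (fun k => \sum_(m <- box N) x (k - m)) (fun k => sum_shift_le k x0 xs).
have h2 := H (fun m => \sum_(k <- box N) x (k - m)) (fun k => sum_shift_le2 k x0 xs).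
under eq_bigr do rewrite -mulr_sumr.
under [X in _ + X]eq_bigr do rewrite -mulr_sumr.
by apply: le_trans (lerD h1 h2) _; lra.
Qed.

Lemma young2 N (a x : int * int -> R) : (forall m, 0 <= x m) ->
  (forall m, m \notin box N -> a m = 0) ->
  \sum_(k <- box N) \sum_(m <- box N) a k * a (k - m) * x m <=
  (\sum_(m <- box N) x m) * \sum_(k <- box N) a k ^+ 2.
Proof.
move=> x0 as0; rewrite exchange_big/= mulr_suml; apply: ler_sum => m _.
rewrite -mulr_suml [X in _ <= X]mulrC; apply: ler_wpM2r => //.
apply: le_trans (_ : \sum_(k <- box N) (2^-1 * a k ^+ 2 + 2^-1 * a (k - m) ^+ 2) <= _).
  by apply: ler_sum => k _; have := sqr_ge0 (a k - a (k - m)); rewrite sqrrB; lra.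
rewrite big_split/= -!mulr_sumr.
have as2 j : j \notin box N -> a j ^+ 2 = 0 by move=> /as0 ->; rewrite expr0n.
have := @sum_shift_le2 N m (fun j => a j ^+ 2) (fun j => sqr_ge0 _) as2; lra.
Qed.

(* [tau a b c] is the real part of [conj a * b * (i c)]. *)
Definition tau (a b c : R[i]) : R :=
  - ((complex.Re a * complex.Re b + complex.Im a * complex.Im b) * complex.Im c) -
  (complex.Re a * complex.Im b - complex.Im a * complex.Re b) * complex.Re c.

Lemma tauC (a b c : R[i]) : tau a b c = tau a c b.
Proof. by rewrite /tau; ring. Qed.

Lemma tau_le (a b c : R[i]) : `|tau a b c| <= nc a * nc b * nc c.
Proof.
have n0 z : 0 <= nc z by case: z => u v; exact: sqrtr_ge0.
rewrite -(@ler_pXn2r _ 2) ?nnegrE ?mulr_ge0//.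
rewrite !exprMn !normc2E real_normK ?num_real//.
case: a => a1 a2; case: b => b1 b2; case: c => c1 c2; rewrite /tau /normc2/=.
set u := a1 * b1 + a2 * b2; set v := a1 * b2 - a2 * b1.
have -> : (a1 ^+ 2 + a2 ^+ 2) * (b1 ^+ 2 + b2 ^+ 2) = u ^+ 2 + v ^+ 2 by rewrite /u /v; ring.
have := sqr_ge0 (u * c1 - v * c2).
by rewrite -subr_ge0 => h; rewrite -subr_ge0; apply: le_trans h _; rewrite le_eqVlt; apply/orP; left; apply/eqP; ring.
Qed.

(** Multiplication by i times a real function is skew-adjoint: the matrix i q (k - m) is
    skew-hermitian. *)
Lemma tau_swap (d q : int * int -> R[i]) k m : herm q ->
  tau (d m) (q (m - k)) (d k) = - tau (d k) (q (k - m)) (d m).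
Proof.
by move=> hq; have := hq (k - m); rewrite opprB => -[h1 h2]; rewrite /tau h1 h2; ring.
Qed.

Lemma antisym_eq N (d q : int * int -> R[i]) (w : int * int -> int * int -> R) : herm q ->
  \sum_(k <- box N) \sum_(m <- box N) w k m * tau (d k) (q (k - m)) (d m) =
  - \sum_(k <- box N) \sum_(m <- box N) w m k * tau (d k) (q (k - m)) (d m).
Proof.
move=> hq; rewrite exchange_big/= -sumrN; apply: eq_bigr => k _.
by rewrite -sumrN; apply: eq_bigr => m _; rewrite tau_swap// mulrN.
Qed.

Lemma normc_ge0 (z : R[i]) : 0 <= nc z.
Proof. by case: z => u v; exact: sqrtr_ge0. Qed.

(** Antisymmetrisation replaces the weight k_1 by (k_1 - m_1) / 2: the derivative moves from d to
    the transporting field q, whose coefficients absorb it. *)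
Lemma antisym_bound N (d q : int * int -> R[i]) : herm q ->
  (forall m, m \notin box N -> q m = 0) ->
  `|\sum_(k <- box N) \sum_(m <- box N) k.1%:~R * tau (d k) (q (k - m)) (d m)| <=
  2^-1 * (\sum_(k <- box N) bra k * nc (q k)) * \sum_(k <- box N) normc2 (d k).
Proof.
move=> hq q0; set S := \sum_(k <- _) _.
have E : S = 2^-1 * \sum_(k <- box N) \sum_(m <- box N) (k.1 - m.1)%:~R * tau (d k) (q (k - m)) (d m).
  have h := antisym_eq N d (fun k _ => k.1%:~R) hq; rewrite -/S in h.
  have -> : \sum_(k <- box N) \sum_(m <- box N) (k.1 - m.1)%:~R * tau (d k) (q (k - m)) (d m) =
     S - \sum_(k <- box N) \sum_(m <- box N) m.1%:~R * tau (d k) (q (k - m)) (d m).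
    rewrite /S -sumrB; apply: eq_bigr => k _; rewrite -sumrB; apply: eq_bigr => m _.
    by rewrite intrB; ring.
  by rewrite {2}h; lra.
rewrite E normrM ger0_norm// -mulrA; apply: ler_wpM2l => //.
have Y := @young1 N (fun k => nc (d k)) (fun l => bra l * nc (q l)).
have xs m : m \notin box N -> bra m * nc (q m) = 0.
  by move=> /q0 ->; rewrite Normc.normc0 mulr0.
have x0 m : 0 <= bra m * nc (q m) by rewrite mulr_ge0 ?normc_ge0// ltW// bra_gt0.
have {Y} := Y x0 xs; under [X in _ <= _ * X]eq_bigr do rewrite normc2E.
apply: le_trans; apply: le_trans (ler_norm_sum _ _ _) _; apply: ler_sum => k _.
apply: le_trans (ler_norm_sum _ _ _) _; apply: ler_sum => m _.
rewrite normrM; apply: le_trans (_ : bra (k - m) * (nc (d k) * nc (q (k - m)) * nc (d m)) <= _).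
  by apply: ler_pM => //; [exact: (abs1_bra (k - m))|exact: tau_le].
by rewrite le_eqVlt; apply/orP; left; apply/eqP; ring.
Qed.

(** Leibniz' rule for a square: k_1 = m_1 + (k - m)_1, and reflection in m exchanges the two
    contributions. *)
Lemma convection_sym N c k : (forall m, m \notin box N -> c m = 0) ->
  \sum_(m <- box N) k.1%:~R * tau (c k) (c (k - m)) (c m) =
  2 * \sum_(m <- box N) m.1%:~R * tau (c k) (c (k - m)) (c m).
Proof.
move=> c0; have t0 z w : tau z 0 w = 0 by rewrite /tau /=; ring.
have := @sum_reflect N k (fun m => m.1%:~R * tau (c k) (c (k - m)) (c m)).
have -> : \sum_(m <- box N) (k - m).1%:~R * tau (c k) (c (k - (k - m))) (c (k - m)) =
    \sum_(m <- box N) k.1%:~R * tau (c k) (c (k - m)) (c m) -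
    \sum_(m <- box N) m.1%:~R * tau (c k) (c (k - m)) (c m).
  rewrite -sumrB; apply: eq_bigr => m _; rewrite subKr tauC /= intrB; ring.
have A1 m : m \notin box N -> m.1%:~R * tau (c k) (c (k - m)) (c m) = 0.
  by move=> /c0 ->; rewrite tauC t0 mulr0.
have A2 m : k - m \notin box N -> m.1%:~R * tau (c k) (c (k - m)) (c m) = 0.
  by move=> /c0 ->; rewrite t0 mulr0.
by move=> /(_ A1 A2); lra.
Qed.

(** With T the same sum weighted by m_1, antisymmetry gives S = - T and Leibniz' rule gives S = 2 T.
    This is the conservation of the L^2 norm. *)
Lemma energy0 N c : herm c -> (forall m, m \notin box N -> c m = 0) ->
  \sum_(k <- box N) \sum_(m <- box N) k.1%:~R * tau (c k) (c (k - m)) (c m) = 0.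
Proof.
move=> hc c0; set S := LHS.
have h := antisym_eq N c (fun k _ => k.1%:~R) hc; rewrite -/S in h.
have : S = 2 * \sum_(k <- box N) \sum_(m <- box N) m.1%:~R * tau (c k) (c (k - m)) (c m).
  by rewrite /S mulr_sumr; apply: eq_bigr => k _; exact: convection_sym.
by move=> h2; lra.
Qed.

(* Kato-Ponce type energy estimate: the top order part of the transport term
   is antisymmetric, the rest is controlled by [commutator_weight]. *)
Lemma energy_bound N (s : R) c : 1 <= s -> herm c -> (forall m, m \notin box N -> c m = 0) ->
  `|\sum_(k <- box N) ws s k ^+ 2 * \sum_(m <- box N) k.1%:~R * tau (c k) (c (k - m)) (c m)| <=
  (1 + 4 * Cs s) * (\sum_(k <- box N) bra k * nc (c k)) *
    \sum_(k <- box N) ws s k ^+ 2 * normc2 (c k).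
Proof.
move=> s1 hc c0; pose w := ws s; pose t k m := tau (c k) (c (k - m)) (c m).
pose v k := w k * nc (c k); pose x k := bra k * nc (c k).
have C0 := Cs_ge0 s1.
have w0 k : 0 <= w k by rewrite ltW// ws_gt0.
have x0 k : 0 <= x k by rewrite mulr_ge0 ?normc_ge0// ltW// bra_gt0.
have xs m : m \notin box N -> x m = 0 by move=> /c0 h; rewrite /x h Normc.normc0 mulr0.
have vs m : m \notin box N -> v m = 0 by move=> /c0 h; rewrite /v h Normc.normc0 mulr0.
(* Leibniz' rule turns the weight into 2 w_k^2 m_1, which is 2 w_k w_m m_1 plus the commutator 2 w_k
   (w_k - w_m) m_1; antisymmetrising the first part leaves w_k w_m (m_1 - k_1). *)
have E : \sum_(k <- box N) w k ^+ 2 * \sum_(m <- box N) k.1%:~R * t k m =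
  \sum_(k <- box N) \sum_(m <- box N) (w k * w m * (m.1 - k.1)%:~R + 2 * (w k * (w k - w m) * m.1%:~R)) * t k m.
  have h := antisym_eq N c (fun k m => w k * w m * m.1%:~R) hc.
  transitivity (2 * \sum_(k <- box N) \sum_(m <- box N) (w k * w m * m.1%:~R) * t k m +
     \sum_(k <- box N) \sum_(m <- box N) 2 * (w k * (w k - w m) * m.1%:~R) * t k m).
    rewrite mulr_sumr -big_split; apply: eq_bigr => k _ /=.
    rewrite /t convection_sym// mulrCA !mulr_sumr -big_split; apply: eq_bigr => m _ /=; ring.
  transitivity (\sum_(k <- box N) \sum_(m <- box N) (w k * w m * m.1%:~R) * t k m -
     \sum_(k <- box N) \sum_(m <- box N) (w m * w k * k.1%:~R) * t k m +
     \sum_(k <- box N) \sum_(m <- box N) 2 * (w k * (w k - w m) * m.1%:~R) * t k m).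
    by rewrite -/t in h; congr (_ + _); move: h; rewrite -/(t _ _) => h; rewrite {2}h; lra.
  rewrite -sumrB -big_split; apply: eq_bigr => k _ /=.
  by rewrite -sumrB -big_split; apply: eq_bigr => m _ /=; rewrite intrB; ring.
rewrite -/w [X in `|X|]E.
have Y1 := @young1 N v x x0 xs; have Y2 := @young2 N v x x0 vs.
have EY : \sum_(k <- box N) w k ^+ 2 * normc2 (c k) = \sum_(k <- box N) v k ^+ 2.
  by apply: eq_bigr => k _; rewrite /v exprMn normc2E.
rewrite EY; set X := \sum_(k <- box N) bra k * nc (c k); rewrite -/X in Y1 Y2.
set Y := \sum_(k <- box N) v k ^+ 2; rewrite -/Y in Y1 Y2.
apply: le_trans (_ : (1 + 2 * Cs s) * \sum_(k <- box N) \sum_(m <- box N) v k * v m * x (k - m) +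
   2 * Cs s * \sum_(k <- box N) \sum_(m <- box N) v k * v (k - m) * x m <= _); last first.
  have : 0 <= 1 + 2 * Cs s by lra.
  move=> h; apply: le_trans (lerD (ler_wpM2l h Y1) (ler_wpM2l _ Y2)) _; lra.
rewrite !mulr_sumr -big_split/=; apply: le_trans (ler_norm_sum _ _ _) _; apply: ler_sum => k _.
rewrite !mulr_sumr -big_split/=; apply: le_trans (ler_norm_sum _ _ _) _; apply: ler_sum => m _.
have T := @tau_le (c k) (c (k - m)) (c m); rewrite -/(t k m) in T.
rewrite normrM; apply: le_trans (_ : (w k * w m * bra (k - m) + 2 * w k * (Cs s * (bra (k - m) * w m + w (k - m) * bra m))) *
   (nc (c k) * nc (c (k - m)) * nc (c m)) <= _); last first.
  by rewrite le_eqVlt /v /x; apply/orP; left; apply/eqP; ring.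
apply: ler_pM => //; apply: le_trans (ler_normD _ _) _; apply: lerD.
  rewrite !normrM (ger0_norm (w0 k)) (ger0_norm (w0 m)); apply: ler_wpM2l; first exact: mulr_ge0.
  by rewrite intrB distrC -intrB; exact: (abs1_bra (k - m)).
rewrite !normrM (ger0_norm (w0 k)) ger0_norm// -!mulrA; apply: ler_wpM2l => //; apply: ler_wpM2l => //.
rewrite mulrA; exact: commutator_weight.
Qed.

End FiniteConv.

(** * Summability of negative powers of the weight *)

Section LatticeSum.
Context {R : realType}.

(** Comparison with the integral of x^(-s), as the mean value theorem for x^(1-s), in a form that
    telescopes. *)
Lemma zeta_step (s : R) (j : nat) : 1 < s ->
  (j.+2%:R `^ s)^-1 <= (s - 1)^-1 * (j.+1%:R `^ (1 - s) - j.+2%:R `^ (1 - s)).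
Proof.
move=> s1.
have d (x : R) : 0 < x -> is_derive x (1 : R) (fun y : R => y `^ (1 - s)) ((1 - s) * x `^ (1 - s - 1)).
  by move=> x0; exact: is_derive1_powR.
have ab : j.+1%:R < j.+2%:R :> R by rewrite ltr_nat.
have j0 : 0 < j.+1%:R :> R by rewrite ltr0n.
have cf : {within `[j.+1%:R, j.+2%:R], continuous (fun y : R => y `^ (1 - s))}.
  apply: derivable_within_continuous => x; rewrite in_itv/= => /andP[bx _].
  by have [] := d x (lt_le_trans j0 bx).
have dab (x : R) : x \in `]j.+1%:R, j.+2%:R[ -> is_derive x (1 : R) (fun y : R => y `^ (1 - s)) ((1 - s) * x `^ (1 - s - 1)).
  by rewrite in_itv/= => /andP[bx _]; apply: d; exact: lt_trans bx.
have [c cab e] := MVT ab dab cf.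
move: cab; rewrite in_itv/= => /andP[c1 c2]; have c0 : 0 < c := lt_trans j0 c1.
have e1 : j.+2%:R - j.+1%:R = 1 :> R by rewrite -[j.+2%:R]natr1; ring.
rewrite e1 in e.
have -> : (s - 1)^-1 * (j.+1%:R `^ (1 - s) - j.+2%:R `^ (1 - s)) = c `^ (1 - s - 1).
  by rewrite -(opprB (j.+2%:R `^ _)) e; field; rewrite subr_eq0 gt_eqF.
rewrite (_ : 1 - s - 1 = - s); last by ring.
rewrite powRN lef_pV2 ?posrE ?powR_gt0//.
by apply: ge0_ler_powR; rewrite ?nnegrE ?ler0n ?ltW//; lra.
Qed.

Lemma zeta_bound (s : R) n : 1 < s ->
  \sum_(0 <= j < n) (j.+1%:R `^ s)^-1 <= 1 + (s - 1)^-1.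
Proof.
move=> s1; have s0 : 0 < (s - 1)^-1 by rewrite invr_gt0 subr_gt0.
case: n => [|n]; first by rewrite big_geq//; lra.
rewrite big_nat_recl//= powR1 invr1 lerD2l.
apply: le_trans (_ : \sum_(0 <= j < n) (s - 1)^-1 * (j.+1%:R `^ (1 - s) - j.+2%:R `^ (1 - s)) <= _).
  by apply: ler_sum => j _; exact: zeta_step.
rewrite -mulr_sumr -[X in _ <= X]mulr1; apply: ler_wpM2l; first exact: ltW.
suff -> : \sum_(0 <= j < n) (j.+1%:R `^ (1 - s) - j.+2%:R `^ (1 - s)) = 1 - n.+1%:R `^ (1 - s).
  by rewrite gerBl powR_ge0.
elim: n => [|n IH]; first by rewrite big_geq// powR1 subrr.
by rewrite big_nat_recr//= IH; ring.
Qed.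

Lemma sum_sym_int N (g : int -> R) : (forall z, g (- z) = g z) ->
  \sum_(i <- iota 0 N.*2.+1) g (i%:Z - N%:Z) = g 0 + 2 * \sum_(0 <= j < N) g j.+1%:Z.
Proof.
move=> gN; rewrite -[iota _ _]/(index_iota 0 N.*2.+1).
rewrite (@big_cat_nat _ _ _ N)//=; last by rewrite -addnn -addnS leq_addr.
rewrite big_nat_rev/= add0n [X in _ + X](@big_addn _ _ _ 0)/=.
have -> : (N.*2.+1 - N = N.+1)%N by lia.
rewrite [X in _ + X]big_nat_recl//.
have -> : \sum_(0 <= i < N) g ((N - i.+1)%N%:Z - N%:Z) = \sum_(0 <= i < N) g i.+1%:Z.
  rewrite big_nat [RHS]big_nat; apply: eq_bigr => i /andP[_ iN].
  by rewrite -gN; congr g; lia.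
have -> : \sum_(0 <= i < N) g ((i.+1 + N)%N%:Z - N%:Z) = \sum_(0 <= i < N) g i.+1%:Z.
  by apply: eq_bigr => i _; congr g; lia.
by rewrite add0n subrr; lra.
Qed.

(** From (1 + a^2 + b^2)^2 >= (1 + a^2) (1 + b^2) the double sum is bounded by the square of a
    one-dimensional one: the term at 0 plus twice a zeta sum. *)
Lemma lattice_sum (s : R) : 1 < s -> exists2 Z : R, 0 <= Z &
  forall N, \sum_(k <- box N) (ws s k ^+ 2)^-1 <= Z.
Proof.
move=> s1; have s0 : 0 < (s - 1)^-1 by rewrite invr_gt0 subr_gt0.
exists ((1 + 2 * (1 + (s - 1)^-1)) ^+ 2); first exact: sqr_ge0.
move=> N; pose g (z : int) : R := ((1 + z%:~R ^+ 2) `^ (s / 2))^-1.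
have g0 z : 0 <= g z by rewrite invr_ge0 powR_ge0.
have gN z : g (- z) = g z by rewrite /g mulrNz sqrrN.
apply: le_trans (_ : \sum_(k <- box N) g k.1 * g k.2 <= _).
  apply: ler_sum => k _; rewrite /g -invfM lef_pV2 ?posrE ?exprn_gt0 ?ws_gt0 ?mulr_gt0 ?powR_gt0//;
    try by rewrite ltr_pwDl// sqr_ge0.
  rewrite -powRM ?addr_ge0 ?sqr_ge0// sqr_ws.
  have -> : (1 + sqnormk R k) `^ s = ((1 + sqnormk R k) ^+ 2) `^ (s / 2).
    by rewrite -powR_mulrn ?bra1_ge0// -powRrM; congr (_ `^ _); field.
  have := sqr_ge0 (k.1%:~R : R); have := sqr_ge0 (k.2%:~R : R).
  rewrite /sqnormk; set a := k.1%:~R ^+ 2; set b := k.2%:~R ^+ 2 => b0 a0.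
  by apply: ge0_ler_powR; rewrite ?nnegrE; nra.
rewrite /box big_allpairs_dep/= -[_ :: _]/(iota 0 N.*2.+1).
have -> : \sum_(i <- iota 0 N.*2.+1) \sum_(j <- iota 0 N.*2.+1) g (i%:Z - N%:Z) * g (j%:Z - N%:Z) =
  (\sum_(i <- iota 0 N.*2.+1) g (i%:Z - N%:Z)) ^+ 2.
  by rewrite expr2 mulr_suml; apply: eq_bigr => i _; rewrite mulr_sumr.
rewrite ler_pXn2r ?nnegrE ?sumr_ge0//; last lra.
rewrite sum_sym_int//.
have -> : g 0 = 1 by rewrite /g expr0n addr0 powR1 invr1.
rewrite lerD2l; apply: ler_wpM2l => //; apply: le_trans (zeta_bound N s1).
apply: ler_sum => j _; rewrite lef_pV2 ?posrE ?powR_gt0 ?ltr_pwDl ?sqr_ge0//.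
have -> : (j.+1%:R : R) `^ s = (j.+1%:R ^+ 2) `^ (s / 2).
  by rewrite -powR_mulrn// -powRrM; congr (_ `^ _); field.
apply: ge0_ler_powR; rewrite ?nnegrE ?addr_ge0 ?sqr_ge0//; first lra.
by rewrite -pmulrn lerDr.
Qed.

End LatticeSum.

(** * Fourier coefficients of products *)

Section Products.
Context {R : realType}.
Local Notation mu := (@leb2 R).
Local Notation Om := (@Omega R).
Local Notation mfO f := (measurable_fun (Om : set (measurableTypeR R * measurableTypeR R)) f).
Local Notation vol := (@vol R).
Local Notation nc := (@Normc.normc R).
Implicit Types (f g h : R * R -> R) (c d : int * int -> R[i]) (k : int * int).

Lemma mfO_cosk k : mfO (cosk k). Proof. exact: mfO_cont2 (@cosk_cont R k). Qed.
Lemma mfO_sink k : mfO (sink k). Proof. exact: mfO_cont2 (@sink_cont R k). Qed.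

Lemma L2_mcosk g k : L2per R g -> L2per R (fun x => g x * cosk k x).
Proof.
move=> Lg; apply: (L2M_bounded (M := 1)) => //; first exact: mfO_cosk.
by move=> x _; exact: normr_cos_le1.
Qed.

Lemma L2_msink g k : L2per R g -> L2per R (fun x => g x * sink k x).
Proof.
move=> Lg; apply: (L2M_bounded (M := 1)) => //; first exact: mfO_sink.
by move=> x _; exact: normr_sin_le1.
Qed.

Lemma nrm2_le f g : L2per R f -> L2per R g -> (forall x, Om x -> `|f x| <= `|g x|) -> nrm2 f <= nrm2 g.
Proof.
move=> Lf Lg fg; rewrite -(@ler_pXn2r _ 2) ?nnegrE ?nrm2_ge0// -lee_fin -!integral_sqr_nrm2//.
apply: ge0_le_integral => //.
- by move=> x _; rewrite lee_fin sqr_ge0.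
- by apply/measurable_EFinP; apply: measurable_funX; exact: measurable_L2.
- by apply/measurable_EFinP; apply: measurable_funX; exact: measurable_L2.
- move=> x Ox; rewrite lee_fin -(real_normK (num_real (f x))) -(real_normK (num_real (g x))).
  by rewrite ler_pXn2r ?nnegrE ?fg.
Qed.

(** The k-th coefficient of f g, written as an inner product of f with g times a mode: bilinearity
    and Cauchy-Schwarz in L^2 then apply, although f g is in general only integrable. *)
Definition four2 f g k : R[i] :=
  Complex (vol^-1 * inner f (fun x => g x * cosk k x)) (- (vol^-1 * inner f (fun x => g x * sink k x))).

Lemma fourier_mul f g k : L2per R f -> L2per R g ->
  fourier (fun x => f x * g x) k = four2 f g k.
Proof.
move=> Lf Lg; rewrite /fourier /four2; congr Complex.
  by congr (_ * _); apply: eq_Rintegral => x _; rewrite cosN mulrA.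
rewrite -mulrN; congr (_ * _).
have -> : - inner f (fun x => g x * sink k x) = inner f (fun x => -1 * (g x * sink k x)).
  by rewrite innerZr ?mulN1r//; exact: L2_msink.
by apply: eq_Rintegral => x _; rewrite sinN /sink; ring.
Qed.

Lemma fourier_sqr f k : L2per R f -> fourier (fun x => f x ^+ 2) k = four2 f f k.
Proof.
by move=> Lf; rewrite -fourier_mul//; congr (fourier _ k); apply/funext => x; rewrite expr2.
Qed.

Lemma four2C f g k : four2 f g k = four2 g f k.
Proof.
rewrite /four2; congr Complex; first by congr (_ * _); apply: eq_Rintegral => x _; ring.
by congr (- (_ * _)); apply: eq_Rintegral => x _; ring.
Qed.

Lemma four2Dl f f' g k : L2per R f -> L2per R f' -> L2per R g ->
  four2 (fun x => f x + f' x) g k = four2 f g k + four2 f' g k.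
Proof.
move=> Lf Lf' Lg; rewrite /four2 !innerDl//; try exact: L2_mcosk; try exact: L2_msink.
by apply: complexP; rewrite ?RecD ?ImcD/=; ring.
Qed.

Lemma four2Bl f f' g k : L2per R f -> L2per R f' -> L2per R g ->
  four2 (fun x => f x - f' x) g k = four2 f g k - four2 f' g k.
Proof.
move=> Lf Lf' Lg; rewrite /four2 !innerBl//; try exact: L2_mcosk; try exact: L2_msink.
by apply: complexP => /=; ring.
Qed.

Lemma four2Br f g g' k : L2per R f -> L2per R g -> L2per R g' ->
  four2 f (fun x => g x - g' x) k = four2 f g k - four2 f g' k.
Proof. by move=> *; rewrite four2C four2Bl// four2C (four2C g'). Qed.

Lemma normc_le2 (z : R[i]) (B : R) : `|complex.Re z| <= B -> `|complex.Im z| <= B -> nc z <= 2 * B.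
Proof.
case: z => a b /= ha hb; have B0 : 0 <= B by apply: le_trans ha.
rewrite -[X in _ <= X]ger0_norm ?mulr_ge0// -sqrtr_sqr ler_wsqrtr//.
rewrite -(real_normK (num_real a)) -(real_normK (num_real b)).
have := normr_ge0 a; have := normr_ge0 b; nra.
Qed.

Lemma four2_le f g k : L2per R f -> L2per R g -> nc (four2 f g k) <= 2 * (vol^-1 * (nrm2 f * nrm2 g)).
Proof.
move=> Lf Lg; have v0 : 0 < vol^-1 by rewrite invr_gt0 vol_gt0.
apply: normc_le2; rewrite /= ?normrN normrM (gtr0_norm v0); apply: ler_wpM2l; try exact: ltW.
- apply: le_trans (CauchySchwarz Lf (L2_mcosk k Lg)) _; apply: ler_wpM2l; first exact: nrm2_ge0.
  apply: nrm2_le => //; first exact: L2_mcosk.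
  by move=> x _; rewrite normrM ler_piMr// normr_cos_le1.
- apply: le_trans (CauchySchwarz Lf (L2_msink k Lg)) _; apply: ler_wpM2l; first exact: nrm2_ge0.
  apply: nrm2_le => //; first exact: L2_msink.
  by move=> x _; rewrite normrM ler_piMr// normr_sin_le1.
Qed.

Lemma tp_odd_part N c x : herm c ->
  \sum_(l <- box N) (complex.Re (c l) * sink l x + complex.Im (c l) * cosk l x) = 0.
Proof.
move=> hc; have := congr1 (@complex.Im R) (trig_sum_real N x hc).
move=> h; transitivity (complex.Im (trig_sum N c x)); last by rewrite h.
rewrite trig_sumE Imc_sum; apply: eq_bigr => l _.
by rewrite ImcM/=.
Qed.

Lemma four2_tp N c g k : herm c -> L2per R g ->
  four2 g (tp (box N) c) k = \sum_(l <- box N) c l * fourier g (k - l).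
Proof.
move=> hc Lg.
(* The vanishing imaginary part of the hermitian sum is added with the factor that completes the
   products to the modes k - l. *)
have E1 x : tp (box N) c x * cosk k x =
    \sum_(l <- box N) (complex.Re (c l) * cosk (k - l) x + complex.Im (c l) * sink (k - l) x).
  transitivity (tp (box N) c x * cosk k x + sink k x * \sum_(l <- box N) (complex.Re (c l) * sink l x + complex.Im (c l) * cosk l x)).
    by rewrite tp_odd_part// mulr0 addr0.
  rewrite /tp mulr_suml mulr_sumr -big_split.
  by apply: eq_bigr => l _ /=; rewrite /cosk /sink dotkB cosB sinB; ring.
have E2 x : tp (box N) c x * sink k x =
    \sum_(l <- box N) (complex.Re (c l) * sink (k - l) x - complex.Im (c l) * cosk (k - l) x).
  transitivity (tp (box N) c x * sink k x - cosk k x * \sum_(l <- box N) (complex.Re (c l) * sink l x + complex.Im (c l) * cosk l x)).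
    by rewrite tp_odd_part// mulr0 subr0.
  rewrite /tp mulr_suml mulr_sumr -sumrB.
  by apply: eq_bigr => l _ /=; rewrite /cosk /sink dotkB cosB sinB; ring.
rewrite /four2; under [in X in Complex X _]eq_fun do rewrite E1.
under [in X in Complex _ X]eq_fun do rewrite E2.
have Lc l := @L2_cosk R l; have Ls l := @L2_sink R l.
rewrite ![inner g _]innerC !inner_suml//; last 2 first.
- by move=> l; apply: L2B; exact: L2Z.
- by move=> l; apply: L2D; exact: L2Z.
have F1 l : inner (fun x => complex.Re (c l) * cosk (k - l) x + complex.Im (c l) * sink (k - l) x) g =
   vol * complex.Re (c l * fourier g (k - l)).
  rewrite innerDl//; try exact: L2Z.
  rewrite !innerZl// fourierE// RecM/= (innerC g (cosk _)) (innerC g (sink _)).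
  by field; rewrite gt_eqF// vol_gt0.
have F2 l : inner (fun x => complex.Re (c l) * sink (k - l) x - complex.Im (c l) * cosk (k - l) x) g =
   - (vol * complex.Im (c l * fourier g (k - l))).
  rewrite innerBl//; try exact: L2Z.
  rewrite !innerZl// fourierE// ImcM/= (innerC g (cosk _)) (innerC g (sink _)).
  by field; rewrite gt_eqF// vol_gt0.
rewrite (eq_bigr _ (fun l _ => F1 l)) (eq_bigr _ (fun l _ => F2 l)) sumrN -!mulr_sumr.
apply: complexP; rewrite ?Rec_sum ?Imc_sum/=; field; rewrite gt_eqF// vol_gt0//.
Qed.

End Products.

(** * The equation on the Fourier side *)

Section Derivatives.
Context {R : realType}.
Local Notation mu := (@leb2 R).
Local Notation Om := (@Omega R).
Local Notation vol := (@vol R).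
Local Notation nc := (@Normc.normc R).
Implicit Types (f g h : R * R -> R) (c d : int * int -> R[i]) (k : int * int).

Lemma compact_Omega : compact (Om : set (R * R)).
Proof. by apply: compact_setX; exact: segment_compact. Qed.

Lemma cont_bounded f : continuous f -> exists M : R, forall x, Om x -> `|f x| <= M.
Proof.
move=> cf.
have /compact_bounded [M [_ HM]] : compact (f @` Om).
  by apply: continuous_compact; [exact: continuous_subspaceT|exact: compact_Omega].
exists (M + 1) => x Ox; apply: HM; first by rewrite ltrDl.
by exists x.
Qed.

Lemma L2_cont f : continuous f -> L2per R f.
Proof. by move=> cf; have [M hM] := cont_bounded cf; exact: L2_cont2 cf hM. Qed.

Lemma cont_slice1 f y : continuous f -> continuous (fun x => f (x, y)).
Proof.
move=> cf x; have cy : (fun=> y) z @[z --> x] --> y by exact: cvg_cst.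
have cx : z @[z --> x] --> x by exact: cvg_id.
exact: (cvg_comp _ _ (cvg_pair cx cy) (cf (x, y))).
Qed.

Lemma int_partial1 f (df : R * R -> R) : continuous df ->
  (forall x : R * R, is_derive x.1 (1 : R) (fun y => f (y, x.2)) (df x)) ->
  (forall x, f (x.1 + 2 * pi, x.2) = f x) -> \int[mu]_(x in Om) df x = 0.
Proof.
move=> cdf dF per; apply: Rintegral_Omega_eq0_1.
  exact: integrable_L2 (L2_cont cdf).
move=> y _; apply: (@integral_derive_period R (fun x => f (x, y))).
- exact: cont_slice1.
- by move=> x; exact: dF (x, y).
- by rewrite -(per (- pi, y))/=; congr (f (_, _)); ring.
Qed.

Lemma integrable_Z (a : R) f : mu.-integrable Om (EFin \o f) ->
  mu.-integrable Om (EFin \o (fun x => a * f x)).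
Proof.
move=> If; rewrite (_ : EFin \o _ = (fun x => a%:E * (EFin \o f) x)%E).
  exact: integrableZl.
by apply/funext => x; rewrite /= EFinM.
Qed.

Lemma cos_2piM (m : int) : cos (2 * pi * m%:~R) = 1 :> R.
Proof.
have -> : 2 * pi * m%:~R = pi * m%:~R + pi * m%:~R :> R by ring.
rewrite cosD sin_intpi mulr0 subr0 -expr2.
by have := cos2Dsin2 (pi * m%:~R : R); rewrite sin_intpi expr0n addr0.
Qed.

Lemma sin_2piM (m : int) : sin (2 * pi * m%:~R) = 0 :> R.
Proof.
have -> : 2 * pi * m%:~R = pi * m%:~R + pi * m%:~R :> R by ring.
by rewrite sinD sin_intpi mul0r mulr0 addr0.
Qed.

Lemma cosD_2piM (x : R) (m : int) : cos (x + 2 * pi * m%:~R) = cos x.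
Proof. by rewrite cosD cos_2piM sin_2piM mulr0 subr0 mulr1. Qed.

Lemma sinD_2piM (x : R) (m : int) : sin (x + 2 * pi * m%:~R) = sin x.
Proof. by rewrite sinD cos_2piM sin_2piM mulr0 addr0 mulr1. Qed.

Lemma cos_phase_cont k (b : R) : continuous (fun x => cos (dotk k x + b)).
Proof.
move=> x; apply: continuous_comp; last exact: continuous_cos.
by apply: cvgD; [exact: dotk_continuous|exact: cvg_cst].
Qed.

(** Each derivative shifts the phase by pi / 2, which gives all mixed derivatives in one formula;
    the sine is the phase - pi / 2. *)
Lemma smooth_periodic_cos k (b : R) : smooth_periodic (fun x => cos (dotk k x + b)).
Proof.
split.
  move=> x; split; rewrite /dotk /=.
    by rewrite -[RHS](cosD_2piM _ k.1); congr cos; ring.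
  by rewrite -[RHS](cosD_2piM _ k.2); congr cos; ring.
pose ph i j (x : R * R) := dotk k x + (b + (i + j)%:R * (pi / 2)).
have phS i j m x : (i + j)%N = m.+1 -> cos (ph i j x) = - sin (dotk k x + (b + m%:R * (pi / 2))).
  move=> ij; rewrite /ph ij -cosDpihalf; congr cos.
  by rewrite -(natr1 m); ring.
exists (fun i j x => (k.1%:~R ^+ i * k.2%:~R ^+ j) * cos (ph i j x)).
split.
  by apply/funext => x; rewrite /ph !expr0 !mul1r mul0r addr0.
move=> i j; split.
- by move=> x; apply: cvgM; [exact: cvg_cst|exact: cos_phase_cont].
- move=> x; have H := derive_Z (k.1%:~R ^+ i * k.2%:~R ^+ j)
    (is_derive_cos_affine (k.1%:~R) (k.2%:~R * x.2 + (b + (i + j)%:R * (pi / 2))) x.1).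
  rewrite (phS i.+1 j (i + j)%N x erefl) exprS.
  rewrite (_ : (fun y : R => _) = (fun y : R => k.1%:~R ^+ i * k.2%:~R ^+ j *
      cos (k.1%:~R * y + (k.2%:~R * x.2 + (b + (i + j)%:R * (pi / 2)))))).
    by apply: is_derive_eq H _; rewrite /dotk !addrA; ring.
  by apply/funext => y; rewrite /ph /dotk /= !addrA.
- move=> x; have H := derive_Z (k.1%:~R ^+ i * k.2%:~R ^+ j)
    (is_derive_cos_affine (k.2%:~R) (k.1%:~R * x.1 + (b + (i + j)%:R * (pi / 2))) x.2).
  rewrite (phS i j.+1 (i + j)%N x (addnS i j)) exprS.
  rewrite (_ : (fun y : R => _) = (fun y : R => k.1%:~R ^+ i * k.2%:~R ^+ j *
      cos (k.2%:~R * y + (k.1%:~R * x.1 + (b + (i + j)%:R * (pi / 2)))))).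
    apply: is_derive_eq H _; rewrite /dotk.
    rewrite (_ : k.1%:~R * x.1 + k.2%:~R * x.2 + _ = k.2%:~R * x.2 + (k.1%:~R * x.1 + (b + (i + j)%:R * (pi / 2)))); ring.
  apply/funext => y; congr (_ * cos _); rewrite /ph /dotk /=; ring.
Qed.

Lemma smooth_cosk k : smooth_periodic (@cosk R k).
Proof.
have := smooth_periodic_cos k 0.
by rewrite (_ : (fun x => cos (dotk k x + 0)) = cosk k)//; apply/funext => x; rewrite addr0.
Qed.

Lemma smooth_sink k : smooth_periodic (@sink R k).
Proof.
have := smooth_periodic_cos k (- (pi / 2)).
by rewrite (_ : (fun x => cos (dotk k x + _)) = sink k)//; apply/funext => x; rewrite cosBpihalf.
Qed.

Lemma derive_cosk1 k (x : R * R) :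
  is_derive x.1 (1 : R) (fun y => cosk k (y, x.2)) (- (k.1%:~R * sink k x)).
Proof. exact: (is_derive_cos_affine k.1%:~R (k.2%:~R * x.2) x.1). Qed.

Lemma derive_sink1 k (x : R * R) :
  is_derive x.1 (1 : R) (fun y => sink k (y, x.2)) (k.1%:~R * cosk k x).
Proof. exact: (is_derive_sin_affine k.1%:~R (k.2%:~R * x.2) x.1). Qed.

Lemma partial1_of f df : (forall x : R * R, is_derive x.1 (1 : R) (fun y => f (y, x.2)) (df x)) ->
  partial1 f = df.
Proof. by move=> H; apply/funext => x; rewrite /partial1 derive1E; have [_ ->] := H x. Qed.

Definition ik k : R[i] := Complex 0 k.1%:~R.

Lemma Re_ik k z : complex.Re (ik k * z) = - (k.1%:~R * complex.Im z).
Proof. by rewrite RecM/=; ring. Qed.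

Lemma Im_ik k z : complex.Im (ik k * z) = k.1%:~R * complex.Re z.
Proof. by rewrite ImcM/=; ring. Qed.

Lemma herm_ik c : herm c -> herm (fun k => ik k * c k).
Proof.
by move=> hc k; have [h1 h2] := hc k; rewrite !Re_ik !Im_ik h1 h2 /= mulrNz; split; ring.
Qed.

Lemma derive_tp1 s c (x : R * R) :
  is_derive x.1 (1 : R) (fun y => tp s c (y, x.2)) (tp s (fun k => ik k * c k) x).
Proof.
apply: derive_sum_seq => k _.
have := derive_B (derive_Z (complex.Re (c k)) (derive_cosk1 k x)) (derive_Z (complex.Im (c k)) (derive_sink1 k x)).
by move/is_derive_eq; apply; rewrite Re_ik Im_ik; ring.
Qed.

Lemma partial1_tp s c : partial1 (tp s c) = tp s (fun k => ik k * c k).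
Proof. exact: partial1_of (derive_tp1 s c). Qed.

Lemma L2_smooth f : smooth_periodic f -> L2per R f /\ L2per R (partial1 f).
Proof.
move=> [_ [D [D0 hD]]]; have [c00 d00 _] := hD 0%N 0%N.
rewrite D0 in c00 d00; rewrite (partial1_of d00).
by have [c10 _ _] := hD 1%N 0%N; split; exact: L2_cont.
Qed.

Lemma fourier_partial1 f k : smooth_periodic f -> fourier (partial1 f) k = ik k * fourier f k.
Proof.
move=> sf; have [Lf Ldf] := L2_smooth sf.
move: sf => [per [D [D0 hD]]]; have [c00 d00 _] := hD 0%N 0%N.
rewrite D0 in c00 d00; have [c10 _ _] := hD 1%N 0%N.
have p1 := partial1_of d00.
have Lc := @L2_cosk R k; have Ls := @L2_sink R k.
have pc (x : R * R) : cosk k (x.1 + 2 * pi, x.2) = cosk k x.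
  by rewrite /cosk /dotk/= -[RHS](cosD_2piM _ k.1); congr cos; ring.
have ps (x : R * R) : sink k (x.1 + 2 * pi, x.2) = sink k x.
  by rewrite /sink /dotk/= -[RHS](sinD_2piM _ k.1); congr sin; ring.
have E1 : inner (partial1 f) (cosk k) = k.1%:~R * inner f (sink k).
  have H1 : continuous (fun x => f x * - (k.1%:~R * sink k x) + cosk k x * partial1 f x).
    move=> x; rewrite p1; apply: cvgD; apply: cvgM; [exact: c00| |exact: cosk_cont|exact: c10].
    by apply: cvgN; apply: cvgM; [exact: cvg_cst|exact: sink_cont].
  have H2 (x : R * R) : is_derive x.1 (1 : R) (fun y => (fun x => f x * cosk k x) (y, x.2)) ((fun x => f x * - (k.1%:~R * sink k x) + cosk k x * partial1 f x) x).
    by case: x => x1 x2; rewrite p1; exact: derive_M (d00 (x1, x2)) (derive_cosk1 k (x1, x2)).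
  have H3 (x : R * R) : (fun x => f x * cosk k x) (x.1 + 2 * pi, x.2) = (fun x => f x * cosk k x) x.
    by rewrite pc (per x).1.
  have := int_partial1 H1 H2 H3.
  rewrite RintegralD//; last 2 first.
  - exact: integrable_L2M Lf (L2N (L2Z _ Ls)).
  - exact: integrable_L2M Lc Ldf.
  rewrite -[X in X + _]/(inner f (fun x => - (k.1%:~R * sink k x))) -[X in _ + X]/(inner (cosk k) (partial1 f)).
  by rewrite innerC innerNl//; [rewrite innerZl// (innerC (sink k)) (innerC (cosk k)); lra|exact: L2Z].
have E2 : inner (partial1 f) (sink k) = - (k.1%:~R * inner f (cosk k)).
  have H1 : continuous (fun x => f x * (k.1%:~R * cosk k x) + sink k x * partial1 f x).
    move=> x; rewrite p1; apply: cvgD; apply: cvgM; [exact: c00| |exact: sink_cont|exact: c10].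
    by apply: cvgM; [exact: cvg_cst|exact: cosk_cont].
  have H2 (x : R * R) : is_derive x.1 (1 : R) (fun y => (fun x => f x * sink k x) (y, x.2)) ((fun x => f x * (k.1%:~R * cosk k x) + sink k x * partial1 f x) x).
    by case: x => x1 x2; rewrite p1; exact: derive_M (d00 (x1, x2)) (derive_sink1 k (x1, x2)).
  have H3 (x : R * R) : (fun x => f x * sink k x) (x.1 + 2 * pi, x.2) = (fun x => f x * sink k x) x.
    by rewrite ps (per x).1.
  have := int_partial1 H1 H2 H3.
  rewrite RintegralD//; last 2 first.
  - exact: integrable_L2M Lf (L2Z _ Lc).
  - exact: integrable_L2M Ls Ldf.
  rewrite -[X in X + _]/(inner f (fun x => k.1%:~R * cosk k x)) -[X in _ + X]/(inner (sink k) (partial1 f)).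
  by rewrite innerZr// (innerC (sink k)); lra.
rewrite !fourierE// E1 E2; apply: complexP; rewrite ?Re_ik ?Im_ik/=; ring.
Qed.

Lemma weak_partial1_fourier f g k : is_weak_partial1 f g -> fourier g k = ik k * fourier f k.
Proof.
move=> [Lf Lg H].
have Lc := @L2_cosk R k; have Ls := @L2_sink R k.
have := H _ (smooth_cosk k); have := H _ (smooth_sink k).
rewrite (partial1_of (derive_sink1 k)) (partial1_of (derive_cosk1 k)).
rewrite innerZr// (innerC f (fun x => - _)) innerNl; [|exact: L2Z|by []]; rewrite innerZl// (innerC (sink k) f) => h1 h2.
rewrite !fourierE//; apply: complexP; rewrite ?Re_ik ?Im_ik/=.
  have -> : inner g (cosk k) = k.1%:~R * inner f (sink k) by lra.
  by ring.
have -> : inner g (sink k) = - (k.1%:~R * inner f (cosk k)) by lra.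
by ring.
Qed.

Lemma nc_tri (a b : R[i]) : nc (a + b) <= nc a + nc b.
Proof. exact: le_normcD. Qed.

Lemma ncN (a : R[i]) : nc (- a) = nc a.
Proof. by case: a => u v; rewrite /= !sqrrN. Qed.

Lemma nc_eq0 (a : R[i]) : nc a <= 0 -> a = 0.
Proof.
by move=> h; apply: Normc.eq0_normc; apply/eqP; rewrite eq_le h normc_ge0.
Qed.

Lemma inner_proj_cvg f h (e : R) : L2per R f -> L2per R h -> 0 < e ->
  exists N, forall M, (N <= M)%N -> `|inner f h - inner (proj M f) h| <= e.
Proof.
move=> Lf Lh e0.
have e1 : 0 < e / (nrm2 h + 1) by rewrite divr_gt0// ltr_wpDl// nrm2_ge0.
have [N hN] := proj_cvg Lf e1; exists N => M NM.
have Lp : L2per R (proj M f) by exact: L2_tp.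
rewrite -innerBl//; apply: le_trans (CauchySchwarz (L2B Lf Lp) Lh) _.
have h0 := nrm2_ge0 h; have := hN M NM; rewrite ltr_pdivlMr; last by lra.
by have := nrm2_ge0 (fun x => f x - proj M f x); nra.
Qed.

(** For projections the identity is Parseval's formula mode by mode; both sides pass to the limit
    because the test function and its derivative are in L^2. *)
Lemma fourier_weak_partial1 f g : L2per R f -> L2per R g ->
  (forall k, fourier g k = ik k * fourier f k) -> is_weak_partial1 f g.
Proof.
move=> Lf Lg fg; split => // phi sp; have [Lp Ldp] := L2_smooth sp.
have E N : inner (proj N f) (partial1 phi) = - inner (proj N g) phi.
  rewrite !inner_tp// -mulrN -sumrN; congr (_ * _); apply: eq_bigr => k _.
  by rewrite fourier_partial1// fg /cdot !Re_ik !Im_ik; ring.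
apply/eqP; rewrite -subr_eq0 -normr_le0; apply/ler_addgt0Pl => e e0; rewrite addr0.
have e2 : 0 < e / 2 by lra.
have [N1 h1] := inner_proj_cvg Lf Ldp e2; have [N2 h2] := inner_proj_cvg Lg Lp e2.
pose M := maxn N1 N2.
have := h1 M (leq_maxl _ _); have := h2 M (leq_maxr _ _); rewrite E.
rewrite !ler_norml => /andP[a1 a2] /andP[a3 a4]; apply/andP; split; lra.
Qed.

Definition lapm (alpha : R) k : R := Num.sqrt (sqnormk R k) `^ alpha.

Lemma lapmN alpha k : lapm alpha (- k) = lapm alpha k.
Proof. by rewrite /lapm /sqnormk/= !mulrNz !sqrrN. Qed.

Lemma herm_mul (a : int * int -> R) c : (forall k, a (- k) = a k) -> herm c ->
  herm (fun k => real_complex R (a k) * c k).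
Proof.
by move=> ha hc k; have [h1 h2] := hc k; rewrite !RecM !ImcM/= ha h1 h2; split; ring.
Qed.

Lemma cvg_EFin0 (u : nat -> R) : u n @[n --> \oo] --> 0 -> (u n)%:E @[n --> \oo] --> 0%E.
Proof. by move=> h; apply: cvg_EFin => //; exact: nearW. Qed.

Lemma EFin_cvg0 (u : nat -> R) : (u n)%:E @[n --> \oo] --> 0%E -> u n @[n --> \oo] --> 0.
Proof. by move=> /fine_cvgP[]. Qed.

Lemma frac_lap_norm alpha f g N : L2per R f -> L2per R g ->
  fnorm (L2per R) (fun x => nc
      (trig_sum N (fun k => real_complex R (Num.sqrt (sqnormk R k) `^ alpha) * fourier f k) x
       - real_complex R (g x))) =
  (nrm2 (fun x => g x - tp (box N) (fun k => real_complex R (lapm alpha k) * fourier f k) x))%:E.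
Proof.
move=> Lf Lg; set c := (fun k => _ * fourier f k).
have hc : herm c by apply: herm_mul; [exact: lapmN|exact: fourier_herm].
have E : (fun x => nc (trig_sum N c x - real_complex R (g x))) = (fun x => `|g x - tp (box N) c x|).
  apply/funext => x; rewrite trig_sum_real//=.
  by rewrite subrr expr0n addr0 sqrtr_sqr distrC.
have LL := L2B Lg (L2_tp (box N) c).
have La : L2per R (fun x => `|g x - tp (box N) c x|).
  apply: (L2_le (g := fun x => g x - tp (box N) c x)) => //.
    by apply: measurableT_comp => //; exact: measurable_L2.
  by move=> x _; rewrite normr_id.
rewrite E fnorm_L2E//; congr EFin; apply/eqP; rewrite eq_le.
by apply/andP; split; apply: nrm2_le => // x _; rewrite normr_id.
Qed.

Lemma frac_lap_fourier alpha f g k : L2per R f -> is_frac_lap alpha f g ->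
  fourier g k = real_complex R (lapm alpha k) * fourier f k.
Proof.
move=> Lf [Lg]; under eq_fun do rewrite frac_lap_norm//.
set c := (fun k => real_complex R (lapm alpha k) * fourier f k).
have hc : herm c by apply: herm_mul; [exact: lapmN|exact: fourier_herm].
move=> /EFin_cvg0 cv; apply/eqP; rewrite -subr_eq0; apply/eqP/normc2_eq0.
apply/ler_addgt0Pl => e e0; rewrite addr0.
have ve : 0 < Num.sqrt (vol * e) by rewrite sqrtr_gt0 mulr_gt0// vol_gt0.
move/cvgrPdist_le : cv => /(_ _ ve) [n _ hn].
pose j := maxn n (maxn `|k.1|%N `|k.2|%N).
have kN : k \in box j by rewrite mem_box /j !leq_max !leqnn !orbT.
have := hn j (leq_maxl _ _); rewrite /= sub0r normrN ger0_norm ?nrm2_ge0// => h.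
have := fourier_le k (L2B Lg (L2_tp (box j) c)).
rewrite fourierB//; last exact: L2_tp.
rewrite fourier_tp// kN => h'.
rewrite -(ler_pM2l (@vol_gt0 R)); apply: le_trans h' _.
rewrite -(sqr_sqrtr (ltW (mulr_gt0 (@vol_gt0 R) e0))).
by rewrite ler_pXn2r ?nnegrE ?nrm2_ge0 ?sqrtr_ge0.
Qed.

Lemma fourier_frac_lap alpha f g : L2per R f -> L2per R g ->
  (forall k, fourier g k = real_complex R (lapm alpha k) * fourier f k) -> is_frac_lap alpha f g.
Proof.
move=> Lf Lg fg; split => //; under eq_fun do rewrite frac_lap_norm//.
have -> : (fun k => real_complex R (lapm alpha k) * fourier f k) = fourier g.
  by apply/funext => k; rewrite fg.
apply: cvg_EFin0; apply/cvgrPdist_lt => e e0; have [N hN] := proj_cvg Lg e0.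
by exists N => // M /= NM; rewrite sub0r normrN ger0_norm ?nrm2_ge0//; exact: hN.
Qed.

(** The common denominator A exceeds by 1 the total weight of the errors once np is replaced by nf;
    what remains is (A - 1) e / A. *)
Lemma convection_arith (v d1 d2 nf ng np K e : R) :
  0 <= v -> 0 <= nf -> 0 <= ng -> 0 <= K -> 0 <= np -> np <= nf -> 0 <= d1 -> 0 <= d2 ->
  d1 <= e / (2 * v * (ng + nf + 2 * K * nf) + 1) ->
  d2 <= e / (2 * v * (ng + nf + 2 * K * nf) + 1) ->
  2 * (v * (d1 * ng)) + 2 * (v * (np * d2)) +
    K * (2 * (v * (d1 * nf)) + 2 * (v * (np * d1))) <= e.
Proof.
move=> v0 f0 g0 K0 p0 pf d10 d20; set A := _ + 1.
have A0 : 0 < A.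
  by rewrite ltr_wpDl//; apply: mulr_ge0; [lra|rewrite !addr_ge0// !mulr_ge0].
set q := e / A => h1 h2.
have q0 : 0 <= q by exact: le_trans h1.
have v2 : 0 <= 2 * v by lra.
have w1 := ler_wpM2l v2 (ler_wpM2r g0 h1); have w2 := ler_wpM2l v2 (ler_pM p0 d20 pf h2).
have w3 := ler_wpM2l v2 (ler_wpM2r f0 h1); have w4 := ler_wpM2l v2 (ler_pM p0 d10 pf h1).
rewrite -!(mulrA 2) in w1 w2 w3 w4; apply: le_trans (lerD (lerD w1 w2) (ler_wpM2l K0 (lerD w3 w4))) _.
rewrite [X in X <= _](_ : _ = (A - 1) * q); last by rewrite /A; ring.
by rewrite mulrBl mul1r [A * _]mulrC divfK ?gt_eqF//; lra.
Qed.

(* The product rule u u_x = (u^2 / 2)_x on the Fourier side. *)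
Lemma fourier_convection f df k : L2per R f -> L2per R df ->
  (forall l, fourier df l = ik l * fourier f l) ->
  fourier (fun x => f x * df x) k = real_complex R 2^-1 * (ik k * fourier (fun x => f x ^+ 2) k).
Proof.
move=> Lf Ldf fdf; rewrite fourier_mul// fourier_sqr//.
pose p N := proj N f; pose dp N := proj N df.
have dpE N : dp N = tp (box N) (fun l => ik l * fourier f l).
  by apply/funext => x; rewrite /dp /proj /tp; apply: eq_bigr => l _; rewrite fdf.
have Lp N : L2per R (p N) by exact: L2_tp.
have Ldp N : L2per R (dp N) by exact: L2_tp.
have cp N : continuous (p N) by exact: tp_cont.
have cdp N : continuous (dp N) by exact: tp_cont.
have pp N (x : R * R) : p N (x.1 + 2 * pi, x.2) = p N x.
  rewrite /p /proj /tp; apply: eq_bigr => l _; congr (_ * _ - _ * _).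
    by rewrite /cosk /dotk/= -[RHS](cosD_2piM _ l.1); congr cos; ring.
  by rewrite /sink /dotk/= -[RHS](sinD_2piM _ l.1); congr sin; ring.
have dpp N (x : R * R) : is_derive x.1 (1 : R) (fun y => p N (y, x.2)) (dp N x).
  by rewrite dpE; exact: derive_tp1.
have pc (x : R * R) : cosk k (x.1 + 2 * pi, x.2) = cosk k x.
  by rewrite /cosk /dotk/= -[RHS](cosD_2piM _ k.1); congr cos; ring.
have ps (x : R * R) : sink k (x.1 + 2 * pi, x.2) = sink k x.
  by rewrite /sink /dotk/= -[RHS](sinD_2piM _ k.1); congr sin; ring.
(* For trigonometric polynomials this is integration by parts: the x_1-derivative of p^2 times the
   mode is periodic with mean zero. *)
have E1 N : inner (p N) (fun x => dp N x * cosk k x) = k.1%:~R / 2 * inner (p N) (fun x => p N x * sink k x).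
  have H1 : continuous (fun x => p N x ^+ 2 * - (k.1%:~R * sink k x) + cosk k x * (2 * p N x * dp N x)).
    move=> x; apply: cvgD; apply: cvgM.
    - by rewrite expr2; under eq_fun do rewrite expr2; apply: cvgM; exact: cp.
    - by apply: cvgN; apply: cvgM; [exact: cvg_cst|exact: sink_cont].
    - exact: cosk_cont.
    - by apply: cvgM; [apply: cvgM; [exact: cvg_cst|exact: cp]|exact: cdp].
  have H2 (x : R * R) : is_derive x.1 (1 : R) (fun y => (fun x => p N x ^+ 2 * cosk k x) (y, x.2)) ((fun x => p N x ^+ 2 * - (k.1%:~R * sink k x) + cosk k x * (2 * p N x * dp N x)) x).
    by apply: derive_M; [exact: derive_sqr (dpp N x)|exact: derive_cosk1].
  have H3 (x : R * R) : (fun x => p N x ^+ 2 * cosk k x) (x.1 + 2 * pi, x.2) = (fun x => p N x ^+ 2 * cosk k x) x.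
    by rewrite pc pp.
  have := int_partial1 H1 H2 H3.
  rewrite (_ : (fun x => _ + _) = (fun x => - k.1%:~R * (p N x * (p N x * sink k x)) + 2 * (p N x * (dp N x * cosk k x)))); last first.
    by apply/funext => x; ring.
  have I1 := integrable_L2M (Lp N) (L2_msink k (Lp N)); have I2 := integrable_L2M (Lp N) (L2_mcosk k (Ldp N)).
  rewrite RintegralD//; last 2 first.
  - exact: integrable_Z I1.
  - exact: integrable_Z I2.
  rewrite !RintegralZl// -[X in _ + _ * X]/(inner _ _) -[X in _ * X + _]/(inner _ _); lra.
have E2 N : inner (p N) (fun x => dp N x * sink k x) = - (k.1%:~R / 2 * inner (p N) (fun x => p N x * cosk k x)).
  have H1 : continuous (fun x => p N x ^+ 2 * (k.1%:~R * cosk k x) + sink k x * (2 * p N x * dp N x)).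
    move=> x; apply: cvgD; apply: cvgM.
    - by rewrite expr2; under eq_fun do rewrite expr2; apply: cvgM; exact: cp.
    - by apply: cvgM; [exact: cvg_cst|exact: cosk_cont].
    - exact: sink_cont.
    - by apply: cvgM; [apply: cvgM; [exact: cvg_cst|exact: cp]|exact: cdp].
  have H2 (x : R * R) : is_derive x.1 (1 : R) (fun y => (fun x => p N x ^+ 2 * sink k x) (y, x.2)) ((fun x => p N x ^+ 2 * (k.1%:~R * cosk k x) + sink k x * (2 * p N x * dp N x)) x).
    by apply: derive_M; [exact: derive_sqr (dpp N x)|exact: derive_sink1].
  have H3 (x : R * R) : (fun x => p N x ^+ 2 * sink k x) (x.1 + 2 * pi, x.2) = (fun x => p N x ^+ 2 * sink k x) x.
    by rewrite ps pp.
  have := int_partial1 H1 H2 H3.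
  rewrite (_ : (fun x => _ + _) = (fun x => k.1%:~R * (p N x * (p N x * cosk k x)) + 2 * (p N x * (dp N x * sink k x)))); last first.
    by apply/funext => x; ring.
  have I1 := integrable_L2M (Lp N) (L2_mcosk k (Lp N)); have I2 := integrable_L2M (Lp N) (L2_msink k (Ldp N)).
  rewrite RintegralD//; last 2 first.
  - exact: integrable_Z I1.
  - exact: integrable_Z I2.
  rewrite !RintegralZl// -[X in _ + _ * X]/(inner _ _) -[X in _ * X + _]/(inner _ _); lra.
have EN N : four2 (p N) (dp N) k = real_complex R 2^-1 * (ik k * four2 (p N) (p N) k).
  rewrite /four2 E1 E2; apply: complexP; rewrite !(RecM, ImcM)/=; ring.
pose K := real_complex R 2^-1 * ik k.
apply/eqP; rewrite -subr_eq0; apply/eqP/nc_eq0/ler_addgt0Pl => e e0; rewrite addr0.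
pose v := vol^-1; have v0 : 0 < v by rewrite invr_gt0 vol_gt0.
pose A := 2 * v * (nrm2 df + nrm2 f + 2 * nc K * nrm2 f) + 1.
have n1 := nrm2_ge0 f; have n2 := nrm2_ge0 df; have n3 := normc_ge0 K.
have A0 : 0 < A by rewrite ltr_wpDl// mulr_ge0 ?addr_ge0// ?mulr_ge0// ltW.
have eA : 0 < e / A by rewrite divr_gt0.
have [N1 h1] := proj_cvg Lf eA; have [N2 h2] := proj_cvg Ldf eA.
pose M := maxn N1 N2.
have {h1} := h1 M (leq_maxl _ _); have {h2} := h2 M (leq_maxr _ _).
rewrite -[fun x => df x - _]/(fun x => df x - dp M x) -[fun x => f x - _]/(fun x => f x - p M x).
set d2 := nrm2 (fun x => df x - _); set d1 := nrm2 (fun x => f x - _) => h2 h1.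
have pM : nrm2 (p M) <= nrm2 f.
  rewrite -(@ler_pXn2r _ 2) ?nnegrE ?nrm2_ge0// nrm2_proj//; exact: Bessel.
(* Subtracting the identity [EN] for the projections leaves four terms, each with one factor that
   tends to zero in L^2. *)
have -> : four2 f df k - real_complex R 2^-1 * (ik k * four2 f f k) =
   (four2 (fun x => f x - p M x) df k + four2 (p M) (fun x => df x - dp M x) k) +
   - (K * (four2 (fun x => f x - p M x) f k + four2 (p M) (fun x => f x - p M x) k)).
  by rewrite !four2Bl// !four2Br// EN /K; ring.
apply: le_trans (nc_tri _ _) _; rewrite ncN Normc.normcM.
have LL1 := L2B Lf (Lp M); have LL2 := L2B Ldf (Ldp M).
have b1 := four2_le k LL1 Ldf; have b2 := four2_le k (Lp M) LL2.
have b3 := four2_le k LL1 Lf; have b4 := four2_le k (Lp M) LL1.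
rewrite -/d1 -/d2 -/v in b1 b2 b3 b4.
have t1 := le_trans (nc_tri (four2 (fun x => f x - p M x) df k) (four2 (p M) (fun x => df x - dp M x) k)) (lerD b1 b2).
have t2 := le_trans (nc_tri (four2 (fun x => f x - p M x) f k) (four2 (p M) (fun x => f x - p M x) k)) (lerD b3 b4).
apply: le_trans (lerD t1 (ler_wpM2l n3 t2)) _.
apply: (convection_arith (ltW v0) n1 n2 n3 (nrm2_ge0 (p M)) pM (nrm2_ge0 _) (nrm2_ge0 _) (ltW h1) (ltW h2)).
Qed.

End Derivatives.

(** * Galerkin approximations *)

Section Nodes.
Context {R : realType}.
Local Notation Rec := (@complex.Re R).
Local Notation Imc := (@complex.Im R).
Implicit Types (f g h : R * R -> R) (c d : int * int -> R[i]) (k : int * int).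

Lemma sin_pi_div_neq0 (n : nat) (m : int) : m != 0 -> (`|m| < n)%N -> sin (pi * m%:~R / n%:R : R) != 0.
Proof.
move=> m0 mn.
have n0 : 0 < n%:R :> R by rewrite ltr0n; lia.
have H (q : int) : 0 < q -> (`|q| < n)%N -> sin (pi * q%:~R / n%:R : R) != 0.
  move=> q0 qn; rewrite gt_eqF// sin_gt0_pi// -mulrA; apply/andP; split.
    by rewrite mulr_gt0 ?pi_gt0// divr_gt0// ltr0z.
  rewrite -[ltRHS]mulr1 ltr_pM2l ?pi_gt0// ltr_pdivrMr// mul1r.
  by rewrite -[n%:R]/(n%:~R) ltr_int; lia.
case: (ltP 0 m) => [h|h]; first exact: H.
have := H (- m); rewrite mulrNz mulrN mulNr sinN oppr_eq0; apply; lia.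
Qed.

(** Multiplication by sin (pi m / n), which does not vanish for 0 < |m| < n, makes the sum telescope
    over a full number of periods. *)
Lemma sum_cos_roots (n : nat) (m : int) (b : R) : m != 0 -> (`|m| < n)%N ->
  \sum_(a < n) cos (m%:~R * (2 * pi * a%:R / n%:R) + b) = 0.
Proof.
move=> m0 mn; have s0 := sin_pi_div_neq0 m0 mn.
have n0 : n%:R != 0 :> R by rewrite pnatr_eq0; lia.
set t := pi * m%:~R / n%:R in s0.
apply: (mulfI s0); rewrite mulr0.
rewrite -(big_mkord xpredT (fun a => cos (m%:~R * (2 * pi * a%:R / n%:R) + b))) mulr_sumr.
rewrite (telescope_sumr_eq (fun a => 2^-1 * sin (2 * t * a%:R + (b - t))))//; last first.
  move=> a _; rewrite -mulrBr.
  have -> : 2 * t * a.+1%:R + (b - t) = (m%:~R * (2 * pi * a%:R / n%:R) + b) + t.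
    by rewrite -natr1 /t; field.
  have -> : 2 * t * a%:R + (b - t) = (m%:~R * (2 * pi * a%:R / n%:R) + b) - t by rewrite /t; field.
  by rewrite sinD sinB; lra.
rewrite -mulrBr mulr0 add0r.
have -> : 2 * t * n%:R + (b - t) = (b - t) + 2 * pi * m%:~R by rewrite /t; field.
by rewrite sinD_2piM subrr mulr0.
Qed.

Definition node (n a b : nat) : R * R := (2 * pi * a%:R / n%:R, 2 * pi * b%:R / n%:R).

Lemma sum_node_cos n k (b : R) : (`|k.1| < n)%N -> (`|k.2| < n)%N ->
  \sum_(i < n) \sum_(j < n) cos (dotk k (node n i j) + b) =
  (if k == 0 then n%:R ^+ 2 * cos b else 0).
Proof.
move=> k1 k2; case: ifPn => [/eqP ->|k0].
  under eq_bigr do (under eq_bigr do rewrite /dotk !mul0r !add0r).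
  by rewrite !sumr_const !card_ord -mulrnA -[LHS]mulr_natl natrM expr2.
have [k20|k20] := eqVneq k.2 0.
  have k10 : k.1 != 0 by apply: contra_neq k0 => k10; rewrite (surjective_pairing k) k10 k20.
  under eq_bigr do (under eq_bigr do rewrite /dotk k20 mul0r addr0).
  transitivity (\sum_(i < n) cos (k.1%:~R * (2 * pi * i%:R / n%:R) + b) *+ n).
    by apply: eq_bigr => i _; rewrite /= sumr_const card_ord.
  by rewrite sumrMnl sum_cos_roots ?mul0rn.
rewrite big1// => i _; rewrite -[RHS](sum_cos_roots (k.1%:~R * (node n i 0).1 + b) k20 k2).
by apply: eq_bigr => j _; rewrite /dotk; congr cos; rewrite /=; ring.
Qed.

(** The discrete Fourier transform on an n by n grid. A coefficient becomes a finite combination of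
    point values, so continuity and differentiability in time, which [galerkin_solution] provides
    for each x separately, pass to coefficients without differentiating under an integral. *)
Definition dft n f k : R[i] :=
  Complex (n%:R ^- 2 * \sum_(i < n) \sum_(j < n) f (node n i j) * cosk k (node n i j))
          (- (n%:R ^- 2 * \sum_(i < n) \sum_(j < n) f (node n i j) * sink k (node n i j))).

Lemma dft_herm n f : herm (dft n f).
Proof.
move=> k; split => /=; congr (_ * _) || congr (- _).
  by apply: eq_bigr => i _; apply: eq_bigr => j _; rewrite coskN.
rewrite -mulrN -sumrN; congr (_ * _); apply: eq_bigr => i _.
by rewrite -sumrN; apply: eq_bigr => j _; rewrite sinkN mulrN.
Qed.

Lemma sum_box_pick N k (F : int * int -> R) : k \in box N ->
  \sum_(l <- box N) (if l == k then F l else 0) = F k.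
Proof.
by move=> kN; rewrite (bigD1_seq k kN (uniq_box N))/= eqxx big1 ?addr0// => l /negPf ->.
Qed.

(** No aliasing occurs: sums and differences of modes of the box have components of modulus at most
    2 N, less than the number 2 N + 1 of nodes per direction. *)
Lemma dft_tp N c k : herm c -> k \in box N -> dft N.*2.+1 (tp (box N) c) k = c k.
Proof.
move=> hc kN; have := kN; rewrite mem_box => /andP[k1 k2].
set n := N.*2.+1; have n0 : n%:R != 0 :> R by rewrite pnatr_eq0.
have bnd l : l \in box N -> [/\ (`|(l + k)%R.1| < n)%N, (`|(l + k)%R.2| < n)%N,
    (`|(l - k)%R.1| < n)%N & (`|(l - k)%R.2| < n)%N].
  by rewrite mem_box /n => /andP[l1 l2]; rewrite /=; split; lia.
pose G l b := \sum_(i < n) \sum_(j < n) cos (dotk l (node n i j) + b).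
have cosP (x y : R) : cos x * cos y = 2^-1 * (cos (x + y + 0) + cos (x - y + 0)).
  by rewrite !addr0 cosD cosB; lra.
have sinP (x y : R) : sin x * sin y = 2^-1 * (cos (x - y + 0) - cos (x + y + 0)).
  by rewrite !addr0 cosB cosD; lra.
have scP (x y : R) : sin x * cos y = 2^-1 * (cos (x + y - pi / 2) + cos (x - y - pi / 2)).
  by rewrite !cosBpihalf sinD sinB; lra.
have csP (x y : R) : cos x * sin y = 2^-1 * (cos (x + y - pi / 2) - cos (x - y - pi / 2)).
  by rewrite !cosBpihalf sinD sinB; lra.
have GE l : l \in box N -> [/\ G (l + k) 0 = (if l == - k then n%:R ^+ 2 else 0),
   G (l - k) 0 = (if l == k then n%:R ^+ 2 else 0), G (l + k) (- (pi / 2)) = 0 & G (l - k) (- (pi / 2)) = 0].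
  move=> /bnd[b1 b2 b3 b4]; rewrite /G !sum_node_cos// cosN cos_pihalf cos0 mulr1 mulr0 subr_eq0 addr_eq0 !if_same.
  by [].
have kN' : - k \in box N by rewrite box_opp.
apply: complexP => /=.
- transitivity (n%:R ^- 2 * \sum_(l <- box N) 2^-1 *
    (complex.Re (c l) * (G (l + k) 0 + G (l - k) 0) - complex.Im (c l) * (G (l + k) (- (pi / 2)) + G (l - k) (- (pi / 2))))).
    congr (_ * _).
    under eq_bigr do (under eq_bigr do rewrite /tp mulr_suml).
    under eq_bigr do rewrite exchange_big/=.
    rewrite exchange_big/=; apply: eq_bigr => l _.
    rewrite /G -!big_split/= !mulr_sumr -sumrB mulr_sumr; apply: eq_bigr => i _.
    rewrite -!big_split/= !mulr_sumr -sumrB mulr_sumr; apply: eq_bigr => j _.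
    rewrite mulrBl -!mulrA /cosk /sink cosP scP -dotkD -dotkB; ring.
  transitivity (n%:R ^- 2 * (2^-1 * (\sum_(l <- box N) (if l == - k then complex.Re (c l) * n%:R ^+ 2 else 0) + \sum_(l <- box N) (if l == k then complex.Re (c l) * n%:R ^+ 2 else 0)))).
    congr (_ * _); rewrite -big_split mulr_sumr big_seq [RHS]big_seq; apply: eq_bigr => l lN /=.
    by have [-> -> -> ->] := GE l lN; do 2 case: ifP => _; ring.
  rewrite !sum_box_pick// (hc k).1; field; exact: n0.
- transitivity (- (n%:R ^- 2 * \sum_(l <- box N) 2^-1 *
    (complex.Re (c l) * (G (l + k) (- (pi / 2)) - G (l - k) (- (pi / 2))) - complex.Im (c l) * (G (l - k) 0 - G (l + k) 0)))).
    congr (- (_ * _)).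
    under eq_bigr do (under eq_bigr do rewrite /tp mulr_suml).
    under eq_bigr do rewrite exchange_big/=.
    rewrite exchange_big/=; apply: eq_bigr => l _.
    rewrite /G -!sumrB !mulr_sumr -sumrB mulr_sumr; apply: eq_bigr => i _.
    rewrite -!sumrB !mulr_sumr -sumrB mulr_sumr; apply: eq_bigr => j _.
    rewrite mulrBl -!mulrA /cosk /sink sinP csP -dotkD -dotkB; ring.
  transitivity (n%:R ^- 2 * (2^-1 * (\sum_(l <- box N) (if l == k then complex.Im (c l) * n%:R ^+ 2 else 0) - \sum_(l <- box N) (if l == - k then complex.Im (c l) * n%:R ^+ 2 else 0)))).
    rewrite -mulrN; congr (_ * _); rewrite -sumrB -sumrN mulr_sumr big_seq [RHS]big_seq; apply: eq_bigr => l lN /=.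
    by have [-> -> -> ->] := GE l lN; do 2 case: ifP => _; ring.
  rewrite !sum_box_pick// (hc k).2; field; exact: n0.
Qed.

Lemma trig_poly_dft N f : trig_poly N f -> f = tp (box N) (dft N.*2.+1 f).
Proof.
move=> tf; have Lf := trig_poly_L2 tf; move/trig_polyP : tf => fE.
rewrite {1}fE; apply/funext => x; rewrite /tp !(big_seq _ _ _ (fun k => _ - _)); apply: eq_bigr => k kN.
by rewrite {3 4}fE dft_tp//; exact: fourier_herm.
Qed.

Lemma fourier_dft N f k : trig_poly N f -> k \in box N -> fourier f k = dft N.*2.+1 f k.
Proof.
move=> tf kN; rewrite {1}(trig_poly_dft tf) fourier_tp ?kN//; exact: dft_herm.
Qed.

End Nodes.

(** * Galerkin solutions as solutions of the coefficient system *)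

Section Galerkin.
Context {R : realType}.
Local Notation mu := (@leb2 R).
Local Notation Om := (@Omega R).
Local Notation vol := (@vol R).
Local Notation Rec := (@complex.Re R).
Local Notation Imc := (@complex.Im R).
Implicit Types (f g h : R * R -> R) (c d : int * int -> R[i]) (k : int * int).

Definition is_cderive (t : R) (z : R -> R[i]) (dz : R[i]) :=
  is_derive t (1 : R) (fun s => Rec (z s)) (Rec dz) /\
  is_derive t (1 : R) (fun s => Imc (z s)) (Imc dz).

Definition ccont (T : R) (z : R -> R[i]) :=
  {within `[0, T], continuous (fun s => Rec (z s))} /\
  {within `[0, T], continuous (fun s => Imc (z s))}.

(** The nonlinearity is kept in conservative form, so that the expression makes sense for every f in
    L^2, whose square is integrable. *)
Definition rhs (alpha : R) f k : R[i] :=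
  ik k * (real_complex R (lapm alpha k) * fourier f k) -
  real_complex R 2^-1 * (ik k * fourier (fun x => f x ^+ 2) k).

(* The Fourier-Galerkin system on the box of size N; [f t] need not be a
   trigonometric polynomial, so that it also describes the exact solution. *)
Definition coef_ode (alpha T : R) N (f : R -> R * R -> R) :=
  forall k, k \in box N -> ccont T (fun t => fourier (f t) k) /\
    forall t : R, t \in `]0, T[ -> is_cderive t (fun t => fourier (f t) k) (rhs alpha (f t) k).

Lemma herm_B c d : herm c -> herm d -> herm (fun k => c k - d k).
Proof.
move=> hc hd k; have [a1 a2] := hc k; have [b1 b2] := hd k.
by rewrite !raddfB/= a1 a2 b1 b2; split; [|rewrite -opprD].
Qed.

Lemma herm_rhs alpha f : L2per R f -> L2per R (fun x => f x ^+ 2) -> herm (rhs alpha f).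
Proof.
move=> Lf Lf2; apply: herm_B.
  by apply: herm_ik; apply: herm_mul; [exact: lapmN|exact: fourier_herm].
by apply: herm_mul => //; apply: herm_ik; exact: fourier_herm.
Qed.

Lemma galerkin_test N d g f h : L2per R g -> L2per R f -> L2per R h ->
  inner g (tp (box N) d) + inner f (partial1 (tp (box N) d)) - 2^-1 * inner h (partial1 (tp (box N) d)) =
  vol * \sum_(k <- box N) cdot (d k)
    (fourier g k - (ik k * fourier f k - real_complex R 2^-1 * (ik k * fourier h k))).
Proof.
move=> Lg Lf Lh; rewrite partial1_tp !inner_tpr// mulrCA -mulrDr -mulrBr; congr (_ * _).
rewrite mulr_sumr -big_split -sumrB; apply: eq_bigr => k _ /=.
rewrite /cdot !(RecD, ImcD, RecM, ImcM, raddfN)/=; ring.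
Qed.

Lemma sum_normc2_eq0 N d : \sum_(k <- box N) normc2 (d k) = 0 -> forall k, k \in box N -> d k = 0.
Proof.
move=> + k kN => /eqP; rewrite psumr_eq0; last by move=> l _; exact: normc2_ge0.
by move=> /allP /(_ k kN) /eqP h; apply: normc2_eq0; rewrite h.
Qed.

Lemma L2_trig_sqr N f : trig_poly N f -> L2per R (fun x => f x ^+ 2).
Proof.
move=> /trig_polyP fE; have cf : continuous f by rewrite fE; exact: tp_cont.
exact: (@L2_cont R (fun x => f x * f x) (fun x => cvgM (cf x) (cf x))).
Qed.

Lemma near_itv (T t : R) (P : R -> Prop) : t \in `]0, T[ ->
  (forall s : R, s \in `]0, T[ -> P s) -> \near t, P t.
Proof.
by move=> tT H; apply: filterS (near_in_itvoo tT) => s; exact: H.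
Qed.

Lemma derive_dft (v : R -> R * R -> R) n k (t : R) :
  (forall x, derivable (v^~ x) t 1) ->
  is_cderive t (fun s => dft n (v s) k) (dft n (fun x => derive1 (v^~ x) t) k).
Proof.
move=> dv; have D x (c : R) : is_derive t (1 : R) (fun s => v s x * c) (derive1 (v^~ x) t * c).
  under eq_fun do rewrite mulrC; rewrite mulrC; apply: derive_Z.
  by rewrite derive1E; exact: derivableP.
have S (w : R * R -> R) : is_derive t (1 : R)
    (fun s => n%:R ^- 2 * \sum_(i < n) \sum_(j < n) v s (node n i j) * w (node n i j))
    (n%:R ^- 2 * \sum_(i < n) \sum_(j < n) derive1 (v^~ (node n i j)) t * w (node n i j)).
  apply: derive_Z; apply: derive_sum_seq => i _; apply: derive_sum_seq => j _; exact: D.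
split => /=; first exact: S.
have := derive_Z (-1) (S (@sink R k)); rewrite mulN1r.
by under eq_fun do rewrite mulN1r.
Qed.

Lemma within_ext (T : R) (F G : R -> R) : (forall t : R, t \in `[0, T] -> F t = G t) ->
  {within `[0, T], continuous F} -> {within `[0, T], continuous G}.
Proof. by move=> FG; apply: subspace_eq_continuous => x; rewrite inE; exact: FG. Qed.

Lemma cont_dft (T : R) (v : R -> R * R -> R) n k :
  (forall x, {within `[0, T], continuous (v^~ x)}) -> ccont T (fun s => dft n (v s) k).
Proof.
move=> cv; have S (w : R * R -> R) : {within `[0, T], continuous
    (fun s => n%:R ^- 2 * \sum_(i < n) \sum_(j < n) v s (node n i j) * w (node n i j))}.
  apply: within_M; first exact: within_cst.
  apply: within_sum => i; apply: within_sum => j; apply: within_M => //; exact: within_cst.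
split => /=; first exact: S.
by apply: within_ext (within_M (@within_cst R `[0, T] (-1)) (S (@sink R k))) => t _; rewrite mulN1r.
Qed.

Lemma galerkin_coef (alpha T : R) N u0 v : L2per R u0 -> 0 < T -> galerkin_solution alpha T N u0 v ->
  [/\ forall t : R, t \in `[0, T] -> trig_poly N (v t), coef_ode alpha T N v &
    forall k, k \in box N -> fourier (v 0) k = fourier u0 k].
Proof.
move=> L0 T0 [tv cv dv eqv ini]; split => //; last first.
  move=> k kN; have z0 : (0 : R) \in `[0, T] by rewrite in_itv/= lexx ltW.
  have Lv0 := trig_poly_L2 (tv 0 z0).
  apply/eqP; rewrite -subr_eq0; apply/eqP.
  apply: (@sum_normc2_eq0 N (fun k => fourier (v 0) k - fourier u0 k)) => //.
  have := ini _ (trig_poly_tp N (fun k => fourier (v 0) k - fourier u0 k)).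
  rewrite !inner_tpr// => /(mulfI (lt0r_neq0 (@vol_gt0 R)))/eqP.
  rewrite -subr_eq0 -sumrB => /eqP h; rewrite -[RHS]h; apply: eq_bigr => l _.
  by rewrite -cdotzz /cdot !raddfB/=; ring.
move=> k kN; split.
  have [c1 c2] := cont_dft N.*2.+1 k cv.
  by split; [apply: within_ext c1|apply: within_ext c2] => t tT; rewrite (fourier_dft (tv t tT) kN).
move=> t tT; have dvt x : derivable (v^~ x) t 1 by exact: dv.
set g := fun x => derive1 (v^~ x) t.
have [d1 d2] := derive_dft N.*2.+1 k dvt.
(* The pointwise time derivative is again a trigonometric polynomial, since v is reconstructed from
   its node values at all nearby times. *)
have gE : g = tp (box N) (dft N.*2.+1 g).
  apply/funext => x.
  have D : is_derive t (1 : R) (fun s => tp (box N) (dft N.*2.+1 (v s)) x) (tp (box N) (dft N.*2.+1 g) x).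
    apply: derive_sum_seq => l lN; have [e1 e2] := derive_dft N.*2.+1 l dvt.
    have := derive_B (derive_Z (cosk l x) e1) (derive_Z (sink l x) e2).
    under eq_fun do rewrite (mulrC (cosk l x)) (mulrC (sink l x)).
    by rewrite (mulrC (cosk l x)) (mulrC (sink l x)).
  have E : \near t, tp (box N) (dft N.*2.+1 (v t)) x = v t x.
    by apply: near_itv tT _ => s sT; rewrite -(trig_poly_dft (tv s (itv_oo_cc sT))).
  by rewrite {1}/g derive1E; have [_ ->] := near_eq_is_derive E D.
have Lg : L2per R g by rewrite gE; exact: L2_tp.
have tvt := tv t (itv_oo_cc tT); have Lv := trig_poly_L2 tvt.
suff E : dft N.*2.+1 g k = rhs alpha (v t) k.
  split; rewrite -E.
    by apply: near_eq_is_derive d1; apply: near_itv tT _ => s sT; rewrite (fourier_dft (tv s (itv_oo_cc sT)) kN).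
  by apply: near_eq_is_derive d2; apply: near_itv tT _ => s sT; rewrite (fourier_dft (tv s (itv_oo_cc sT)) kN).
have [LuN hL eqt] := eqv t tT; have [LLu _] := hL.
(* Testing with the polynomial whose coefficients are the residual yields a vanishing sum of
   squares. *)
pose d := fun k => fourier g k - rhs alpha (v t) k.
have := eqt _ (trig_poly_tp N d).
rewrite galerkin_test//; last exact: L2_trig_sqr tvt.
rewrite -[RHS](mulr0 vol) => /(mulfI (lt0r_neq0 (@vol_gt0 R))) h.
have : d k = 0.
  apply: (@sum_normc2_eq0 N) kN; rewrite -[RHS]h; apply: eq_bigr => l _.
  by rewrite -cdotzz; congr cdot; rewrite /d /rhs (frac_lap_fourier _ Lv hL).
move/eqP; rewrite subr_eq0 => /eqP <-.
by rewrite {2}gE fourier_tp ?kN//; exact: dft_herm.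
Qed.

Lemma galerkin_of_coef (alpha T : R) N u0 (c : R -> int * int -> R[i]) : 0 < T -> L2per R u0 ->
  (forall t, herm (c t)) -> (forall k, k \in box N -> ccont T (c^~ k)) ->
  (forall k (t : R), k \in box N -> t \in `]0, T[ ->
     is_cderive t (c^~ k) (rhs alpha (tp (box N) (c t)) k)) ->
  (forall k, k \in box N -> c 0 k = fourier u0 k) ->
  galerkin_solution alpha T N u0 (fun t => tp (box N) (c t)).
Proof.
move=> T0 L0 hc cc dc c0.
have D x (t : R) : t \in `]0, T[ -> is_derive t (1 : R) (fun s => tp (box N) (c s) x)
    (tp (box N) (rhs alpha (tp (box N) (c t))) x).
  move=> tT; apply: derive_sum_seq => l lN; have [e1 e2] := dc l t lN tT.
  have := derive_B (derive_Z (cosk l x) e1) (derive_Z (sink l x) e2).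
  under eq_fun do rewrite (mulrC (cosk l x)) (mulrC (sink l x)).
  by rewrite (mulrC (cosk l x)) (mulrC (sink l x)).
split.
- by move=> t _; exact: trig_poly_tp.
- move=> x; apply: within_sum_seq => l lN; have [c1 c2] := cc l lN.
  by apply: within_B; apply: within_M => //; exact: within_cst.
- by move=> x t tT; have [] := D x t tT.
- move=> t tT; set f := tp (box N) (c t).
  have tf : trig_poly N f by exact: trig_poly_tp.
  have Lf : L2per R f by exact: L2_tp.
  pose l := tp (box N) (fun k => real_complex R (lapm alpha k) * fourier f k).
  have hl : herm (fun k => real_complex R (lapm alpha k) * fourier f k).
    by apply: herm_mul; [exact: lapmN|exact: fourier_herm].
  have fl k : fourier l k = real_complex R (lapm alpha k) * fourier f k.
    rewrite fourier_tp//; case: ifPn => // kN.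
    by rewrite (fourier_trig_poly tf kN) mulr0.
  have Ll : L2per R l by exact: L2_tp.
  exists l; first exact: fourier_frac_lap.
  move=> v /trig_polyP ->.
  rewrite (_ : (fun x => _) = tp (box N) (rhs alpha f)); last first.
    by apply/funext => x; rewrite derive1E; have [_ ->] := D x t tT.
  rewrite (galerkin_test _ _ (L2_tp _ _) Ll (L2_trig_sqr tf)).
  rewrite big_seq big1 ?mulr0// => k kN.
  have hr := herm_rhs alpha Lf (L2_trig_sqr tf).
  by rewrite fourier_tp// kN fl /rhs subrr /cdot /= !mulr0 addr0.
- move=> v /trig_polyP ->; rewrite !inner_tpr//; last exact: L2_tp.
  congr (_ * _); rewrite big_seq [RHS]big_seq; apply: eq_bigr => k kN.
  by rewrite fourier_tp// kN c0.
Qed.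

End Galerkin.

(** * Global solutions of energy-conserving quadratic systems *)

Section QuadraticODE.
Context {R : realType} {I : finType}.
Implicit Types (y z : I -> R).

Definition jnorm y : R := Num.sqrt (1 + \sum_i y i ^+ 2).

Lemma sqr_jnorm y : jnorm y ^+ 2 = 1 + \sum_i y i ^+ 2.
Proof. by rewrite sqr_sqrtr// addr_ge0// sumr_ge0// => i _; exact: sqr_ge0. Qed.

Lemma jnorm_ge1 y : 1 <= jnorm y.
Proof.
by rewrite -{1}sqrtr1 ler_wsqrtr// lerDl sumr_ge0// => i _; exact: sqr_ge0.
Qed.

Lemma jnorm_gt0 y : 0 < jnorm y.
Proof. exact: lt_le_trans (jnorm_ge1 y). Qed.

Lemma le_jnorm y i : `|y i| <= jnorm y.
Proof.
rewrite -sqrtr_sqr ler_wsqrtr// (bigD1 i)//= addrCA lerDl addr_ge0// sumr_ge0// => j _.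
exact: sqr_ge0.
Qed.

Lemma jnorm_dist y z : `|jnorm y - jnorm z| <= \sum_i `|y i - z i|.
Proof.
have s0 : 0 < jnorm y + jnorm z by rewrite addr_gt0 ?jnorm_gt0.
rewrite -(ler_pM2r s0) -{1}(gtr0_norm s0) -normrM -subr_sqr !sqr_jnorm.
rewrite opprD addrACA subrr add0r -sumrB; apply: le_trans (ler_norm_sum _ _ _) _.
rewrite mulr_suml; apply: ler_sum => i _; rewrite subr_sqr normrM; apply: ler_wpM2l => //.
by apply: le_trans (ler_normD _ _) _; apply: lerD; exact: le_jnorm.
Qed.

(** The 1 inside [jnorm] makes this normalisation globally Lipschitz, also through the origin. *)
Definition jdir y i : R := y i / jnorm y.

Lemma jdir_le1 y i : `|jdir y i| <= 1.
Proof.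
by rewrite normrM normfV (gtr0_norm (jnorm_gt0 y)) ler_pdivrMr ?jnorm_gt0// mul1r le_jnorm.
Qed.

Lemma jdir_dist y z i : `|jdir y i - jdir z i| <= 2 * \sum_j `|y j - z j|.
Proof.
have y0 := jnorm_gt0 y; have z0 := jnorm_gt0 z.
have -> : jdir y i - jdir z i = (y i - z i) / jnorm y + jdir z i * ((jnorm z - jnorm y) / jnorm y).
  by rewrite /jdir; field; rewrite !gt_eqF.
have H (a : R) : `|a| <= \sum_j `|y j - z j| -> `|a / jnorm y| <= \sum_j `|y j - z j|.
  move=> h; rewrite normrM normfV (gtr0_norm y0) ler_pdivrMr//; apply: le_trans h _.
  by rewrite ler_peMr ?jnorm_ge1// sumr_ge0.
apply: le_trans (ler_normD _ _) _; rewrite mulr_natl mulr2n; apply: lerD.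
  by apply: H; rewrite (bigD1 i)//= lerDl sumr_ge0.
rewrite normrM; apply: le_trans (ler_piMl (normr_ge0 _) (jdir_le1 z i)) _.
by apply: H; rewrite distrC; exact: jnorm_dist.
Qed.

(* The quadratic part is evaluated on the bounded Lipschitz vector [jdir y]
   instead of [y]; since both parts conserve the energy, the factor
   1 + |y0|^2 undoes the normalisation. *)
Lemma quadratic_ode (A Q : (I -> R) -> I -> R) (LA LQ T : R) (y0 : I -> R) :
  0 <= LA -> 0 <= LQ -> 0 < T ->
  (forall y z i, `|A y i - A z i| <= LA * \sum_j `|y j - z j|) ->
  (forall y z i, (forall j, `|y j| <= 1) -> (forall j, `|z j| <= 1) ->
     `|Q y i - Q z i| <= LQ * \sum_j `|y j - z j|) ->
  (forall (a : R) y i, Q (fun j => a * y j) i = a ^+ 2 * Q y i) ->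
  (forall y, \sum_i y i * A y i = 0) -> (forall y, \sum_i y i * Q y i = 0) ->
  exists y : R -> I -> R, [/\ forall i, {within `[0, T], continuous (y^~ i)},
    forall i (t : R), t \in `]0, T[ -> is_derive t (1 : R) (y^~ i) (A (y t) i + Q (y t) i) &
    forall i, y 0 i = y0 i].
Proof.
move=> LA0 LQ0 T0 hA hQ Q2 eA eQ.
pose S2 := 1 + \sum_i y0 i ^+ 2.
have S20 : 0 < S2 by rewrite ltr_pwDl// sumr_ge0// => i _; exact: sqr_ge0.
pose F y i := A y i + S2 * Q (jdir y) i.
have QE y i : jnorm y ^+ 2 * Q (jdir y) i = Q y i.
  rewrite -Q2; congr (Q _ i); apply/funext => j.
  by rewrite /jdir mulrC divfK// gt_eqF// jnorm_gt0.
pose L := LA + S2 * (LQ * (#|I|%:R * 2)) + 1.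
have L0 : 0 < L by rewrite ltr_wpDl// addr_ge0// !mulr_ge0// ltW.
have FL y z i : `|F y i - F z i| <= L * \sum_j `|y j - z j|.
  have -> : F y i - F z i = (A y i - A z i) + S2 * (Q (jdir y) i - Q (jdir z) i) by rewrite /F; ring.
  apply: le_trans (ler_normD _ _) _.
  apply: le_trans (_ : LA * \sum_j `|y j - z j| + S2 * (LQ * (#|I|%:R * 2)) * \sum_j `|y j - z j| <= _); last first.
    by rewrite -mulrDl; apply: ler_wpM2r; [exact: sumr_ge0|rewrite /L lerDl].
  apply: lerD => //; rewrite normrM (gtr0_norm S20) -mulrA; apply: ler_wpM2l; first exact: ltW.
  apply: le_trans (hQ _ _ i (jdir_le1 y) (jdir_le1 z)) _; rewrite -mulrA; apply: ler_wpM2l => //.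
  apply: le_trans (ler_sum _ (fun j _ => jdir_dist y z j)) _.
  by rewrite sumr_const -[leLHS]mulr_natl mulrA.
have [y [cy dy y00]] := cauchy_lipschitz y0 L0 T0 FL.
exists y; split => // i t tT.
have eF z : \sum_i z i * F z i = 0.
  rewrite -[RHS](_ : \sum_i z i * A z i + S2 * (jnorm z * \sum_i jdir z i * Q (jdir z) i) = 0); last first.
    by rewrite eA eQ !mulr0 addr0.
  rewrite !mulr_sumr -big_split/=; apply: eq_bigr => j _.
  have -> : z j = jnorm z * jdir z j by rewrite /jdir mulrC divfK// gt_eqF// jnorm_gt0.
  by rewrite /F; ring.
have E : \sum_i y t i ^+ 2 = \sum_i y0 i ^+ 2.
  have d (x : R) : x \in `]0, T[ -> is_derive x (1 : R) (fun x => \sum_i y x i ^+ 2) 0.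
    move=> xT; have := derive_sum_seq (r := index_enum I) (fun j _ => derive_sqr (dy j x xT)).
    move/is_derive_eq; apply; under eq_bigr do rewrite -mulrA.
    by rewrite -mulr_sumr eF mulr0.
  have z0 : (0 : R) \in `[0, T] by rewrite in_itv/= lexx ltW.
  have c : {within `[0, T], continuous (fun x => \sum_i y x i ^+ 2)}.
    by apply: within_sum => j; exact: within_M (cy j) (cy j).
  have n0 (x : R) : x \in `]0, T[ -> `|0 : R| <= 0 by rewrite normr0.
  have := lipschitz_itv d c n0 (itv_oo_cc tT) z0.
  rewrite mul0r normr_le0 subr_eq0 => /eqP ->.
  by apply: eq_bigr => j _; rewrite y00.
have := dy i t tT; rewrite /F (_ : S2 = jnorm (y t) ^+ 2) ?QE//.
by rewrite sqr_jnorm E.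
Qed.

End QuadraticODE.

(** * Existence of Galerkin solutions *)

Section GalerkinExistence.
Context {R : realType} (N : nat).
Local Notation Rec := (@complex.Re R).
Local Notation Imc := (@complex.Im R).
Local Notation nc := (@Normc.normc R).
Local Notation J := (seq_sub (box N)).
Implicit Types (y z : J * bool -> R) (c d : int * int -> R[i]) (k : int * int).

Lemma sum_seq_sub (V : nmodType) (G : int * int -> V) :
  \sum_(j : J) G (ssval j) = \sum_(k <- box N) G k.
Proof.
rewrite -(big_map (@ssval _ (box N)) xpredT G); apply: perm_big; apply: uniq_perm.
- by rewrite map_inj_uniq ?index_enum_uniq//; exact: val_inj.
- exact: uniq_box.
- move=> k; apply/mapP/idP => [[j _ ->]|kN]; first exact: ssvalP.
  by exists (SeqSub kN) => //; rewrite mem_index_enum.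
Qed.

Lemma nc_sum (K : Type) (r : seq K) (F : K -> R[i]) :
  nc (\sum_(i <- r) F i) <= \sum_(i <- r) nc (F i).
Proof.
elim: r => [|i r IH]; first by rewrite !big_nil /= expr0n /= addr0 sqrtr0.
by rewrite !big_cons; apply: le_trans (nc_tri _ _) _; rewrite lerD2l.
Qed.

Lemma abs_Re_le (w : R[i]) : `|Rec w| <= nc w.
Proof. by case: w => a b /=; rewrite -sqrtr_sqr ler_wsqrtr// lerDl sqr_ge0. Qed.

Lemma abs_Im_le (w : R[i]) : `|Imc w| <= nc w.
Proof. by case: w => a b /=; rewrite -sqrtr_sqr ler_wsqrtr// lerDr sqr_ge0. Qed.

Lemma nc_le_abs (w : R[i]) : nc w <= `|Rec w| + `|Imc w|.
Proof.
case: w => a b /=; rewrite -(ler_pXn2r (n := 2)) ?nnegrE ?sqrtr_ge0 ?addr_ge0//.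
rewrite sqr_sqrtr ?addr_ge0 ?sqr_ge0// sqrrD !real_normK ?num_real//.
by rewrite addrAC lerDl mulrn_wge0// mulr_ge0.
Qed.

Definition comp (b : bool) (w : R[i]) : R := if b then Rec w else Imc w.

Lemma comp_le b (w : R[i]) : `|comp b w| <= nc w.
Proof. by case: b; [exact: abs_Re_le|exact: abs_Im_le]. Qed.

(** The unknowns are indexed by a mode and a boolean for real or imaginary part, with no symmetry
    imposed; modes outside the box get the coefficient 0. *)
Definition raw y k : R[i] :=
  oapp (fun j : J => Complex (y (j, true)) (y (j, false))) 0 (insub k).

Lemma raw_in y (j : J) : raw y (ssval j) = Complex (y (j, true)) (y (j, false)).
Proof. by rewrite /raw -[ssval j]/(val j) valK. Qed.

Lemma raw_out y k : k \notin box N -> raw y k = 0.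
Proof. by move=> kN; rewrite /raw insubN. Qed.

Lemma sum_pairJ (G : J * bool -> R) :
  \sum_(p : J * bool) G p = \sum_(j : J) (G (j, true) + G (j, false)).
Proof.
have -> : \sum_(j : J) (G (j, true) + G (j, false)) = \sum_(j : J) \sum_(b : bool) G (j, b).
  by apply: eq_bigr => j _; rewrite big_bool.
by rewrite pair_bigA/=; apply: eq_bigr => -[j b].
Qed.

Lemma sum_raw y (h : int * int -> R[i]) :
  \sum_(p : J * bool) y p * comp p.2 (h (ssval p.1)) = \sum_(k <- box N) cdot (raw y k) (h k).
Proof.
by rewrite sum_pairJ -sum_seq_sub; apply: eq_bigr => j _; rewrite raw_in.
Qed.

Lemma raw_dist y z k : nc (raw y k - raw z k) <= \sum_p `|y p - z p|.
Proof.
have S0 : 0 <= \sum_p `|y p - z p| by exact: sumr_ge0.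
have [kN|kN] := boolP (k \in box N); last first.
  by rewrite !raw_out// subrr /= expr0n /= addr0 sqrtr0.
rewrite -[k]/(ssval (SeqSub kN)) !raw_in; apply: le_trans (nc_le_abs _) _ => /=.
by rewrite sum_pairJ (bigD1 (SeqSub kN))//= lerDl sumr_ge0// => j _; rewrite addr_ge0.
Qed.

Lemma raw_le2 y k : (forall p, `|y p| <= 1) -> nc (raw y k) <= 2.
Proof.
move=> h; have [kN|kN] := boolP (k \in box N); last first.
  by rewrite raw_out//= expr0n /= addr0 sqrtr0.
rewrite -[k]/(ssval (SeqSub kN)) raw_in; apply: le_trans (nc_le_abs _) _ => /=.
by rewrite (_ : 2 = 1 + 1)// lerD.
Qed.

Lemma nc_symm c k : nc (symm c k) <= nc (c k) + nc (c (- k)).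
Proof.
apply: le_trans (nc_le_abs _) _ => /=.
have h1 := abs_Re_le (c k); have h2 := abs_Re_le (c (- k)).
have h3 := abs_Im_le (c k); have h4 := abs_Im_le (c (- k)).
have h5 := ler_normD (Rec (c k)) (Rec (c (- k))).
have h6 := ler_normB (Imc (c k)) (Imc (c (- k))).
have t : `|2^-1| = 2^-1 :> R by rewrite ger0_norm.
by rewrite !normrM t; lra.
Qed.

Lemma symmB c d k : symm c k - symm d k = symm (fun k => c k - d k) k.
Proof. by apply: complexP; rewrite !raddfB/=; ring. Qed.

Lemma symm_id c k : herm c -> symm c k = c k.
Proof. by move=> hc; have [h1 h2] := hc k; apply: complexP; rewrite /= ?h1 ?h2; lra. Qed.

Lemma symm_out c k : (forall k, k \notin box N -> c k = 0) -> k \notin box N -> symm c k = 0.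
Proof.
move=> c0 kN; apply: complexP; rewrite /= !c0 ?box_opp//=; ring.
Qed.

Lemma cdot_symm c h : herm h ->
  \sum_(k <- box N) cdot (c k) (h k) = \sum_(k <- box N) cdot (symm c k) (h k).
Proof.
move=> hh.
have -> : \sum_(k <- box N) cdot (symm c k) (h k) =
    2^-1 * (\sum_(k <- box N) cdot (c k) (h k) + \sum_(k <- box N) cdot (c (- k)) (h (- k))).
  rewrite -big_split mulr_sumr; apply: eq_bigr => k _; have [h1 h2] := hh k.
  by rewrite /cdot /= h1 h2; ring.
rewrite (sum_box_opp N (fun k => cdot (c k) (h k))); lra.
Qed.

Definition conv c k : R[i] := \sum_(l <- box N) c l * c (k - l).

Lemma conv_fourier c k : herm c -> (forall k, k \notin box N -> c k = 0) ->
  fourier (fun x => tp (box N) c x ^+ 2) k = conv c k.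
Proof.
move=> hc c0; rewrite fourier_sqr; last exact: L2_tp.
rewrite four2_tp//; last exact: L2_tp.
by apply: eq_bigr => l _; rewrite fourier_tp//; case: ifPn => // /c0 ->.
Qed.

Lemma conv_dist c d k (D B : R) : (forall l, nc (c l - d l) <= D) ->
  (forall l, nc (c l) <= B) -> (forall l, nc (d l) <= B) ->
  nc (conv c k - conv d k) <= (size (box N))%:R * (2 * B * D).
Proof.
move=> hD hc hd; rewrite /conv -sumrB; apply: le_trans (nc_sum _ _) _.
apply: le_trans (_ : \sum_(l <- box N) 2 * B * D <= _); last first.
  by rewrite big_const_seq count_predT iter_addr_0 -[leLHS]mulr_natl.
apply: ler_sum => l _.
have -> : c l * c (k - l) - d l * d (k - l) = (c l - d l) * c (k - l) + d l * (c (k - l) - d (k - l)) by ring.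
apply: le_trans (nc_tri _ _) _; rewrite !Normc.normcM.
have := ler_pM (normc_ge0 _) (normc_ge0 _) (hD l) (hc (k - l)).
have := ler_pM (normc_ge0 _) (normc_ge0 _) (hd l) (hD (k - l)).
lra.
Qed.

(** The abstract system has unconstrained unknowns, so the quadratic term is evaluated on their
    hermitian part. Both energy identities then hold for every vector: the linear multiplier is
    imaginary, and pairing with a hermitian family sees only the hermitian part, to which [energy0]
    applies. *)
Lemma galerkin_exists (alpha T : R) u0 : 0 < T -> L2per R u0 ->
  exists uN, galerkin_solution alpha T N u0 uN.
Proof.
move=> T0 L0.
pose m k := ik k * real_complex R (lapm alpha k).
pose q k := - (real_complex R 2^-1 * ik k).
pose C y := symm (raw y).
have hC y : herm (C y) by exact: symm_herm.
have C0 y k : k \notin box N -> C y k = 0 by apply: symm_out; exact: raw_out.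
pose A y (p : J * bool) := comp p.2 (m (ssval p.1) * raw y (ssval p.1)).
pose Q y (p : J * bool) := comp p.2 (q (ssval p.1) * conv (C y) (ssval p.1)).
pose LA := \sum_(k <- box N) nc (m k).
pose Lq := \sum_(k <- box N) nc (q k).
have le1 (F : int * int -> R) (j : J) : (forall k, 0 <= F k) -> F (ssval j) <= \sum_(k <- box N) F k.
  by move=> F0; rewrite -sum_seq_sub (bigD1 j)//= lerDl sumr_ge0.
have compB b (v w : R[i]) : comp b v - comp b w = comp b (v - w) by case: b; rewrite /= raddfB.
have hA y z p : `|A y p - A z p| <= LA * \sum_p `|y p - z p|.
  rewrite /A compB -mulrBr; apply: le_trans (comp_le _ _) _; rewrite Normc.normcM.
  apply: ler_pM; rewrite ?normc_ge0//; last exact: raw_dist.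
  by apply: (le1 (fun k => nc (m k))) => k; exact: normc_ge0.
(* The constants are those of [conv_dist]: on the unit cube the hermitian parts are bounded by 4,
   and they differ by at most twice the l^1 distance of the vectors. *)
pose LQ := Lq * ((size (box N))%:R * (2 * 4 * 2)).
have hQ y z p : (forall j, `|y j| <= 1) -> (forall j, `|z j| <= 1) ->
    `|Q y p - Q z p| <= LQ * \sum_j `|y j - z j|.
  move=> y1 z1; rewrite /Q compB -mulrBr; apply: le_trans (comp_le _ _) _; rewrite Normc.normcM.
  rewrite /LQ -mulrA; apply: ler_pM; rewrite ?normc_ge0//.
    by apply: (le1 (fun k => nc (q k))) => k; exact: normc_ge0.
  have b4 x l : (forall j, `|x j| <= 1) -> nc (C x l) <= 4.
    move=> x1; apply: le_trans (nc_symm _ _) _.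
    by have := raw_le2 l x1; have := raw_le2 (- l) x1; lra.
  apply: le_trans (conv_dist (D := 2 * \sum_j `|y j - z j|) (B := 4) _ _ _ _) _.
  - move=> l; rewrite /C symmB; apply: le_trans (nc_symm _ _) _.
    by have := raw_dist y z l; have := raw_dist y z (- l); lra.
  - by move=> l; exact: b4.
  - by move=> l; exact: b4.
  - by rewrite -!mulrA.
have hh y : herm (fun k => q k * conv (C y) k).
  have h : herm (conv (C y)).
    have := fourier_herm (L2_trig_sqr (trig_poly_tp N (C y))).
    by rewrite (_ : fourier _ = conv (C y))//; apply/funext => k; rewrite conv_fourier//; exact: C0.
  have := herm_mul (a := fun=> - 2^-1) (fun _ => erefl) (herm_ik h).
  rewrite (_ : (fun k => _) = (fun k => q k * conv (C y) k))//.
  by apply/funext => k; rewrite /q raddfN/=; ring.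
have Q2 (a : R) y p : Q (fun j => a * y j) p = a ^+ 2 * Q y p.
  have rE k : raw (fun j => a * y j) k = real_complex R a * raw y k.
    rewrite /raw; case: insub => [j|] /=; last by rewrite mulr0.
    by apply: complexP; rewrite ?RecM ?ImcM/=; ring.
  have CE k : C (fun j => a * y j) k = real_complex R a * C y k.
    by rewrite /C /symm !rE; apply: complexP; rewrite !(RecM, ImcM)/=; ring.
  have cE : conv (C (fun j => a * y j)) (ssval p.1) = real_complex R (a ^+ 2) * conv (C y) (ssval p.1).
    by rewrite /conv mulr_sumr; apply: eq_bigr => l _; rewrite !CE rmorphXn/=; ring.
  by rewrite /Q cE mulrCA; case: p.2; rewrite /comp !(RecM, ImcM)/=; ring.
have eA y : \sum_p y p * A y p = 0.
  rewrite (sum_raw y (fun k => m k * raw y k)) big1// => k _.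
  by rewrite /cdot /m -mulrA Re_ik Im_ik !(RecM, ImcM)/=; ring.
have eQ y : \sum_p y p * Q y p = 0.
  rewrite (sum_raw y (fun k => q k * conv (C y) k)) cdot_symm//.
  have := energy0 (hC y) (C0 y); rewrite -[RHS](mulr0 (- 2)) => h.
  have E : \sum_(k <- box N) cdot (C y k) (q k * conv (C y) k) =
     - 2^-1 * \sum_(k <- box N) \sum_(l <- box N) k.1%:~R * tau (C y k) (C y (k - l)) (C y l).
    rewrite mulr_sumr; apply: eq_bigr => k _; rewrite /conv !mulr_sumr.
    rewrite /cdot Rec_sum Imc_sum !mulr_sumr -big_split; apply: eq_bigr => l _ /=.
    rewrite /tau /=; ring.
  by rewrite E h; ring.
have LA0 : 0 <= LA by apply: sumr_ge0 => k _; exact: normc_ge0.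
have LQ0 : 0 <= LQ.
  by apply: mulr_ge0; [apply: sumr_ge0 => k _; exact: normc_ge0|rewrite !mulr_ge0].
pose y0 (p : J * bool) := comp p.2 (fourier u0 (ssval p.1)).
have [y [cy dy yi]] := quadratic_ode y0 LA0 LQ0 T0 hA hQ Q2 eA eQ.
exists (fun t => tp (box N) (C (y t))).
apply: galerkin_of_coef => //.
- move=> k kN; have kN' : - k \in box N by rewrite box_opp.
  rewrite -[k]/(ssval (SeqSub kN)) /C /symm; split => /=.
    apply: within_M; last exact: within_cst.
    apply: within_D.
      by apply: within_ext (cy (SeqSub kN, true)) => t _; rewrite -[k]/(ssval (SeqSub kN)) raw_in.
    by apply: within_ext (cy (SeqSub kN', true)) => t _; rewrite -[- k]/(ssval (SeqSub kN')) raw_in.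
  apply: within_M; last exact: within_cst.
  apply: within_B.
    by apply: within_ext (cy (SeqSub kN, false)) => t _; rewrite -[k]/(ssval (SeqSub kN)) raw_in.
  by apply: within_ext (cy (SeqSub kN', false)) => t _; rewrite -[- k]/(ssval (SeqSub kN')) raw_in.
- move=> k t kN tT.
  have rhsE : rhs alpha (tp (box N) (C (y t))) k = m k * C (y t) k + q k * conv (C (y t)) k.
    rewrite /rhs fourier_tp ?kN// conv_fourier//; last exact: C0.
    by rewrite /m /q; ring.
  have D l (lN : l \in box N) : is_cderive t (fun s => raw (y s) l) (m l * raw (y t) l + q l * conv (C (y t)) l).
    have e1 := dy (SeqSub lN, true) t tT; have e2 := dy (SeqSub lN, false) t tT.
    split.
      rewrite (_ : (fun s => _) = (fun s => y s (SeqSub lN, true))).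
        by apply: is_derive_eq e1 _; rewrite raddfD.
      by apply/funext => s; rewrite -[l]/(ssval (SeqSub lN)) raw_in.
    rewrite (_ : (fun s => _) = (fun s => y s (SeqSub lN, false))).
      by apply: is_derive_eq e2 _; rewrite raddfD.
    by apply/funext => s; rewrite -[l]/(ssval (SeqSub lN)) raw_in.
  have kN' : - k \in box N by rewrite box_opp.
  (* Combining the equations for k and -k gives the one for the hermitian part: the linear
     multiplier commutes with [symm] and the quadratic term is already hermitian. *)
  have [a1 a2] := D k kN; have [b1 b2] := D (- k) kN'; have [h1 h2] := hh (y t) k.
  split.
    have := derive_Z 2^-1 (derive_D a1 b1); under eq_fun do rewrite mulrC.
    move/is_derive_eq; apply.
    rewrite rhsE !RecD h1; move: (Rec (q k * _)) => Z.
    by rewrite /m lapmN -!mulrA !Re_ik !ImcM /C /symm /= !mulrNz; field.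
  have := derive_Z 2^-1 (derive_B a2 b2); under eq_fun do rewrite mulrC.
  move/is_derive_eq; apply.
  rewrite rhsE !ImcD h2; move: (Imc (q k * _)) => Z.
  by rewrite /m lapmN -!mulrA !Im_ik !RecM /C /symm /= !mulrNz; field.
- move=> k kN; have kN' : - k \in box N by rewrite box_opp.
  rewrite -[RHS](symm_id k (fourier_herm L0)) /C /symm.
  rewrite -{1 3}[k]/(ssval (SeqSub kN)) -{1 2}[- k]/(ssval (SeqSub kN')) !raw_in !yi.
  by [].
Qed.

End GalerkinExistence.

(** * Uniform bounds and stability *)

Section Estimates.
Context {R : realType}.
Local Notation vol := (@vol R).
Local Notation Rec := (@complex.Re R).
Local Notation Imc := (@complex.Im R).
Local Notation nc := (@Normc.normc R).
Implicit Types (f g h : R * R -> R) (c d : int * int -> R[i]) (k : int * int).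

(** The square of the H^s norm of the part of c in the box: a finite sum, hence continuous and
    differentiable in time as soon as the coefficients are. *)
Definition Ys (s : R) N c : R := \sum_(k <- box N) ws s k ^+ 2 * normc2 (c k).

Lemma Ys_ge0 s N c : 0 <= Ys s N c.
Proof. by apply: sumr_ge0 => k _; rewrite mulr_ge0 ?sqr_ge0// normc2_ge0. Qed.

Lemma Ys_nd s N M c : (N <= M)%N -> Ys s N c <= Ys s M c.
Proof. by move=> NM; apply: ler_sum_box => // k; rewrite mulr_ge0 ?sqr_ge0// normc2_ge0. Qed.

Lemma eq_Ys s N c d : (forall k, k \in box N -> c k = d k) -> Ys s N c = Ys s N d.
Proof. by move=> cd; rewrite /Ys big_seq [RHS]big_seq; apply: eq_bigr => k kN; rewrite cd. Qed.

Lemma trig_conv N f k : trig_poly N f -> fourier (fun x => f x ^+ 2) k = conv N (fourier f) k.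
Proof.
move=> tf; have Lf := trig_poly_L2 tf; have /trig_polyP fE := tf.
rewrite {1}fE conv_fourier//; first exact: fourier_herm.
by move=> l; exact: fourier_trig_poly.
Qed.

(** The dispersive multiplier is imaginary and therefore orthogonal to the coefficient in the real
    pairing [cdot]. *)
Lemma cdot_rhs (alpha : R) N f k : trig_poly N f ->
  cdot (fourier f k) (rhs alpha f k) =
  - 2^-1 * \sum_(l <- box N) k.1%:~R * tau (fourier f k) (fourier f (k - l)) (fourier f l).
Proof.
move=> tf; rewrite /rhs (trig_conv _ tf) /conv; set c := fourier f.
transitivity (- 2^-1 * cdot (c k) (ik k * \sum_(l <- box N) c l * c (k - l))).
  move: (\sum_(l <- box N) _) (c k) => [u v] [a b].
  by rewrite /cdot /=; ring.
congr (_ * _); rewrite mulr_sumr /cdot Rec_sum Imc_sum !mulr_sumr -big_split.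
by apply: eq_bigr => l _; rewrite /tau !(RecM, ImcM)/=; ring.
Qed.

Lemma derive_normc2 (z : R -> R[i]) dz (t : R) : is_cderive t z dz ->
  is_derive t (1 : R) (fun s => normc2 (z s)) (2 * cdot (z t) dz).
Proof.
move=> [h1 h2]; have := derive_D (derive_sqr h1) (derive_sqr h2).
by move/is_derive_eq; apply; rewrite /cdot; ring.
Qed.

Lemma within_normc2 (T : R) (z : R -> R[i]) : ccont T z ->
  {within `[0, T], continuous (fun s => normc2 (z s))}.
Proof. by move=> [h1 h2]; apply: within_D; exact: within_M. Qed.

(** The left side dominates the supremum norm of the gradient. It is split as [bra k] to the power 1
    - s times the weighted coefficient, and 2 a b <= a^2 + b^2 gives a bound that is affine in [Ys],
    as the Riccati inequality requires. *)
Lemma W_bound (s : R) : 2 < s -> exists2 Z : R, 0 <= Z &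
  forall N c, \sum_(k <- box N) bra k * nc (c k) <= 2^-1 * (Z + Ys s N c).
Proof.
move=> s2; have s1 : 1 < s - 1 by lra.
have [Z Z0 hZ] := lattice_sum s1; exists Z => // N c.
apply: le_trans (_ : 2^-1 * (\sum_(k <- box N) (ws (s - 1) k ^+ 2)^-1 + Ys s N c) <= _); last first.
  by rewrite ler_wpM2l// lerD2r.
rewrite -big_split mulr_sumr; apply: ler_sum => k _ /=.
rewrite -normc2E -exprMn -exprVn.
have -> : bra k * nc (c k) = (ws (s - 1) k)^-1 * (ws s k * nc (c k)).
  have -> : ws s k = bra k * ws (s - 1) k by rewrite -ws1 -wsD; congr ws; ring.
  by field; rewrite gt_eqF// ws_gt0.
by have := sqr_ge0 ((ws (s - 1) k)^-1 - ws s k * nc (c k)); lra.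
Qed.

(* -1 / (1 + Y) - C t is nonincreasing because Y' <= C (1 + Y)^2. *)
Lemma riccati (Y dY : R -> R) (T B C : R) : 0 < B -> 0 <= C ->
  (forall t : R, 0 <= Y t) -> {within `[0, T], continuous Y} ->
  (forall t : R, t \in `]0, T[ -> is_derive t (1 : R) Y (dY t)) ->
  (forall t : R, t \in `]0, T[ -> dY t <= C * (1 + Y t) ^+ 2) ->
  1 + Y 0 <= B -> C * T <= (2 * B)^-1 ->
  forall t : R, t \in `[0, T] -> 1 + Y t <= 2 * B.
Proof.
move=> B0 C0 Y0 cY dYt hY Y0B CT t tT.
have p x : 0 < 1 + Y x by rewrite ltr_pwDl.
have n x : 1 + Y x != 0 by rewrite gt_eqF.
have D (x : R) : x \in `]0, T[ -> is_derive x (1 : R) (fun x => - (1 + Y x)^-1 - C * x) (dY x / (1 + Y x) ^+ 2 - C).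
  move=> xT; have d1 : is_derive x (1 : R) (fun x => 1 + Y x) (dY x).
    by rewrite -[X in is_derive _ _ _ X]add0r; apply: derive_D; exact: dYt.
  have d2 := @is_deriveV R (fun x => 1 + Y x) x _ _ (n x) d1.
  have d3 := derive_B (derive_Z (-1) d2) (derive_Z C (is_derive_id x (1 : R))).
  under eq_fun do rewrite -mulN1r; apply: is_derive_eq d3 _.
  by rewrite -[_ *: _]/(_ * _); ring.
have cc : {within `[0, T], continuous (fun x => - (1 + Y x)^-1 - C * x)}.
  apply: within_B.
    have c1 : {within `[0, T], continuous (fun x => 1 + Y x)} by apply: within_D => //; exact: within_cst.
    by move=> x; apply: cvgN; apply: cvgV; [exact: n|exact: c1].
  by apply: within_cont => x; apply: cvgM; [exact: cvg_cst|exact: cvg_id].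
have := nonincreasing_itv D cc _ tT; rewrite mulr0 subr0 => H.
have {}H : - (1 + Y t)^-1 - C * t <= - (1 + Y 0)^-1.
  by apply: H => x xT; rewrite subr_le0 ler_pdivrMr ?exprn_gt0// hY.
have b1 : B^-1 <= (1 + Y 0)^-1 by rewrite lef_pV2 ?posrE.
have ct : C * t <= (2 * B)^-1.
  by apply: le_trans CT; apply: ler_wpM2l => //; move: tT; rewrite in_itv/= => /andP[].
have b2 : (2 * B)^-1 = B^-1 / 2 by rewrite invfM mulrC.
rewrite -lef_pV2 ?posrE ?mulr_gt0//; lra.
Qed.

Lemma hs_bound (s : R) : 2 < s -> exists2 C : R, 0 < C &
  forall (alpha T B : R) N (g : R -> R * R -> R), 0 < B -> C * T <= (2 * B)^-1 ->
  (forall t : R, t \in `[0, T] -> trig_poly N (g t)) -> coef_ode alpha T N g ->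
  1 + Ys s N (fourier (g 0)) <= B ->
  forall t : R, t \in `[0, T] -> 1 + Ys s N (fourier (g t)) <= 2 * B.
Proof.
move=> s2; have s1 : 1 <= s by lra.
have [Z Z0 hW] := W_bound s2; have K0 := Cs_ge0 s1.
(* The constant of [energy_bound], combined with (Z + Y) / 2 * Y <= (Z + 1) (1 + Y)^2; it depends on
   s alone, not on alpha or N. *)
exists ((1 + 4 * Cs s) * (Z + 1)); first by rewrite mulr_gt0//; lra.
move=> alpha T B N g B0 CT tg og Y0 t tT.
pose Y t := Ys s N (fourier (g t)).
pose dY t := \sum_(k <- box N) ws s k ^+ 2 * (2 * cdot (fourier (g t) k) (rhs alpha (g t) k)).
apply: (@riccati Y dY T B ((1 + 4 * Cs s) * (Z + 1))) => //.
- by rewrite mulr_ge0//; lra.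
- by move=> x; exact: Ys_ge0.
- apply: within_sum_seq => k kN; apply: within_M; first exact: within_cst.
  by apply: within_normc2; have [] := og k kN.
- move=> x xT; apply: derive_sum_seq => k kN; apply: derive_Z; apply: derive_normc2.
  by have [_] := og k kN; exact.
- move=> x xT; have tgx := tg x (itv_oo_cc xT).
  have := energy_bound s1 (fourier_herm (trig_poly_L2 tgx)) (fun m => fourier_trig_poly tgx (k := m)).
  have -> : dY x = - \sum_(k <- box N) ws s k ^+ 2 * \sum_(m <- box N) k.1%:~R *
      tau (fourier (g x) k) (fourier (g x) (k - m)) (fourier (g x) m).
    rewrite -sumrN; apply: eq_bigr => k _; by rewrite (cdot_rhs _ _ tgx); field.
  set S := \sum_(k <- _) _ => hS; apply: le_trans (ler_norm _) _; rewrite normrN.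
  apply: le_trans hS _; rewrite -/(Ys s N (fourier (g x))) -/(Y x).
  have := hW N (fourier (g x)); rewrite -/(Y x); set W := \sum_(k <- _) _ => hWx.
  have y0 : 0 <= Y x := Ys_ge0 _ _ _.
  rewrite -!mulrA; apply: ler_wpM2l; first by lra.
  apply: le_trans (ler_wpM2r y0 hWx) _; nra.
Qed.

Lemma abs2_bra k : `|k.2%:~R : R| <= bra k.
Proof.
rewrite -(@ler_pXn2r _ 2) ?nnegrE ?(ltW (bra_gt0 k))// sqr_bra real_normK ?num_real//.
by rewrite /sqnormk; have := sqr_ge0 (k.1%:~R : R); lra.
Qed.

Lemma bra_tail N k : k \notin box N -> N.+1%:R <= bra k :> R.
Proof.
rewrite mem_box negb_and -!ltnNge => /orP[h|h].
  by apply: le_trans (abs1_bra k); rewrite -intr_norm -[N.+1%:R]/(N.+1%:~R) ler_int; lia.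
by apply: le_trans (abs2_bra k); rewrite -intr_norm -[N.+1%:R]/(N.+1%:~R) ler_int; lia.
Qed.

Lemma ws_tail (s : R) N k : 0 <= s -> k \notin box N -> N.+1%:R `^ s <= ws s k.
Proof. by move=> s0 kN; rewrite ge0_ler_powR ?nnegrE ?bra_tail// ltW// bra_gt0. Qed.

Lemma nrm2_Ys (s B : R) f : 0 <= s -> L2per R f -> (forall M, Ys s M (fourier f) <= B) ->
  nrm2 f ^+ 2 <= vol * B.
Proof.
move=> s0 Lf hB; apply: Parseval_le => // N; apply: ler_wpM2l; first exact: ltW (@vol_gt0 R).
apply: le_trans (hB N); apply: ler_sum => k _.
rewrite ler_peMl ?normc2_ge0// exprn_ege1// -(ws0 k); exact: le_ws.
Qed.

Lemma tail_Ys (s B : R) f N : 0 <= s -> L2per R f -> (forall M, Ys s M (fourier f) <= B) ->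
  nrm2 (fun x => f x - proj N f x) ^+ 2 <= vol * (B / (N.+1%:R `^ s) ^+ 2).
Proof.
move=> s0 Lf hB; have Lp : L2per R (proj N f) by exact: L2_tp.
apply: Parseval_le; first exact: L2B.
move=> M; apply: ler_wpM2l; first exact: ltW (@vol_gt0 R).
have p0 : 0 < (N.+1%:R `^ s) ^+ 2 :> R by rewrite exprn_gt0// powR_gt0.
rewrite ler_pdivlMr//; apply: le_trans (hB M); rewrite mulr_suml; apply: ler_sum => k _.
rewrite fourierB// fourier_tp; last exact: fourier_herm.
case: ifPn => kN.
  rewrite subrr (_ : normc2 0 = 0); last by rewrite /normc2 /= expr0n addr0.
  by rewrite mul0r mulr_ge0 ?sqr_ge0// normc2_ge0.
rewrite subr0 mulrC; apply: ler_wpM2r; first exact: normc2_ge0.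
by rewrite ler_pXn2r ?nnegrE ?powR_ge0// ws_tail.
Qed.

Lemma abs_cdot_le (a b : R[i]) : `|cdot a b| <= nc a * nc b.
Proof.
rewrite -(@ler_pXn2r _ 2) ?nnegrE ?mulr_ge0 ?normc_ge0// real_normK ?num_real// exprMn !normc2E.
case: a => a a'; case: b => b b'; rewrite /cdot /normc2 /=.
by have := sqr_ge0 (a * b' - a' * b); nra.
Qed.

(** With p the projection of f, f^2 - g^2 = (f^2 - p^2) + (p - g) (p + g). The second term
    transports the difference by a field of bounded gradient and is handled by antisymmetry. The
    first has coefficients of size K eta, the derivative multiplies them by at most N, and the
    squares are added over the box. *)
Lemma stability_deriv (alpha K W eta : R) N f g : L2per R f -> trig_poly N g ->
  nrm2 f <= K -> nrm2 (fun x => f x - proj N f x) <= eta ->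
  \sum_(k <- box N) bra k * nc (fourier f k) <= W ->
  \sum_(k <- box N) bra k * nc (fourier g k) <= W ->
  forall d, (forall k, d k = fourier f k - fourier g k) ->
  \sum_(k <- box N) 2 * cdot (d k) (rhs alpha f k - rhs alpha g k) <=
  (W + 1) * \sum_(k <- box N) normc2 (d k) +
    (size (box N))%:R * (N%:R * (4 * vol^-1 * K * eta)) ^+ 2.
Proof.
move=> Lf tg fK feta Wf Wg d0 /funext ->; set d := (fun k => fourier f k - fourier g k).
have Lg := trig_poly_L2 tg; have v0 : 0 < vol^-1 by rewrite invr_gt0 vol_gt0.
pose p := proj N f; pose h x := f x - p x; pose q x := p x + g x.
have Lp : L2per R p by exact: L2_tp.
have Lh : L2per R h by exact: L2B.
have Lq : L2per R q by exact: L2D.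
have hd : herm d by apply: herm_B; exact: fourier_herm.
have pgE : (fun x => p x - g x) = tp (box N) d.
  apply/funext => x; rewrite {1}(trig_polyP N g).1// /p /proj /tp -sumrB; apply: eq_bigr => k _.
  by rewrite /d !raddfB/=; ring.
have qE k : fourier q k = if k \in box N then fourier f k + fourier g k else 0.
  rewrite fourierD// fourier_tp; last exact: fourier_herm.
  by case: ifPn => // kN; rewrite (fourier_trig_poly tg kN) addr0.
pose X k := four2 h f k + four2 p h k.
have pK : nrm2 p <= K.
  apply: le_trans fK; rewrite -(@ler_pXn2r _ 2) ?nnegrE ?nrm2_ge0// nrm2_proj//; exact: Bessel.
have XB k : nc (X k) <= 4 * vol^-1 * K * eta.
  apply: le_trans (nc_tri _ _) _.
  apply: le_trans (lerD (four2_le k Lh Lf) (four2_le k Lp Lh)) _.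
  have h1 := ler_pM (nrm2_ge0 _) (nrm2_ge0 _) feta fK.
  have h2 := ler_pM (nrm2_ge0 _) (nrm2_ge0 _) pK feta.
  have h3 := ler_wpM2l (ltW v0) h1; have h4 := ler_wpM2l (ltW v0) h2.
  by rewrite -/h in h3 h4; lra.
have FE k : fourier (fun x => f x ^+ 2) k - fourier (fun x => g x ^+ 2) k =
    X k + \sum_(l <- box N) d l * fourier q (k - l).
  rewrite !fourier_sqr// -four2_tp// -pgE four2Br// !four2Dl// (four2C g p) /X /h four2Bl// four2Br//.
  by ring.
have E k : 2 * cdot (d k) (rhs alpha f k - rhs alpha g k) =
    - cdot (d k) (ik k * X k) - \sum_(l <- box N) k.1%:~R * tau (d k) (fourier q (k - l)) (d l).
  have -> : rhs alpha f k - rhs alpha g k = ik k * (real_complex R (lapm alpha k) * d k) -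
      real_complex R 2^-1 * (ik k * (X k + \sum_(l <- box N) d l * fourier q (k - l))).
    by rewrite -FE /rhs /d; ring.
  have -> : \sum_(l <- box N) k.1%:~R * tau (d k) (fourier q (k - l)) (d l) =
      cdot (d k) (ik k * \sum_(l <- box N) d l * fourier q (k - l)).
    rewrite mulr_sumr /cdot Rec_sum Imc_sum !mulr_sumr -big_split.
    by apply: eq_bigr => l _; rewrite /tau !(RecM, ImcM)/=; ring.
  move: (\sum_(l <- box N) _) (d k) (X k) => [u v] [a b] [x y].
  by rewrite /cdot /=; field.
have W0 : 0 <= W by apply: le_trans Wf; apply: sumr_ge0 => k _; rewrite mulr_ge0 ?normc_ge0// ltW// bra_gt0.
have D0 : 0 <= \sum_(k <- box N) normc2 (d k) by apply: sumr_ge0 => k _; exact: normc2_ge0.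
under eq_bigr do rewrite E.
rewrite big_split/=.
have q0 k : k \notin box N -> fourier q k = 0 by move=> kN; rewrite qE (negbTE kN).
have AB := antisym_bound d (fourier_herm Lq) q0.
have Wq : \sum_(k <- box N) bra k * nc (fourier q k) <= 2 * W.
  apply: le_trans (_ : \sum_(k <- box N) (bra k * nc (fourier f k) + bra k * nc (fourier g k)) <= _).
    rewrite big_seq [leRHS]big_seq; apply: ler_sum => k kN; rewrite qE kN -mulrDr.
    by apply: ler_wpM2l; [exact: ltW (bra_gt0 k)|exact: nc_tri].
  by rewrite big_split/=; lra.
rewrite mulrDl mul1r addrAC -addrA addrC; apply: lerD.
  rewrite [leLHS]sumrN; apply: le_trans (ler_norm _) _; rewrite normrN; apply: le_trans AB _.
  by apply: ler_wpM2r => //; lra.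
have -> : (size (box N))%:R * (N%:R * (4 * vol^-1 * K * eta)) ^+ 2 = \sum_(k <- box N) (N%:R * (4 * vol^-1 * K * eta)) ^+ 2.
  by rewrite big_const_seq count_predT iter_addr_0 [LHS]mulr_natl.
rewrite -big_split big_seq [leRHS]big_seq; apply: ler_sum => k kN /=.
apply: le_trans (ler_norm _) _; rewrite normrN; apply: le_trans (abs_cdot_le _ _) _.
rewrite -normc2E; set a := nc (d k); set b := N%:R * _.
have a0 : 0 <= a := normc_ge0 _.
have bb : nc (ik k * X k) <= b.
  rewrite Normc.normcM; apply: ler_pM; rewrite ?normc_ge0//.
  rewrite /= expr0n /= add0r sqrtr_sqr -intr_norm -[N%:R]/(N%:~R) ler_int.
  by move: kN; rewrite mem_box => /andP[+ _]; clear; lia.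
apply: le_trans (ler_wpM2l a0 bb) _.
have b0 : 0 <= b := le_trans (normc_ge0 _) bb.
by have := sqr_ge0 (a - b); nra.
Qed.

Lemma derive_cB (t : R) (z w : R -> R[i]) dz dw : is_cderive t z dz -> is_cderive t w dw ->
  is_cderive t (fun s => z s - w s) (dz - dw).
Proof.
move=> [a1 a2] [b1 b2]; split.
  by have := derive_B a1 b1; rewrite -raddfB/=; under eq_fun do rewrite -raddfB/=.
by have := derive_B a2 b2; rewrite -raddfB/=; under eq_fun do rewrite -raddfB/=.
Qed.

Lemma ccontB (T : R) (z w : R -> R[i]) : ccont T z -> ccont T w -> ccont T (fun s => z s - w s).
Proof.
move=> [a1 a2] [b1 b2]; split.
  by apply: within_ext (within_B a1 b1) => t _; rewrite raddfB.
by apply: within_ext (within_B a2 b2) => t _; rewrite raddfB.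
Qed.

Lemma stability_coef (alpha T K W eta : R) N (f g : R -> R * R -> R) : 0 < T -> 0 <= W ->
  (forall t : R, t \in `[0, T] -> [/\ L2per R (f t), nrm2 (f t) <= K,
     nrm2 (fun x => f t x - proj N (f t) x) <= eta &
     \sum_(k <- box N) bra k * nc (fourier (f t) k) <= W]) ->
  (forall t : R, t \in `[0, T] -> trig_poly N (g t) /\
     \sum_(k <- box N) bra k * nc (fourier (g t) k) <= W) ->
  coef_ode alpha T N f -> coef_ode alpha T N g ->
  (forall k, k \in box N -> fourier (f 0) k = fourier (g 0) k) ->
  forall t : R, t \in `[0, T] ->
    \sum_(k <- box N) normc2 (fourier (f t) k - fourier (g t) k) <=
    (size (box N))%:R * (N%:R * (4 * vol^-1 * K * eta)) ^+ 2 * expR ((W + 1) * T).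
Proof.
move=> T0 W0 hf hg of_ og fg0 t tT.
set b := (size (box N))%:R * _.
have b0 : 0 <= b by rewrite mulr_ge0 ?sqr_ge0.
have W1 : 0 < W + 1 by lra.
pose D t := \sum_(k <- box N) normc2 (fourier (f t) k - fourier (g t) k).
pose dD t := \sum_(k <- box N) 2 * cdot (fourier (f t) k - fourier (g t) k) (rhs alpha (f t) k - rhs alpha (g t) k).
have H := @gronwall R D dD T (W + 1) b W1 b0 _ _ _ t tT.
have D0 : D 0 = 0.
  rewrite /D big_seq big1// => k kN; rewrite fg0// subrr /normc2 /= expr0n addr0//.
apply: le_trans (H _ _ _) _.
- move=> x xT; apply: derive_sum_seq => k kN.
  have [_ h1] := of_ k kN; have [_ h2] := og k kN.
  exact: derive_normc2 (derive_cB (h1 x xT) (h2 x xT)).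
- apply: within_sum_seq => k kN; apply: within_normc2.
  by have [h1 _] := of_ k kN; have [h2 _] := og k kN; exact: ccontB.
- move=> x xT; have [L1 L2 L3 L4] := hf x (itv_oo_cc xT); have [G1 G2] := hg x (itv_oo_cc xT).
  exact: stability_deriv.
rewrite D0 add0r; apply: ler_pM; rewrite ?expR_ge0 ?divr_ge0 ?(ltW W1)//.
  by rewrite ler_pdivrMr// ler_peMr//; lra.
by rewrite ler_expR ler_pM2l//; move: tT; rewrite in_itv/= => /andP[].
Qed.

Lemma trig_poly_inj N f g : trig_poly N f -> trig_poly N g ->
  (forall k, k \in box N -> fourier f k = fourier g k) -> f = g.
Proof.
move=> /trig_polyP fE /trig_polyP gE h; rewrite fE gE.
by apply/funext => x; rewrite /tp big_seq [RHS]big_seq; apply: eq_bigr => k kN; rewrite h.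
Qed.

(** The stability estimate with tail eta = 0: both functions equal their projections. *)
Lemma galerkin_unique (alpha s B T : R) N (f g : R -> R * R -> R) : 2 < s -> 0 < T ->
  (forall t : R, t \in `[0, T] -> trig_poly N (f t) /\ Ys s N (fourier (f t)) <= B) ->
  (forall t : R, t \in `[0, T] -> trig_poly N (g t) /\ Ys s N (fourier (g t)) <= B) ->
  coef_ode alpha T N f -> coef_ode alpha T N g ->
  (forall k, k \in box N -> fourier (f 0) k = fourier (g 0) k) ->
  forall t : R, t \in `[0, T] -> f t = g t.
Proof.
move=> s2 T0 hf hg of_ og fg0 t tT.
have [Z Z0 hW] := W_bound s2; pose W := 2^-1 * (Z + B).
have B0 : 0 <= B by have [_] := hf t tT; apply: le_trans; exact: Ys_ge0.
have YM x M : trig_poly N x -> Ys s N (fourier x) <= B -> Ys s M (fourier x) <= B.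
  move=> tx; apply: le_trans; case: (leqP M N) => [MN|/ltnW NM]; first exact: Ys_nd.
  rewrite /Ys (sum_box_widen NM)// => k _ kN.
  by rewrite (fourier_trig_poly tx kN) /normc2 /= expr0n addr0 mulr0.
have H := @stability_coef alpha T (Num.sqrt (vol * B)) W 0 N f g T0 _ _ _ of_ og fg0 t tT.
have {}H : \sum_(k <- box N) normc2 (fourier (f t) k - fourier (g t) k) <= 0.
  apply: le_trans (H _ _ _) _.
  - by rewrite mulr_ge0// addr_ge0.
  - move=> x xT; have [tf Yf] := hf x xT; have Lf := trig_poly_L2 tf; split => //.
    + rewrite -[leLHS]ger0_norm ?nrm2_ge0// -sqrtr_sqr ler_wsqrtr//.
      by apply: (@nrm2_Ys s) => //; [lra|move=> M; exact: YM].
    + rewrite (_ : (fun y => _) = (fun=> 0)); last first.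
        by apply/funext => y; rewrite {1}((trig_polyP N (f x)).1 tf) subrr.
      by rewrite /nrm2 inner0l sqrtr0.
    + by apply: le_trans (hW _ _) _; rewrite /W ler_wpM2l// lerD2l.
  - move=> x xT; have [tf Yf] := hg x xT; split => //.
    by apply: le_trans (hW _ _) _; rewrite /W ler_wpM2l// lerD2l.
  - by rewrite !mulr0 expr0n/= mulr0 mul0r.
have [tf _] := hf t tT; have [tg _] := hg t tT; apply: (trig_poly_inj tf tg) => k kN.
apply/eqP; rewrite -subr_eq0; apply/eqP.
apply: (@sum_normc2_eq0 R N (fun k => fourier (f t) k - fourier (g t) k)) => //.
by apply/eqP; rewrite eq_le H sumr_ge0// => l _; exact: normc2_ge0.
Qed.

(** The tail eta is K (N + 1)^(-s). A mode contributes N eta and the box has (2 N + 1)^2 modes, so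
    the distance in L^2 is of order (2 N + 1) N eta, at most 2 (N + 1)^2 eta. The constant A is the
    same for all alpha, N and pairs of solutions below the bound B. *)
Lemma stability (s B T : R) : 2 < s -> 0 < T -> 0 <= B -> exists2 A : R, 0 <= A &
  forall (alpha : R) N (f g : R -> R * R -> R),
  (forall t : R, t \in `[0, T] -> L2per R (f t) /\ forall M, Ys s M (fourier (f t)) <= B) ->
  (forall t : R, t \in `[0, T] -> trig_poly N (g t) /\ Ys s N (fourier (g t)) <= B) ->
  coef_ode alpha T N f -> coef_ode alpha T N g ->
  (forall k, k \in box N -> fourier (f 0) k = fourier (g 0) k) ->
  forall t : R, t \in `[0, T] -> nrm2 (fun x => f t x - g t x) <= A * N.+1%:R `^ (2 - s).
Proof.
move=> s2 T0 B0; have [Z Z0 hW] := W_bound s2; pose W := 2^-1 * (Z + B).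
have W0 : 0 <= W by rewrite mulr_ge0// addr_ge0.
have vol0 := @vol_gt0 R.
pose K := Num.sqrt (vol * B); have K0 : 0 <= K := sqrtr_ge0 _.
pose E := Num.sqrt (expR ((W + 1) * T)); have E0 : 0 <= E := sqrtr_ge0 _.
pose c := 4 * vol^-1 * K; have c0 : 0 <= c by rewrite !mulr_ge0// invr_ge0 ltW.
pose sv := Num.sqrt vol; have sv0 : 0 <= sv := sqrtr_ge0 _.
exists ((1 + 2 * (sv * (c * E))) * K).
  apply: mulr_ge0 => //; apply: addr_ge0 => //; apply: mulr_ge0 => //; apply: mulr_ge0 => //; exact: mulr_ge0.
move=> alpha N f g hf hg of_ og fg0 t tT.
have n0 : 0 < N.+1%:R :> R by rewrite ltr0n.
have n2 : 0 <= 2 * N.+1%:R ^+ 2 :> R.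
  by apply: mulr_ge0 => //; exact: sqr_ge0.
pose eta := K * N.+1%:R `^ (- s); have eta0 : 0 <= eta by rewrite mulr_ge0// powR_ge0.
have sK x : 0 <= x -> x ^+ 2 <= vol * B -> x <= K.
  by move=> x0 h; rewrite -[x]ger0_norm// -sqrtr_sqr ler_wsqrtr.
have hK x : x \in `[0, T] -> nrm2 (f x) <= K.
  move=> xT; have [Lf Yf] := hf x xT; apply: sK; first exact: nrm2_ge0.
  by apply: (@nrm2_Ys s) => //; lra.
have heta x : x \in `[0, T] -> nrm2 (fun y => f x y - proj N (f x) y) <= eta.
  move=> xT; have [Lf Yf] := hf x xT.
  rewrite -(@ler_pXn2r _ 2) ?nnegrE ?nrm2_ge0//.
  have s0 : 0 <= s by lra.
  apply: le_trans (tail_Ys N s0 Lf Yf) _.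
  have vB : 0 <= vol * B by apply: mulr_ge0 => //; exact: ltW.
  by rewrite /eta powRN exprMn exprVn /K (sqr_sqrtr vB) mulrA.
have ce0 : 0 <= c * eta by exact: mulr_ge0.
have n3 : N.*2.+1%:R * (N%:R * (c * eta)) <= 2 * N.+1%:R ^+ 2 * (c * eta).
  rewrite [leLHS]mulrA; apply: ler_wpM2r => //.
  have -> : 2 * N.+1%:R ^+ 2 = (2 * (N.+1 * N.+1))%:R :> R by rewrite expr2 -!natrM.
  by rewrite -natrM ler_nat; clear; nia.
have n4 : 0 <= N.*2.+1%:R * (N%:R * (c * eta)) by apply: mulr_ge0 => //; exact: mulr_ge0.
have n5 : 0 <= 2 * N.+1%:R ^+ 2 * (c * eta) by exact: mulr_ge0.
have H := stability_coef T0 W0 (K := K) (eta := eta) _ _ of_ og fg0 tT.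
have {}H : \sum_(k <- box N) normc2 (fourier (f t) k - fourier (g t) k) <=
    (2 * N.+1%:R ^+ 2 * (c * eta) * E) ^+ 2.
  apply: le_trans (H _ _) _.
  - move=> x xT; have [Lf Yf] := hf x xT; split; [exact: Lf|exact: hK|exact: heta|].
    by apply: le_trans (hW _ _) _; rewrite /W ler_wpM2l// lerD2l.
  - move=> x xT; have [tf Yf] := hg x xT; split => //.
    by apply: le_trans (hW _ _) _; rewrite /W ler_wpM2l// lerD2l.
  rewrite [leRHS]exprMn /E [X in _ <= _ * X]sqr_sqrtr ?expR_ge0//.
  apply: ler_wpM2r; first exact: expR_ge0.
  rewrite size_box natrX -exprMn -/c; by apply: lerXn2r; rewrite ?nnegrE.
have [Lf Yf] := hf t tT; have [tg _] := hg t tT; have Lg := trig_poly_L2 tg.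
have Lp : L2per R (proj N (f t)) by exact: L2_tp.
have hd : herm (fun k => fourier (f t) k - fourier (g t) k) by apply: herm_B; exact: fourier_herm.
have pg : nrm2 (fun x => proj N (f t) x - g t x) <= sv * (2 * N.+1%:R ^+ 2 * (c * eta) * E).
  rewrite -(@ler_pXn2r _ 2) ?nnegrE ?nrm2_ge0//; last first.
    by apply: mulr_ge0 => //; apply: mulr_ge0 => //; apply: mulr_ge0 => //; exact: mulr_ge0.
  rewrite exprMn (sqr_sqrtr (ltW vol0)).
  rewrite (_ : (fun x => _) = tp (box N) (fun k => fourier (f t) k - fourier (g t) k)).
    by rewrite nrm2_tp//; apply: ler_wpM2l; [exact: ltW|exact: H].
  apply/funext => x; rewrite {1}((trig_polyP N (g t)).1 tg) /proj /tp -sumrB; apply: eq_bigr => k _.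
  by rewrite !raddfB/=; ring.
have -> : (fun x => f t x - g t x) = (fun x => (f t x - proj N (f t) x) + (proj N (f t) x - g t x)).
  by apply/funext => x; rewrite addrA subrK.
apply: le_trans (nrm2D (L2B Lf Lp) (L2B Lp Lg)) _.
apply: le_trans (lerD (heta t tT) pg) _.
rewrite powRD; last by rewrite (gt_eqF n0) implybT.
rewrite (powR_mulrn _ (ltW n0)) /eta.
rewrite [leRHS](_ : _ = N.+1%:R ^+ 2 * (K * N.+1%:R `^ (- s)) + sv * (2 * N.+1%:R ^+ 2 * (c * (K * N.+1%:R `^ (- s))) * E)); last by ring.
by rewrite lerD2r ler_peMl// exprn_ege1// ler1n.
Qed.

End Estimates.

(** * The limit of the Galerkin approximations *)

Section Limit.
Context {R : realType}.
Local Notation vol := (@vol R).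
Local Notation Om := (@Omega R).
Local Notation Rec := (@complex.Re R).
Local Notation Imc := (@complex.Im R).
Local Notation nc := (@Normc.normc R).
Implicit Types (f g h : R * R -> R) (c d : int * int -> R[i]) (k : int * int).

Lemma rate_small (A s e : R) : 0 <= A -> 2 < s -> 0 < e -> exists N, forall n, (N <= n)%N ->
  A * n.+1%:R `^ (2 - s) <= e.
Proof.
move=> A0 s2 e0; pose b := (A + 1) / e; have b0 : 0 < b by rewrite divr_gt0//; lra.
pose q := b `^ (s - 2)^-1; have q0 : 0 <= q by exact: powR_ge0.
exists (Num.bound q) => n Nn.
have qn : q <= n.+1%:R.
  apply: le_trans (ltW (archi_boundP q0)) _; rewrite ler_nat; exact: leq_trans Nn (leqnSn _).
have h : b <= n.+1%:R `^ (s - 2).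
  have := ge0_ler_powR (r := s - 2) _ _ _ qn; rewrite -powRrM mulVf ?powRr1 ?(ltW b0)//; last by rewrite gt_eqF//; lra.
  by apply; rewrite ?nnegrE//; lra.
have -> : 2 - s = - (s - 2) by ring.
have p0 : 0 < n.+1%:R `^ (s - 2) :> R by rewrite powR_gt0.
rewrite powRN ler_pdivrMr//; have := ler_wpM2l (ltW e0) h.
by rewrite /b [e * _]mulrC divfK ?gt_eqF//; lra.
Qed.

Lemma unif_cauchy_lim (x r : nat -> R) :
  (forall e, 0 < e -> exists N, forall n, (N <= n)%N -> r n <= e) ->
  (forall n m, (n <= m)%N -> `|x m - x n| <= r n) ->
  x n @[n --> \oo] --> limn x /\ forall n, `|x n - limn x| <= r n.
Proof.
move=> r0 xr; have cv : x n @[n --> \oo] --> limn x.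
  apply/cauchy_cvgP/cauchy_exP => e e0.
  have e2 : 0 < e / 2 by lra.
  have [N hN] := r0 _ e2; exists (x N); exists N => // m /= Nm.
  rewrite /ball/= distrC; apply: le_lt_trans (xr _ _ Nm) _.
  by apply: le_lt_trans (hN N (leqnn N)) _; lra.
split => // n.
have cvn : `|x n - x m| @[m --> \oo] --> `|x n - limn x|.
  by apply: cvg_norm; apply: cvgB; [exact: cvg_cst|exact: cv].
rewrite -(cvg_lim (@Rhausdorff R) cvn); apply: limr_le.
  by apply/cvg_ex; eexists; exact: cvn.
by exists n => // m /= nm; rewrite distrC; exact: xr.
Qed.

Lemma cvg_le_bound (x : nat -> R) (l b : R) N : x n @[n --> \oo] --> l ->
  (forall n, (N <= n)%N -> x n <= b) -> l <= b.
Proof.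
move=> cv h; rewrite -(cvg_lim (@Rhausdorff R) cv); apply: limr_le.
  by apply/cvg_ex; eexists; exact: cv.
by exists N.
Qed.

Lemma quad_lim_le (w : int * int -> R) (c_ : nat -> int * int -> R[i]) c d M N (b : R) :
  (forall k, Rec (c_ n k) @[n --> \oo] --> Rec (c k)) ->
  (forall k, Imc (c_ n k) @[n --> \oo] --> Imc (c k)) ->
  (forall n, (N <= n)%N -> \sum_(k <- box M) w k * normc2 (c_ n k - d k) <= b) ->
  \sum_(k <- box M) w k * normc2 (c k - d k) <= b.
Proof.
move=> cr ci; apply: cvg_le_bound; elim: (box M) => [|k l IH].
  by rewrite big_nil; under eq_fun do rewrite big_nil; exact: cvg_cst.
rewrite big_cons; under eq_fun do rewrite big_cons.
apply: cvgD => //; apply: cvgM; first exact: cvg_cst.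
rewrite /normc2; under eq_fun do rewrite !raddfB/= !expr2.
rewrite !raddfB/= !expr2.
by apply: cvgD; apply: cvgM; apply: cvgB => //; exact: cvg_cst.
Qed.

Lemma fourier_nc_le f k : L2per R f -> nc (fourier f k) <= (Num.sqrt vol)^-1 * nrm2 f.
Proof.
move=> Lf; have s0 : 0 < Num.sqrt vol by rewrite sqrtr_gt0 vol_gt0.
rewrite -ler_pdivrMl ?invr_gt0// invrK -(@ler_pXn2r _ 2) ?nnegrE ?nrm2_ge0//; last first.
  by rewrite mulr_ge0 ?normc_ge0// ltW.
by rewrite exprMn sqr_sqrtr ?normc2E ?fourier_le// ltW// vol_gt0.
Qed.

Lemma Ys_trig (s B : R) N M f : trig_poly N f -> Ys s N (fourier f) <= B -> Ys s M (fourier f) <= B.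
Proof.
move=> tf; apply: le_trans; case: (leqP M N) => [MN|/ltnW NM]; first exact: Ys_nd.
rewrite /Ys (sum_box_widen NM)// => k _ kN.
by rewrite (fourier_trig_poly tf kN) /normc2 /= expr0n addr0 mulr0.
Qed.

(** A Lipschitz constant of the k-th coefficient of the right-hand side on the ball of radius K of
    L^2; it grows with k, so convergence of the equations is obtained mode by mode. *)
Definition rhsC (alpha K : R) k : R :=
  nc (ik k) * (lapm alpha k * (Num.sqrt vol)^-1 + 2 * vol^-1 * K).

Lemma rhsC_ge0 alpha K k : 0 <= K -> 0 <= rhsC alpha K k.
Proof.
move=> K0; have v0 := ltW (@vol_gt0 R).
apply: mulr_ge0; first exact: normc_ge0.
by rewrite addr_ge0// !mulr_ge0// ?invr_ge0 ?sqrtr_ge0// powR_ge0.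
Qed.

Lemma rhs_dist (alpha K : R) f g k : L2per R f -> L2per R g -> nrm2 f <= K -> nrm2 g <= K ->
  nc (rhs alpha f k - rhs alpha g k) <= rhsC alpha K k * nrm2 (fun x => f x - g x).
Proof.
move=> Lf Lg fK gK; have Lfg := L2B Lf Lg; have v0 : 0 < vol^-1 by rewrite invr_gt0 vol_gt0.
set e := nrm2 _; have e0 : 0 <= e := nrm2_ge0 _.
have -> : rhs alpha f k - rhs alpha g k = ik k * (real_complex R (lapm alpha k) * fourier (fun x => f x - g x) k
    - real_complex R 2^-1 * (four2 (fun x => f x - g x) f k + four2 g (fun x => f x - g x) k)).
  by rewrite fourierB// four2Bl// four2Br// /rhs !fourier_sqr//; ring.
rewrite Normc.normcM /rhsC -[leRHS](mulrA (nc (ik k))); apply: ler_wpM2l; first exact: normc_ge0.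
apply: le_trans (nc_tri _ _) _; rewrite ncN !Normc.normcM mulrDl.
have ncr (a : R) : 0 <= a -> nc (real_complex R a) = a.
  by move=> a0; rewrite /= expr0n/= addr0 sqrtr_sqr ger0_norm.
rewrite !ncr ?powR_ge0//; apply: lerD.
  by rewrite -mulrA; apply: ler_wpM2l; [exact: powR_ge0|exact: fourier_nc_le].
have h1 := four2_le k Lfg Lf; have h2 := four2_le k Lg Lfg.
rewrite -/e in h1 h2.
have h3 := ler_wpM2l (ltW v0) (ler_wpM2l e0 fK); have h4 := ler_wpM2l (ltW v0) (ler_wpM2r e0 gK).
have := nc_tri (four2 (fun x => f x - g x) f k) (four2 g (fun x => f x - g x) k).
lra.
Qed.

Lemma rhs_bound (alpha K : R) f k : L2per R f -> nrm2 f <= K ->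
  nc (rhs alpha f k) <= rhsC alpha K k * K + nc (rhs alpha (fun=> 0) k).
Proof.
move=> Lf fK; have L0 := @L2_cst R 0; have K0 := le_trans (nrm2_ge0 f) fK.
have n0 : nrm2 (fun=> 0 : R) <= K by rewrite /nrm2 inner0l sqrtr0.
rewrite -[rhs alpha f k](subrK (rhs alpha (fun=> 0) k)).
apply: le_trans (nc_tri _ _) _; rewrite lerD2r; apply: le_trans (rhs_dist alpha k Lf L0 fK n0) _.
apply: ler_wpM2l; first exact: rhsC_ge0.
by rewrite (_ : (fun x => f x - 0) = f)//; apply/funext => x; rewrite subr0.
Qed.

(** The L^2 function with coefficients c is truncated at height 2 S. All partial sums stay below
    this height, so truncation does not increase the distance to them and the coefficients are
    unchanged. The bound then holds at every point, which later keeps products with u in L^2. *)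
Lemma fsum (S : R) c : herm c -> (forall N, \sum_(k <- box N) nc (c k) <= S) ->
  exists u, [/\ L2per R u, (forall x, `|u x| <= 2 * S) & forall k, fourier u k = c k].
Proof.
move=> hc cS; have S0 : 0 <= S by apply: le_trans (cS 0%N); apply: sumr_ge0 => k _; exact: normc_ge0.
have hn N : hnrm c N <= S ^+ 2.
  apply: le_trans (_ : S * \sum_(k <- box N) nc (c k) <= _); last by rewrite expr2 ler_wpM2l.
  rewrite /hnrm mulr_sumr big_seq [leRHS]big_seq; apply: ler_sum => k kN.
  rewrite -normc2E expr2 ler_wpM2r ?normc_ge0//; apply: le_trans (cS N).
  by rewrite (bigD1_seq k kN (uniq_box N))/= lerDl sumr_ge0// => j _; exact: normc_ge0.
have [f [Lf fc]] := synth hc hn.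
have fcE : fourier f = c by exact/funext.
pose u x := Num.min (Num.max (f x) (- (2 * S))) (2 * S).
have uS x : `|u x| <= 2 * S.
  by rewrite ler_norml /u le_min le_max lexx orbT ge_min lexx orbT andbT /=; lra.
have tS N x : `|tp (box N) c x| <= 2 * S.
  apply: le_trans (ler_norm_sum _ _ _) _.
  apply: le_trans (_ : \sum_(k <- box N) 2 * nc (c k) <= _); last by rewrite -mulr_sumr ler_wpM2l.
  apply: ler_sum => k _; apply: le_trans (ler_normB _ _) _; rewrite !normrM mulr_natl mulr2n.
  apply: lerD; rewrite -[leRHS]mulr1; apply: ler_pM => //.
  - exact: abs_Re_le.
  - exact: normr_cos_le1.
  - exact: abs_Im_le.
  - exact: normr_sin_le1.
have mu_ : measurable_fun Om u.
  by apply: measurable_minr => //; apply: measurable_maxr => //; exact: measurable_L2.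
have Lu : L2per R u by apply: L2_bounded mu_ _ => x _; exact: uS.
exists u; split => // k; apply/eqP; rewrite -subr_eq0; apply/eqP/nc_eq0/ler_addgt0Pl => e e0; rewrite addr0.
have sv0 : 0 < Num.sqrt vol by rewrite sqrtr_gt0 vol_gt0.
have e1 : 0 < e * Num.sqrt vol by exact: mulr_gt0.
have [N hN] := proj_cvg Lf e1; pose M := maxn N (maxn `|k.1|%N `|k.2|%N).
have kM : k \in box M by rewrite mem_box /M !leq_max !leqnn !orbT.
have Lt : L2per R (tp (box M) c) by exact: L2_tp.
have -> : fourier u k - c k = fourier (fun x => u x - tp (box M) c x) k.
  by rewrite fourierB// fourier_tp// kM.
apply: le_trans (fourier_nc_le _ (L2B Lu Lt)) _; rewrite ler_pdivrMl// mulrC.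
apply: le_trans (ltW (hN M (leq_maxl _ _))).
rewrite /proj fcE; apply: nrm2_le (L2B Lu Lt) (L2B Lf Lt) _ => x _.
have := tS M x; rewrite /u; move: (f x) (tp (box M) c x) => p q; rewrite ler_norml => /andP[q1 q2].
rewrite /Num.min /Num.max; case: (ltP p (- (2 * S))) => h1; case: ltP => h2 //; try lra.
- by rewrite !ler0_norm; lra.
- by rewrite [X in `|X|](_ : _ = 0) ?normr0//; lra.
- by rewrite !ger0_norm; lra.
Qed.

Lemma within_eps (T : R) (F : R -> R) :
  (forall t e : R, t \in `[0, T] -> 0 < e -> exists2 d : R, 0 < d &
     forall r : R, r \in `[0, T] -> `|r - t| < d -> `|F r - F t| <= e) ->
  {within `[0, T], continuous F}.
Proof.
move=> H; apply/subspace_continuousP => t /= tT; apply/cvgrPdist_le => e e0.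
have [d d0 hd] := H t e tT e0.
rewrite near_withinE; exists d => //= r tr rT; rewrite distrC; apply: hd => //.
by rewrite distrC.
Qed.

Lemma eps_within (T : R) (F : R -> R) : {within `[0, T], continuous F} ->
  forall t e : R, t \in `[0, T] -> 0 < e -> exists2 d : R, 0 < d &
     forall r : R, r \in `[0, T] -> `|r - t| < d -> `|F r - F t| <= e.
Proof.
move=> /subspace_continuousP H t e tT e0.
have /cvgrPdist_le/(_ e e0) := H t tT; rewrite near_withinE => -[d /= d0 hd].
by exists d => // r rT rd; rewrite distrC; apply: hd => //=; rewrite distrC.
Qed.

Definition L2cont (T : R) (f : R -> R * R -> R) := forall t e : R, t \in `[0, T] -> 0 < e ->
  exists2 d : R, 0 < d & forall r : R, r \in `[0, T] -> `|r - t| < d ->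
    nrm2 (fun x => f r x - f t x) <= e.

(* Convergence of each coefficient, with a uniform control of the tails. *)
Lemma L2cont_coef (T s B : R) (f : R -> R * R -> R) : 2 < s ->
  (forall t : R, t \in `[0, T] -> L2per R (f t) /\ forall M, Ys s M (fourier (f t)) <= B) ->
  (forall k, ccont T (fun t => fourier (f t) k)) -> L2cont T f.
Proof.
move=> s2 hf cf t e tT e0.
have [Lt Yt] := hf t tT; have B0 : 0 <= B := le_trans (Ys_ge0 _ _ _) (Yt 0%N).
have e4 : 0 < e / 4 by lra.
have s0 : 0 <= s by lra.
have vB : 0 <= vol * B by rewrite mulr_ge0// ltW// vol_gt0.
have [N hN] := rate_small (sqrtr_ge0 (vol * B)) s2 e4.
have tail (r : R) : r \in `[0, T] -> nrm2 (fun x => f r x - proj N (f r) x) <= e / 4.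
  move=> rT; have [Lr Yr] := hf r rT; apply: le_trans (hN N (leqnn N)).
  rewrite -(@ler_pXn2r _ 2) ?nnegrE ?nrm2_ge0 ?mulr_ge0 ?sqrtr_ge0 ?powR_ge0//.
  apply: le_trans (tail_Ys N s0 Lr Yr) _; rewrite exprMn sqr_sqrtr// -(mulrA vol B).
  apply: ler_wpM2l; first exact: ltW (@vol_gt0 R).
  apply: ler_wpM2l => //; rewrite -exprVn -powRN; apply: lerXn2r; rewrite ?nnegrE ?powR_ge0//.
  by apply: ler_powR; rewrite ?ler1n//; lra.
pose Q r := \sum_(k <- box N) normc2 (fourier (f r) k - fourier (f t) k).
have cQ : {within `[0, T], continuous Q}.
  apply: within_sum_seq => k _; apply: within_normc2; apply: ccontB => //.
  by split; exact: within_cst.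
have q0 : 0 < (e / 2) ^+ 2 / vol by rewrite divr_gt0 ?vol_gt0// exprn_gt0//; lra.
have [d d0 hd] := eps_within cQ tT q0; exists d => // r rT rd.
have [Lr Yr] := hf r rT.
have Lpr : L2per R (proj N (f r)) by exact: L2_tp.
have Lpt : L2per R (proj N (f t)) by exact: L2_tp.
have Qt : Q t = 0 by rewrite /Q big1// => k _; rewrite subrr /normc2 /= expr0n addr0.
have pp : nrm2 (fun x => proj N (f r) x - proj N (f t) x) <= e / 2.
  rewrite -(@ler_pXn2r _ 2) ?nnegrE ?nrm2_ge0//; last by lra.
  rewrite (_ : (fun x => _) = tp (box N) (fun k => fourier (f r) k - fourier (f t) k)).
    rewrite nrm2_tp; last by apply: herm_B; exact: fourier_herm.
    rewrite -ler_pdivlMl ?vol_gt0// mulrC; apply: le_trans (hd r rT rd).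
    by rewrite Qt subr0 ler_norm.
  apply/funext => x; rewrite /proj /tp -sumrB; apply: eq_bigr => k _.
  by rewrite !raddfB/=; ring.
have -> : (fun x => f r x - f t x) = (fun x => (f r x - proj N (f r) x) +
    ((proj N (f r) x - proj N (f t) x) - (f t x - proj N (f t) x))).
  by apply/funext => x; ring.
apply: le_trans (nrm2D (L2B Lr Lpr) (L2B (L2B Lpr Lpt) (L2B Lt Lpt))) _.
have h1 := tail r rT; have h2 := tail t tT.
apply: le_trans (lerD h1 (le_trans (nrm2B (L2B Lpr Lpt) (L2B Lt Lpt)) (lerD pp h2))) _.
by clear; lra.
Qed.

Lemma ccont_rhs (alpha T K : R) (f : R -> R * R -> R) k :
  (forall t : R, t \in `[0, T] -> L2per R (f t) /\ nrm2 (f t) <= K) -> L2cont T f ->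
  ccont T (fun t => rhs alpha (f t) k).
Proof.
move=> hf cf.
have [K0|K0] := ltP K 0.
  split; apply: within_eps => t e tT; have [_ /le_lt_trans/(_ K0)] := hf t tT;
  by rewrite ltNge nrm2_ge0.
have C0 := rhsC_ge0 alpha k K0.
have H (t e : R) : t \in `[0, T] -> 0 < e -> exists2 d : R, 0 < d &
    forall r : R, r \in `[0, T] -> `|r - t| < d -> nc (rhs alpha (f r) k - rhs alpha (f t) k) <= e.
  move=> tT e0; have C1 : 0 < rhsC alpha K k + 1 by lra.
  have e1 : 0 < e / (rhsC alpha K k + 1) by exact: divr_gt0.
  have [d d0 hd] := cf t _ tT e1; exists d => // r rT rd.
  have [Lr Kr] := hf r rT; have [Lt Kt] := hf t tT.
  apply: le_trans (rhs_dist alpha k Lr Lt Kr Kt) _.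
  apply: le_trans (ler_wpM2l C0 (hd r rT rd)) _.
  by rewrite mulrA ler_pdivrMr// mulrC ler_wpM2l ?(ltW e0)//; lra.
split; apply: within_eps => t e tT e0; have [d d0 hd] := H t e tT e0; exists d => // r rT rd;
  apply: le_trans (hd r rT rd).
  by rewrite -raddfB; exact: abs_Re_le.
by rewrite -raddfB; exact: abs_Im_le.
Qed.

Lemma coef_lip (alpha T K : R) N (f : R -> R * R -> R) k : k \in box N ->
  (forall t : R, t \in `[0, T] -> L2per R (f t) /\ nrm2 (f t) <= K) -> coef_ode alpha T N f ->
  let L := rhsC alpha K k * K + nc (rhs alpha (fun=> 0) k) in
  forall t r : R, t \in `[0, T] -> r \in `[0, T] ->
    `|Rec (fourier (f t) k) - Rec (fourier (f r) k)| <= L * `|t - r| /\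
    `|Imc (fourier (f t) k) - Imc (fourier (f r) k)| <= L * `|t - r|.
Proof.
move=> kN hf of_ L t r tT rT; have [[c1 c2] D] := of_ k kN.
have B (x : R) : x \in `]0, T[ -> nc (rhs alpha (f x) k) <= L.
  by move=> xT; have [Lx Kx] := hf x (itv_oo_cc xT); exact: rhs_bound.
split.
  apply: (lipschitz_itv (fun x xT => (D x xT).1) c1 _ tT rT) => x xT.
  by apply: le_trans (abs_Re_le _) _; exact: B.
apply: (lipschitz_itv (fun x xT => (D x xT).2) c2 _ tT rT) => x xT.
by apply: le_trans (abs_Im_le _) _; exact: B.
Qed.

Lemma coef_odeS (alpha T : R) N M (f : R -> R * R -> R) : (N <= M)%N -> coef_ode alpha T M f -> coef_ode alpha T N f.
Proof. by move=> NM H k kN; apply: H; exact: box_sub kN. Qed.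

(** [coef_ode] involves the whole function, so a Galerkin solution satisfies the system of every
    smaller box exactly and [stability] compares the two. The limit is taken coefficient by
    coefficient, and a bounded function is synthesised from it at each time. *)
Lemma limit_solution (alpha s T B : R) (u0 : R * R -> R) (U : nat -> R -> R * R -> R) :
  2 < s -> 0 < T ->
  (forall N (t : R), t \in `[0, T] -> trig_poly N (U N t) /\ Ys s N (fourier (U N t)) <= B) ->
  (forall N, coef_ode alpha T N (U N)) ->
  (forall N k, k \in box N -> fourier (U N 0) k = fourier u0 k) ->
  exists (u : R -> R * R -> R) (S : R),
    [/\ forall t : R, t \in `[0, T] -> [/\ L2per R (u t), (forall x, `|u t x| <= S) &
          forall M, Ys s M (fourier (u t)) <= B],
      forall N, coef_ode alpha T N u & forall k, fourier (u 0) k = fourier u0 k].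
Proof.
move=> s2 T0 tU oU iU.
have z0 : (0 : R) \in `[0, T] by rewrite in_itv/= lexx ltW.
have B0 : 0 <= B by have [_] := tU 0%N 0 z0; apply: le_trans; exact: Ys_ge0.
have [A A0 hA] := stability s2 T0 B0.
have LU N (t : R) : t \in `[0, T] -> L2per R (U N t) by move=> tT; have [/trig_poly_L2] := tU N t tT.
have YU N (t : R) : t \in `[0, T] -> forall M, Ys s M (fourier (U N t)) <= B.
  by move=> tT M; have [tr Y] := tU N t tT; exact: Ys_trig tr Y.
pose K := Num.sqrt (vol * B).
have nK f : L2per R f -> (forall M, Ys s M (fourier f) <= B) -> nrm2 f <= K.
  move=> Lf Yf; rewrite -[leLHS]ger0_norm ?nrm2_ge0// -sqrtr_sqr ler_wsqrtr//.
  by apply: (@nrm2_Ys _ s) => //; lra.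
have sv0 : 0 < Num.sqrt vol by rewrite sqrtr_gt0 vol_gt0.
pose r N := (Num.sqrt vol)^-1 * (A * N.+1%:R `^ (2 - s)).
have rs e : 0 < e -> exists N, forall n, (N <= n)%N -> r n <= e.
  move=> e0; have [N hN] := rate_small (mulr_ge0 (ltW (divr_gt0 ltr01 sv0)) A0) s2 e0.
  by exists N => n /hN; rewrite /r mul1r mulrA.
have dU N M (t : R) : (N <= M)%N -> t \in `[0, T] -> nrm2 (fun x => U M t x - U N t x) <= A * N.+1%:R `^ (2 - s).
  move=> NM tT; apply: (hA alpha N (U M) (U N)) => //.
  - by move=> x xT; split; [exact: LU|exact: YU].
  - by move=> x xT; exact: tU.
  - exact: coef_odeS (oU M).
  - by move=> k kN; rewrite !iU// (box_sub NM).
have dC N M k (t : R) : (N <= M)%N -> t \in `[0, T] -> nc (fourier (U M t) k - fourier (U N t) k) <= r N.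
  move=> NM tT; rewrite -fourierB; [|exact: LU|exact: LU].
  apply: le_trans (fourier_nc_le _ (L2B (LU M t tT) (LU N t tT))) _.
  by apply: ler_wpM2l; [rewrite invr_ge0 ltW|exact: dU].
pose a (t : R) k := Complex (limn (fun n => Rec (fourier (U n t) k))) (limn (fun n => Imc (fourier (U n t) k))).
have aR k (t : R) : t \in `[0, T] -> Rec (fourier (U n t) k) @[n --> \oo] --> Rec (a t k).
  move=> tT; apply: (proj1 (unif_cauchy_lim rs _)) => n m nm.
  by rewrite -raddfB; apply: le_trans (abs_Re_le _) _; exact: dC.
have aI k (t : R) : t \in `[0, T] -> Imc (fourier (U n t) k) @[n --> \oo] --> Imc (a t k).
  move=> tT; apply: (proj1 (unif_cauchy_lim rs _)) => n m nm.
  by rewrite -raddfB; apply: le_trans (abs_Im_le _) _; exact: dC.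
have ha (t : R) : t \in `[0, T] -> herm (a t).
  move=> tT k; have h n := fourier_herm (LU n t tT) k.
  have h1 := funext (fun n => (h n).1); have h2 := funext (fun n => (h n).2).
  split; first by rewrite /= h1.
  have := aI (- k) t tT; rewrite h2 => c2.
  exact: (cvg_unique (@Rhausdorff R) c2 (cvgN (aI k t tT))).
have Ya (t : R) M : t \in `[0, T] -> Ys s M (a t) <= B.
  move=> tT; have := @quad_lim_le (fun k => ws s k ^+ 2) (fun n => fourier (U n t)) (a t) (fun=> 0) M 0%N B (fun k => aR k t tT) (fun k => aI k t tT).
  under eq_bigr do rewrite subr0; move=> -> // n _.
  by under eq_bigr do rewrite subr0; exact: YU.
have [Z Z0 hW] := W_bound s2; pose S := 2^-1 * (Z + B).
have aS (t : R) N : t \in `[0, T] -> \sum_(k <- box N) nc (a t k) <= S.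
  move=> tT; apply: le_trans (le_trans (hW N (a t)) _).
    by apply: ler_sum => k _; rewrite ler_peMl ?normc_ge0// bra_ge1.
  by rewrite /S ler_wpM2l// lerD2l Ya.
(* The value outside [0, T] is the constant 0. *)
have /choice[u hu] : forall t : R, exists f, t \in `[0, T] ->
    [/\ L2per R f, (forall x, `|f x| <= 2 * S) & forall k, fourier f k = a t k].
  move=> t; case: (boolP (t \in `[0, T])) => [tT|]; last by exists (fun=> 0).
  by have [f hf] := fsum (ha t tT) (fun N => aS t N tT); exists f.
have Yu (t : R) : t \in `[0, T] -> forall M, Ys s M (fourier (u t)) <= B.
  by move=> tT M; have [_ _ fu] := hu t tT; rewrite (eq_Ys _ (fun k _ => fu k)); exact: Ya.
have Lu (t : R) : t \in `[0, T] -> L2per R (u t) by move=> tT; have [] := hu t tT.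
have fu (t : R) k : t \in `[0, T] -> fourier (u t) k = a t k by move=> tT; have [_ _] := hu t tT.
have uU N (t : R) : t \in `[0, T] -> nrm2 (fun x => u t x - U N t x) <= A * N.+1%:R `^ (2 - s).
  move=> tT; have q0 : 0 <= A * N.+1%:R `^ (2 - s) by rewrite mulr_ge0// powR_ge0.
  rewrite -(@ler_pXn2r _ 2) ?nnegrE ?nrm2_ge0//.
  apply: Parseval_le; first by apply: L2B; [exact: Lu|exact: LU].
  move=> M; rewrite -ler_pdivlMl ?vol_gt0//.
  have E n : hnrm (fourier (fun x => U n t x - U N t x)) M =
      \sum_(k <- box M) 1 * normc2 (fourier (U n t) k - fourier (U N t) k).
    by apply: eq_bigr => k _; rewrite mul1r fourierB//; exact: LU.
  have -> : hnrm (fourier (fun x => u t x - U N t x)) M =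
      \sum_(k <- box M) 1 * normc2 (a t k - fourier (U N t) k).
    by apply: eq_bigr => k _; rewrite mul1r fourierB ?fu//; [exact: Lu|exact: LU].
  apply: (@quad_lim_le (fun=> 1) (fun n => fourier (U n t)) (a t) _ M N) => [k|k|n Nn].
  - exact: aR.
  - exact: aI.
  rewrite -E; apply: le_trans (hnrm_fourier _ (L2B (LU n t tT) (LU N t tT))) _.
  apply: ler_wpM2l; first by rewrite invr_ge0 ltW// vol_gt0.
  by rewrite ler_pXn2r ?nnegrE ?nrm2_ge0//; exact: dU.
have inbox k : exists n, forall N, (n <= N)%N -> k \in box N.
  exists (maxn `|k.1|%N `|k.2|%N) => N nN; rewrite mem_box.
  by rewrite !(leq_trans _ nN) ?leq_maxl ?leq_maxr.
have hK (t : R) : t \in `[0, T] -> L2per R (u t) /\ nrm2 (u t) <= K.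
  by move=> tT; split; [exact: Lu|apply: nK; [exact: Lu|exact: Yu]].
have hKU N (t : R) : t \in `[0, T] -> L2per R (U N t) /\ nrm2 (U N t) <= K.
  by move=> tT; split; [exact: LU|apply: nK; [exact: LU|exact: YU]].
have ca k : ccont T (fun t => fourier (u t) k).
  have [n hn] := inbox k; pose L := rhsC alpha K k * K + nc (rhs alpha (fun=> 0) k).
  have L0 : 0 <= L.
    rewrite addr_ge0 ?normc_ge0// mulr_ge0 ?sqrtr_ge0//; apply: rhsC_ge0; exact: sqrtr_ge0.
  split; apply: (lip_on_within T0); exists L => // t q tT qT; rewrite !fu//.
    have cv : `|Rec (fourier (U m t) k) - Rec (fourier (U m q) k)| @[m --> \oo] --> `|Rec (a t k) - Rec (a q k)|.
      by apply: cvg_norm; apply: cvgB; exact: aR.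
    by apply: (cvg_le_bound cv (N := n)) => m nm; have [] := coef_lip (hn m nm) (hKU m) (oU m) tT qT.
  have cv : `|Imc (fourier (U m t) k) - Imc (fourier (U m q) k)| @[m --> \oo] --> `|Imc (a t k) - Imc (a q k)|.
    by apply: cvg_norm; apply: cvgB; exact: aI.
  by apply: (cvg_le_bound cv (N := n)) => m nm; have [] := coef_lip (hn m nm) (hKU m) (oU m) tT qT.
have cu : L2cont T u.
  by apply: (L2cont_coef s2 _ ca) => t tT; split; [exact: Lu|exact: Yu].
exists u, (2 * S); split.
- by move=> t tT; have [h1 h2 h3] := hu t tT; split => //; exact: Yu.
- move=> N k kN; split; first exact: ca.
  move=> t tT; have [n hn] := inbox k; have [cr1 cr2] := ccont_rhs alpha k hK cu.
  (* The shift by n discards the approximations whose box does not yet contain the mode k. *)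
  have un (e : R) : 0 < e -> exists N, forall m (x : R), (N <= m)%N -> x \in `]0, T[ ->
      nc (rhs alpha (U (m + n)%N x) k - rhs alpha (u x) k) <= e.
    have C0 := rhsC_ge0 alpha k (sqrtr_ge0 (vol * B)).
    move=> e0; have [M hM] := rate_small (mulr_ge0 C0 A0) s2 e0.
    exists M => m x Mm xT; have xc := itv_oo_cc xT.
    have [L1 K1] := hKU (m + n)%N x xc; have [L2 K2] := hK x xc.
    apply: le_trans (rhs_dist alpha k L1 L2 K1 K2) _; rewrite nrm2_distC.
    apply: le_trans (ler_wpM2l C0 (uU (m + n)%N x xc)) _.
    by rewrite mulrA; apply: hM; exact: leq_trans Mm (leq_addr _ _).
  split.
    apply: (@derive_limit R (fun m x => Rec (fourier (U (m + n)%N x) k)) (fun m x => Rec (rhs alpha (U (m + n)%N x) k))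
       (fun x => Rec (fourier (u x) k)) (fun x => Rec (rhs alpha (u x) k)) T) => //.
    + by move=> m x xT; have [_ D] := oU _ k (hn _ (leq_addl m n)); exact: (D x xT).1.
    + by move=> m; have [[]] := oU _ k (hn _ (leq_addl m n)).
    + by move=> x xT; rewrite fu// (cvg_shiftn n (fun m => Rec (fourier (U m x) k))); exact: aR.
    + move=> e e0; have [M hM] := un e e0; exists M => m x Mm xT.
      by apply: le_trans (hM m x Mm xT); rewrite -raddfB; exact: abs_Re_le.
    + exact: within_interior_cont cr1 t tT.
  apply: (@derive_limit R (fun m x => Imc (fourier (U (m + n)%N x) k)) (fun m x => Imc (rhs alpha (U (m + n)%N x) k))
     (fun x => Imc (fourier (u x) k)) (fun x => Imc (rhs alpha (u x) k)) T) => //.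
  + by move=> m x xT; have [_ D] := oU _ k (hn _ (leq_addl m n)); exact: (D x xT).2.
  + by move=> m; have [[]] := oU _ k (hn _ (leq_addl m n)).
  + by move=> x xT; rewrite fu// (cvg_shiftn n (fun m => Imc (fourier (U m x) k))); exact: aI.
  + move=> e e0; have [M hM] := un e e0; exists M => m x Mm xT.
    by apply: le_trans (hM m x Mm xT); rewrite -raddfB; exact: abs_Im_le.
  + exact: within_interior_cont cr2 t tT.
- move=> k; rewrite fu//; have [n hn] := inbox k; apply: complexP.
    apply: (cvg_unique (@Rhausdorff R) (aR k 0 z0)); rewrite /mkset -(cvg_shiftn n).
    rewrite (_ : (fun m => _) = (fun=> Rec (fourier u0 k))); first exact: cvg_cst.
    by apply/funext => m; rewrite iU// hn// leq_addl.
  apply: (cvg_unique (@Rhausdorff R) (aI k 0 z0)); rewrite /mkset -(cvg_shiftn n).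
  rewrite (_ : (fun m => _) = (fun=> Imc (fourier u0 k))); first exact: cvg_cst.
  by apply/funext => m; rewrite iU// hn// leq_addl.
Qed.

End Limit.

(** * Sobolev norms and Bochner integrals *)

Section Sobolev.
Context {R : realType}.
Local Notation nc := (@Normc.normc R).
Implicit Types (f g h : R * R -> R) (c d : int * int -> R[i]) (k : int * int).

(* Unlike [ge0_le_integral], no measurability is needed. *)
Lemma ge0_integral_mono (dsp : measure_display) (T : measurableType dsp) (mu : {measure set T -> \bar R}) (D : set T)
    (f1 f2 : T -> \bar R) : (forall x, D x -> 0 <= f1 x)%E -> (forall x, D x -> f1 x <= f2 x)%E ->
  (\int[mu]_(x in D) f1 x <= \int[mu]_(x in D) f2 x)%E.
Proof.
move=> f0 f12; rewrite !ge0_integralE//; last by move=> x Dx; apply: le_trans (f12 x Dx); exact: f0.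
apply: ereal_sup_le => _ [h hf <-]; exists h => // x; apply: le_trans (hf x) _.
by rewrite /patch; case: ifP => // /[!inE]; exact: f12.
Qed.

Definition hsum (s : R) f : \bar R :=
  (\esum_(k in [set: int * int]) ((1 + sqnormk R k) `^ s * nc (fourier f k) ^+ 2)%:E)%E.

Lemma hsum_ge0 s f : (0 <= hsum s f)%E.
Proof. by apply: esum_ge0 => k _; rewrite lee_fin mulr_ge0 ?powR_ge0 ?sqr_ge0. Qed.

Lemma Ys_le_hsum s M f : ((Ys s M (fourier f))%:E <= hsum s f)%E.
Proof.
apply: esum_ge; exists [set` box M].
  by split => //; exact: finite_seq.
rewrite -fsbig_seq ?uniq_box// sumEFin lee_fin.
by rewrite le_eqVlt; apply/orP; left; apply/eqP; apply: eq_bigr => k _; rewrite sqr_ws normc2E.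
Qed.

Lemma hsum_le s (b : R) f : (forall M, Ys s M (fourier f) <= b) -> (hsum s f <= b%:E)%E.
Proof.
move=> hb; apply: ge_ereal_sup => _ [A [/finite_seqP[r ->] _] <-].
rewrite (_ : [set` r] = [set` undup r]); last by apply/seteqP; split => k; rewrite /= mem_undup.
rewrite -fsbig_seq ?undup_uniq// sumEFin lee_fin.
rewrite (eq_bigr (fun k => ws s k ^+ 2 * normc2 (fourier f k))); last first.
  by move=> k _; rewrite -sqr_ws normc2E.
pose M := \max_(k <- undup r) maxn `|k.1|%N `|k.2|%N.
apply: le_trans (hb M); rewrite /Ys.
have sub k : k \in undup r -> k \in box M.
  move=> kr; rewrite mem_box -geq_max; by rewrite /M (big_rem k kr)/= leq_maxl.
rewrite [leRHS](bigID (mem (undup r)))/= -[leLHS]addr0; apply: lerD; last first.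
  by apply: sumr_ge0 => k _; rewrite mulr_ge0 ?sqr_ge0// normc2_ge0.
rewrite -[leRHS]big_filter le_eqVlt; apply/orP; left; apply/eqP.
apply: perm_big; apply: uniq_perm; rewrite ?filter_uniq ?undup_uniq ?uniq_box// => k.
by rewrite mem_filter; case: (boolP (k \in undup r)) => //= kr; rewrite sub.
Qed.

Lemma fnormHE s f : fnorm (Hper s) f = (hsum s f `^ 2^-1)%E.
Proof. by []. Qed.

Lemma fnormH_le s (b : R) f : 0 <= b -> (forall M, Ys s M (fourier f) <= b ^+ 2) ->
  (fnorm (Hper s) f <= b%:E)%E.
Proof.
move=> b0 hb; rewrite fnormHE; apply: le_trans (_ : (((b ^+ 2)%:E) `^ 2^-1)%E <= _)%E.
  apply: gt0_ler_poweR => //; last exact: hsum_le.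
    by rewrite in_itv/= hsum_ge0 leey.
  by rewrite in_itv/= lee_fin sqr_ge0 leey.
by rewrite poweR_EFin lee_fin powR12_sqrt ?sqr_ge0// sqrtr_sqr ger0_norm.
Qed.

Lemma HperP s (b : R) f : 0 <= b -> L2per R f -> (forall M, Ys s M (fourier f) <= b ^+ 2) -> Hper s f.
Proof. by move=> b0 Lf hb; split => //; apply: le_lt_trans (fnormH_le b0 hb) _; rewrite ltry. Qed.

Lemma Ys_fnormH s (b : R) M f : (fnorm (Hper s) f <= b%:E)%E -> Ys s M (fourier f) <= b ^+ 2.
Proof.
move=> hb; have b0 : 0 <= b by rewrite -lee_fin; apply: le_trans hb; exact: poweR_ge0.
have Y0 := Ys_ge0 s M (fourier f).
have : ((Ys s M (fourier f))%:E `^ 2^-1 <= b%:E)%E.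
  apply: le_trans hb; rewrite fnormHE; apply: gt0_ler_poweR => //; last exact: Ys_le_hsum.
    by rewrite in_itv/= lee_fin Y0 leey.
  by rewrite in_itv/= hsum_ge0 leey.
rewrite poweR_EFin lee_fin powR12_sqrt// => h.
rewrite -(sqr_sqrtr Y0); apply: lerXn2r => //; rewrite nnegrE ?sqrtr_ge0//.
Qed.

Lemma Hper_Ys s M f : Hper s f -> Ys s M (fourier f) <= fine (fnorm (Hper s) f) ^+ 2.
Proof.
move=> [Lf fin]; apply: Ys_fnormH; rewrite fineK// ge0_fin_numE//; exact: poweR_ge0.
Qed.

Lemma unif_within (T : R) (F : R -> R) : {within `[0, T], continuous F} ->
  forall e : R, 0 < e -> exists2 d : R, 0 < d & forall t r : R, t \in `[0, T] -> r \in `[0, T] ->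
    `|t - r| < d -> `|F t - F r| <= e.
Proof.
move=> cF e e0; have e2 : 0 < e / 2 by lra.
pose P (d x : R) := forall r : R, x \in `[0, T] -> r \in `[0, T] -> `|x - r| < d -> `|F x - F r| <= e.
have /compact_near_coveringP/(_ R (0^'+) P) : compact (`[0, T] : set R) by exact: segment_compact.
move=> /(_ _)[x xT|d /= d0 hd].
  have [d d0 hd] := eps_within cF xT e2.
  have d2 : 0 < d / 2 by lra.
  exists (ball x (d / 2), [set q : R | q < d / 2]); first split => /=.
  - exact: nbhsx_ballx.
  - exact: nbhs_right_lt.
  move=> [y q] /= [xy qd] r yT rT yr.
  have h1 : `|y - x| < d by move: xy; rewrite /ball/= distrC; lra.
  have h2 : `|r - x| < d.
    move: xy yr; rewrite /ball/= !ltr_norml => /andP[a1 a2] /andP[a3 a4]; apply/andP; split; lra.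
  have := hd y yT h1; have := hd r rT h2; rewrite !ler_norml => /andP[a1 a2] /andP[a3 a4].
  by apply/andP; split; lra.
exists (d / 2); first by lra.
move=> t r tT rT tr; apply: (hd (d / 2)) => //=.
- by rewrite sub0r normrN gtr0_norm; lra.
- by lra.
Qed.

End Sobolev.

(** * Simple functions of time with trigonometric polynomials as values *)

Section Bochner.
Context {R : realType}.
Local Notation vol := (@vol R).
Local Notation leb := (@lebesgue_measure R).
Local Notation Rec := (@complex.Re R).
Local Notation Imc := (@complex.Im R).
Local Notation nc := (@Normc.normc R).
Implicit Types (f g h : R * R -> R) (c d : int * int -> R[i]) (k : int * int).

Lemma integrable_add (D : set R) (F G : R -> R) : measurable D -> leb.-integrable D (EFin \o F) ->
  leb.-integrable D (EFin \o G) -> leb.-integrable D (EFin \o (fun t => F t + G t)).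
Proof.
move=> mD iF iG; rewrite (_ : EFin \o _ = (EFin \o F) \+ (EFin \o G))%E; first exact: integrableD.
by apply/funext => t /=; rewrite EFinD.
Qed.

Lemma Rintegral_simple (D : set R) (J : Type) (r : seq J) (A : J -> set R) (v : J -> R) :
  measurable D -> (leb D < +oo)%E -> (forall j, measurable (A j)) ->
  leb.-integrable D (EFin \o (fun t => \sum_(j <- r) \1_(A j) t * v j)) /\
  \int[leb]_(t in D) (\sum_(j <- r) \1_(A j) t * v j) = \sum_(j <- r) fine (leb (A j `&` D)) * v j.
Proof.
move=> mD fD mA.
have iI j : leb.-integrable D (EFin \o \1_(A j)).
  apply/integrableP; split.
    exact: (measurableT_comp (@EFin_measurable R setT) (measurable_indic (mA j))).
  under eq_integral do rewrite /= ger0_norm//.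
  have -> : (\int[leb]_(x in D) (\1_(A j) x)%:E = leb (A j `&` D))%E := integral_indic leb mD (mA j).
  apply: le_lt_trans fD; apply: le_measure; rewrite ?inE//.
  exact: (measurableI (A j) D (mA j) mD).
have iA j : leb.-integrable D (EFin \o (fun t => \1_(A j) t * v j)).
  rewrite (_ : EFin \o _ = fun t => ((v j)%:E * (EFin \o \1_(A j)) t)%E); last first.
    by apply/funext => t /=; rewrite -EFinM mulrC.
  by apply: integrableZl.
elim: r => [|j r [IH1 IH2]].
  under eq_fun do rewrite big_nil; split; first exact: integrable0.
  by rewrite Rintegral_cst// mul0r big_nil.
have E : (fun t => \sum_(i <- j :: r) \1_(A i) t * v i) = (fun t => \1_(A j) t * v j + \sum_(i <- r) \1_(A i) t * v i).
  by apply/funext => t; rewrite big_cons.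
rewrite E; split; first exact: integrable_add.
rewrite RintegralD// IH2 big_cons; congr (_ + _).
under eq_Rintegral do rewrite mulrC.
rewrite RintegralZl//.
rewrite mulrC; congr (_ * _); rewrite /Rintegral; congr fine.
exact: (integral_indic leb mD (mA j)).
Qed.

Lemma lebT (T : R) : 0 < T -> leb (`]0, T[ : set R) = T%:E.
Proof. by move=> T0; rewrite lebesgue_measure_itv/= lte_fin T0 sube0. Qed.

Lemma integrable_oo (T : R) (F : R -> R) : {within `[0, T], continuous F} ->
  leb.-integrable `]0, T[ (EFin \o F).
Proof.
move=> cF; apply: integrableS (integrable_within cF) => // x /=.
by rewrite !in_itv/= => /andP[h1 h2]; rewrite !ltW.
Qed.

Lemma integral_oo (T : R) (F : R -> R) : 0 < T -> {within `[0, T], continuous F} ->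
  \int[leb]_(t in `]0, T[) F t = prim F T.
Proof.
move=> T0 cF; rewrite /prim -Rintegral_itv_obnd_cbnd; last first.
  apply: integrableS (integrable_within cF) => // x /=.
  by rewrite !in_itv/= => /andP[/ltW -> ->].
by rewrite Rintegral_itv_bndo_bndc//; exact: integrable_oo.
Qed.

Lemma simple_prim_dist (T e : R) (F G : R -> R) : 0 < T -> {within `[0, T], continuous F} ->
  leb.-integrable `]0, T[ (EFin \o G) -> (forall t : R, t \in `]0, T[ -> `|G t - F t| <= e) ->
  `|\int[leb]_(t in `]0, T[) G t - prim F T| <= T * e.
Proof.
move=> T0 cF iG GF; rewrite -(integral_oo T0 cF) -RintegralB//; last exact: integrable_oo.
have iB : leb.-integrable `]0, T[ (EFin \o (fun t => G t - F t)).
  rewrite (_ : EFin \o _ = (EFin \o G) \- (EFin \o F))%E; last by apply/funext => t /=; rewrite EFinB.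
  by apply: integrableB => //; exact: integrable_oo.
apply: le_trans (le_normr_Rintegral _ iB) _ => //.
apply: le_trans (_ : \int[leb]_(t in `]0, T[) e <= _).
  apply: le_Rintegral => //.
  - by have := integrable_abse iB.
  - by apply/integrable_oo/within_cst.
rewrite Rintegral_cst//= (_ : fine _ = T); last by rewrite lebT.
by rewrite mulrC.
Qed.

Definition prim_coef (T : R) (z : R -> R[i]) : R[i] :=
  Complex (prim (fun t => Rec (z t)) T) (prim (fun t => Imc (z t)) T).

(** On each time cell the value is the projection of f at its left end. Closeness is measured on the
    finitely many coefficients of the box only, so the same simple functions serve both H^s and L^2,
    and both measurability and integrals. *)
Lemma step_approx (X : fspace R) (T e : R) n (f : R -> R * R -> R) : 0 < T -> 0 < e ->
  (forall c, X (tp (box n) c)) -> (forall t : R, t \in `[0, T] -> L2per R (f t)) ->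
  (forall k, k \in box n -> ccont T (fun t => fourier (f t) k)) ->
  exists (p : simple X) (c : R -> int * int -> R[i]) (C : int * int -> R[i]),
  [/\ forall t : R, t \in `]0, T[ -> [/\ simple_fun p t = tp (box n) (c t), herm (c t) &
        forall k, k \in box n -> nc (c t k - fourier (f t) k) <= e],
      simple_integral `]0, T[ p = tp (box n) C, herm C &
      forall k, k \in box n -> nc (C k - prim_coef T (fun t => fourier (f t) k)) <= 2 * (T * e)].
Proof.
move=> T0 e0 Xtp Lf cf.
have e2 : 0 < e / 2 by lra.
have [d d0 hd] : exists2 d : R, 0 < d & forall k, k \in box n -> forall t r : R, t \in `[0, T] -> r \in `[0, T] ->
    `|t - r| < d -> nc (fourier (f t) k - fourier (f r) k) <= e.
  (* A common modulus of continuity for finitely many modes, by induction on the list. *)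
  have H (s : seq (int * int)) : {subset s <= box n} -> exists2 d : R, 0 < d & forall k, k \in s -> forall t r : R,
      t \in `[0, T] -> r \in `[0, T] -> `|t - r| < d -> nc (fourier (f t) k - fourier (f r) k) <= e.
    elim: s => [|k s IH] sb; first by exists 1.
    have [d1 d10 h1] := IH (fun l ls => sb l (mem_behead (s := k :: s) ls)).
    have [c1 c2] := cf k (sb k (mem_head _ _)).
    have [d2 d20 h2] := unif_within c1 e2; have [d3 d30 h3] := unif_within c2 e2.
    exists (Num.min d1 (Num.min d2 d3)); first by rewrite !lt_min d10 d20.
    move=> l; rewrite inE => /orP[/eqP ->|ls] t r tT rT; rewrite !lt_min => /and3P[q1 q2 q3]; last exact: h1.
    apply: le_trans (nc_le_abs _) _; rewrite !raddfB/=.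
    by have := h2 t r tT rT q2; have := h3 t r tT rT q3; lra.
  exact: H.
pose m := (Num.bound (T / d)).+1.
have m0 : 0 < m%:R :> R by rewrite ltr0n.
pose D := T / m%:R; have D0 : 0 < D by rewrite divr_gt0.
have mD : m%:R * D = T by rewrite mulrC divfK// gt_eqF.
have Dd : D < d.
  rewrite ltr_pdivrMr// mulrC -ltr_pdivrMr//; apply: lt_trans (archi_boundP _) _.
    by rewrite divr_ge0// ltW.
  by rewrite ltr_nat ltnS.
pose A (i : 'I_m) : set R := [set` `[0 + i%:R * D, 0 + i.+1%:R * D[%R].
have mA i : measurable (A i) by exact: measurable_itv.
pose ti (i : 'I_m) : R := i%:R * D.
have tiT i : ti i \in `[0, T].
  rewrite in_itv/= mulr_ge0 ?(ltW D0)//= -mD; apply: ler_wpM2r; first exact: ltW.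
  by rewrite ler_nat ltnW.
pose v i := tp (box n) (fourier (f (ti i))).
pose p := @Simple R X m A v mA (fun i => Xtp (fourier (f (ti i)))).
have idx (t : R) : t \in `]0, T[ -> exists2 j : 'I_m, `|ti j - t| < d & forall i, \1_(A i) t = (i == j)%:R :> R.
  rewrite in_itv/= => /andP[t0 tT].
  have [|j /andP[j1 j2] hj] := @step_index R 0 D t m D0 (ltW t0); first by rewrite add0r mD.
  exists j => //; rewrite add0r in j1; rewrite add0r -natr1 mulrDl mul1r in j2.
  by rewrite ltr_norml /ti; apply/andP; split; lra.
have pick (V : nmodType) (w : 'I_m -> V) j : \sum_i (if i == j then w i else 0) = w j.
  by rewrite (bigD1 j)//= eqxx big1 ?addr0// => i /negPf ->.
have /choice[J hJ] : forall t : R, exists j : 'I_m, t \in `]0, T[ ->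
    `|ti j - t| < d /\ forall i, \1_(A i) t = (i == j)%:R :> R.
  move=> t; case: (boolP (t \in `]0, T[)) => [tT|]; last by exists ord0.
  by have [j h1 h2] := idx t tT; exists j.
pose C k := \sum_i real_complex R (fine (leb (A i `&` `]0, T[))) * fourier (f (ti i)) k.
exists p, (fun t => fourier (f (ti (J t)))), C; split.
- move=> t tT; have [h1 h2] := hJ t tT; split.
  + apply/funext => x; rewrite /simple_fun /=.
    rewrite (eq_bigr (fun i => if i == J t then v i x else 0)) ?pick// => i _.
    by rewrite h2; case: eqP => _; rewrite ?mul1r ?mul0r.
  + by apply: fourier_herm; exact: Lf.
  + by move=> k kn; apply: hd => //; exact: itv_oo_cc.
- apply/funext => x; rewrite /simple_integral/= /tp.
  under eq_bigr do rewrite /v /tp mulr_sumr.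
  rewrite exchange_big/=; apply: eq_bigr => k _.
  rewrite /C Rec_sum Imc_sum !mulr_suml -sumrB; apply: eq_bigr => i _.
  by rewrite /leb1 !(RecM, ImcM)/=; ring.
- move=> k; rewrite /C !Rec_sum !Imc_sum; split; last rewrite -sumrN; apply: eq_bigr => i _;
    have [h1 h2] := fourier_herm (Lf (ti i) (tiT i)) k; rewrite ?RecM ?ImcM h1 h2 /=; ring.
- move=> k kn; have [c1 c2] := cf k kn.
  have fT : (leb (`]0%R, T[ : set R) < +oo)%E by rewrite lebT// ltry.
  have H (w : R[i] -> R) : {within `[0, T], continuous (fun t => w (fourier (f t) k))} ->
      (forall a b : R[i], `|w a - w b| <= nc (a - b)) ->
      `|\sum_i fine (leb (A i `&` `]0, T[)) * w (fourier (f (ti i)) k) - prim (fun t => w (fourier (f t) k)) T| <= T * e.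
    move=> cw wl.
    have [i1 <-] := @Rintegral_simple `]0, T[%classic _ (index_enum 'I_m) A (fun i => w (fourier (f (ti i)) k)) (measurable_itv _) fT mA.
    apply: simple_prim_dist => // t tT; have [h1 h2] := hJ t tT.
    rewrite (eq_bigr (fun i => if i == J t then w (fourier (f (ti i)) k) else 0)) ?pick; last first.
      by move=> i _; rewrite h2; case: eqP => _; rewrite ?mul1r ?mul0r.
    by apply: le_trans (wl _ _) _; apply: hd => //; exact: itv_oo_cc.
  have w1 (a b : R[i]) : `|Rec a - Rec b| <= nc (a - b) by rewrite -raddfB; exact: abs_Re_le.
  have w2 (a b : R[i]) : `|Imc a - Imc b| <= nc (a - b) by rewrite -raddfB; exact: abs_Im_le.
  apply: le_trans (nc_le_abs _) _; rewrite !raddfB/=.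
  move: (H _ c1 w1) (H _ c2 w2).
  have -> : \sum_i fine (leb (A i `&` `]0, T[)) * Rec (fourier (f (ti i)) k) = Rec (C k).
    by rewrite /C Rec_sum; apply: eq_bigr => i _; rewrite RecM/=; ring.
  have -> : \sum_i fine (leb (A i `&` `]0, T[)) * Imc (fourier (f (ti i)) k) = Imc (C k).
    by rewrite /C Imc_sum; apply: eq_bigr => i _; rewrite ImcM/=; ring.
  by move=> h1 h2; apply: le_trans (lerD h1 h2) _; rewrite mulr_natl mulr2n.
Qed.

End Bochner.

(** * Strong measurability and Bochner integrals of trajectories *)

Section Measurability.
Context {R : realType}.
Local Notation vol := (@vol R).
Local Notation leb := (@lebesgue_measure R).
Local Notation Rec := (@complex.Re R).
Local Notation Imc := (@complex.Im R).
Local Notation nc := (@Normc.normc R).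
Implicit Types (f g h : R * R -> R) (c d : int * int -> R[i]) (k : int * int).

Definition Yl (s : R) f : R := limn (fun n => Ys s n (fourier f)).

Lemma Yl_spec (s B : R) f : (forall M, Ys s M (fourier f) <= B) ->
  [/\ Ys s n (fourier f) @[n --> \oo] --> Yl s f, forall M, Ys s M (fourier f) <= Yl s f & Yl s f <= B].
Proof.
move=> hB.
have nd : nondecreasing_seq (fun n => Ys s n (fourier f)) by move=> n m; exact: Ys_nd.
have ub : has_ubound (range (fun n => Ys s n (fourier f))).
  by exists B => _ [n _ <-]; exact: hB.
have ic := nondecreasing_is_cvgn nd ub.
by split => [//|M|]; [exact: nondecreasing_cvgn_le|apply: limr_le => //; exact: nearW].
Qed.

Lemma approx_coef (s e b : R) n f c : L2per R f -> herm c -> 0 <= e ->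
  (forall k, k \in box n -> nc (c k - fourier f k) <= e) -> (forall M, Ys s M (fourier f) <= b) ->
  forall M, Ys s M (fourier (fun x => tp (box n) c x - f x)) <=
    (\sum_(k <- box n) ws s k ^+ 2) * e ^+ 2 + (b - Ys s n (fourier f)).
Proof.
move=> Lf hc e0 hce hb M.
apply: le_trans (Ys_nd s _ (leq_maxl M n)) _; set P := maxn M n.
pose G k := if k \in box n then ws s k ^+ 2 * e ^+ 2 - ws s k ^+ 2 * normc2 (fourier f k) else 0.
apply: le_trans (_ : \sum_(k <- box P) (G k + ws s k ^+ 2 * normc2 (fourier f k)) <= _).
  apply: ler_sum => k _; rewrite fourierB//; last exact: L2_tp.
  rewrite fourier_tp// /G; case: ifPn => kn.
    rewrite subrK; apply: ler_wpM2l; first exact: sqr_ge0.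
    by rewrite -normc2E; apply: lerXn2r; rewrite ?nnegrE ?normc_ge0// hce.
  rewrite add0r; move: (fourier f k) => [u v].
  by rewrite /normc2 /= !add0r !sqrrN.
rewrite big_split/= (sum_box_widen (N := n)) ?leq_maxr//; last by move=> k _ kn; rewrite /G (negPf kn).
have -> : \sum_(k <- box n) G k = (\sum_(k <- box n) ws s k ^+ 2) * e ^+ 2 - Ys s n (fourier f).
  rewrite mulr_suml -sumrB big_seq [RHS]big_seq; apply: eq_bigr => k kn.
  by rewrite /G kn.
by have := hb P; rewrite /Ys; lra.
Qed.

(** The tolerance on single coefficients for which the weighted square error over the box n is at
    most a^2 / (n + 1) when each error is below a times it. *)
Definition en (s : R) n : R := (n.+1%:R * (1 + \sum_(k <- box n) ws s k ^+ 2))^-1.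

Lemma en_gt0 s n : 0 < en s n.
Proof.
rewrite invr_gt0 mulr_gt0 ?ltr0n// ltr_pwDl// sumr_ge0// => k _; exact: sqr_ge0.
Qed.

Lemma en_small (s a : R) n : (\sum_(k <- box n) ws s k ^+ 2) * (a * en s n) ^+ 2 <= a ^+ 2 * n.+1%:R^-1.
Proof.
rewrite exprMn mulrCA; apply: ler_wpM2l; first exact: sqr_ge0.
rewrite /en; set S := \sum_(k <- box n) _.
have S0 : 0 <= S by apply: sumr_ge0 => k _; exact: sqr_ge0.
have n1 : 1 <= n.+1%:R :> R by rewrite ler1n.
rewrite exprVn ler_pdivrMr ?exprn_gt0 ?mulr_gt0//; try by lra.
rewrite exprMn [n.+1%:R ^+ 2]expr2 !mulrA mulVf ?mul1r; last by rewrite gt_eqF//; lra.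
have h : 0 <= (n.+1%:R - 1) * (1 + S) ^+ 2 by rewrite mulr_ge0 ?sqr_ge0//; lra.
nra.
Qed.

(** A bound for the square of the H^s distance from f to its n-th approximation: coefficient errors
    inside the box plus the tail of f. The scale a is 1 for values and 2 T for integrals. *)
Definition qn (s a : R) n f : R := a ^+ 2 * n.+1%:R^-1 + (Yl s f - Ys s n (fourier f)).

Lemma approx_qn (s a B : R) n f c : L2per R f -> herm c -> 0 <= a ->
  (forall k, k \in box n -> nc (c k - fourier f k) <= a * en s n) ->
  (forall M, Ys s M (fourier f) <= B) ->
  forall M, Ys s M (fourier (fun x => tp (box n) c x - f x)) <= qn s a n f.
Proof.
move=> Lf hc a0 hce hB M; have [_ h2 _] := Yl_spec hB.
apply: le_trans (approx_coef Lf hc (mulr_ge0 a0 (ltW (en_gt0 s n))) hce h2 M) _.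
by rewrite lerD2r en_small.
Qed.

Lemma qn_ge0 (s a B : R) n f : (forall M, Ys s M (fourier f) <= B) -> 0 <= qn s a n f.
Proof.
move=> hB; have [_ h2 _] := Yl_spec hB.
apply: addr_ge0; last by rewrite subr_ge0.
by apply: mulr_ge0; [exact: sqr_ge0|rewrite invr_ge0].
Qed.

Lemma qn_cvg (s a B : R) f : (forall M, Ys s M (fourier f) <= B) -> qn s a n f @[n --> \oo] --> 0.
Proof.
move=> hB; have [h1 _ _] := Yl_spec hB.
rewrite -[X in _ --> X](_ : a ^+ 2 * 0 + (Yl s f - Yl s f) = 0); last by rewrite mulr0 subrr addr0.
apply: cvgD; last by apply: cvgB => //; exact: cvg_cst.
by apply: cvgM; [exact: cvg_cst|exact: cvg_harmonic].
Qed.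

Lemma sqrt_cvg0 (u : nat -> R) : u n @[n --> \oo] --> 0 -> (Num.sqrt (u n))%:E @[n --> \oo] --> 0%E.
Proof.
move=> u0; apply: cvg_EFin0; rewrite -[X in _ --> X]sqrtr0.
by apply: continuous_cvg => //; exact: sqrt_continuous.
Qed.

Lemma squeeze0 (u : nat -> \bar R) (v : nat -> \bar R) : (forall n, 0 <= u n <= v n)%E ->
  v n @[n --> \oo] --> 0%E -> u n @[n --> \oo] --> 0%E.
Proof. by move=> h v0; apply: squeeze_cvge (cvg_cst _) v0; exact: nearW. Qed.

Lemma Hper_tp (s : R) n c : Hper s (tp (box n) c).
Proof.
have tt := trig_poly_tp n c.
apply: (HperP (b := Num.sqrt (Ys s n (fourier (tp (box n) c))))); first exact: sqrtr_ge0.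
  exact: L2_tp.
by move=> M; rewrite sqr_sqrtr ?Ys_ge0//; exact: Ys_trig tt (lexx _).
Qed.

Lemma strong_hper (s B T : R) (f : R -> R * R -> R) : 0 < T ->
  (forall t : R, t \in `[0, T] -> L2per R (f t) /\ forall M, Ys s M (fourier (f t)) <= B) ->
  (forall k, ccont T (fun t => fourier (f t) k)) -> strongly_measurable (Hper s) `]0, T[ f.
Proof.
move=> T0 hf cf.
have /choice[p hp] : forall n, exists p : simple (Hper s), forall t : R, t \in `]0, T[ ->
    exists c, [/\ simple_fun p t = tp (box n) c, herm c &
      forall k, k \in box n -> nc (c k - fourier (f t) k) <= 1 * en s n].
  move=> n; have [p [c [C [h1 _ _ _]]]] := step_approx (X := Hper s) T0 (en_gt0 s n) (@Hper_tp s n)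
    (fun t tT => (hf t tT).1) (fun k _ => cf k).
  by exists p => t tT; exists (c t); rewrite mul1r; exact: h1.
exists p; apply: aeW => t tT; have [Lf Yf] := hf t (itv_oo_cc tT).
have B0 : 0 <= B := le_trans (Ys_ge0 _ _ _) (Yf 0%N).
split; first by apply: (HperP (b := Num.sqrt B)) => // M; rewrite sqr_sqrtr.
apply: (squeeze0 (v := fun n => (Num.sqrt (qn s 1 n (f t)))%:E)); last exact: sqrt_cvg0 (qn_cvg 1 Yf).
move=> n; have [c [-> hc hce]] := hp n t tT; apply/andP; split; first exact: poweR_ge0.
apply: fnormH_le => [|M]; first exact: sqrtr_ge0.
by rewrite sqr_sqrtr ?(qn_ge0 _ _ Yf)//; exact: approx_qn Lf hc ler01 hce Yf M.
Qed.

Lemma Ys0 M c : Ys 0 M c = hnrm c M.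
Proof. by apply: eq_bigr => k _; rewrite ws0 expr1n mul1r. Qed.

Lemma L2_qn (a : R) n f c : L2per R f -> herm c -> 0 <= a ->
  (forall k, k \in box n -> nc (c k - fourier f k) <= a * en 0 n) ->
  nrm2 (fun x => tp (box n) c x - f x) <= Num.sqrt (vol * qn 0 a n f).
Proof.
move=> Lf hc a0 hce.
have hB M : Ys 0 M (fourier f) <= vol^-1 * nrm2 f ^+ 2 by rewrite Ys0; exact: hnrm_fourier.
have q0 := qn_ge0 a n hB; have v0 := ltW (@vol_gt0 R).
rewrite -[leLHS]ger0_norm ?nrm2_ge0// -sqrtr_sqr ler_wsqrtr//.
apply: Parseval_le => [|M]; first by apply: L2B => //; exact: L2_tp.
by rewrite -Ys0; apply: ler_wpM2l => //; exact: approx_qn hce hB M.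
Qed.

Lemma fnorm_simple_le (a : R) (p : simple (L2per R)) n f (t : R) c :
  L2per R f -> simple_fun p t = tp (box n) c -> herm c -> 0 <= a ->
  (forall k, k \in box n -> nc (c k - fourier f k) <= a * en 0 n) ->
  (fnorm (L2per R) (simple_fun p t \- f)%R <= (Num.sqrt (vol * qn 0 a n f))%:E)%E.
Proof.
move=> Lf pE hc a0 hce; rewrite pE -[_ \- _]/(fun x => tp (box n) c x - f x) fnorm_L2E.
  by rewrite lee_fin; exact: L2_qn.
by apply: L2B => //; exact: L2_tp.
Qed.

Lemma L2_bounded_Ys (K : R) f : L2per R f -> nrm2 f <= K ->
  forall M, Ys 0 M (fourier f) <= vol^-1 * K ^+ 2.
Proof.
move=> Lf fK M; rewrite Ys0; apply: le_trans (hnrm_fourier M Lf) _.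
apply: ler_wpM2l; first by rewrite invr_ge0 ltW// vol_gt0.
by apply: lerXn2r; rewrite ?nnegrE ?nrm2_ge0// (le_trans (nrm2_ge0 _) fK).
Qed.

Lemma fnorm_L2_ge0 f : (0 <= fnorm (L2per R) f)%E.
Proof. exact: Lnorm_ge0. Qed.

(** Coefficients determine the integral: the integrals of the simple functions have coefficients
    close to those of I, so they converge to I in L^2 by the estimate used for the values. *)
Lemma bochner_coef (T K : R) (f : R -> R * R -> R) I : 0 < T ->
  (forall t : R, t \in `[0, T] -> L2per R (f t) /\ nrm2 (f t) <= K) ->
  (forall k, ccont T (fun t => fourier (f t) k)) -> L2per R I ->
  (forall k, fourier I k = prim_coef T (fun t => fourier (f t) k)) ->
  is_bochner_integral (L2per R) `]0, T[ f I.
Proof.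
move=> T0 hf cf LI hI.
have Yf (t : R) : t \in `[0, T] -> forall M, Ys 0 M (fourier (f t)) <= vol^-1 * K ^+ 2.
  by move=> tT; have [Lt Kt] := hf t tT; exact: L2_bounded_Ys.
have v0 := @vol_gt0 R.
have /choice[p hp] : forall n, exists p : simple (L2per R),
    (forall t : R, t \in `]0, T[ -> exists c, [/\ simple_fun p t = tp (box n) c, herm c &
      forall k, k \in box n -> nc (c k - fourier (f t) k) <= 1 * en 0 n]) /\
    exists C, [/\ simple_integral `]0, T[ p = tp (box n) C, herm C &
      forall k, k \in box n -> nc (C k - fourier I k) <= 2 * T * en 0 n].
  move=> n; have [p [c [C [h1 h2 h3 h4]]]] := step_approx (X := L2per R) T0 (en_gt0 0 n) (fun c => L2_tp (box n) c)
    (fun t tT => (hf t tT).1) (fun k _ => cf k).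
  exists p; split; first by move=> t tT; exists (c t); rewrite mul1r; exact: h1.
  by exists C; split => // k kn; rewrite hI -mulrA; exact: h4.
have le (t : R) n : t \in `]0, T[ -> (fnorm (L2per R) (simple_fun (p n) t \- f t)%R <=
    (Num.sqrt (vol * qn 0 1 n (f t)))%:E)%E.
  move=> tT; have [Lt _] := hf t (itv_oo_cc tT); have [c [h1 h2 h3]] := (hp n).1 t tT.
  exact: fnorm_simple_le Lt h1 h2 ler01 h3.
have q0 (t : R) : t \in `]0, T[ -> (Num.sqrt (vol * qn 0 1 n (f t)))%:E @[n --> \oo] --> 0%E.
  move=> tT; apply: sqrt_cvg0; rewrite -[X in _ --> X](mulr0 vol).
  by apply: cvgM; [exact: cvg_cst|exact: qn_cvg (Yf t (itv_oo_cc tT))].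
split => //.
  exists p; apply: aeW => t tT; have [Lt _] := hf t (itv_oo_cc tT); split => //.
  apply: squeeze0 (q0 t tT) => n; apply/andP; split; [exact: fnorm_L2_ge0|exact: le].
exists p; split.
  pose D : set R := [set` `]0%R, T[].
  have mD : measurable D by exact: measurable_itv.
  have mY n : measurable_fun D (fun t => Ys 0 n (fourier (f t))).
    have : {within `[0%R, T], continuous (fun t => Ys 0 n (fourier (f t)))}.
      by apply: within_sum => k; apply: within_M; [exact: within_cst|exact: within_normc2].
    move=> cY; have := subspace_continuous_measurable_fun (measurable_itv `[0%R, T]) cY.
    by apply: measurable_funS => // x; exact: itv_oo_cc.
  have mYl : measurable_fun D (fun t => Yl 0 (f t)).
    apply: measurable_fun_cvg mY _ => t tT.
    by have [] := Yl_spec (Yf t (itv_oo_cc tT)).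
  (* Dominated convergence is applied to this majorant, measurable as a limit expression in
     continuous coefficients; the integral of the norm is then squeezed by monotonicity. *)
  pose H n (t : R) := (Num.sqrt (vol * qn 0 1 n (f t)))%:E.
  have mH n : measurable_fun D (H n).
    apply: measurableT_comp => //; apply: measurableT_comp.
      by apply: continuous_measurable_fun; exact: sqrt_continuous.
    apply: measurable_funM => //; apply: measurable_funD => //.
    exact: measurable_funB.
  pose B := Num.sqrt (vol * (1 + vol^-1 * K ^+ 2)).
  have HB n (t : R) : t \in `]0, T[ -> Num.sqrt (vol * qn 0 1 n (f t)) <= B.
    move=> tT; apply: ler_wsqrtr; apply: ler_wpM2l; first exact: ltW.
    rewrite /qn expr1n mul1r; apply: lerD.
      by rewrite invf_le1 ?ltr0n// ler1n.
    have [_ _ h] := Yl_spec (Yf t (itv_oo_cc tT)).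
    by apply: le_trans h; rewrite gerBl Ys_ge0.
  have fD : (leb D < +oo)%E by rewrite /D lebT// ltry.
  have [||||_ H1 _] := @dominated_convergence _ _ R leb D mD H (cst 0%E) (cst B%:E) mH.
  - exact: measurable_cst.
  - by apply: aeW => t tT; exact: q0.
  - apply/integrableP; split; first exact: measurable_cst.
    by rewrite /= integral_cst//= lte_mul_pinfty ?lee_fin.
  - apply: aeW => t n tT; rewrite /H /= lee_fin ger0_norm ?sqrtr_ge0//; exact: HB.
  apply: squeeze0 H1 => n; apply/andP; split.
    by apply: integral_ge0 => t _; exact: fnorm_L2_ge0.
  apply: ge0_integral_mono => t tT; first exact: fnorm_L2_ge0.
  by rewrite sube0 gee0_abs; [exact: le|rewrite lee_fin sqrtr_ge0].
have YI := L2_bounded_Ys LI (lexx _).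
apply: (squeeze0 (v := fun n => (Num.sqrt (vol * qn 0 (2 * T) n I))%:E)); last first.
  apply: sqrt_cvg0; rewrite -[X in _ --> X](mulr0 vol).
  by apply: cvgM; [exact: cvg_cst|exact: qn_cvg YI].
move=> n; have [C [h1 h2 h3]] := (hp n).2; apply/andP; split; first exact: fnorm_L2_ge0.
rewrite h1 -[_ \- _]/(fun x => tp (box n) C x - I x) fnorm_L2E.
  by rewrite lee_fin; apply: L2_qn => //; rewrite mulr_ge0// ltW.
by apply: L2B => //; exact: L2_tp.
Qed.

End Measurability.

(** * Strong solutions *)

Section StrongSolution.
Context {R : realType}.
Local Notation vol := (@vol R).
Local Notation Om := (@Omega R).
Local Notation leb := (@lebesgue_measure R).
Local Notation Rec := (@complex.Re R).
Local Notation Imc := (@complex.Im R).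
Local Notation nc := (@Normc.normc R).
Implicit Types (f g h : R * R -> R) (c d : int * int -> R[i]) (k : int * int).

Lemma synth_mult (s B : R) (m : int * int -> R[i]) f : (forall k, nc (m k) <= ws s k) ->
  herm (fun k => m k * fourier f k) -> (forall M, Ys s M (fourier f) <= B) ->
  exists g, [/\ L2per R g, forall k, fourier g k = m k * fourier f k & nrm2 g <= Num.sqrt (vol * B)].
Proof.
move=> hm hh hB.
have hn N : hnrm (fun k => m k * fourier f k) N <= B.
  apply: le_trans (hB N); apply: ler_sum => k _; rewrite -!normc2E Normc.normcM exprMn.
  apply: ler_wpM2r; first exact: sqr_ge0.
  by apply: lerXn2r; rewrite ?nnegrE ?normc_ge0// ltW// ws_gt0.
have [g [Lg gE]] := synth hh hn; exists g; split => //.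
rewrite -[leLHS]ger0_norm ?nrm2_ge0// -sqrtr_sqr ler_wsqrtr//; apply: Parseval_le => // N.
apply: ler_wpM2l; first exact: ltW (@vol_gt0 R).
by rewrite (_ : fourier g = (fun k => m k * fourier f k)) //; apply/funext.
Qed.

Lemma nc_ik k : nc (ik k) <= bra k :> R.
Proof. by rewrite /= expr0n /= add0r sqrtr_sqr; exact: abs1_bra. Qed.

Lemma lapm_le alpha k : 0 <= alpha -> lapm alpha k <= ws alpha k :> R.
Proof.
move=> a0; apply: ge0_ler_powR => //; rewrite ?nnegrE ?sqrtr_ge0// ?(ltW (bra_gt0 k))//.
by rewrite ler_wsqrtr// lerDr.
Qed.

Lemma nc_lapm alpha k : nc (real_complex R (lapm alpha k)) = lapm alpha k.
Proof. by rewrite /= expr0n /= addr0 sqrtr_sqr ger0_norm// powR_ge0. Qed.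

(** The condition 1 + alpha <= s puts the dispersive term in L^2, and the pointwise bound S does so
    for the product of f with its derivative. *)
Lemma fzk_rhs (alpha s S B : R) f : 0 <= alpha -> 1 + alpha <= s -> L2per R f ->
  (forall x, `|f x| <= S) -> (forall M, Ys s M (fourier f) <= B) ->
  exists g, [/\ L2per R g, forall k, fourier g k = rhs alpha f k,
    nrm2 g <= (1 + S) * Num.sqrt (vol * B) & fzk_equation alpha f g].
Proof.
move=> a0 as_ Lf fS fB.
have S0 : 0 <= S by apply: le_trans (fS (0, 0)).
have hf := fourier_herm Lf.
have [Lu [L1 F1 _]] : exists g, [/\ L2per R g, forall k, fourier g k = real_complex R (lapm alpha k) * fourier f k &
    nrm2 g <= Num.sqrt (vol * B)].
  apply: (synth_mult _ _ fB); last by apply: herm_mul => //; exact: lapmN.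
  move=> k; rewrite nc_lapm; apply: le_trans (lapm_le k a0) _; apply: le_ws; lra.
have [dLu [L2 F2 N2]] : exists g, [/\ L2per R g, forall k, fourier g k = ik k * real_complex R (lapm alpha k) * fourier f k &
    nrm2 g <= Num.sqrt (vol * B)].
  apply: (synth_mult _ _ fB).
    move=> k; rewrite Normc.normcM nc_lapm; apply: le_trans (_ : ws (1 + alpha) k <= _); last exact: le_ws.
    rewrite wsD ws1; apply: ler_pM; rewrite ?normc_ge0 ?powR_ge0 ?nc_ik ?lapm_le//.
  rewrite (_ : (fun k => _) = (fun k => ik k * (real_complex R (lapm alpha k) * fourier f k))); last first.
    by apply/funext => k; rewrite mulrA.
  by apply: herm_ik; apply: herm_mul => //; exact: lapmN.
have [du [L3 F3 N3]] : exists g, [/\ L2per R g, forall k, fourier g k = ik k * fourier f k &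
    nrm2 g <= Num.sqrt (vol * B)].
  apply: (synth_mult _ _ fB); last exact: herm_ik.
  by move=> k; apply: le_trans (nc_ik k) _; rewrite -ws1; apply: le_ws; lra.
have L4 : L2per R (fun x => f x * du x).
  rewrite (_ : (fun x => _) = (fun x => du x * f x)); last by apply/funext => x; rewrite mulrC.
  exact: L2M_bounded L3 (measurable_L2 Lf) (fun x _ => fS x).
exists (fun x => dLu x - f x * du x); split.
- exact: L2B.
- by move=> k; rewrite fourierB// F2 fourier_convection// /rhs (mulrA (ik k) (real_complex R (lapm alpha k))).
- apply: le_trans (nrm2B L2 L4) _; rewrite mulrDl mul1r; apply: lerD => //.
  apply: le_trans (_ : nrm2 (fun x => S * du x) <= _).
    apply: nrm2_le => //; first exact: L2Z.
    by move=> x _; rewrite !normrM (ger0_norm S0) ler_wpM2r.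
  by rewrite nrm2Z// (ger0_norm S0) ler_wpM2l.
- exists Lu, dLu, du; split.
  + exact: fourier_frac_lap.
  + by apply: fourier_weak_partial1 => // k; rewrite F2 F1 mulrA.
  + exact: fourier_weak_partial1.
  + by apply: aeW => x _; ring.
Qed.

Lemma primD (T : R) (F G : R -> R) : {within `[0, T], continuous F} -> {within `[0, T], continuous G} ->
  prim (fun t => F t + G t) T = prim F T + prim G T.
Proof. by move=> cF cG; rewrite /prim RintegralD//; exact: integrable_within. Qed.

Lemma primN (T : R) (F : R -> R) : {within `[0, T], continuous F} -> prim (fun t => - F t) T = - prim F T.
Proof.
move=> cF; rewrite /prim -mulN1r -RintegralZl//; last exact: integrable_within.
by apply: eq_Rintegral => t _; rewrite mulN1r.
Qed.

Lemma eq_prim (T : R) (F G : R -> R) : (forall t : R, t \in `[0, T] -> F t = G t) -> prim F T = prim G T.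
Proof. by move=> FG; apply: eq_Rintegral => t; rewrite inE; exact: FG. Qed.

Lemma prim_parts (T : R) (p q F G : R -> R) : 0 < T ->
  {within `[0, T], continuous p} -> {within `[0, T], continuous q} ->
  {within `[0, T], continuous F} -> {within `[0, T], continuous G} ->
  (forall t : R, t \in `]0, T[ -> is_derive t (1 : R) p (q t)) ->
  (forall t : R, t \in `]0, T[ -> is_derive t (1 : R) F (G t)) ->
  prim (fun t => q t * F t) T + prim (fun t => p t * G t) T = p T * F T - p 0 * F 0.
Proof.
move=> T0 cp cq cF cG dp dF.
have c1 : {within `[0, T], continuous (fun t => q t * F t + p t * G t)}.
  by apply: within_D; exact: within_M.
have z0 : (0 : R) \in `[0, T] by rewrite in_itv/= lexx ltW.
have zT : T \in `[0, T] by rewrite in_itv/= lexx ltW.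
pose D t := prim (fun t => q t * F t + p t * G t) t - p t * F t.
have dD (t : R) : t \in `]0, T[ -> is_derive t (1 : R) D 0.
  move=> tT; have := derive_B (prim_derive c1 tT) (derive_M (dp t tT) (dF t tT)).
  by move/is_derive_eq; apply; ring.
have cD : {within `[0, T], continuous D}.
  by apply: within_B; [exact: prim_cont|exact: within_M].
have n0 (x : R) : x \in `]0, T[ -> `|0 : R| <= 0 by rewrite normr0.
have := lipschitz_itv dD cD n0 zT z0.
rewrite mul0r normr_le0 subr_eq0 => /eqP; rewrite /D prim0 primD; [|exact: within_M|exact: within_M].
lra.
Qed.

(** The time integrals e of the coefficients must be square summable. The function J, the primitive
    of the pairing of e with f t, ends at E = |e|^2, while its derivative is at most (E / T + T F) /
    2; hence E <= (E + T^2 F) / 2, where E is absorbed. *)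
Lemma prim_exists (T K : R) (f : R -> R * R -> R) : 0 < T ->
  (forall t : R, t \in `[0, T] -> L2per R (f t) /\ nrm2 (f t) <= K) ->
  (forall k, ccont T (fun t => fourier (f t) k)) ->
  exists I, L2per R I /\ forall k, fourier I k = prim_coef T (fun t => fourier (f t) k).
Proof.
have aux (x y : R) : x <= 2^-1 * (x + y) -> x <= y by lra.
move=> T0 hf cf; pose e k := prim_coef T (fun t => fourier (f t) k).
have he : herm e.
  move=> k; have [c1 c2] := cf k; rewrite /e /prim_coef /=; split.
    by apply: eq_prim => t tT; have [] := fourier_herm (hf t tT).1 k.
  by rewrite -primN//; apply: eq_prim => t tT; have [] := fourier_herm (hf t tT).1 k.
have z0 : (0 : R) \in `[0, T] by rewrite in_itv/= lexx ltW.
pose F := vol^-1 * K ^+ 2.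
have F0 : 0 <= F by rewrite mulr_ge0 ?sqr_ge0// invr_ge0 ltW// vol_gt0.
suff : forall N, hnrm e N <= T ^+ 2 * F by exact: synth.
move=> N; set E := hnrm e N.
pose J t := \sum_(k <- box N) (Rec (e k) * prim (fun t => Rec (fourier (f t) k)) t + Imc (e k) * prim (fun t => Imc (fourier (f t) k)) t).
pose dJ t := \sum_(k <- box N) cdot (e k) (fourier (f t) k).
have dJJ (t : R) : t \in `]0, T[ -> is_derive t (1 : R) J (dJ t).
  move=> tT; apply: derive_sum_seq => k kN; have [c1 c2] := cf k.
  by apply: derive_D; apply: derive_Z; exact: prim_derive.
have cJ : {within `[0, T], continuous J}.
  apply: within_sum => k; have [c1 c2] := cf k.
  by apply: within_D; apply: within_M; try exact: within_cst; exact: prim_cont.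
have bJ (t : R) : t \in `]0, T[ -> `|dJ t| <= 2^-1 * (E / T + T * F).
  move=> tT; have [Lt Kt] := hf t (itv_oo_cc tT).
  apply: le_trans (ler_norm_sum _ _ _) _.
  apply: le_trans (_ : \sum_(k <- box N) 2^-1 * (normc2 (e k) / T + T * normc2 (fourier (f t) k)) <= _).
    apply: ler_sum => k _; apply: le_trans (abs_cdot_le _ _) _; rewrite -!normc2E.
    have := sqr_ge0 (nc (e k) / T - nc (fourier (f t) k)).
    move: (nc (e k)) (nc (fourier (f t) k)) => a b h.
    have -> : a ^+ 2 / T = T * (a / T) ^+ 2 by field; rewrite gt_eqF.
    have -> : a * b = T * (a / T * b) by field; rewrite gt_eqF.
    have := mulr_ge0 (ltW T0) h; move: (a / T) => q; clear; lra.
  rewrite -mulr_sumr big_split/= -mulr_suml -mulr_sumr; apply: ler_wpM2l => //.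
  rewrite lerD2l; apply: ler_wpM2l; first exact: ltW.
  by have := L2_bounded_Ys Lt Kt N; rewrite Ys0.
have := mean_value_le (ltW T0) dJJ cJ bJ; rewrite subr0.
have -> : J 0 = 0 by rewrite /J big1// => k _; rewrite !prim0 !mulr0 addr0.
have -> : J T = E by apply: eq_bigr => k _; rewrite /normc2 !expr2.
rewrite subr0 => /(le_trans (ler_norm _)).
have -> : 2^-1 * (E / T + T * F) * T = 2^-1 * (E + T ^+ 2 * F) by field; rewrite gt_eqF.
exact: aux.
Qed.

Lemma within_bounded (T : R) (F : R -> R) : {within `[0, T], continuous F} ->
  exists M : R, forall t : R, t \in `[0, T] -> `|F t| <= M.
Proof.
move=> cF; have /compact_bounded [M [_ HM]] : compact (F @` `[0, T]).
  by apply: continuous_compact => //; exact: segment_compact.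
by exists (M + 1) => t tT; apply: HM; [rewrite ltrDl|exists t].
Qed.

Lemma derive1n_cont (phi : R -> R) n : (forall n t, derivable (derive1n n phi) t 1) ->
  continuous (derive1n n phi).
Proof. by move=> h t; apply: differentiable_continuous; apply/derivable1_diffP; exact: h. Qed.

Lemma test_functionP (T : R) phi : 0 < T -> test_function T phi ->
  [/\ continuous phi, continuous (derive1 phi), forall t : R, is_derive t (1 : R) phi (derive1 phi t),
    phi 0 = 0 & phi T = 0].
Proof.
move=> T0 [dphi [a [b [a0 bT supp]]]]; split.
- exact: (derive1n_cont (n := 0)).
- exact: (derive1n_cont (n := 1)).
- by move=> t; rewrite derive1E; apply: derivableP; exact: (dphi 0%N t).
- by apply: supp; rewrite in_itv/= leNgt a0.
- by apply: supp; rewrite in_itv/= negb_and orbC -ltNge bT.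
Qed.

Lemma scaled_traj (T K : R) (phi : R -> R) (f : R -> R * R -> R) : continuous phi ->
  (forall t : R, t \in `[0, T] -> L2per R (f t) /\ nrm2 (f t) <= K) ->
  (forall k, ccont T (fun t => fourier (f t) k)) ->
  exists K', (forall t : R, t \in `[0, T] -> L2per R (fun x => phi t * f t x) /\
      nrm2 (fun x => phi t * f t x) <= K') /\
    forall k, ccont T (fun t => fourier (fun x => phi t * f t x) k) /\
      prim_coef T (fun t => fourier (fun x => phi t * f t x) k) =
      Complex (prim (fun t => phi t * Rec (fourier (f t) k)) T) (prim (fun t => phi t * Imc (fourier (f t) k)) T).
Proof.
move=> cphi hf cf; have [M hM] := within_bounded (within_cont (A := `[0, T]) cphi).
have E (t : R) k : t \in `[0, T] -> fourier (fun x => phi t * f t x) k = real_complex R (phi t) * fourier (f t) k.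
  by move=> tT; rewrite fourierZ//; exact: (hf t tT).1.
have ER (t : R) k : t \in `[0, T] -> Rec (fourier (fun x => phi t * f t x) k) = phi t * Rec (fourier (f t) k).
  by move=> tT; rewrite E// RecM mul0r subr0.
have EI (t : R) k : t \in `[0, T] -> Imc (fourier (fun x => phi t * f t x) k) = phi t * Imc (fourier (f t) k).
  by move=> tT; rewrite E// ImcM mul0r addr0.
exists (M * K); split.
  move=> t tT; have [Lt Kt] := hf t tT; split; first exact: L2Z.
  by rewrite nrm2Z//; apply: ler_pM; rewrite ?nrm2_ge0 ?hM.
move=> k; have [c1 c2] := cf k; split.
  split; first by apply: within_ext (within_M (within_cont cphi) c1) => t tT; rewrite ER.
  by apply: within_ext (within_M (within_cont cphi) c2) => t tT; rewrite EI.
by congr Complex; apply: eq_prim => t tT; [exact: ER|exact: EI].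
Qed.

Lemma L2cont_repr (T : R) (u : R -> R * R -> R) :
  (forall t : R, t \in `[0, T] -> L2per R (u t)) -> L2cont T u -> continuous_repr T (L2per R) u u.
Proof.
move=> Lu cu; split => //; last by apply: aeW => t _; apply: aeW.
move=> t tT; apply/fine_cvgP; split.
  rewrite near_withinE; apply: nearW => r rT.
  by rewrite -[_ \- _]/(fun x => u r x - u t x) fnorm_L2E//; apply: L2B; exact: Lu.
apply/cvgrPdist_le => e e0; have [d d0 hd] := cu t e tT e0.
rewrite near_withinE; exists d => // r tr rT.
rewrite -[X in `|_ - X|]/(fine (fnorm (L2per R) (fun x => u r x - u t x))) fnorm_L2E; last by apply: L2B; exact: Lu.
by rewrite sub0r normrN ger0_norm ?nrm2_ge0//; apply: hd => //; rewrite distrC.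
Qed.

Lemma strong_of_coef (alpha s T S B : R) (u0 : R * R -> R) (u : R -> R * R -> R) :
  0 <= alpha -> 1 + alpha <= s -> 2 < s -> 0 < T -> L2per R u0 ->
  (forall t : R, t \in `[0, T] -> [/\ L2per R (u t), (forall x, `|u t x| <= S) &
     forall M, Ys s M (fourier (u t)) <= B]) ->
  (forall N, coef_ode alpha T N u) -> (forall k, fourier (u 0) k = fourier u0 k) ->
  strong_solution alpha s T u0 u.
Proof.
move=> a0 as_ s2 T0 L0 hu ou u00.
have s0 : 0 <= s by lra.
have z0 : (0 : R) \in `[0, T] by rewrite in_itv/= lexx ltW.
have Lu (t : R) : t \in `[0, T] -> L2per R (u t) by move=> tT; have [] := hu t tT.
have inbox k : k \in box (maxn `|k.1|%N `|k.2|%N).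
  by rewrite mem_box !leq_max !leqnn orbT.
have cu k : ccont T (fun t => fourier (u t) k) by have [] := ou _ k (inbox k).
have hY (t : R) : t \in `[0, T] -> L2per R (u t) /\ forall M, Ys s M (fourier (u t)) <= B.
  by move=> tT; have [] := hu t tT.
have B0 : 0 <= B by have [_ h] := hY 0 z0; exact: le_trans (Ys_ge0 _ _ _) (h 0%N).
pose K := Num.sqrt (vol * B).
have hK (t : R) : t \in `[0, T] -> L2per R (u t) /\ nrm2 (u t) <= K.
  move=> tT; have [Lt Yt] := hY t tT; split => //.
  by rewrite -[leLHS]ger0_norm ?nrm2_ge0// -sqrtr_sqr ler_wsqrtr//; exact: nrm2_Ys Yt.
have cL : L2cont T u by exact: L2cont_coef s2 hY cu.
have /choice[ut hut] : forall t : R, exists g, t \in `[0, T] -> [/\ L2per R g,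
    forall k, fourier g k = rhs alpha (u t) k, nrm2 g <= (1 + S) * K & fzk_equation alpha (u t) g].
  move=> t; case: (boolP (t \in `[0, T])) => [tT|]; last by exists (fun=> 0).
  by have [L1 L2 L3] := hu t tT; have [g hg] := fzk_rhs a0 as_ L1 L2 L3; exists g.
have hK' (t : R) : t \in `[0, T] -> L2per R (ut t) /\ nrm2 (ut t) <= (1 + S) * K.
  by move=> tT; have [] := hut t tT.
have cut k : ccont T (fun t => fourier (ut t) k).
  have [c1 c2] := ccont_rhs alpha k hK cL.
  by split; [apply: within_ext c1|apply: within_ext c2] => t tT; have [_ -> _ _] := hut t tT.
have strL2 (K1 : R) (f : R -> R * R -> R) : (forall t : R, t \in `[0, T] -> L2per R (f t) /\ nrm2 (f t) <= K1) ->
    (forall k, ccont T (fun t => fourier (f t) k)) -> Linfty T (L2per R) f.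
  move=> h1 h2; split.
    by have [I [LI hI]] := prim_exists T0 h1 h2; have [] := bochner_coef T0 h1 h2 LI hI.
  exists K1; apply: aeW => t tT; have [Lt Kt] := h1 t (itv_oo_cc tT).
  by rewrite fnorm_L2E.
split.
  split; first exact: strong_hper hY cu.
  exists (Num.sqrt B); apply: aeW => t tT; have [Lt Yt] := hY t (itv_oo_cc tT).
  by apply: fnormH_le => [|M]; [exact: sqrtr_ge0|rewrite sqr_sqrtr].
split; last first.
  exists u; split; first exact: L2cont_repr.
  exact: fourier_inj (Lu 0 z0) L0 u00.
exists ut; split; last by apply: aeW => t tT; have [] := hut t (itv_oo_cc tT).
split; [exact: strL2 hK cu|exact: strL2 hK' cut|].
move=> phi tphi; have [c0 c1 dphi p0 pT] := test_functionP T0 tphi.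
have [K1 [b1 e1]] := scaled_traj c1 hK cu; have [K2 [b2 e2]] := scaled_traj c0 hK' cut.
(* The witness is synthesised from the integrals against the derivative of phi; that its opposite is
   the integral of phi times the time derivative is integration by parts in each coefficient. *)
have [I [LI hI]] := prim_exists T0 b1 (fun k => (e1 k).1).
exists I; split; first exact: bochner_coef T0 b1 (fun k => (e1 k).1) LI hI.
apply: (bochner_coef T0 b2 (fun k => (e2 k).1) (L2N LI)) => k.
rewrite (e2 k).2.
have -> : fourier (fun x => - I x) k = - fourier I k.
  rewrite (_ : (fun x => _) = (fun x => (-1) * I x)); last by apply/funext => x; rewrite mulN1r.
  by rewrite fourierZ//; apply: complexP; rewrite !(RecM, ImcM)/=; ring.
rewrite hI (e1 k).2; have [_ D] := ou _ k (inbox k).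
have [k1 k2] := cu k; have [l1 l2] := cut k.
have wc (f : R -> R) : continuous f -> {within `[0, T], continuous f} by exact: within_cont.
have D1 (t : R) : t \in `]0, T[ -> is_derive t (1 : R) (fun t => Rec (fourier (u t) k)) (Rec (fourier (ut t) k)).
  by move=> tT; have [_ -> _ _] := hut t (itv_oo_cc tT); have [] := D t tT.
have D2 (t : R) : t \in `]0, T[ -> is_derive t (1 : R) (fun t => Imc (fourier (u t) k)) (Imc (fourier (ut t) k)).
  by move=> tT; have [_ -> _ _] := hut t (itv_oo_cc tT); have [] := D t tT.
have := prim_parts T0 (wc _ c0) (wc _ c1) k1 l1 (fun t _ => dphi t) D1.
have := prim_parts T0 (wc _ c0) (wc _ c1) k2 l2 (fun t _ => dphi t) D2.
rewrite p0 pT !mul0r subrr => h2 h1; apply: complexP => /=.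
  by apply/eqP; rewrite eq_sym -subr_eq0 opprK addrC; apply/eqP.
by apply/eqP; rewrite eq_sym -subr_eq0 opprK addrC; apply/eqP.
Qed.

End StrongSolution.

(** * Weak time derivatives *)

Section TestFunctions.
Context {R : realType}.

Lemma derive_near (F G : R -> R) (t l : R) : (\near t, F t = G t) ->
  is_derive t (1 : R) F l -> is_derive t (1 : R) G l.
Proof. exact: near_eq_is_derive. Qed.

Lemma near_lt (t z : R) : t < z -> \forall y \near t, y < z.
Proof.
move=> tz; have tI : t \in `]t - 1, z[ by rewrite in_itv/= tz andbT; lra.
by apply: filterS (near_in_itvoo tI) => y; rewrite in_itv/= => /andP[].
Qed.

Lemma derive_cst (c t : R) : is_derive t (1 : R) (fun=> c) 0.
Proof. exact: is_derive_cst. Qed.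

Lemma horner_growth (p : {poly R}) : exists (C : R) n, 0 <= C /\ forall y : R, 1 <= y -> `|p.[y]| <= C * y ^+ n.
Proof.
elim/poly_ind: p => [|p c [C [n [C0 IH]]]].
  by exists 0, 0%N; split => // y _; rewrite horner0 normr0 mul0r.
exists (C + `|c|), n.+1; split; first by rewrite addr_ge0.
move=> y y1; rewrite hornerMXaddC; apply: le_trans (ler_normD _ _) _; rewrite mulrDl.
have y0 : 0 <= y by lra.
apply: lerD.
  by rewrite normrM (ger0_norm y0) exprSr mulrA ler_wpM2r// IH.
by rewrite ler_peMr// exprn_ege1.
Qed.

(** The functions p (1/x) e^(-1/x) extended by 0. The derivative stays in the class, with p replaced
    by X^2 (p - p'), so derivatives of all orders exist without being computed. *)
Definition EP (p : {poly R}) (x : R) : R := if 0 < x then p.[x^-1] * expR (- x^-1) else 0.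

Lemma EP_flat (p : {poly R}) (e : R) : 0 < e -> exists2 d : R, 0 < d &
  forall x : R, 0 < x -> x < d -> `|EP p x| <= e * x.
Proof.
move=> e0; have [C [n [C0 hC]]] := horner_growth p.
pose F : R := (n.+2)`!%:R; have F0 : 0 < F by rewrite ltr0n fact_gt0.
pose K := C * F + 1; have K0 : 0 < K by rewrite ltr_wpDl// mulr_ge0// ltW.
exists (Num.min 1 (e / K)); first by rewrite lt_min ltr01 divr_gt0.
move=> x x0; rewrite lt_min => /andP[x1 xe]; rewrite /EP x0 normrM (ger0_norm (expR_ge0 _)).
have y0 : 0 < x^-1 by rewrite invr_gt0.
have y1 : 1 <= x^-1 by rewrite invf_ge1// ltW.
have h1 := hC _ y1; have := expR_ge1Dxn n.+1 (ltW y0); rewrite -/F => h2.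
rewrite expRN ler_pdivrMr ?expR_gt0//; apply: le_trans h1 _.
apply: le_trans (ler_wpM2l (mulr_ge0 (ltW e0) (ltW x0)) h2).
have h3 : C <= e * x^-1 / F.
  rewrite ler_pdivlMr// ler_pdivlMr//; move: xe; rewrite ltr_pdivlMr// /K => h.
  by apply: le_trans (ltW h); rewrite mulrDr mulr1 mulrC lerDl ltW.
apply: le_trans (_ : e * x^-1 / F * x^-1 ^+ n <= _).
  by apply: ler_wpM2r => //; rewrite exprn_ge0// ltW.
rewrite mulrDr mulr1 -[leLHS]add0r; apply: lerD; first by rewrite mulr_ge0// ltW.
rewrite le_eqVlt; apply/orP; left; apply/eqP; rewrite !exprS; field.
by rewrite !gt_eqF.
Qed.

Definition dEP (p : {poly R}) : {poly R} := 'X^2 * (p - p^`()).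

Lemma EP_le0 (p : {poly R}) (x : R) : x <= 0 -> EP p x = 0.
Proof. by rewrite /EP; case: ltP. Qed.

Lemma EP_derive (p : {poly R}) (x : R) : is_derive x (1 : R) (EP p) (EP (dEP p) x).
Proof.
have [x0|x0|x0] := ltgtP 0 x.
- have n0 : x != 0 by rewrite gt_eqF.
  have dv : is_derive x (1 : R) (fun y => y^-1) (- x ^- 2).
    by have := is_deriveV n0 (is_derive_id x (1 : R)); rewrite -[_ *: _]/(_ * _) mulr1.
  have d1 := @is_derive1_comp R (horner p) (fun y => y^-1) x _ _ (is_derive_poly p x^-1) dv.
  have d2 := @is_derive1_comp R (@expR R) (fun y => -1 * y^-1) x _ _ (is_derive_expR (-1 * x^-1)) (derive_Z (-1) dv).
  apply: (derive_near (F := fun y => p.[y^-1] * expR (-1 * y^-1))).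
    have xx : x \in `]0, x + 1[ by rewrite in_itv/= x0 ltrDl ltr01.
    by apply: near_itv xx _ => y; rewrite in_itv/= => /andP[y0 _]; rewrite /EP y0 mulN1r.
  apply: is_derive_eq (derive_M d1 d2) _.
  rewrite /= /EP x0 /dEP !mulN1r hornerM hornerXn hornerD hornerN exprVn; ring.
- rewrite EP_le0 ?ltW//; apply: (@derive_near (fun=> 0) (EP p) x 0 _ (derive_cst 0 x)).
  by near=> y; rewrite EP_le0// ltW//; near: y; exact: near_lt.
- rewrite -x0 EP_le0//; apply: is_derive_eps => e e0; have [d d0 hd] := EP_flat p e0.
  exists d => // y; rewrite subr0 mul0r subr0 (EP_le0 _ (lexx 0)) subr0 => yd.
  have [y0|y0] := ltP 0 y; last by rewrite EP_le0// normr0 mulr_ge0// ltW.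
  by rewrite (gtr0_norm y0); apply: hd => //; apply: le_lt_trans yd; exact: ler_norm.
Unshelve. all: by end_near. Qed.

(** Finite sums of products of two such flat functions, one facing right and one facing left, coded
    by their data: differentiation becomes the operation [dbumps] on lists, and the minus sign of
    the left-facing factor goes into the first polynomial. *)
Definition bumps (l : seq (({poly R} * {poly R}) * (R * R))) (x : R) : R :=
  \sum_(q <- l) EP q.1.1 (x - q.2.1) * EP q.1.2 (q.2.2 - x).

Definition dbumps (l : seq (({poly R} * {poly R}) * (R * R))) :=
  [seq ((dEP q.1.1, q.1.2), q.2) | q <- l] ++ [seq ((- q.1.1, dEP q.1.2), q.2) | q <- l].

Lemma bumps_derive l (x : R) : is_derive x (1 : R) (bumps l) (bumps (dbumps l) x).
Proof.
have -> : bumps (dbumps l) x = \sum_(q <- l) (EP (dEP q.1.1) (x - q.2.1) * EP q.1.2 (q.2.2 - x) +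
    EP (- q.1.1) (x - q.2.1) * EP (dEP q.1.2) (q.2.2 - x)).
  by rewrite /bumps /dbumps big_cat/= !big_map [RHS]big_split.
apply: derive_sum_seq => -[[p q] [a b]] _ /=.
have dl : is_derive x (1 : R) (fun y => y - a) 1.
  by rewrite -[X in is_derive _ _ _ X]subr0; apply: derive_B.
have dr : is_derive x (1 : R) (fun y => b - y) (- 1).
  by rewrite -[X in is_derive _ _ _ X]sub0r; apply: derive_B.
have := derive_M (@is_derive1_comp R (EP p) (fun y => y - a) x _ _ (EP_derive p (x - a)) dl)
  (@is_derive1_comp R (EP q) (fun y => b - y) x _ _ (EP_derive q (b - x)) dr).
move/is_derive_eq; apply; rewrite /= [EP (- p) _]/EP; case: ifP => h; first by rewrite hornerN /EP h; ring.
by rewrite [EP p _]/EP h; ring.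
Qed.

Lemma bumps_derive1n l n : derive1n n (bumps l) = bumps (iter n dbumps l).
Proof.
elim: n => [//|n IH]; rewrite derive1nS IH iterS; apply/funext => x.
by rewrite derive1E; have [_ ->] := bumps_derive (iter n dbumps l) x.
Qed.

Lemma bumps_cont l : continuous (bumps l).
Proof. by move=> x; exact: derive_continuous (bumps_derive l x). Qed.

Definition beta (a d x : R) : R := EP 1 (x - a) * EP 1 (a + d - x).

Lemma betaE a d : beta a d = bumps [:: ((1, 1), (a, a + d))].
Proof. by apply/funext => x; rewrite /bumps big_seq1. Qed.

Lemma EP1_ge0 (x : R) : 0 <= EP 1 x.
Proof. by rewrite /EP; case: ifP => // _; rewrite hornerC mul1r expR_ge0. Qed.

Lemma beta_ge0 a d x : 0 <= beta a d x.
Proof. by rewrite mulr_ge0// EP1_ge0. Qed.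

Lemma beta_out a d x : x <= a \/ a + d <= x -> beta a d x = 0.
Proof.
by case=> h; rewrite /beta; [rewrite (EP_le0 _ (x := x - a)) ?mul0r|rewrite (EP_le0 _ (x := a + d - x)) ?mulr0]; lra.
Qed.

Lemma beta_cont a d : continuous (beta a d).
Proof. by rewrite betaE; exact: bumps_cont. Qed.

(** The bump starts at 1 because [prim] integrates from 0 and is differentiated only at positive
    times; the primitive vanishes near 0, and other positions are obtained by translation. *)
Lemma beta_prim (d : R) : 0 < d -> exists (P : R -> R) (m : R), [/\ 0 < m,
  forall t : R, is_derive t (1 : R) P (beta 1 d t), forall t : R, t <= 1 -> P t = 0 &
  forall t : R, 1 + d <= t -> P t = m].
Proof.
move=> d0; pose P := prim (beta 1 d).
have P0 (t : R) : t <= 1 -> P t = 0.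
  move=> t1; transitivity (\int[@lebesgue_measure R]_(x in `[0, t]) (0 : R)); last by rewrite Rintegral_cst// mul0r.
  apply: eq_Rintegral; move=> x; rewrite inE/= in_itv/= => /andP[_ xt]; rewrite beta_out//; left; exact: le_trans xt t1.
have dP (t : R) : is_derive t (1 : R) P (beta 1 d t).
  have [t1|t1] := ltP t 1.
    rewrite beta_out; last by left; exact: ltW.
    apply: (@derive_near (fun=> 0) P t 0 _ (derive_cst 0 t)).
    by near=> y; rewrite P0// ltW//; near: y; exact: near_lt.
  apply: (prim_derive (T := t + 1)); first exact/within_cont/beta_cont.
  by rewrite in_itv/=; apply/andP; split; lra.
have cP (a b : R) : {within `[a, b], continuous P}.
  by apply: within_cont => t; exact: derive_continuous (dP t).
exists P, (P (1 + d)); split => //.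
  have d1 : 1 < 1 + d by lra.
  have [c cd E] := MVT d1 (fun x _ => dP x) (cP _ _).
  rewrite (P0 1 (lexx _)) subr0 in E; rewrite E mulr_gt0//; last by lra.
  move: cd; rewrite in_itv/= => /andP[c1 c2]; rewrite /beta /EP.
  by rewrite !subr_gt0 c1 c2 !hornerC !mul1r mulr_gt0// expR_gt0.
move=> t td; apply/eqP; rewrite -subr_eq0 -normr_le0.
apply: le_trans (mean_value_le (C := 0) td (fun x _ => dP x) (cP _ _) _) _; last by rewrite mul0r.
move=> x; rewrite in_itv/= => /andP[x1 _]; rewrite beta_out ?normr0//; right; exact: ltW.
Unshelve. all: by end_near. Qed.

Lemma beta_shift (a d t : R) : beta 1 d (t - a + 1) = beta a d t.
Proof. by rewrite /beta; congr (EP 1 _ * EP 1 _); ring. Qed.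

(* Testing with an antiderivative of the difference of two narrow bumps. *)
Lemma du_bois_reymond (T : R) (H : R -> R) : 0 < T -> {within `[0, T], continuous H} ->
  (forall phi, test_function T phi -> prim (fun t => derive1 phi t * H t) T = 0) ->
  forall a b : R, a \in `]0, T[ -> b \in `]0, T[ -> H a = H b.
Proof.
move=> T0 cH tH.
suff key (a b : R) : a \in `]0, T[ -> b \in `]0, T[ -> a < b -> H a = H b.
  move=> a b aT bT; case: (ltgtP a b) => [|h|->] //; first exact: key.
  by apply/esym; exact: key.
move=> aT bT ab; apply/eqP; rewrite -subr_eq0 -normr_le0; apply/ler_addgt0Pl => e e0; rewrite addr0.
have e2 : 0 < e / 2 by lra.
have [q q0 hq] := unif_within cH e2.
(* The width is below the modulus of continuity of H, and the bump placed at b still ends before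
   T. *)
pose d := Num.min (q / 2) ((T - b) / 2).
have /andP[a0 aT'] : 0 < a < T by move: aT; rewrite in_itv.
have /andP[b0 bT'] : 0 < b < T by move: bT; rewrite in_itv.
have d0 : 0 < d by rewrite lt_min !divr_gt0// subr_gt0.
have dq : d < q by rewrite gt_min; apply/orP; left; lra.
have dT : d <= (T - b) / 2 by rewrite ge_min lexx orbT.
have [P [m [m0 dP P0 Pm]]] := beta_prim d0.
have dPs (c t : R) : is_derive t (1 : R) (fun t => P (t - c + 1)) (beta c d t).
  have dl : is_derive t (1 : R) (fun y => y - c + 1) 1.
    rewrite -[X in is_derive _ _ _ X]addr0; apply: derive_D.
    by rewrite -[X in is_derive _ _ _ X]subr0; apply: derive_B.
  by have := @is_derive1_comp R P (fun y => y - c + 1) t _ _ (dP (t - c + 1)) dl; rewrite mulr1 beta_shift.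
pose phi t := P (t - a + 1) - P (t - b + 1).
have dphi (t : R) : is_derive t (1 : R) phi (beta a d t - beta b d t) by exact: derive_B.
have dphiE : derive1 phi = fun t => beta a d t - beta b d t.
  by apply/funext => t; rewrite derive1E; have [_ ->] := dphi t.
have dphiB : derive1 phi = bumps [:: ((1, 1), (a, a + d)); ((-1, 1), (b, b + d))].
  rewrite dphiE; apply/funext => t; rewrite /bumps big_cons big_seq1 /=; congr (_ + _).
  by rewrite /beta -mulNr; congr (_ * _); rewrite /EP; case: ifP; rewrite ?oppr0// !hornerE mulN1r.
have tphi : test_function T phi.
  split.
    case=> [|n] t; first by have [] := dphi t.
    by rewrite derive1Sn dphiB bumps_derive1n; have [] := bumps_derive (iter n dbumps [:: ((1, 1), (a, a + d)); ((-1, 1), (b, b + d))]) t.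
  exists a, (b + d); split => //; first by lra.
  move=> t; rewrite in_itv/= negb_and -!ltNge => /orP[h|h]; rewrite /phi.
    by rewrite !P0 ?subrr//; lra.
  by rewrite !Pm ?subrr//; lra.
have wb c : {within `[0, T], continuous (beta c d)} by exact/within_cont/beta_cont.
have cphi (c : R) : {within `[0, T], continuous (fun t => P (t - c + 1))}.
  by apply: within_cont => t; exact: derive_continuous (dPs c t).
have mass (c : R) : 0 < c -> c + d <= T -> prim (beta c d) T = m.
  move=> c0 cd; have := prim_parts T0 (cphi c) (wb c) (@within_cst R `[0, T] 1) (@within_cst R `[0, T] 0)
    (fun t _ => dPs c t) (fun t _ => derive_cst 1 t).
  rewrite (eq_prim (G := beta c d)); last by move=> t _; rewrite mulr1.
  rewrite (eq_prim (F := fun t => _ * 0) (G := fun=> 0)); last by move=> t _; rewrite mulr0.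
  rewrite [prim (fun=> 0) T]Rintegral_cst// mul0r addr0 => ->.
  by rewrite Pm ?P0 ?mul0r ?subr0 ?mulr1//; lra.
have near_ (c : R) : c \in `]0, T[ -> 0 < c -> c + d <= T -> `|prim (fun t => beta c d t * H t) T - H c * m| <= e / 2 * m.
  move=> cT c0 cd; have wd : {within `[0, T], continuous (fun t => beta c d t * (H t - H c))}.
    by apply: within_M => //; apply: within_B => //; exact: within_cst.
  have -> : prim (fun t => beta c d t * H t) T - H c * m = prim (fun t => beta c d t * (H t - H c)) T.
    rewrite -(mass c c0 cd) (eq_prim (F := fun t => beta c d t * H t) (G := fun t => beta c d t * (H t - H c) + H c * beta c d t)); last first.
      by move=> t _; ring.
    rewrite primD//; last by apply: within_M => //; exact: within_cst.
    by rewrite {2}/prim RintegralZl ?addrK//; exact: integrable_within.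
  apply: le_trans (le_normr_Rintegral _ (integrable_within wd)) _ => //.
  have -> : e / 2 * m = \int[@lebesgue_measure R]_(t in `[0, T]) (e / 2 * beta c d t).
    by rewrite RintegralZl//; [rewrite -/(prim _ _) mass|exact: integrable_within].
  apply: le_Rintegral => //.
  - exact: integrable_abse (integrable_within wd).
  - by apply: integrable_within; apply: within_M => //; exact: within_cst.
  move=> t /= tT; rewrite normrM (ger0_norm (beta_ge0 _ _ _)) mulrC.
  have [h|h] := leP t c; first by rewrite beta_out ?mulr0//; left.
  have [h'|h'] := leP (c + d) t; first by rewrite beta_out ?mulr0//; right.
  apply: ler_wpM2r; first exact: beta_ge0.
  apply: hq => //; first exact: itv_oo_cc.
  by rewrite ger0_norm; lra.
have := tH phi tphi; rewrite dphiE (eq_prim (G := fun t => beta a d t * H t + - (beta b d t * H t))); last first.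
  by move=> t _; ring.
rewrite primD; last 2 first.
- exact: within_M.
- have := within_M (@within_cst R `[0, T] (-1)) (within_M (wb b) cH).
  by apply: within_ext => t _; rewrite mulN1r.
rewrite primN; last exact: within_M.
move=> /eqP; rewrite subr_eq0 => /eqP E.
have ba : a + d <= T by lra.
have bb : b + d <= T by lra.
have h1 := near_ a aT a0 ba; have h2 := near_ b bT b0 bb; rewrite E in h1.
rewrite -(ler_pM2r m0) -{1}(gtr0_norm m0) -normrM mulrBl.
move: h1 h2; set X := prim _ T => h1 h2.
have -> : H a * m - H b * m = (X - H b * m) - (X - H a * m) by ring.
apply: le_trans (ler_normB _ _) _; apply: le_trans (lerD h2 h1) _.
by rewrite -mulrDl -splitr.
Qed.

(** F minus the primitive of G has vanishing weak derivative, hence is constant on the open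
    interval. *)
Lemma weak_derivative (T : R) (F G : R -> R) : 0 < T -> {within `[0, T], continuous F} ->
  {within `[0, T], continuous G} ->
  (forall phi, test_function T phi ->
     prim (fun t => derive1 phi t * F t) T = - prim (fun t => phi t * G t) T) ->
  forall t : R, t \in `]0, T[ -> is_derive t (1 : R) F (G t).
Proof.
move=> T0 cF cG FG t tT; have cP := prim_cont T0 cG.
have cH : {within `[0, T], continuous (fun t => F t - prim G t)} by exact: within_B.
have := du_bois_reymond T0 cH; move=> /(_ _) H.
have {}H (b : R) : b \in `]0, T[ -> F b = prim G b + (F t - prim G t).
  move=> bT; rewrite (H _ t b tT bT); first by ring.
  move=> phi tphi; have [c0 c1 dphi p0 pT] := test_functionP T0 tphi.
  have w1 := within_cont (A := `[0, T]) c1; have w0 := within_cont (A := `[0, T]) c0.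
  rewrite (eq_prim (G := fun t => derive1 phi t * F t + - (derive1 phi t * prim G t))); last by move=> x _; ring.
  rewrite primD; last 2 first.
  - exact: within_M.
  - have := within_M (@within_cst R `[0, T] (-1)) (within_M w1 cP).
    by apply: within_ext => x _; rewrite mulN1r.
  rewrite primN ?FG//; last exact: within_M.
  have := prim_parts T0 w0 w1 cP cG (fun x _ => dphi x) (prim_derive cG).
  rewrite p0 pT !mul0r subrr; lra.
apply: (derive_near (F := fun b => prim G b + (F t - prim G t))).
  by apply: near_itv tT _ => b bT; rewrite -H.
rewrite -[X in is_derive _ _ _ X]addr0; apply: derive_D; exact: prim_derive.
Qed.

End TestFunctions.

(** * Testing Bochner integrals against fixed functions *)

Section BochnerCoef.
Context {R : realType}.
Local Notation vol := (@vol R).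
Local Notation mu := (@leb2 R).
Local Notation Om := (@Omega R).
Local Notation leb := (@lebesgue_measure R).
Local Notation Rec := (@complex.Re R).
Local Notation Imc := (@complex.Im R).
Local Notation nc := (@Normc.normc R).
Implicit Types (f g h : R * R -> R) (c d : int * int -> R[i]) (k : int * int).

Lemma ae_exceptional (P : R -> Prop) : {ae leb, forall t, P t} ->
  exists A : set R, [/\ measurable A, leb A = 0%E & forall t, ~ A t -> P t].
Proof.
move=> [A [mA A0 sub]]; exists A; split => // t nA.
by apply: contrapT => nP; apply: nA; exact: sub.
Qed.

Lemma inner_simple (p : simple (L2per R)) (t : R) h : L2per R h -> L2per R (simple_fun p t) /\
  inner (simple_fun p t) h = \sum_(i < sdim p) \1_(@slevel _ _ p i) t * inner (@svalue _ _ p i) h.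
Proof.
move=> Lh; have L i : L2per R (@svalue _ _ p i) by exact: svalueP.
split; first by apply: L2_sum => i; exact: L2Z.
rewrite (inner_suml _ _ (F := fun i x => \1_(@slevel _ _ p i) t * @svalue _ _ p i x))//; last by move=> i; exact: L2Z.
by apply: eq_bigr => i _; rewrite innerZl.
Qed.

Lemma inner_simple_integral (D : set R) (p : simple (L2per R)) h : L2per R h ->
  L2per R (simple_integral D p) /\
  inner (simple_integral D p) h = \sum_(i < sdim p) fine (leb (@slevel _ _ p i `&` D)) * inner (@svalue _ _ p i) h.
Proof.
move=> Lh; have L i : L2per R (@svalue _ _ p i) by exact: svalueP.
split; first by apply: L2_sum => i; exact: L2Z.
rewrite (inner_suml _ _ (F := fun i x => fine (leb (@slevel _ _ p i `&` D)) * @svalue _ _ p i x))//; last by move=> i; exact: L2Z.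
by apply: eq_bigr => i _; rewrite innerZl.
Qed.

(** F is meant to be a norm along a trajectory whose measurability is unknown, so the null set A is
    removed from the integral of the measurable minorant g. *)
Lemma integral_le_ae (D A : set R) (g : R -> R) (F : R -> \bar R) : measurable D -> measurable A -> leb A = 0%E ->
  leb.-integrable D (EFin \o g) -> (forall t, D t -> 0 <= g t) -> (forall t, D t -> 0 <= F t)%E ->
  (forall t, D t -> ~ A t -> ((g t)%:E <= F t)%E) ->
  (\int[leb]_(t in D) (g t)%:E <= \int[leb]_(t in D) F t)%E.
Proof.
move=> mD mA A0 Ig g0 F0 gF.
have -> : (\int[leb]_(t in D) (g t)%:E = \int[leb]_(t in D `\` A) (g t)%:E)%E.
  by apply: negligible_integral.
rewrite integral_mkcond [leRHS]integral_mkcond; apply: ge0_integral_mono => t _; rewrite /patch.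
  by case: ifPn => // /[!inE] -[Dt _]; rewrite lee_fin g0.
case: ifPn => [/[!inE] -[Dt nA]|_]; first by rewrite mem_set//; exact: gF.
by case: ifPn => // /[!inE]; exact: F0.
Qed.

(** A bounded functional commutes with the Bochner integral: for simple functions this is linearity,
    and by Cauchy-Schwarz the error is at most K times the two quantities that tend to zero. The
    continuous function z stands for the pairing, which is known almost everywhere. *)
Lemma bochner_inner (T : R) (f : R -> R * R -> R) I h (z : R -> R) : 0 < T -> L2per R h ->
  is_bochner_integral (L2per R) `]0, T[ f I -> {within `[0, T], continuous z} ->
  {ae leb, forall t, t \in `]0, T[ -> inner (f t) h = z t} -> inner I h = prim z T.
Proof.
move=> T0 Lh [[p0 hp0] LI [p [h1 h2]]] cz fz.
have [A [mA A0 hA]] : exists A : set R, [/\ measurable A, leb A = 0%E &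
    forall t, ~ A t -> t \in `]0, T[ -> L2per R (f t) /\ inner (f t) h = z t].
  apply: ae_exceptional; apply: (@filterS2 _ _ (ae_filter_ringOfSetsType leb) _ _ _ _ hp0 fz) => t H1 H2 tT.
  by split; [have [] := H1 tT|exact: H2].
pose D : set R := [set` `]0, T[].
have mD : measurable D by exact: measurable_itv.
have fD : (leb D < +oo)%E by rewrite /D lebT// ltry.
pose K := nrm2 h + 1; have K0 : 0 < K by rewrite ltr_wpDl ?nrm2_ge0.
pose P n t := \sum_(i < sdim (p n)) \1_(@slevel _ _ (p n) i) t * inner (@svalue _ _ (p n) i) h.
have IP n : leb.-integrable D (EFin \o P n) /\
    \int[leb]_(t in D) P n t = inner (simple_integral D (p n)) h.
  rewrite (inner_simple_integral _ _ Lh).2.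
  by apply: Rintegral_simple => // i; exact: slevelP.
have Iz : leb.-integrable D (EFin \o z) by exact: integrable_oo.
have CS f1 f2 : L2per R f1 -> L2per R f2 ->
    ((K^-1 * `|inner f1 h - inner f2 h|)%:E <= fnorm (L2per R) (f1 \- f2)%R)%E.
  move=> L1 L2; rewrite -[(f1 \- f2)%R]/(fun x => f1 x - f2 x) fnorm_L2E; last exact: L2B.
  rewrite lee_fin -innerBl// ler_pdivrMl//; apply: le_trans (CauchySchwarz _ _) _ => //; first exact: L2B.
  by rewrite mulrC; apply: ler_wpM2r; rewrite ?nrm2_ge0// lerDl.
have Ig n : leb.-integrable D (EFin \o (fun t => P n t - z t)).
  rewrite (_ : EFin \o _ = (EFin \o P n) \- (EFin \o z))%E; last by apply/funext => t /=; rewrite EFinB.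
  by apply: integrableB => //; exact: (IP n).1.
have Ig' n : leb.-integrable D (EFin \o (fun t => K^-1 * `|P n t - z t|)).
  rewrite (_ : EFin \o _ = fun t => ((K^-1)%:E * (abse \o (EFin \o (fun t => (P n t - z t)%R))) t)%E); last first.
    by apply/funext => t /=; rewrite EFinM.
  by apply: integrableZl => //; exact: integrable_abse.
have bound n : ((K^-1 * `|inner I h - prim z T|)%:E <=
    \int[leb]_(t in D) fnorm (L2per R) (simple_fun (p n) t \- f t)%R +
    fnorm (L2per R) (simple_integral D (p n) \- I)%R)%E.
  have [Ls _] := inner_simple_integral D (p n) Lh.
  apply: le_trans (_ : ((K^-1 * `|\int[leb]_(t in D) P n t - prim z T|)%:E +
      (K^-1 * `|inner (simple_integral D (p n)) h - inner I h|)%:E <= _)%E).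
    rewrite -EFinD lee_fin -mulrDr ler_pM2l ?invr_gt0// (IP n).2.
    rewrite [X in _ <= X]addrC -(distrC (inner I h)); apply: le_trans (ler_normD _ _).
    by rewrite addrA subrK.
  apply: leeD; last exact: CS.
  apply: le_trans (_ : (\int[leb]_(t in D) (K^-1 * `|P n t - z t|)%:E <= _)%E); last first.
    apply: (integral_le_ae mD mA A0 (Ig' n)).
    - by move=> t _; rewrite mulr_ge0// invr_ge0 ltW.
    - by move=> t _; exact: fnorm_L2_ge0.
    - move=> t tD nA; have [Lf <-] := hA t nA tD; rewrite /P.
      have [L1 <-] := inner_simple (p n) t Lh; exact: CS.
  have -> : (\int[leb]_(t in D) (K^-1 * `|P n t - z t|)%:E)%E = (\int[leb]_(t in D) (K^-1 * `|P n t - z t|))%:E.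
    by rewrite /Rintegral fineK//; by apply: integrable_fin_num => //; exact: (Ig' n).
  rewrite lee_fin RintegralZl//; last by have := integrable_abse (Ig n).
  rewrite ler_pM2l ?invr_gt0// -(integral_oo T0 cz) -RintegralB//; last exact: (IP n).1.
  exact: le_normr_Rintegral.
have c0 : (K^-1 * `|inner I h - prim z T|)%:E @[n --> \oo] --> 0%E.
  have h3 : (\int[leb]_(t in D) fnorm (L2per R) (simple_fun (p n) t \- f t)%R +
      fnorm (L2per R) (simple_integral D (p n) \- I)%R)%E @[n --> \oo] --> (0 + 0)%E by apply: cvgeD.
  rewrite adde0 in h3; apply: squeeze0 h3 => n.
  by rewrite bound lee_fin mulr_ge0// invr_ge0 ltW.
have : (K^-1 * `|inner I h - prim z T|)%:E = 0%E.
  by rewrite -(cvg_lim (@ereal_hausdorff R) c0) lim_cst//; exact: ereal_hausdorff.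
move=> [] /eqP; rewrite mulf_eq0 invr_eq0 gt_eqF//= normr_eq0 subr_eq0.
by move/eqP.
Qed.

(** This version is for products of L^2 functions, whose membership in L^2 is not known in advance;
    the modes are continuous, so only measurability of f and g enters. *)
Lemma fourier_ae f g k : measurable_fun (Om : set (measurableTypeR R * measurableTypeR R)) f ->
  measurable_fun (Om : set (measurableTypeR R * measurableTypeR R)) g -> eq_torus f g ->
  fourier f k = fourier g k.
Proof.
move=> mf mg fg.
have hI (w : R * R -> R) : continuous w -> \int[mu]_(x in Om) (f x * w x) = \int[mu]_(x in Om) (g x * w x).
  move=> cw; have Lw := L2_cont cw; rewrite /Rintegral; congr fine; apply: ae_eq_integral => //.
  - by apply/measurable_EFinP; apply: measurable_funM => //; exact: measurable_L2.
  - by apply/measurable_EFinP; apply: measurable_funM => //; exact: measurable_L2.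
  - by apply: aeS_Omega fg => x H xO /=; rewrite H.
congr Complex; congr (_ * _); apply: hI => x.
  by apply: continuous_comp; [apply: cvgN; exact: dotk_continuous|exact: continuous_cos].
by apply: continuous_comp; [apply: cvgN; exact: dotk_continuous|exact: continuous_sin].
Qed.

(** The product f du is a priori only integrable; the equation identifies it almost everywhere with
    [dLu - g], which is in L^2 and can be split linearly. *)
Lemma fzk_rhs_rev alpha f g k : L2per R f -> L2per R g -> fzk_equation alpha f g ->
  fourier g k = rhs alpha f k.
Proof.
move=> Lf Lg [Lu [dLu [du [h1 h2 h3 h4]]]].
have [LLu LdLu _] := h2; have [_ Ldu _] := h3.
have Lq : L2per R (fun x => dLu x - g x) by exact: L2B.
have E : eq_torus (fun x => f x * du x) (fun x => dLu x - g x).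
  apply: aeS_Omega h4 => x H xO; have := H xO; lra.
have -> : fourier g k = fourier dLu k - fourier (fun x => f x * du x) k.
  have <- : fourier (fun x => dLu x - g x) k = fourier (fun x => f x * du x) k.
    symmetry; apply: fourier_ae E; first by apply: measurable_funM; exact: measurable_L2.
    exact: measurable_L2.
  by rewrite fourierB// subKr.
rewrite (weak_partial1_fourier _ h2) (frac_lap_fourier _ Lf h1) fourier_convection// => l.
exact: weak_partial1_fourier h3.
Qed.

End BochnerCoef.

(** * The coefficient system of an arbitrary strong solution *)

Section StrongUniqueness.
Context {R : realType}.
Local Notation vol := (@vol R).
Local Notation leb := (@lebesgue_measure R).
Local Notation Rec := (@complex.Re R).
Local Notation Imc := (@complex.Im R).
Local Notation nc := (@Normc.normc R).
Implicit Types (f g h : R * R -> R) (c d : int * int -> R[i]) (k : int * int).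

Lemma primZ (T a : R) (F : R -> R) : {within `[0, T], continuous F} ->
  prim (fun t => a * F t) T = a * prim F T.
Proof. by move=> cF; rewrite /prim RintegralZl//; exact: integrable_within. Qed.

Lemma bochner_fourier (T : R) (f : R -> R * R -> R) I (z : R -> R[i]) k : 0 < T ->
  is_bochner_integral (L2per R) `]0, T[ f I -> ccont T z ->
  {ae leb, forall t, t \in `]0, T[ -> fourier (f t) k = z t} -> fourier I k = prim_coef T z.
Proof.
move=> T0 bI [c1 c2] fz; have [[p hp] LI _] := bI.
have v0 : vol != 0 by rewrite gt_eqF// vol_gt0.
have h1 : inner I (cosk k) = prim (fun t => vol * Rec (z t)) T.
  apply: (bochner_inner T0 (@L2_cosk R k) bI); first by apply: within_M => //; exact: within_cst.
  apply: (@filterS2 _ _ (ae_filter_ringOfSetsType leb) _ _ _ _ hp fz) => t H1 H2 tT.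
  by have [Lf _] := H1 tT; rewrite -(H2 tT) (fourierE _ Lf) /= mulrA mulfV// mul1r.
have h2 : inner I (sink k) = prim (fun t => - vol * Imc (z t)) T.
  apply: (bochner_inner T0 (@L2_sink R k) bI); first by apply: within_M => //; exact: within_cst.
  apply: (@filterS2 _ _ (ae_filter_ringOfSetsType leb) _ _ _ _ hp fz) => t H1 H2 tT.
  by have [Lf _] := H1 tT; rewrite -(H2 tT) (fourierE _ Lf) /= mulrNN mulrA mulfV// mul1r.
rewrite (fourierE _ LI) h1 h2 !primZ// mulrA mulVf// mul1r.
by rewrite mulNr mulrN opprK mulrA mulVf// mul1r.
Qed.

Lemma ae_dense (T : R) (P : R -> Prop) : {ae leb, forall t, t \in `]0, T[ -> P t} ->
  forall t e : R, 0 < T -> t \in `[0, T] -> 0 < e -> exists r, [/\ r \in `]0, T[, `|r - t| < e & P r].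
Proof.
move=> /ae_exceptional[A [mA A0 hA]] t e T0; rewrite in_itv/= => /andP[t0 tT] e0.
pose a := Num.max 0 (t - e); pose b := Num.min T (t + e).
have ab : a < b by rewrite gt_max !lt_min; apply/andP; split; apply/andP; split; lra.
apply: contrapT => H.
have sub : [set` `]a, b[] `<=` A.
  move=> r /=; rewrite in_itv/= gt_max lt_min => /andP[/andP[r0 re] /andP[rT rt]].
  apply: contrapT => nA; apply: H; have rI : r \in `]0, T[ by rewrite in_itv/= r0 rT.
  exists r; split => //; last exact: hA nA rI.
  by rewrite ltr_norml; apply/andP; split; lra.
have : (leb [set` `]a, b[] <= leb A)%E by apply: le_measure; rewrite ?inE//; exact: measurable_itv.
rewrite A0 lebesgue_measure_itv/= lte_fin ab -EFinB lee_fin; lra.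
Qed.

Lemma within_le_ae (T b : R) (F : R -> R) : 0 < T -> {within `[0, T], continuous F} ->
  {ae leb, forall t, t \in `]0, T[ -> F t <= b} -> forall t : R, t \in `[0, T] -> F t <= b.
Proof.
move=> T0 cF Fb t tT; rewrite leNgt; apply/negP => bF.
have e0 : 0 < (F t - b) / 2 by lra.
have [d d0 hd] := eps_within cF tT e0.
have [r [rT rt Fr]] := ae_dense Fb T0 tT d0.
by have := hd r (itv_oo_cc rT) rt; rewrite ler_norml => /andP[]; lra.
Qed.

Lemma repr_L2cont (T : R) (u w : R -> R * R -> R) : continuous_repr T (L2per R) u w -> L2cont T w.
Proof.
move=> [Lw cw _] t e tT e0; have := cw t tT.
move/fine_cvgP => [_ /cvgrPdist_le /(_ e e0)]; rewrite near_withinE => -[d d0 hd].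
exists d => // r rT rt.
have h : `|0 - fine (fnorm (L2per R) (fun x => w r x - w t x))| <= e.
  by apply: hd => //; rewrite /ball/= distrC.
apply: le_trans h; rewrite fnorm_L2E; last by apply: L2B; exact: Lw.
by rewrite sub0r normrN; exact: ler_norm.
Qed.

Lemma L2cont_ccont (T : R) (w : R -> R * R -> R) k : (forall t : R, t \in `[0, T] -> L2per R (w t)) ->
  L2cont T w -> ccont T (fun t => fourier (w t) k).
Proof.
move=> Lw cw; have s0 : 0 < Num.sqrt vol by rewrite sqrtr_gt0 vol_gt0.
have H (t e : R) : t \in `[0, T] -> 0 < e -> exists2 d : R, 0 < d &
    forall r : R, r \in `[0, T] -> `|r - t| < d -> nc (fourier (w r) k - fourier (w t) k) <= e.
  move=> tT e0; have [d d0 hd] := cw t (Num.sqrt vol * e) tT (mulr_gt0 s0 e0).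
  exists d => // r rT rt; rewrite -fourierB; [|exact: Lw|exact: Lw].
  apply: le_trans (fourier_nc_le _ _) _; first by apply: L2B; exact: Lw.
  by rewrite ler_pdivrMl//; exact: hd.
split; apply: within_eps => t e tT e0; have [d d0 hd] := H t e tT e0; exists d => // r rT rt;
  rewrite -raddfB; apply: le_trans (hd r rT rt); [exact: abs_Re_le|exact: abs_Im_le].
Qed.

Lemma strong_coef (alpha s T : R) (v w : R -> R * R -> R) :
  0 < T -> 2 < s -> (exists ut, W1infty T (L2per R) v ut /\
     {ae leb, forall t, t \in `]0, T[ -> fzk_equation alpha (v t) (ut t)}) ->
  Linfty T (Hper s) v -> continuous_repr T (L2per R) v w ->
  exists B : R, (forall t : R, t \in `[0, T] -> L2per R (w t) /\ forall M, Ys s M (fourier (w t)) <= B) /\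
    forall N, coef_ode alpha T N w.
Proof.
move=> T0 s2 [ut [[_ [[p hp] _] wd] eqn]] [[q hq] [M hM]] cw.
have [Lw _ vw] := cw; have Lc := repr_L2cont cw.
have cc k := L2cont_ccont k Lw Lc.
have FF := ae_filter_ringOfSetsType leb.
have Lv : {ae leb, forall t, t \in `]0, T[ -> L2per R (v t)}.
  by apply: (@filterS _ _ FF _ _ _ hq) => t H tT; have [[]] := H tT.
have vwk k : {ae leb, forall t, t \in `]0, T[ -> fourier (v t) k = fourier (w t) k}.
  apply: (@filterS2 _ _ FF _ _ _ _ Lv vw) => t H1 H2 tT.
  by apply: fourier_ext (H1 tT) (Lw t (itv_oo_cc tT)) (H2 tT).
have wB (t : R) : t \in `[0, T] -> L2per R (w t) /\ forall N, Ys s N (fourier (w t)) <= M ^+ 2.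
  move=> tT; split; first exact: Lw.
  (* The H^s bound is known for almost every t. Each finite sum is continuous in t along the
     representative w, so the bound extends to every t of [0, T]. *)
  move=> N; apply: (within_le_ae (F := fun t => Ys s N (fourier (w t))) T0 _ _ tT).
    by apply: within_sum => k; apply: within_M; [exact: within_cst|exact: within_normc2].
  apply: (@filterS3 _ _ FF _ _ _ _ _ Lv vw hM) => r H1 H2 H3 rT.
  have <- : fourier (v r) = fourier (w r).
    by apply/funext => k; apply: fourier_ext (H1 rT) (Lw r (itv_oo_cc rT)) (H2 rT).
  by apply: Ys_fnormH; exact: H3.
exists (M ^+ 2); split => // N k _; split; first exact: cc.
have wK (t : R) : t \in `[0, T] -> L2per R (w t) /\ nrm2 (w t) <= Num.sqrt (vol * M ^+ 2).
  move=> tT; have [Lt Yt] := wB t tT; split => //.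
  by rewrite -[leLHS]ger0_norm ?nrm2_ge0// -sqrtr_sqr ler_wsqrtr//; apply: nrm2_Ys Yt => //; lra.
have [r1 r2] := ccont_rhs alpha k wK Lc; have [w1 w2] := cc k.
have utk : {ae leb, forall t, t \in `]0, T[ -> fourier (ut t) k = rhs alpha (w t) k}.
  apply: (@filterS _ _ FF _ _ _ (@filterI _ _ FF _ _ (@filterI _ _ FF _ _ Lv vw) (@filterI _ _ FF _ _ hp eqn))).
  move=> t [[H1 H2] [H3 H4]] tT; have {}H1 := H1 tT; have {}H2 := H2 tT; have {}H4 := H4 tT.
  have [H5 _] := H3 tT; rewrite (fzk_rhs_rev _ H1 H5 H4) /rhs.
  have L' := Lw t (itv_oo_cc tT).
  rewrite (fourier_ext _ H1 L' H2) (@fourier_ae R (fun x => v t x ^+ 2) (fun x => w t x ^+ 2))//.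
  - by apply: measurable_funX; exact: measurable_L2.
  - by apply: measurable_funX; exact: measurable_L2.
  - by apply: aeS_Omega H2 => x Hx xO; rewrite Hx.
have key phi : test_function T phi ->
    prim_coef T (fun t => real_complex R (derive1 phi t) * fourier (w t) k) =
    - prim_coef T (fun t => real_complex R (phi t) * rhs alpha (w t) k).
  move=> tphi; have [c0 c1 _ _ _] := test_functionP T0 tphi.
  have cR (a : R -> R) (z : R -> R[i]) : continuous a -> ccont T z -> ccont T (fun t => real_complex R (a t) * z t).
    move=> ca [z1 z2]; have wa := within_cont (A := `[0, T]) ca.
    split; [apply: within_ext (within_M wa z1)|apply: within_ext (within_M wa z2)] => t _.
      by rewrite RecM mul0r subr0.
    by rewrite ImcM mul0r addr0.
  have [I [b1 b2]] := wd phi tphi; have [_ LI _] := b1.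
  rewrite -(bochner_fourier (k := k) T0 b1 (cR _ _ c1 (cc k))); last first.
    apply: (@filterS2 _ _ FF _ _ _ _ Lv (vwk k)) => t H1 H2 tT.
    by rewrite fourierZ ?H2//; exact: H1.
  rewrite -(bochner_fourier (k := k) T0 b2 (cR _ _ c0 (conj r1 r2))); last first.
    apply: (@filterS2 _ _ FF _ _ _ _ hp utk) => t H1 H2 tT.
    by rewrite fourierZ ?H2//; have [] := H1 tT.
  rewrite -[(\- I)%R]/(fun x => - I x) (_ : (fun x => - I x) = (fun x => -1 * I x)); last first.
    by apply/funext => x; rewrite mulN1r.
  by rewrite fourierZ// rmorphN1 mulN1r opprK.
have [wr wi] : (forall phi, test_function T phi ->
     prim (fun t => derive1 phi t * Rec (fourier (w t) k)) T = - prim (fun t => phi t * Rec (rhs alpha (w t) k)) T) /\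
   (forall phi, test_function T phi ->
     prim (fun t => derive1 phi t * Imc (fourier (w t) k)) T = - prim (fun t => phi t * Imc (rhs alpha (w t) k)) T).
  split => phi tphi.
    have E : prim (fun t => Rec (real_complex R (derive1 phi t) * fourier (w t) k)) T =
        - prim (fun t => Rec (real_complex R (phi t) * rhs alpha (w t) k)) T := congr1 Rec (key phi tphi).
    by apply: etrans (etrans E _); [|congr (- _)]; apply: eq_prim => t _; rewrite RecM mul0r subr0.
    have E : prim (fun t => Imc (real_complex R (derive1 phi t) * fourier (w t) k)) T =
        - prim (fun t => Imc (real_complex R (phi t) * rhs alpha (w t) k)) T := congr1 Imc (key phi tphi).
    by apply: etrans (etrans E _); [|congr (- _)]; apply: eq_prim => t _; rewrite ImcM mul0r addr0.
move=> t tT; split.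
  exact: (weak_derivative T0 w1 r1 wr tT).
exact: (weak_derivative T0 w2 r2 wi tT).
Qed.

End StrongUniqueness.

(** * Comparison of representatives and conclusion *)

Section Convergence.
Context {R : realType}.
Local Notation leb := (@lebesgue_measure R).
Implicit Types (f g h : R * R -> R).

Lemma nrm2_triangle f g h : L2per R f -> L2per R g -> L2per R h ->
  nrm2 (fun x => f x - h x) <= nrm2 (fun x => f x - g x) + nrm2 (fun x => g x - h x).
Proof.
move=> Lf Lg Lh; apply: le_trans (nrm2D (L2B Lf Lg) (L2B Lg Lh)).
by rewrite (_ : (fun x => f x - g x + _) = (fun x => f x - h x))//; apply/funext => x; ring.
Qed.

(** Times at which u and w agree are dense, and both are continuous in L^2. *)
Lemma repr_eq (T : R) (u w : R -> R * R -> R) : 0 < T ->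
  (forall t : R, t \in `[0, T] -> L2per R (u t)) -> L2cont T u -> continuous_repr T (L2per R) u w ->
  forall t : R, t \in `[0, T] -> nrm2 (fun x => u t x - w t x) = 0.
Proof.
move=> T0 Lu cu cw t tT; have cw' := repr_L2cont cw; have [Lw _ uw] := cw.
apply/eqP; rewrite eq_le nrm2_ge0 andbT; apply/ler_addgt0Pr => e e0; rewrite add0r.
have e2 : 0 < e / 2 by lra.
have [d1 d10 h1] := cu t (e / 2) tT e2; have [d2 d20 h2] := cw' t (e / 2) tT e2.
have [r [rT]] := ae_dense uw T0 tT (ltac:(by rewrite lt_min d10) : 0 < Num.min d1 d2).
rewrite lt_min => /andP[rd1 rd2] urw; have rT' := itv_oo_cc rT.
have L1 := Lu t tT; have L2 := Lu r rT'; have L3 := Lw t tT; have L4 := Lw r rT'.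
have E := (eq_torusP L2 L4).1 urw.
have q1 := h1 r rT' rd1; have q2 := h2 r rT' rd2; rewrite nrm2_distC in q1.
have := nrm2_triangle L1 L2 L3; have := nrm2_triangle L2 L4 L3; rewrite E.
lra.
Qed.

Lemma rate_cvg0 (A s : R) : 0 <= A -> 2 < s -> (A * n.+1%:R `^ (2 - s))%:E @[n --> \oo] --> 0%E.
Proof.
move=> A0 s2; apply: cvg_EFin0; apply/cvgrPdist_le => e e0.
have [N hN] := rate_small A0 s2 e0; exists N => // n nN.
by rewrite sub0r normrN ger0_norm ?mulr_ge0 ?powR_ge0//; exact: hN.
Qed.

End Convergence.

Theorem theorem3p2 (R : realType) (alpha s : R)
    (alpha_gt0 : 0 < alpha) (alpha_le2 : alpha <= 2) (hs : 2 + alpha <= s) :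
  exists Tbar : R -> R, (forall M : R, 0 < Tbar M) /\
  forall u0 : R * R -> R, Hper s u0 ->
  let T := Tbar (fine (fnorm (Hper s) u0)) in
  exists u : R -> R * R -> R,
    [/\ strong_solution alpha s T u0 u,
        (forall v : R -> R * R -> R, strong_solution alpha s T u0 v ->
           {ae @leb1 R, forall t, t \in `]0, T[ -> eq_torus (v t) (u t)}),
        (forall N : nat, exists2 uN : R -> R * R -> R,
           galerkin_solution alpha T N u0 uN &
           forall vN : R -> R * R -> R, galerkin_solution alpha T N u0 vN ->
             forall t, t \in `[0, T] -> forall x, vN t x = uN t x) &
        (forall uN : nat -> R -> R * R -> R,
           (forall N : nat, galerkin_solution alpha T N u0 (uN N)) ->
           forall w : R -> R * R -> R, continuous_repr T (L2per R) u w ->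
             ereal_sup [set fnorm (L2per R) (uN N t \- w t) | t in `[0, T]]
               @[N --> \oo] --> 0%E)].
Proof.
have s2 : 2 < s by lra.
have [C C0 hb] := hs_bound s2.
(* The Riccati bound holds as long as C T <= 1 / (2 B0), where B0 = 1 + M^2 dominates 1 + Y at time
   0; this T gives equality. *)
exists (fun M => (C * (2 * (1 + M ^+ 2)))^-1); split.
  by move=> M; rewrite invr_gt0 !mulr_gt0// ltr_pwDl// sqr_ge0.
move=> u0 Hu0; set M := fine _; cbv zeta; set T := _^-1.
have B0 : 0 < 1 + M ^+ 2 by rewrite ltr_pwDl// sqr_ge0.
have T0 : 0 < T by rewrite invr_gt0 !mulr_gt0.
have CT : C * T <= (2 * (1 + M ^+ 2))^-1 by rewrite /T invfM mulrA mulfV ?mul1r// gt_eqF.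
have L0 : L2per R u0 := Hu0.1.
have z0 : (0 : R) \in `[0, T] by rewrite in_itv/= lexx ltW.
pose B := 2 * (1 + M ^+ 2); have B0' : 0 <= B by rewrite mulr_ge0// ltW.
(* The bounds concern every Galerkin solution and not only the constructed one, as uniqueness and
   convergence require. *)
have gal N v : galerkin_solution alpha T N u0 v ->
    [/\ forall t : R, t \in `[0, T] -> trig_poly N (v t) /\ Ys s N (fourier (v t)) <= B,
      coef_ode alpha T N v & forall k, k \in box N -> fourier (v 0) k = fourier u0 k].
  move=> /(galerkin_coef L0 T0)[tv ov iv]; split => // t tT; split; first exact: tv.
  have := hb alpha T _ N v B0 CT tv ov; rewrite (eq_Ys _ iv) => /(_ _ t tT) h.
  have := h (ltac:(by rewrite lerD2l; exact: Hper_Ys)); rewrite -/B; lra.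
have /choice[U hU] : forall N, exists uN, galerkin_solution alpha T N u0 uN.
  by move=> N; exact: galerkin_exists.
have gU N := gal N _ (hU N).
have [u [S [hu ou u00]]] : exists (u : R -> R * R -> R) (S : R),
    [/\ forall t : R, t \in `[0, T] -> [/\ L2per R (u t), (forall x, `|u t x| <= S) &
          forall M, Ys s M (fourier (u t)) <= B],
      forall N, coef_ode alpha T N u & forall k, fourier (u 0) k = fourier u0 k].
  apply: (limit_solution (U := U) s2 T0) => [N t tT|N|N k kN].
  - by have [h _ _] := gU N; exact: h.
  - by have [] := gU N.
  - by have [_ _ h] := gU N; exact: h.
have hY (t : R) : t \in `[0, T] -> L2per R (u t) /\ forall M, Ys s M (fourier (u t)) <= B.
  by move=> tT; have [] := hu t tT.
have su : strong_solution alpha s T u0 u.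
  by apply: (strong_of_coef (S := S) (B := B)) => //; lra.
exists u; split => //.
- move=> v [Lv [eqv [w [cw w0]]]]; have [Lw _ vw] := cw.
  have [B1 [hw ow]] := strong_coef T0 s2 eqv Lv cw.
  have w00 k : fourier (w 0) k = fourier u0 k by apply: fourier_ext w0 => //; exact: Lw.
  (* The bound B1 of the competing solution is unrelated to B. With their maximum, both solutions
     are compared with the same Galerkin approximation, whose distance to each tends to zero. *)
  have B2 : 0 <= Num.max B B1 by rewrite le_max B0'.
  have [A A0 hA] := stability s2 T0 B2.
  have bw (t : R) : t \in `[0, T] -> L2per R (w t) /\ forall M, Ys s M (fourier (w t)) <= Num.max B B1.
    by move=> tT; have [h1 h2] := hw t tT; split => // N; rewrite le_max h2 orbT.
  have bu (t : R) : t \in `[0, T] -> L2per R (u t) /\ forall M, Ys s M (fourier (u t)) <= Num.max B B1.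
    by move=> tT; have [h1 h2] := hY t tT; split => // N; rewrite le_max h2.
  have bU N (t : R) : t \in `[0, T] -> trig_poly N (U N t) /\ Ys s N (fourier (U N t)) <= Num.max B B1.
    by move=> tT; have [h _ _] := gU N; have [h1 h2] := h t tT; split => //; rewrite le_max h2.
  have wu (t : R) : t \in `[0, T] -> eq_torus (w t) (u t).
    move=> tT; have [Lwt _] := hw t tT; have [Lut _] := hY t tT.
    apply/(eq_torusP Lwt Lut)/eqP; rewrite eq_le nrm2_ge0 andbT.
    apply/ler_addgt0Pr => e e0; rewrite add0r.
    have e2 : 0 < e / 2 by lra.
    have [N hN] := rate_small A0 s2 e2; have {}hN := hN N (leqnn N).
    have [_ oU iU] := gU N; have [tU _] := bU N t tT.
    have iw k : k \in box N -> fourier (w 0) k = fourier (U N 0) k by move=> kN; rewrite w00 iU.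
    have iu k : k \in box N -> fourier (u 0) k = fourier (U N 0) k by move=> kN; rewrite u00 iU.
    have h1 := hA alpha N w (U N) bw (bU N) (ow N) oU iw t tT.
    have h2 := hA alpha N u (U N) bu (bU N) (ou N) oU iu t tT.
    have LU := trig_poly_L2 tU.
    have := nrm2_triangle Lwt LU Lut; rewrite (nrm2_distC (U N t) (u t)).
    move: h1 h2 hN; clear; lra.
  apply: (@filterS _ _ (ae_filter_ringOfSetsType _) _ _ _ vw) => t H tT.
  apply: (@filterS2 _ _ (ae_filter_ringOfSetsType (@leb2 R)) _ _ _ _ (H tT) (wu t (itv_oo_cc tT))) => x h1 h2 xO.
  by rewrite h1// h2.
- move=> N; exists (U N); first exact: hU.
  move=> vN gv t tT x; have [h1 h2 h3] := gal N _ gv; have [k1 k2 k3] := gU N.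
  rewrite (galerkin_unique s2 T0 h1 k1 h2 k2 _ tT)// => k kN.
  by rewrite h3// k3.
- move=> uN guN w cw; have [Lw _ _] := cw.
  have cu : L2cont T u.
    by apply: (L2cont_coef s2 hY) => k; have [] := ou (maxn `|k.1|%N `|k.2|%N) k;
      rewrite ?mem_box ?leq_max ?leqnn ?orbT.
  have Lu (t : R) : t \in `[0, T] -> L2per R (u t) by move=> tT; have [] := hu t tT.
  have [A A0 hA] := stability s2 T0 B0'.
  apply: squeeze0 (rate_cvg0 A0 s2) => N.
  have [bN oN iN] := gal N _ (guN N).
  have LN (t : R) : t \in `[0, T] -> L2per R (uN N t).
    by move=> tT; have [tt _] := bN t tT; exact: trig_poly_L2 tt.
  apply/andP; split.
    apply: le_trans (fnorm_L2_ge0 (uN N 0 \- w 0)%R) _; apply: ereal_sup_ubound.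
    by exists 0.
  apply: ge_ereal_sup => _ [t tT <-].
  rewrite -[(_ \- _)%R]/(fun x => uN N t x - w t x) fnorm_L2E; last by apply: L2B; [exact: LN|exact: Lw].
  rewrite lee_fin; apply: le_trans (nrm2_triangle (LN t tT) (Lu t tT) (Lw t tT)) _.
  (* The function u is continuous in L^2, so w agrees with it at every time and the detour through u
     costs nothing. *)
  rewrite (repr_eq T0 Lu cu cw tT) addr0 nrm2_distC.
  apply: (hA alpha N u (uN N)) => // k kN.
  by rewrite u00 iN.
Qed.
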